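(* Let $k$ be a perfect field of characteristic $p>2$. There exists a $\boldsymbol{\mathcal P}$-algebra isomorphism $\theta:\boldsymbol\Omega^{(1)}\xrightarrow{\sim}H^\bullet(\boldsymbol\Omega)$ (the super Cartier isomorphism) that restricts for each $n\in\mathbb N$ to an isomorphism $\boldsymbol\Omega_n^{(1)}\cong H^\bullet(\boldsymbol\Omega_{pn})$. Here cohomology is taken with respect to the de Rham differential $\boldsymbol d$.
   Context: A superspace is a $\mathbb Z/2$-graded $k$-space $V=V_{\bar0}\oplus V_{\bar1}$; $\bar v$ is the parity of a homogeneous $v$. $\mathfrak S_n$ acts on the right of $V^{\otimes n}$, the transposition $(i,i+1)$ acting by the supertwist $v\otimes w\mapsto(-1)^{\bar v\bar w}w\otimes v$ on factors $i,i+1$; $\boldsymbol\Gamma^n(V)=(V^{\otimes n})^{\mathfrak S_n}$. $\boldsymbol\Gamma^n\boldsymbol{\mathcal V}$ is the category of finite-dimensional superspaces with morphisms $\boldsymbol\Gamma^n\mathrm{Hom}_k(V,W)\cong\mathrm{Hom}_{k\mathfrak S_n}(V^{\otimes n},W^{\otimes n})$, composed as $k\mathfrak S_n$-maps. $\boldsymbol{\mathcal P}_n$ has as objects the functors $F$ from $\boldsymbol\Gamma^n\boldsymbol{\mathcal V}$ to finite-dimensional superspaces (all linear maps) that are even linear on Hom-spaces; a morphism $\eta:F\to G$ is a family of linear maps $\eta(V)$ with $\eta(W)F(\phi)=(-1)^{\bar\eta\bar\phi}G(\phi)\eta(V)$. $\boldsymbol{\mathcal P}=\prod_n\boldsymbol{\mathcal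 P}_n$ (objects written $F=\bigoplus_nF^n$). $F\otimes G$ and $F\circ G$ are defined pointwise (on morphisms via $\boldsymbol\Gamma^{m+n}(U)\subset\boldsymbol\Gamma^m(U)\otimes\boldsymbol\Gamma^n(U)$ and $\boldsymbol\Gamma^{mn}(U)\subset\boldsymbol\Gamma^m(\boldsymbol\Gamma^n(U))$). Isomorphisms are even. A $\boldsymbol{\mathcal P}$-algebra is $A\in\boldsymbol{\mathcal P}$ with even homomorphisms $k\to A$, $A\otimes A\to A$ making each $A(V)$ a $k$-superalgebra; a $\boldsymbol{\mathcal P}$-algebra homomorphism is a morphism that is a superalgebra homomorphism for each $V$. $V^{(1)}=k\otimes_\varphi V$ with $\varphi(\lambda)=\lambda^{p}$. $\boldsymbol I^{(1)}\in\boldsymbol{\mathcal P}_p$ has $\boldsymbol I^{(1)}(V)=V^{(1)}$; on morphisms $\boldsymbol\Gamma^p\mathrm{Hom}_k(V,W)\to\mathrm{Hom}_k(V^{(1)},W^{(1)})_{\bar0}$ is the map dual to the $p$-power map: $f^{\otimes p}\mapsto f^{(1)}$ for $f$ an even member of a homogeneous basis, and all other basis monomials (in the divided power type basis) go to $0$. $F^{(1)}=F\circ\boldsymbol I^{(1)}$. $\boldsymbol S^n(V)=(V^{\otimes n})_{\mathfrak S_n}$ and $\boldsymbol A^n(V)=\{z\in V^{\otimes n}:z.\sigma=(-1)^\sigma z\ \forall\sigma\in\mathfrak S_n\}$. $\boldsymbol S=\bigoplus\boldsymbol S^n$ has the product induced by the tensor algebra; $\boldsymbol A=\bigoplus\boldsymbol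 A^n$ has product $\boldsymbol A^m\otimes\boldsymbol A^n\to\boldsymbol A^{m+n}$ given by $\sum_\sigma(-1)^\sigma\sigma$ over right coset representatives of $\mathfrak S_m\times\mathfrak S_n$ in $\mathfrak S_{m+n}$. Both have coproducts given by $X(V)\to X(V\oplus V)\cong X(V)\otimes X(V)$ (diagonal, followed by the inverse of the multiplication isomorphism). $\boldsymbol\Omega=\boldsymbol S\otimes\boldsymbol A$ with the super tensor product algebra structure $(a\otimes b)(c\otimes d)=(-1)^{\bar b\bar c}ac\otimes bd$; $\boldsymbol\Omega_n^i=\boldsymbol S^{n-i}\otimes\boldsymbol A^i$, $\boldsymbol\Omega_n=\bigoplus_i\boldsymbol\Omega_n^i$, with cohomological degree $i$. The de Rham differential is $\boldsymbol d:\boldsymbol S^{n-i}\otimes\boldsymbol A^i\to\boldsymbol S^{n-i-1}\otimes\boldsymbol I\otimes\boldsymbol A^i\to\boldsymbol S^{n-i-1}\otimes\boldsymbol A^{i+1}$ (coproduct of $\boldsymbol S$, then product of $\boldsymbol A$; $\boldsymbol I$ the identity functor). It makes each $\boldsymbol\Omega(V)$ a differential graded superalgebra, so $H^\bullet(\boldsymbol\Omega)=\bigoplus_nH^\bullet(\boldsymbol\Omega_n)$ is a $\boldsymbol{\mathcal P}$-algebra. The isomorphism is not required to preserve the cohomological degree. *)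

(* Defs.v *)
From HB Require Import structures.
From mathcomp Require Import all_boot all_order all_fingroup all_algebra.

Set Implicit Arguments.
Unset Strict Implicit.
Unset Printing Implicit Defensive.

Import GRing.Theory.
Local Open Scope ring_scope.

Section SuperCartier.

Variable k : fieldType.

(* spart V false and spart V true are the even and the odd part of V. *)
Record superspace := Superspace {
  sspace :> vectType k;
  spart : bool -> {vspace sspace};
  spart_add : (spart false + spart true = fullv)%VS;
  spart_cap : (spart false :&: spart true = 0)%VS }.

Implicit Types U V W X Y Z : superspace.

Lemma spart_capN V b :
  (spart V b :&: spart V (~~ b) = 0)%VS.
Proof. by case: b; last exact: spart_cap; rewrite capvC; exact: spart_cap. Qed.

Lemma spart_addN (V : superspace) b :
  (spart V b + spart V (~~ b) = fullv)%VS.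
Proof. by case: b; last exact: spart_add; rewrite addvC; exact: spart_add. Qed.

Definition hproj (V : superspace) (b : bool) : 'End(V) :=
  daddv_pi (spart V b) (spart V (~~ b)).

Lemma mem_hproj V b (v : sspace V) : hproj V b v \in spart V b.
Proof. exact: memv_pi. Qed.

Lemma hproj_sum V (v : sspace V) : hproj V false v + hproj V true v = v.
Proof.
by apply: daddv_pi_add; [exact: spart_capN | rewrite spart_addN memvf].
Qed.

Lemma hproj_id V b (v : sspace V) : v \in spart V b -> hproj V b v = v.
Proof. by apply: daddv_pi_id; apply: spart_capN. Qed.

Lemma hproj0 V b c (v : sspace V) : v \in spart V b -> c != b -> hproj V c v = 0.
Proof.
move=> vb cb; have Dc : c = ~~ b by case: (c) (b) cb => [] [].
have := hproj_sum v; rewrite {}Dc; case: b vb {cb} => /hproj_id Ev.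
  by rewrite Ev => /(canRL (addrK _)) ->; rewrite subrr.
by rewrite Ev => /(canRL (addKr _)) ->; rewrite addNr.
Qed.

(* A homogeneous basis: a basis of the even part followed by one of the odd *)
(* part.                                                                     *)
Definition hidx (V : superspace) : finType :=
  'I_(\dim (spart V false) + \dim (spart V true)).

Definition hpar (V : superspace) (i : hidx V) : bool :=
  (\dim (spart V false) <= i)%N.

Definition hbasis (V : superspace) :
    (\dim (spart V false) + \dim (spart V true)).-tuple V :=
  [tuple of vbasis (spart V false) ++ vbasis (spart V true)].

Definition hb (V : superspace) (i : hidx V) : V := (hbasis V)`_i.

Definition hcoord (V : superspace) (i : hidx V) (v : V) : k :=
  coord (hbasis V) i v.

Lemma hb_basis V : basis_of fullv (hbasis V).
Proof.
rewrite -(spart_add V); apply: cat_basis; rewrite ?vbasisP //.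
by rewrite directv_addE /= !directv_trivial spart_cap eqxx.
Qed.

Lemma mem_hb V (i : hidx V) : hb i \in spart V (hpar i).
Proof.
rewrite /hb /hpar nth_cat size_tuple ltnNge; case: leqP => h /=.
  by rewrite vbasis_mem // mem_nth // size_tuple ltn_subLR.
by rewrite vbasis_mem // mem_nth // size_tuple.
Qed.

Lemma hcoord_sum V (v : V) : v = \sum_i hcoord i v *: hb i.
Proof. exact: (coord_basis (hb_basis V) (memvf v)). Qed.

Lemma hcoord_hb V (i j : hidx V) : hcoord i (hb j) = (i == j)%:R.
Proof.
have fr := basis_free (hb_basis V).
by rewrite /hcoord /hb (coord_free j i fr) eq_sym.
Qed.

Section Free.
Variables (X : finType) (par : X -> bool).

Definition delta (x : X) : {ffun X -> k^o} := [ffun y => (y == x)%:R].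

Definition flin (W : vectType k) (g : X -> W) : 'Hom({ffun X -> k^o}, W) :=
  linfun (fun t : {ffun X -> k^o} => \sum_x (t x : k) *: g x).

Definition fcut (b : bool) : 'End({ffun X -> k^o}) :=
  flin (fun x => if par x == b then delta x else 0).

Lemma flinE (W : vectType k) (g : X -> W) t :
  flin g t = \sum_x (t x : k) *: g x.
Proof.
have fl : linear (fun t : {ffun X -> k^o} => \sum_x (t x : k) *: g x).
  move=> a u v; rewrite scaler_sumr -big_split; apply: eq_bigr => x _ /=.
  by rewrite !ffunE scalerDl scalerA.
pose F : {linear _ -> _} := HB.pack (fun t : {ffun X -> k^o} =>
  \sum_x (t x : k) *: g x) (GRing.isLinear.Build _ _ _ _ _ fl).
exact: (lfunE F).
Qed.

Lemma flin_delta (W : vectType k) (g : X -> W) x : flin g (delta x) = g x.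
Proof.
rewrite flinE (bigD1 x) //= ffunE eqxx scale1r big1 ?addr0 // => y ne_yx.
by rewrite ffunE (negPf ne_yx) scale0r.
Qed.

Lemma fcutE b t x : fcut b t x = if par x == b then t x else 0.
Proof.
rewrite flinE sum_ffunE (bigD1 x) //= big1 => [|y ne_yx].
  by rewrite addr0 ffunE; case: ifP => _; rewrite ffunE ?scaler0 // eqxx [LHS]mulr1.
rewrite ffunE; case: ifP => _; rewrite ffunE ?scaler0 //.
by rewrite eq_sym (negPf ne_yx) scaler0.
Qed.

Lemma fcut_add : (lker (fcut true) + lker (fcut false) = fullv)%VS.
Proof.
apply/eqP; rewrite eqEsubv subvf /=; apply/subvP => t _.
have -> : t = fcut false t + fcut true t.
  by apply/ffunP => x; rewrite ffunE !fcutE; case: (par x); rewrite ?add0r ?addr0.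
by apply: memv_add; rewrite memv_ker; apply/eqP/ffunP => x;
  rewrite !fcutE ffunE; case: (par x).
Qed.

Lemma fcut_cap : (lker (fcut true) :&: lker (fcut false) = 0)%VS.
Proof.
apply/eqP; rewrite -subv0; apply/subvP => t; rewrite memv_cap !memv_ker.
case/andP=> /eqP t1 /eqP t0; rewrite memv0; apply/eqP/ffunP => x.
have:= congr1 (fun u : {ffun _ -> _} => u x) t1.
have:= congr1 (fun u : {ffun _ -> _} => u x) t0.
by rewrite !fcutE !ffunE; case: (par x).
Qed.

Definition freesuper : superspace :=
  @Superspace {ffun X -> k^o} (fun b => lker (fcut (~~ b))) fcut_add fcut_cap.

End Free.

(* The largest graded subspace of U; it is U itself when U is graded. *)
Definition hcore (V : superspace) (U : {vspace V}) : {vspace V} :=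
  ((U :&: spart V false) + (U :&: spart V true))%VS.

Lemma hcore_id (V : superspace) (U : {vspace V}) :
  (forall b v, v \in U -> hproj V b v \in U) -> hcore U = U.
Proof.
move=> hU; apply/eqP; rewrite eqEsubv subv_add !capvSl /=.
apply/subvP => v vU; rewrite -(hproj_sum v).
by apply: memv_add; rewrite memv_cap hU ?mem_hproj.
Qed.

Section SubQuotient.
Variables (V : superspace) (U : {vspace V}).

Definition ssub_in_def : 'Hom(subvs_of (hcore U), V) := linfun vsval.

Lemma ssub_inE v : ssub_in_def v = vsval v.
Proof. exact: lfunE. Qed.

Lemma hcore_proj b v : v \in hcore U -> hproj V b v \in hcore U.
Proof.
case/memv_addP => v0 /[!memv_cap] /andP[v0U v00] [v1].
rewrite memv_cap => /andP[v1U v11] ->; rewrite linearD /=.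
case: b.
  rewrite (hproj0 v00) // (hproj_id v11) add0r.
  by apply: (subvP (addvSr _ _)); rewrite memv_cap v1U.
rewrite (hproj0 v11) // (hproj_id v00) addr0.
by apply: (subvP (addvSl _ _)); rewrite memv_cap v0U.
Qed.

Lemma ssub_add :
  (ssub_in_def @^-1: spart V false + ssub_in_def @^-1: spart V true = fullv)%VS.
Proof.
apply/eqP; rewrite eqEsubv subvf /=; apply/subvP => v _.
have -> : v = vsproj (hcore U) (hproj V false (vsval v))
            + vsproj (hcore U) (hproj V true (vsval v)).
  by rewrite -[LHS]vsvalK -{1}(hproj_sum (vsval v)) linearD.
apply: memv_add; rewrite -memv_preim ssub_inE vsprojK ?mem_hproj //;
  exact/hcore_proj/subvsP.
Qed.

Lemma ssub_cap :
  (ssub_in_def @^-1: spart V false :&: ssub_in_def @^-1: spart V true = 0)%VS.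
Proof.
apply/eqP; rewrite -subv0; apply/subvP => v.
rewrite memv_cap -!memv_preim !ssub_inE -memv_cap spart_cap !memv0 => /eqP v0.
by apply/eqP/val_inj; rewrite /= v0.
Qed.

Definition ssub : superspace :=
  @Superspace (subvs_of (hcore U))
    (fun b => (ssub_in_def @^-1: spart V b)%VS) ssub_add ssub_cap.

Definition ssub_in : 'Hom(ssub, V) := ssub_in_def.
Definition ssub_pr : 'Hom(V, ssub) := linfun (vsproj (hcore U)).

(* The quotient V / U is carried by a complement of U; squot_pi is the       *)
(* quotient map, which is onto with kernel (the graded) U, and squot_sec is  *)
(* a linear section of it.                                                   *)
Definition squot_pi_def : 'Hom(V, subvs_of (hcore U)^C) :=
  (linfun (vsproj (hcore U)^C) \o (\1 - projv (hcore U)))%VF.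

Lemma squot_piE v :
  vsval (squot_pi_def v) = v - projv (hcore U) v.
Proof.
by rewrite comp_lfunE lfunE /= vsprojK !lfun_simp //; exact: memv_projC.
Qed.

Lemma squot_pi_val x : squot_pi_def (vsval x) = x.
Proof.
apply/val_inj; rewrite /= squot_piE.
have h : projv (hcore U) (vsval x) = 0.
  by apply/eqP; rewrite -memv_ker lker_proj; exact: subvsP.
by rewrite h subr0.
Qed.

Lemma squot_pi_eq0 v : (squot_pi_def v == 0) = (v \in hcore U).
Proof.
apply/eqP/idP => [v0 | vU]; last first.
  by apply/val_inj; rewrite /= squot_piE projv_id // subrr.
have := squot_piE v; rewrite v0 linear0 => /esym/eqP.
by rewrite subr_eq0 => /eqP ->; exact: memv_proj.
Qed.

Lemma squot_add :
  (squot_pi_def @: spart V false + squot_pi_def @: spart V true = fullv)%VS.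
Proof.
rewrite -limgD spart_add; apply/eqP; rewrite eqEsubv subvf /=.
by apply/subvP => x _; rewrite -(squot_pi_val x) memv_img ?memvf.
Qed.

Lemma squot_cap :
  (squot_pi_def @: spart V false :&: squot_pi_def @: spart V true = 0)%VS.
Proof.
apply/eqP; rewrite -subv0; apply/subvP => x; rewrite memv_cap memv0.
case/andP=> /memv_imgP[v v0 ->] /memv_imgP[w w1] /eqP.
rewrite -subr_eq0 -linearB squot_pi_eq0 => /(hcore_proj false).
by rewrite linearB /= (hproj_id v0) (hproj0 w1) // subr0 squot_pi_eq0.
Qed.

Definition squot : superspace :=
  @Superspace (subvs_of (hcore U)^C)
    (fun b => (squot_pi_def @: spart V b)%VS) squot_add squot_cap.

Definition squot_pi : 'Hom(V, squot) := squot_pi_def.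
Definition squot_sec : 'Hom(squot, V) := linfun vsval.

End SubQuotient.

Section Hom.
Variables V W : superspace.

Definition hcomp (b : bool) (f : 'Hom(V, W)) : 'Hom(V, W) :=
  \sum_(c : bool) (hproj W (c (+) b) \o f \o hproj V c)%VF.

Lemma hcompE b f c v : v \in spart V c -> hcomp b f v = hproj W (c (+) b) (f v).
Proof.
move=> vc; rewrite sum_lfunE (bigD1 c) //= !comp_lfunE (hproj_id vc).
by rewrite big1 ?addr0 // => c' ne; rewrite !comp_lfunE (hproj0 vc) // !linear0.
Qed.

Lemma hcomp_is_linear b : linear (hcomp b).
Proof.
move=> a f g; rewrite /hcomp scaler_sumr -big_split; apply: eq_bigr => c _ /=.
by rewrite comp_lfunDr comp_lfunDl comp_lfunZl comp_lfunZr.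
Qed.

Lemma lcompE b f : linfun (hcomp b) f = hcomp b f.
Proof.
pose F : {linear _ -> _} :=
  HB.pack (hcomp b) (GRing.isLinear.Build _ _ _ _ _ (hcomp_is_linear b)).
exact: (lfunE F).
Qed.

Lemma lfun_homP (f g : 'Hom(V, W)) :
  (forall c v, v \in spart V c -> f v = g v) -> f = g.
Proof.
move=> fg; apply/lfunP => v; rewrite -(hproj_sum v) !linearD /=.
by congr (_ + _); apply: fg (mem_hproj _ _).
Qed.

Lemma hcomp_sum f : hcomp false f + hcomp true f = f.
Proof.
apply: lfun_homP => c v vc; rewrite add_lfunE !(hcompE _ _ vc).
by case: c {vc}; rewrite /= ?[_ + hproj W false _]addrC hproj_sum.
Qed.

Lemma hcomp_comp b c f : c != b -> hcomp c (hcomp b f) = 0.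
Proof.
move=> cb; apply: lfun_homP => d v vd; rewrite !(hcompE _ _ vd) zero_lfunE.
by apply: hproj0 (mem_hproj _ _) _; case: d b c cb {vd} => [] [] [].
Qed.

Lemma shom_add :
  (lker (linfun (hcomp true)) + lker (linfun (hcomp false)) = fullv)%VS.
Proof.
apply/eqP; rewrite eqEsubv subvf /=; apply/subvP => f _.
by rewrite -(hcomp_sum f); apply: memv_add;
  rewrite memv_ker lcompE; apply/eqP/hcomp_comp.
Qed.

Lemma shom_cap :
  (lker (linfun (hcomp true)) :&: lker (linfun (hcomp false)) = 0)%VS.
Proof.
apply/eqP; rewrite -subv0; apply/subvP => f.
rewrite memv_cap !memv_ker !lcompE memv0 -{3}(hcomp_sum f).
by case/andP=> /eqP -> /eqP ->; rewrite addr0.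
Qed.

Definition shom : superspace :=
  @Superspace 'Hom(V, W) (fun b => lker (linfun (hcomp (~~ b)))) shom_add shom_cap.

Lemma mem_shom b (f : shom) :
  f \in spart shom b <->
  (forall c v, v \in spart V c -> f v \in spart W (c (+) b)).
Proof.
rewrite memv_ker lcompE; split => [/eqP f0 c v vc | hf].
  have Ef : f v = hproj W (c (+) b) (f v).
    rewrite -{1}(hcomp_sum f) add_lfunE -(hcompE _ _ vc).
    by case: (b) f0 => /= -> ; rewrite zero_lfunE ?add0r ?addr0.
  by rewrite Ef mem_hproj.
apply/eqP/lfun_homP => c v vc; rewrite (hcompE _ _ vc) zero_lfunE.
by apply: hproj0 (hf _ _ vc) _; case: (b) (c) => [] [].
Qed.

End Hom.

(* Direct sums, tensor products, tensor powers and Frobenius twists are       *)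
(* realized on the bases induced by the homogeneous bases of their factors;  *)
(* din, tens, tmul and twist_vec are the canonical maps into them.           *)
Section DirectSum.
Variables (J : finType) (F : J -> superspace).

Definition dsum : superspace :=
  freesuper (fun x : {j : J & hidx (F j)} => hpar (tagged x)).

Definition din (j : J) : 'Hom(F j, dsum) :=
  linfun (fun v : F j =>
    \sum_i hcoord i v *: (delta (Tagged (fun j => hidx (F j)) i) : dsum)).

Definition dpr (j : J) : 'Hom(dsum, F j) :=
  linfun (fun t : dsum =>
    \sum_i (t (Tagged (fun j => hidx (F j)) i) : k) *: hb i).

End DirectSum.

Definition stens (X Y : superspace) : superspace :=
  freesuper (fun x : hidx X * hidx Y => hpar x.1 (+) hpar x.2).

Definition tens X Y (x : sspace X) (y : sspace Y) : stens X Y :=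
  [ffun ij => hcoord ij.1 x * hcoord ij.2 y].

(* The linear map on X (x) Y induced by a bilinear map B. *)
Definition tlin X Y (Z : vectType k) (B : sspace X -> sspace Y -> Z) :
    'Hom(stens X Y, Z) :=
  flin (fun ij : hidx X * hidx Y => B (hb ij.1) (hb ij.2)).

Lemma tlinE X Y (Z : vectType k) (B : sspace X -> sspace Y -> Z) x y :
    (forall y, linear (B ^~ y)) -> (forall x, linear (B x)) ->
  tlin B (tens x y) = B x y.
Proof.
move=> Bl Br.
pose Fl y : {linear _ -> _} := HB.pack (B ^~ y) (GRing.isLinear.Build _ _ _ _ _ (Bl y)).
pose Fr x : {linear _ -> _} := HB.pack (B x) (GRing.isLinear.Build _ _ _ _ _ (Br x)).
pose G (i : hidx X) (j : hidx Y) := (hcoord i x * hcoord j y) *: B (hb i) (hb j).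
have Bx : B x y = \sum_i hcoord i x *: B (hb i) y.
  rewrite -[LHS]/(Fl y x) {1}(hcoord_sum x) linear_sum.
  by apply: eq_bigr => i _; rewrite linearZ.
have By z : B z y = \sum_j hcoord j y *: B z (hb j).
  rewrite -[LHS]/(Fr z y) {1}(hcoord_sum y) linear_sum.
  by apply: eq_bigr => j _; rewrite linearZ.
rewrite flinE (eq_bigr (fun ij => G ij.1 ij.2)) => [|ij _]; last by rewrite ffunE.
rewrite -(pair_bigA _ G) /= Bx; apply: eq_bigr => i _.
by rewrite By scaler_sumr; apply: eq_bigr => j _; rewrite scalerA.
Qed.

(* f (x) g for g of parity b, with (f (x) g)(x (x) y) = (-1)^(b |x|) f x (x) g y. *)
Definition stmap (b : bool) X Y X' Y' (f : 'Hom(sspace X, sspace X'))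
    (g : 'Hom(sspace Y, sspace Y')) : 'Hom(stens X Y, stens X' Y') :=
  flin (fun ij : hidx X * hidx Y =>
    ((-1) ^+ (b && hpar ij.1) : k) *: tens (f (hb ij.1)) (g (hb ij.2))).

Definition tassoc X Y Z : 'Hom(stens (stens X Y) Z, stens X (stens Y Z)) :=
  tlin (fun (t : stens X Y) (z : Z) =>
    \sum_ij (t ij : k) *: tens (hb ij.1) (tens (hb ij.2) z)).

Definition word n (V : superspace) : finType := {ffun 'I_n -> hidx V}.

Definition wpar n V (w : word n V) : bool := \big[addb/false]_(a < n) hpar (w a).

Definition tpow n (V : superspace) : superspace := freesuper (@wpar n V).

Definition tmul n V (v : 'I_n -> sspace V) : tpow n V :=
  [ffun w : word n V => \prod_(a < n) hcoord (w a) (v a)].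

(* The right action of s on V^(x)n, for the product (s * t) a = t (s a) of    *)
(* permutations: the factor in position a moves to position s a, and every   *)
(* pair of odd factors whose order is reversed contributes a sign.           *)
Definition tact n V (s : 'S_n) : 'End(tpow n V) :=
  flin (fun w : word n V =>
    ((-1) ^+ (\sum_(a < n) \sum_(b < n | (a < b)%N && (s b < s a)%N)
        (hpar (w a) && hpar (w b))) : k)
    *: (delta ([ffun a => w ((s^-1)%g a)] : word n V) : tpow n V)).

(* g_1 (x) ... (x) g_m, where g_a has parity par a. *)
Definition tbox m V W (par : 'I_m -> bool) (g : 'I_m -> 'Hom(sspace V, sspace W)) :
    'Hom(tpow m V, tpow m W) :=
  flin (fun w : word m V =>
    ((-1) ^+ (\sum_(a < m) \sum_(b < m | (b < a)%N) (par a && hpar (w b))) : k)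
    *: tmul (fun a => g a (hb (w a)))).

(* V^(x)m (x) V^(x)n = V^(x)l for m + n = l: the two halves of a word of     *)
(* length l, and the product of two tensors.                                 *)
Definition wleft m n l (e : (m + n)%N = l) V (x : word l V) : word m V :=
  [ffun a => x (cast_ord e (lshift n a))].

Definition wright m n l (e : (m + n)%N = l) V (x : word l V) : word n V :=
  [ffun b => x (cast_ord e (rshift m b))].

Definition tconc m n l (e : (m + n)%N = l) V
    (z : tpow m V) (z' : tpow n V) : tpow l V :=
  [ffun x : word l V => (z (wleft e x) : k) * z' (wright e x)].

(* f (x) g : V^(x)l -> W^(x)l, where g has parity b. *)
Definition lbox2 m n l (e : (m + n)%N = l) V W (b : bool)
    (f : 'Hom(tpow m V, tpow m W)) (g : 'Hom(tpow n V, tpow n W)) :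
    'Hom(tpow l V, tpow l W) :=
  flin (fun x : word l V =>
    ((-1) ^+ (b && wpar (wleft e x)) : k)
    *: tconc e (f (delta (wleft e x))) (g (delta (wright e x)))).

(* (V^(x)n)^(x)m = V^(x)l for m * n = l: the blocks of a word of length l,   *)
(* and the product of m tensors.                                             *)
Lemma wblock_lt m n l (e : (m * n)%N = l) (a : 'I_m) (c : 'I_n) :
  (a * n + c < l)%N.
Proof.
rewrite -{}e; apply: (@leq_trans (a.+1 * n)).
  by rewrite mulSn addnC ltn_add2r.
by rewrite leq_mul2r ltn_ord orbT.
Qed.

Definition wblock m n l (e : (m * n)%N = l) V (x : word l V) (a : 'I_m) : word n V :=
  [ffun c => x (Ordinal (wblock_lt e a c))].

Definition tmconc m n l (e : (m * n)%N = l) V (z : 'I_m -> tpow n V) : tpow l V :=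
  [ffun x : word l V => \prod_(a < m) (z a (wblock e x a) : k)].

(* f_1 (x) ... (x) f_m : V^(x)l -> W^(x)l, where f_a has parity par a. *)
Definition lbox m n l (e : (m * n)%N = l) V W (par : 'I_m -> bool)
    (f : 'I_m -> 'Hom(tpow n V, tpow n W)) : 'Hom(tpow l V, tpow l W) :=
  flin (fun x : word l V =>
    ((-1) ^+ (\sum_(a < m) \sum_(b < m | (b < a)%N)
        (par a && wpar (wblock e x b))) : k)
    *: tmconc e (fun a => f a (delta (wblock e x a)))).

Definition equivariant n V W : {vspace shom (tpow n V) (tpow n W)} :=
  (\bigcap_(s : 'S_n)
     lker (linfun (fun f : 'Hom(tpow n V, tpow n W) =>
                     ((f \o tact V s) - (tact W s \o f))%VF)))%VS.

Definition ghom n V W : superspace := ssub (equivariant n V W).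

Definition gmap n V W (f : ghom n V W) : 'Hom(tpow n V, tpow n W) :=
  ssub_in (equivariant n V W) f.

Definition gid n V : ghom n V V := ssub_pr (equivariant n V V) \1%VF.

Definition gcomp n U V W (g : ghom n V W) (f : ghom n U V) : ghom n U W :=
  ssub_pr (equivariant n U W) (gmap g \o gmap f)%VF.

Lemma mem_equivariant n V W (f : 'Hom(tpow n V, tpow n W)) :
  f \in equivariant n V W <->
  (forall s, (f \o tact V s = tact W s \o f)%VF).
Proof.
have E s (g : 'Hom(tpow n V, tpow n W)) :
    linfun (fun f : 'Hom(tpow n V, tpow n W) =>
      ((f \o tact V s) - (tact W s \o f))%VF) g = ((g \o tact V s) - (tact W s \o g))%VF.
  have fl : linear (fun f : 'Hom(tpow n V, tpow n W) =>
      ((f \o tact V s) - (tact W s \o f))%VF).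
    move=> a u v; rewrite comp_lfunDl comp_lfunDr -comp_lfunZl -comp_lfunZr.
    by rewrite scalerBr opprD addrACA.
  pose F : {linear _ -> _} := HB.pack (fun f : 'Hom(tpow n V, tpow n W) =>
    ((f \o tact V s) - (tact W s \o f))%VF) (GRing.isLinear.Build _ _ _ _ _ fl).
  exact: (lfunE F).
rewrite memvE; split=> [/subv_bigcapP h s | h].
  have:= h s isT; rewrite -memvE memv_ker E subr_eq0.
  by move/eqP.
by apply/subv_bigcapP => s _; rewrite -memvE memv_ker E h subrr.
Qed.

(* The data of a functor from Gamma^n V to superspaces, linear on Hom spaces; *)
(* is_pfunctor states the laws.                                               *)
Record pfunctor (n : nat) := PFunctor {
  pf_obj :> superspace -> superspace;
  pf_mor : forall V W, 'Hom(ghom n V W, shom (pf_obj V) (pf_obj W)) }.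

Definition pf_map n (F : pfunctor n) V W (f : ghom n V W) : 'Hom(F V, F W) :=
  pf_mor F V W f.

Record is_pfunctor n (F : pfunctor n) : Prop := IsPFunctor {
  pf_even : forall V W,
    pf_mor F V W \in spart (shom (ghom n V W) (shom (F V) (F W))) false;
  pf_id : forall V, pf_map F (gid n V) = \1%VF;
  pf_comp : forall U V W (g : ghom n V W) (f : ghom n U V),
    pf_map F (gcomp g f) = (pf_map F g \o pf_map F f)%VF }.

(* Homomorphisms F -> G of parity b. *)
Definition is_pmorphism (b : bool) n (F G : pfunctor n)
    (eta : forall V, 'Hom(F V, G V)) : Prop :=
  (forall V, eta V \in spart (shom (F V) (G V)) b) /\
  (forall V W (c : bool) (f : ghom n V W), f \in spart (ghom n V W) c ->
     (eta W \o pf_map F f)%VF =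
     ((-1) ^+ (b && c) : k) *: (pf_map G f \o eta V)%VF).

Definition is_pisomorphism n (F G : pfunctor n)
    (eta : forall V, 'Hom(F V, G V)) : Prop :=
  is_pmorphism false eta /\
  exists2 zeta : forall V, 'Hom(G V, F V), is_pmorphism false zeta &
    forall V, (zeta V \o eta V = \1)%VF /\ (eta V \o zeta V = \1)%VF.

(* (F (x) G)(phi) for phi in Gamma^l Hom(V, W): phi is written as             *)
(* \sum_i f_i (x) g_i with f_i in Gamma^m Hom(V, W), g_i in Gamma^n Hom(V, W) *)
(* and sent to \sum_i F(f_i) (x) G(g_i).  The map gsplit is injective and its *)
(* image contains Gamma^l Hom(V, W).                                          *)
Section TensorFunctor.
Variables (m n l : nat) (e : (m + n)%N = l) (F : pfunctor m) (G : pfunctor n).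

Definition gsplit V W :
    'Hom(stens (ghom m V W) (ghom n V W), shom (tpow l V) (tpow l W)) :=
  flin (fun ij : hidx (ghom m V W) * hidx (ghom n V W) =>
    lbox2 e (hpar ij.2) (gmap (hb ij.1)) (gmap (hb ij.2))).

Definition ptensor_img V W :
    'Hom(stens (ghom m V W) (ghom n V W),
         shom (stens (F V) (G V)) (stens (F W) (G W))) :=
  flin (fun ij : hidx (ghom m V W) * hidx (ghom n V W) =>
    stmap (hpar ij.2) (pf_map F (hb ij.1)) (pf_map G (hb ij.2))).

Definition ptensor : pfunctor l :=
  @PFunctor l (fun V => stens (F V) (G V)) (fun V W =>
    (ptensor_img V W \o (gsplit V W)^-1 \o ssub_in (equivariant l V W))%VF).

End TensorFunctor.

(* (F o G)(phi) for phi in Gamma^l Hom(V, W), l = m * n: phi is written as a  *)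
(* sum of terms f_1 (x) ... (x) f_m with f_a in Gamma^n Hom(V, W), and F is   *)
(* applied to the sum of the terms G(f_1) (x) ... (x) G(f_m), which is in     *)
(* Gamma^m Hom(G V, G W).                                                     *)
Section CompositeFunctor.
Variables (m n l : nat) (e : (m * n)%N = l) (F : pfunctor m) (G : pfunctor n).

Definition gblocks V W :
    'Hom(tpow m (ghom n V W), shom (tpow l V) (tpow l W)) :=
  flin (fun f : word m (ghom n V W) =>
    lbox e (fun a => hpar (f a)) (fun a => gmap (hb (f a)))).

Definition pcompose_img V W :
    'Hom(tpow m (ghom n V W), shom (tpow m (G V)) (tpow m (G W))) :=
  flin (fun f : word m (ghom n V W) =>
    tbox (fun a => hpar (f a)) (fun a => pf_map G (hb (f a)))).

Definition pcompose : pfunctor l :=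
  @PFunctor l (fun V => F (G V)) (fun V W =>
    (pf_mor F (G V) (G W) \o ssub_pr (equivariant m (G V) (G W)) \o
     pcompose_img V W \o (gblocks V W)^-1 \o ssub_in (equivariant l V W))%VF).

End CompositeFunctor.

Definition pdsum n (J : finType) (F : J -> pfunctor n) : pfunctor n :=
  @PFunctor n (fun V => dsum (fun j => F j V)) (fun V W =>
    linfun (fun f : ghom n V W =>
      \sum_j (din (fun j => F j W) j \o pf_map (F j) f
              \o dpr (fun j => F j V) j)%VF)).

(* The constant functor k of degree 0, where Gamma^0 Hom(V, W) = k. *)
Definition sone : superspace := freesuper (fun _ : unit => false).

Definition word0 V : word 0 V := ffun0 (card_ord 0).

Definition pone : pfunctor 0 :=
  @PFunctor 0 (fun _ => sone) (fun V W =>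
    linfun (fun f : ghom 0 V W =>
      (gmap f (delta (word0 V)) (word0 W) : k) *: \1%VF)).

(* The data of a P-algebra A = (+)_n A^n: the components A^n, the unit       *)
(* k -> A^0 and the products A^m (x) A^n -> A^l for m + n = l; is_palgebra   *)
(* states the laws.  The product takes the equation as an argument to avoid  *)
(* transport along associativity of addition.                                *)
Record palgebra := PAlgebra {
  pa_deg :> forall n, pfunctor n;
  pa_unit : forall V, 'Hom(sone, pa_deg 0 V);
  pa_prod : forall m n l, (m + n)%N = l ->
    forall V, 'Hom(stens (pa_deg m V) (pa_deg n V), pa_deg l V) }.

Definition pa_one (A : palgebra) V : A 0 V := pa_unit A V (delta tt).

Definition pa_mul (A : palgebra) m n l (e : (m + n)%N = l) V
    (a : A m V) (b : A n V) : A l V := pa_prod A e V (tens a b).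

Record is_palgebra (A : palgebra) : Prop := IsPAlgebra {
  pa_functor : forall n, is_pfunctor (A n);
  pa_unit_hom : @is_pmorphism false 0 pone (A 0) (pa_unit A);
  pa_prod_hom : forall m n l (e : (m + n)%N = l),
    @is_pmorphism false l (ptensor e (A m) (A n)) (A l) (pa_prod A e);
  pa_mul1l : forall n (e : (0 + n)%N = n) V (a : A n V),
    pa_mul e (pa_one A V) a = a;
  pa_mul1r : forall n (e : (n + 0)%N = n) V (a : A n V),
    pa_mul e a (pa_one A V) = a;
  pa_mulA : forall m n q mn nq l (emn : (m + n)%N = mn) (enq : (n + q)%N = nq)
      (e1 : (mn + q)%N = l) (e2 : (m + nq)%N = l)
      V (a : A m V) (b : A n V) (c : A q V),
    pa_mul e1 (pa_mul emn a b) c = pa_mul e2 a (pa_mul enq b c) }.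

Definition is_palgebra_hom (A B : palgebra)
    (theta : forall n V, 'Hom(A n V, B n V)) : Prop :=
  [/\ forall n, @is_pmorphism false n (A n) (B n) (theta n),
      forall V, theta 0 V (pa_one A V) = pa_one B V
    & forall m n l (e : (m + n)%N = l) V (a : A m V) (b : A n V),
        theta l V (pa_mul e a b) = pa_mul e (theta m V a) (theta n V b)].

Definition is_palgebra_isomorphism (A B : palgebra)
    (theta : forall n V, 'Hom(A n V, B n V)) : Prop :=
  [/\ is_palgebra A, is_palgebra B, is_palgebra_hom theta
    & forall n, @is_pisomorphism n (A n) (B n) (theta n)].

(* (a (x) b)(c (x) d) = (-1)^(|b| |c|) mX (a (x) c) (x) mY (b (x) d) *)
Definition stens_mul X1 Y1 X2 Y2 X3 Y3
    (mX : 'Hom(stens X1 X2, X3)) (mY : 'Hom(stens Y1 Y2, Y3)) :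
    'Hom(stens (stens X1 Y1) (stens X2 Y2), stens X3 Y3) :=
  tlin (fun (s : stens X1 Y1) (t : stens X2 Y2) =>
    \sum_ij \sum_kl
      ((s ij : k) * t kl * (-1) ^+ (hpar ij.2 && hpar kl.1)) *:
        tens (mX (tens (hb ij.1) (hb kl.1))) (mY (tens (hb ij.2) (hb kl.2)))).

(* The super tensor product: (A (x) B)^n is the sum of the A^(n-i) (x) B^i. *)
Section TensorAlgebra.
Variables A B : palgebra.

Definition atens_part n (i : 'I_n.+1) : pfunctor n :=
  ptensor (subnK (leq_ord i)) (A (n - i)%N) (B i).

Definition atens_deg n : pfunctor n := pdsum (@atens_part n).

Definition atens_unit V : 'Hom(sone, atens_deg 0 V) :=
  flin (fun _ : unit =>
    din (fun i => atens_part i V) (ord0 : 'I_1) (tens (pa_one A V) (pa_one B V))).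

Lemma atens_eq m n l (e : (m + n)%N = l) (i : 'I_m.+1) (j : 'I_n.+1)
  (r : 'I_l.+1) : (i + j)%N = r -> ((m - i) + (n - j))%N = (l - r)%N.
Proof.
move=> <-; rewrite -e; apply/eqP; rewrite -(eqn_add2r (i + j)).
by rewrite subnK ?leq_add ?leq_ord // addnACA !subnK ?leq_ord.
Qed.

Definition atens_prod m n l (e : (m + n)%N = l) V :
    'Hom(stens (atens_deg m V) (atens_deg n V), atens_deg l V) :=
  \sum_(i : 'I_m.+1) \sum_(j : 'I_n.+1) \sum_(r : 'I_l.+1)
    match (i + j)%N =P r with
    | ReflectT er =>
      (din (fun r => atens_part r V) r
       \o stens_mul (pa_prod A (atens_eq e er) V) (pa_prod B er V)
       \o stmap false (dpr (fun i => atens_part i V) i)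
                      (dpr (fun j => atens_part j V) j))%VF
    | ReflectF _ => 0
    end.

Definition atens : palgebra := PAlgebra atens_unit atens_prod.

End TensorAlgebra.

(* A o G for G homogeneous of degree d: the component of degree m is the sum *)
(* of the A^n o G with n * d = m.                                            *)
Section CompositeAlgebra.
Variables (A : palgebra) (d : nat) (G : pfunctor d).

Definition acomp_idx (m : nat) : finType := {n : 'I_m.+1 | (n * d)%N == m}.

Definition acomp_part m (x : acomp_idx m) : pfunctor m :=
  pcompose (eqP (valP x)) (A (val x)) G.

Definition acomp_deg m : pfunctor m := pdsum (@acomp_part m).

Definition acomp_unit V : 'Hom(sone, acomp_deg 0 V) :=
  (din (fun x => acomp_part x V)
       (exist (fun n : 'I_1 => (n * d)%N == 0%N) ord0 (eqxx 0%N) : acomp_idx 0)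
   \o pa_unit A (G V))%VF.

Definition acomp_prod m n l (e : (m + n)%N = l) V :
    'Hom(stens (acomp_deg m V) (acomp_deg n V), acomp_deg l V) :=
  \sum_(x : acomp_idx m) \sum_(y : acomp_idx n) \sum_(z : acomp_idx l)
    match (val x + val y)%N =P val z with
    | ReflectT ez =>
      (din (fun z => acomp_part z V) z
       \o pa_prod A ez (G V)
       \o stmap false (dpr (fun x => acomp_part x V) x)
                      (dpr (fun y => acomp_part y V) y))%VF
    | ReflectF _ => 0
    end.

Definition acomp : palgebra := PAlgebra acomp_unit acomp_prod.

(* The index n of the summand A^n o G in degree m = n * d. *)
Lemma acomp_lt m n : (0 < d)%N -> (n * d)%N = m -> (n < m.+1)%N.
Proof. by move=> d0 <-; rewrite ltnS leq_pmulr. Qed.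

Definition acomp_at m n (d0 : (0 < d)%N) (e : (n * d)%N = m) : acomp_idx m :=
  exist (fun i : 'I_m.+1 => (i * d)%N == m) (Ordinal (acomp_lt d0 e))
        (introT eqP e).

Definition acomp_in m n (d0 : (0 < d)%N) (e : (n * d)%N = m) V :
    'Hom(A n (G V), acomp m V) :=
  din (fun x => acomp_part x V) (acomp_at d0 e).

End CompositeAlgebra.

Section Symmetric.

Definition symrel n V : {vspace tpow n V} :=
  (\sum_(s : 'S_n) limg (tact V s - \1%VF))%VS.

Definition psym (n : nat) : pfunctor n :=
  @PFunctor n (fun V => squot (symrel n V)) (fun V W =>
    linfun (fun f : ghom n V W =>
      (squot_pi (symrel n W) \o gmap f \o squot_sec (symrel n V))%VF)).

Definition sym_unit V : 'Hom(sone, psym 0 V) :=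
  flin (fun _ : unit => squot_pi (symrel 0 V) (delta (word0 V))).

Definition sym_prod m n l (e : (m + n)%N = l) V :
    'Hom(stens (psym m V) (psym n V), psym l V) :=
  tlin (fun (x : psym m V) (y : psym n V) =>
    squot_pi (symrel l V)
      (tconc e (squot_sec (symrel m V) x) (squot_sec (symrel n V) y))).

Definition Salg : palgebra := PAlgebra sym_unit sym_prod.

End Symmetric.

Section Alternating.

Definition altsub n V : {vspace tpow n V} :=
  (\bigcap_(s : 'S_n) lker (tact V s - ((-1) ^+ s : k) *: \1%VF))%VS.

Definition palt (n : nat) : pfunctor n :=
  @PFunctor n (fun V => ssub (altsub n V)) (fun V W =>
    linfun (fun f : ghom n V W =>
      (ssub_pr (altsub n W) \o gmap f \o ssub_in (altsub n V))%VF)).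

(* The Young subgroup S_m x S_(l-m) of S_l. *)
Definition young m l : {set 'S_l} :=
  [set s : 'S_l | [forall i : 'I_l, (s i < m)%N == (i < m)%N]].

(* \sum_s (-1)^s s over representatives of the right cosets of the Young     *)
(* subgroup.                                                                 *)
Definition antisym m l V : 'End(tpow l V) :=
  \sum_(C in rcosets (young m l) [set: 'S_l])
    ((-1) ^+ (repr C : 'S_l) : k) *: tact V (repr C).

Definition alt_unit V : 'Hom(sone, palt 0 V) :=
  flin (fun _ : unit => ssub_pr (altsub 0 V) (delta (word0 V))).

Definition alt_prod m n l (e : (m + n)%N = l) V :
    'Hom(stens (palt m V) (palt n V), palt l V) :=
  tlin (fun (x : palt m V) (y : palt n V) =>
    ssub_pr (altsub l V) (antisym m l V
      (tconc e (ssub_in (altsub m V) x) (ssub_in (altsub n V) y)))).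

Definition Aalg : palgebra := PAlgebra alt_unit alt_prod.

End Alternating.

(* f^(x)n, in Gamma^n Hom(V, W), for f even *)
Definition gpow n V W (f : 'Hom(sspace V, sspace W)) : ghom n V W :=
  ssub_pr (equivariant n V W) (tbox (fun _ : 'I_n => false) (fun _ => f)).

Definition sdouble V : superspace := dsum (fun _ : bool => V).
Definition sin V (b : bool) : 'Hom(V, sdouble V) := din (fun _ : bool => V) b.

Definition splits (n : nat) : finType :=
  {x : 'I_n.+1 * 'I_n.+1 | (x.1 + x.2)%N == n}.

Definition sym_splits n V : superspace :=
  dsum (fun x : splits n => stens (psym (val x).1 V) (psym (val x).2 V)).

(* The multiplication isomorphism                                            *)
(* (+)_(a + b = n) S^a(V) (x) S^b(V) -> S^n(V (+) V).                         *)
Definition sym_exp n V : 'Hom(sym_splits n V, psym n (sdouble V)) :=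
  \sum_(x : splits n)
    (sym_prod (eqP (valP x)) (sdouble V)
     \o stmap false (pf_map (psym (val x).1) (gpow (val x).1 (sin V false)))
                    (pf_map (psym (val x).2) (gpow (val x).2 (sin V true)))
     \o dpr (fun x : splits n =>
               stens (psym (val x).1 V) (psym (val x).2 V)) x)%VF.

Lemma split1_lt a b n : (a + b)%N = n -> (a < n.+1)%N.
Proof. by move=> <-; rewrite ltnS leq_addr. Qed.

Lemma split2_lt a b n : (a + b)%N = n -> (b < n.+1)%N.
Proof. by move=> <-; rewrite ltnS leq_addl. Qed.

Definition split_at a b n (e : (a + b)%N = n) : splits n :=
  exist (fun x : 'I_n.+1 * 'I_n.+1 => (x.1 + x.2)%N == n)
        (Ordinal (split1_lt e), Ordinal (split2_lt e)) (introT eqP e).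

(* The component S^n -> S^a (x) S^b of the coproduct of S. *)
Definition sym_coprod a b n (e : (a + b)%N = n) V :
    'Hom(psym n V, stens (psym a V) (psym b V)) :=
  (dpr (fun x : splits n => stens (psym (val x).1 V) (psym (val x).2 V))
       (split_at e)
   \o (sym_exp n V)^-1
   \o pf_map (psym n) (gpow n (sin V false + sin V true)))%VF.

(* S^1(V) = V = A^1(V) *)
Definition sym1 V : 'Hom(psym 1 V, V) :=
  (flin (fun w : word 1 V => hb (w ord0)) \o squot_sec (symrel 1 V))%VF.

Definition alt1 V : 'Hom(V, palt 1 V) :=
  linfun (fun v : V => ssub_pr (altsub 1 V) (tmul (fun _ => v))).

(* S^a' (x) A^b -> S^a (x) I (x) A^b -> S^a (x) A^b' for a' = a + 1 and       *)
(* b' = 1 + b.                                                               *)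
Definition dR_part a a' b b' (ea : (a + 1)%N = a') (eb : (1 + b)%N = b') V :
    'Hom(stens (psym a' V) (palt b V), stens (psym a V) (palt b' V)) :=
  (stmap false \1%VF (alt_prod eb V \o stmap false (alt1 V) \1%VF)
   \o tassoc (psym a V) V (palt b V)
   \o stmap false (stmap false \1%VF (sym1 V) \o sym_coprod ea V) \1%VF)%VF.

Definition Omega : palgebra := atens Salg Aalg.

Lemma dR_eq n (i j : 'I_n.+1) : (1 + i)%N = j -> ((n - j) + 1)%N = (n - i)%N.
Proof.
by move=> e; have := leq_ord j; rewrite -e addn1 subnS => h; rewrite prednK // subn_gt0.
Qed.

(* The differential of Omega_n = (+)_i S^(n-i) (x) A^i. *)
Definition dR n V : 'End(Omega n V) :=
  \sum_(i : 'I_n.+1) \sum_(j : 'I_n.+1)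
    match (1 + i)%N =P j with
    | ReflectT e =>
      (din (fun j => atens_part Salg Aalg j V) j
       \o dR_part (dR_eq e) e V
       \o dpr (fun i => atens_part Salg Aalg i V) i)%VF
    | ReflectF _ => 0
    end.

Definition cocycles n V : superspace := ssub (lker (dR n V)).

Definition coboundaries n V : {vspace cocycles n V} :=
  (ssub_in (lker (dR n V)) @^-1: limg (dR n V))%VS.

Definition coho_obj n V : superspace := squot (coboundaries n V).

(* coho_class is meaningful on cocycles only; it projects other vectors first. *)
Definition coho_class n V : 'Hom(Omega n V, coho_obj n V) :=
  (squot_pi (coboundaries n V) \o ssub_pr (lker (dR n V)))%VF.

Definition coho_repr n V : 'Hom(coho_obj n V, Omega n V) :=
  (ssub_in (lker (dR n V)) \o squot_sec (coboundaries n V))%VF.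

Definition coho (n : nat) : pfunctor n :=
  @PFunctor n (coho_obj n) (fun V W =>
    linfun (fun f : ghom n V W =>
      (coho_class n W \o pf_map (Omega n) f \o coho_repr n V)%VF)).

Definition coho_unit V : 'Hom(sone, coho 0 V) :=
  (coho_class 0 V \o pa_unit Omega V)%VF.

Definition coho_prod m n l (e : (m + n)%N = l) V :
    'Hom(stens (coho m V) (coho n V), coho l V) :=
  (coho_class l V \o pa_prod Omega e V
   \o stmap false (coho_repr m V) (coho_repr n V))%VF.

Definition HOmega : palgebra := PAlgebra coho_unit coho_prod.

Section Frobenius.
Variable p : nat.

(* V^(1) = k (x)_phi V, with basis the 1 (x) e_i for e_i in the homogeneous  *)
(* basis of V; twist_vec v is 1 (x) v.                                        *)
Definition stwist V : superspace := freesuper (@hpar V).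

Definition twist_vec V (v : V) : stwist V := [ffun i => hcoord i v ^+ p].

(* For the elementary maps E_ji : e_i |-> e_j, the coefficient in phi of      *)
(* E_ji^(x)p, for E_ji even, is the coefficient of e_j^(x)p in                *)
(* phi(e_i^(x)p).                                                            *)
Definition pfrob : pfunctor p :=
  @PFunctor p stwist (fun V W =>
    linfun (fun f : ghom p V W =>
      flin (fun i : hidx V =>
        \sum_(j | hpar j == hpar i)
          (gmap f (delta ([ffun _ => i] : word p V)) ([ffun _ => j] : word p W) : k)
          *: (delta j : stwist W)))).

Definition twist (A : palgebra) : palgebra := acomp A pfrob.

End Frobenius.

End SuperCartier.

(* Main.v *)
(* Choose a homogeneous basis of V.  Then Omega(V) has a basis of monomials
   mon (a, b), with a and b the contents of the factors in S and A, and the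
   weight a + b is preserved by d.  On each basis vector i, contraction is a
   homotopy for multiplication by the i-th weight, so only the monomials all of
   whose weights are divisible by p contribute to cohomology, and d vanishes on
   them.  Those monomials are the mon (Theta m), where Theta m = (A, B) has
   A_i = p a_i + (p-1) b_i, B_i = b_i for i even and A_i = a_i,
   B_i = p b_i + (p-1) a_i for i odd.  Hence mon m |-> [mon (Theta m)] is a
   bijection Omega_n(V^(1)) -> H(Omega_pn(V)); since Theta is additive and
   preserves parities, it is multiplicative by Lucas' theorem.

   It does not depend on the basis, being natural: since both sides are
   compatible with products, it is enough to compare matrix coefficients on the
   generators e_i of S^1 and A^1 and on the divided powers of the odd e_i in A.
   There only one word contributes on each side, and the coefficient of the
   twist of f between words v and w of matching parities is the one of f between
   v and w with each letter repeated p times.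

   The laws of a P-algebra are proved for H(Omega), from the Leibniz rule and
   the monomial formulas, and transported to the twist along the bijection. *)

Require Import Defs.
From HB Require Import structures.
From mathcomp Require Import all_boot all_fingroup all_algebra zify ring.

Set Implicit Arguments.
Unset Strict Implicit.
Unset Printing Implicit Defensive.

Import GRing.Theory.
Local Open Scope ring_scope.

(** * Linear algebra of superspaces *)

(** Naturality is the hard part. Morphisms are all equivariant maps between tensor powers, not only
    those induced by linear maps [V -> W], so changing bases does not test it. Tensor products and
    composites of functors act through chosen preimages under [gsplit] and [gblocks]; that these
    maps reach every equivariant map is what makes the action computable. Products and differentials
    are represented on tensor powers by operators built from permutations, which commute with every
    morphism.

    Degree one does not generate: in characteristic [p] the [p]-th divided power of an odd letter in
    A is not a product of lower ones. So monomials are split by taking off the full power of a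
    letter, where the binomial coefficient is 1, and the divided powers are compared directly.

    Even letters follow the classical Cartier isomorphism; for an odd letter x squares to zero and
    dx has divided powers, so S and A exchange roles and the cohomological degree changes. The bound
    [p > 2] acts three times: words with a sign-reversing symmetry vanish, Theta preserves parities,
    and the A-degrees 0, 1, p - 1, p of the images of generators are distinct. *)

Section Superspaces.

Variable k : fieldType.
Implicit Types (U V W X Y Z : superspace k).

Lemma linfun_linear (U V : vectType k) (f : U -> V) : linear f -> linfun f =1 f.
Proof.
move=> fl; pose F : {linear _ -> _} := HB.pack f (GRing.isLinear.Build _ _ _ _ _ fl).
exact: (lfunE F).
Qed.

Lemma sub_lfunE (U V : vectType k) (f g : 'Hom(U, V)) u : (f - g) u = f u - g u.
Proof. by rewrite add_lfunE opp_lfunE. Qed.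

Lemma sum_only (U : nmodType) (I : finType) (i : I) (F : I -> U) :
  (forall j, j != i -> F j = 0) -> \sum_j F j = F i.
Proof. by move=> F0; rewrite (bigD1 i) //= big1 ?addr0. Qed.

Section LfunLinear.
Variables (U V : vectType k) (f : 'Hom(U, V)).
Lemma lfunB u v : f (u - v) = f u - f v. Proof. exact: linearB. Qed.
Lemma lfunD u v : f (u + v) = f u + f v. Proof. exact: linearD. Qed.
Lemma lfunZ a u : f (a *: u) = a *: f u. Proof. exact: linearZ. Qed.
Lemma lfunN u : f (- u) = - f u. Proof. exact: linearN. Qed.
Lemma lfun0 : f 0 = 0. Proof. exact: linear0. Qed.
Lemma lfunPl a u v : f (a *: u + v) = a *: f u + f v. Proof. exact: linearP. Qed.
Lemma lfun_sum (I : Type) (r : seq I) (P : pred I) (F : I -> U) :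
  f (\sum_(i <- r | P i) F i) = \sum_(i <- r | P i) f (F i).
Proof. exact: linear_sum. Qed.
End LfunLinear.

Lemma hcoord_linear V (i : hidx V) : linear (hcoord i : V -> k^o).
Proof. by move=> a u v; rewrite /hcoord linearP. Qed.

Lemma hcoordP V (i : hidx V) a u v :
  hcoord i (a *: u + v) = a * hcoord i u + hcoord i v.
Proof. exact: hcoord_linear. Qed.

(** Group the basis expansion of [v] by parity: the part of the wrong parity is [hproj V (~~ b) v],
    which is zero, so its coordinates vanish. *)
Lemma hcoord_par V b (v : V) (i : hidx V) :
  v \in spart V b -> hpar i != b -> hcoord i v = 0.
Proof.
move=> vb ib.
pose w c := \sum_(j | hpar j == c) hcoord j v *: hb j.
have Ew c : w c \in spart V c.
  by apply: memv_suml => j /eqP <-; rewrite memvZ ?mem_hb.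
have Ev : v = w false + w true.
  rewrite {1}(hcoord_sum v) (bigID (fun j => hpar j == false)) /=; congr (_ + _).
  by apply: eq_bigl => j; case: (hpar j).
have wN : w (~~ b) = 0.
  have : hproj V (~~ b) v = 0 by apply: hproj0 vb _; case: (b).
  rewrite Ev linearD /=; case: b {vb ib} => /=.
    by rewrite hproj_id // (hproj0 (Ew _)) // addr0.
  by rewrite (hproj0 (Ew _)) // hproj_id // add0r.
have ibN : hpar i = ~~ b by case: (hpar i) (b) ib => [] [].
have := congr1 (hcoord i) wN.
rewrite /hcoord linear0 /w linear_sum (bigD1 i) /= ?ibN //.
rewrite linearZ /= -/(hcoord i (hb i)) hcoord_hb eqxx big1 ?addr0 => [|j /andP[_ ji]].
  by rewrite [X in X = _]mulr1.
rewrite linearZ /= -/(hcoord i (hb j)) hcoord_hb eq_sym (negPf ji).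
by rewrite [LHS]mulr0.
Qed.

Lemma hpar_spart V b (v : V) (i : hidx V) : v \in spart V b -> hcoord i v != 0 -> hpar i = b.
Proof. by move=> vb; apply: contraNeq => /(hcoord_par vb) ->. Qed.

Lemma hom_basis_ext V (Z : vectType k) (f g : 'Hom(sspace V, Z)) :
  (forall i : hidx V, f (hb i) = g (hb i)) -> f = g.
Proof.
move=> fg; apply/lfunP => v; rewrite (hcoord_sum v) !linear_sum.
by apply: eq_bigr => i _; rewrite !linearZ /= fg.
Qed.

Lemma mem_shom_hb V W b (f : 'Hom(sspace V, sspace W)) :
  (forall i : hidx V, f (hb i) \in spart W (hpar i (+) b)) ->
  f \in spart (shom V W) b.
Proof.
move=> fb; apply/mem_shom => c v vc; rewrite (hcoord_sum v) linear_sum.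
apply: memv_suml => i _; rewrite linearZ /=.
have [-> | /(hpar_spart vc) <-] := eqVneq (hcoord i v) 0; last by rewrite memvZ ?fb.
by rewrite scale0r mem0v.
Qed.

Lemma shom_spart V W b c (f : 'Hom(sspace V, sspace W)) v :
  f \in spart (shom V W) b -> v \in spart V c -> f v \in spart W (c (+) b).
Proof. by move/(@mem_shom _ V W b f) => fb; apply: fb. Qed.

Lemma shom_even V W c (f : 'Hom(sspace V, sspace W)) v :
  f \in spart (shom V W) false -> v \in spart V c -> f v \in spart W c.
Proof. by move=> f0 /(shom_spart f0); rewrite addbF. Qed.

Lemma hproj_even V W b (f : 'Hom(sspace V, sspace W)) v :
  f \in spart (shom V W) false -> hproj W b (f v) = f (hproj V b v).
Proof.
move=> f0; rewrite -{1}(hproj_sum v) !linearD /=.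
have h c : f (hproj V c v) \in spart W c by apply: shom_even => //; exact: mem_hproj.
case: b; first by rewrite (hproj0 (h false)) // (hproj_id (h true)) add0r.
by rewrite (hproj0 (h true)) // (hproj_id (h false)) addr0.
Qed.

Section FreeSuper.
Variables (T : finType) (par : T -> bool).
Local Notation F := (freesuper k par).

Lemma ffun_deltaE (t : {ffun T -> k^o}) : t = \sum_x (t x : k) *: delta k x.
Proof.
apply/ffunP => x; rewrite sum_ffunE (bigD1 x) //= !ffunE eqxx [X in X + _]mulr1.
rewrite big1 ?addr0 // => y yx; rewrite !ffunE eq_sym (negPf yx); exact: mulr0.
Qed.

Lemma delta_ext (Z : vectType k) (f g : 'Hom({ffun T -> k^o}, Z)) :
  (forall x, f (delta k x) = g (delta k x)) -> f = g.
Proof.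
move=> fg; apply/lfunP => t; rewrite (ffun_deltaE t) !linear_sum.
by apply: eq_bigr => x _; rewrite !linearZ /= fg.
Qed.

Lemma mem_free b (t : F) : (forall x, par x != b -> t x = 0) -> t \in spart F b.
Proof.
move=> t0; rewrite memv_ker; apply/eqP/ffunP => x; rewrite fcutE ffunE.
by case: ifP => // /eqP xb; apply: t0; rewrite xb; case: (b).
Qed.

Lemma free_par b (t : F) x : t \in spart F b -> par x != b -> t x = 0.
Proof.
rewrite memv_ker => /eqP t0 xb; have := congr1 (fun u : {ffun T -> k^o} => u x) t0.
by rewrite /= fcutE ffunE; case: (par x) (b) xb => [] [].
Qed.

Lemma mem_delta x : (delta k x : F) \in spart F (par x).
Proof.
by apply: mem_free => y yx; rewrite ffunE; case: eqP => // yx'; rewrite yx' eqxx in yx.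
Qed.

Lemma hom_free_even W (f : 'Hom(F, sspace W)) b :
  (forall x, f (delta k x) \in spart W (par x (+) b)) -> f \in spart (shom F W) b.
Proof.
move=> fb; apply/mem_shom => c v vc; rewrite (ffun_deltaE v) linear_sum.
apply: memv_suml => i _; rewrite linearZ /=.
have [<- | ic] := eqVneq (par i) c; first by rewrite memvZ ?fb.
by rewrite (free_par vc ic) scale0r mem0v.
Qed.

End FreeSuper.

Section Sub.
Variables (V : superspace k) (U : {vspace V}).

Lemma ssub_in_val (u : ssub U) : ssub_in U u = vsval u.
Proof. exact: ssub_inE. Qed.

Lemma ssub_prE v : ssub_pr U v = vsproj (hcore U) v.
Proof. exact: lfunE. Qed.

Lemma ssub_prK v : hcore U = U -> v \in U -> ssub_in U (ssub_pr U v) = v.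
Proof. by move=> hU vU; rewrite ssub_prE ssub_in_val vsprojK ?hU. Qed.

Lemma ssub_inK u : ssub_pr U (ssub_in U u) = u.
Proof. by rewrite ssub_prE ssub_in_val vsvalK. Qed.

Lemma ssub_in_inj : injective (ssub_in U).
Proof. exact: can_inj ssub_inK. Qed.

Lemma hcore_sub : (hcore U <= U)%VS.
Proof. by rewrite subv_add !capvSl. Qed.

Lemma mem_ssub u : ssub_in U u \in U.
Proof. by apply: (subvP hcore_sub); rewrite ssub_in_val subvsP. Qed.

Lemma spart_ssub b (u : ssub U) : (u \in spart (ssub U) b) = (ssub_in U u \in spart V b).
Proof. by rewrite -memv_preim. Qed.

Lemma ssub_in_even : ssub_in U \in spart (shom (ssub U) V) false.
Proof. by apply/mem_shom => c v; rewrite spart_ssub addbF. Qed.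

End Sub.

Section Quot.
Variables (V : superspace k) (U : {vspace V}).

Lemma squot_secK x : squot_pi U (squot_sec U x) = x.
Proof.
have E : squot_sec U x = vsval x by rewrite /squot_sec lfunE.
by rewrite E; apply: (@squot_pi_val k V U x).
Qed.

Lemma squot_pi0 v : hcore U = U -> (squot_pi U v == 0) = (v \in U).
Proof. by move=> hU; rewrite squot_pi_eq0 hU. Qed.

Lemma squot_eq v w : hcore U = U -> v - w \in U -> squot_pi U v = squot_pi U w.
Proof. by move=> hU; rewrite -squot_pi0 // linearB subr_eq0 => /eqP. Qed.

Lemma squot_sec_pi v : hcore U = U -> squot_sec U (squot_pi U v) - v \in U.
Proof. by move=> hU; rewrite -squot_pi0 // linearB /= squot_secK subrr. Qed.

Lemma squot_lift (Z : vectType k) (f : 'Hom(sspace V, Z)) v : hcore U = U ->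
  (forall u, u \in U -> f u = 0) -> f (squot_sec U (squot_pi U v)) = f v.
Proof.
by move=> hU f0; apply/eqP; rewrite -subr_eq0 -linearB; apply/eqP/f0/squot_sec_pi.
Qed.

Lemma squot_pi_even : squot_pi U \in spart (shom V (squot U)) false.
Proof. by apply/mem_shom => c v vc; rewrite addbF memv_img. Qed.

Lemma squot_homog b (x : squot U) : x \in spart (squot U) b ->
  exists2 v, v \in spart V b & squot_pi U v = x.
Proof. by case/memv_imgP => v vb ->; exists v. Qed.

End Quot.

Section DSum.
Variables (J : finType) (F : J -> superspace k).

Lemma dinE j v : din F j v =
  \sum_i hcoord i v *: (delta k (Tagged (fun j => hidx (F j)) i) : dsum F).
Proof.
apply: linfun_linear => a u w; rewrite scaler_sumr -big_split /=; apply: eq_bigr => i _.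
by rewrite hcoordP scalerDl scalerA.
Qed.

Lemma dprE j (t : dsum F) : dpr F j t =
  \sum_i (t (Tagged (fun j => hidx (F j)) i) : k) *: hb i.
Proof.
rewrite /dpr.
have L : linear (fun t : dsum F =>
    \sum_i (t (Tagged (fun j => hidx (F j)) i) : k) *: (hb i : F j)).
  move=> a u w; rewrite scaler_sumr -big_split /=; apply: eq_bigr => i _.
  by rewrite !ffunE scalerDl scalerA.
exact: (linfun_linear L).
Qed.

Lemma din_hb j (i : hidx (F j)) :
  din F j (hb i) = delta k (Tagged (fun j => hidx (F j)) i).
Proof.
rewrite dinE (bigD1 i) //= hcoord_hb eqxx scale1r big1 ?addr0 // => i' ne.
by rewrite hcoord_hb (negPf ne) scale0r.
Qed.

Lemma din_id j v : dpr F j (din F j v) = v.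
Proof.
have : (dpr F j \o din F j)%VF = \1%VF.
  apply: hom_basis_ext => i; rewrite comp_lfunE id_lfunE din_hb dprE.
  rewrite (bigD1 i) //= ffunE eqxx scale1r big1 ?addr0 // => i' ne.
  by rewrite ffunE eq_Tagged /= (negPf ne) scale0r.
by move/lfunP/(_ v); rewrite comp_lfunE id_lfunE.
Qed.

Lemma din_neq j j' v : j' != j -> dpr F j' (din F j v) = 0.
Proof.
move=> jj'; have : (dpr F j' \o din F j)%VF = 0.
  apply: hom_basis_ext => i; rewrite comp_lfunE zero_lfunE din_hb dprE.
  rewrite big1 // => i' _; rewrite ffunE.
  case: eqP => [E | _]; last by rewrite scale0r.
  by have /= jE := congr1 tag E; rewrite jE eqxx in jj'.
by move/lfunP/(_ v); rewrite comp_lfunE zero_lfunE.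
Qed.

Lemma dsum_sum (t : dsum F) : t = \sum_j din F j (dpr F j t).
Proof.
have : \1%VF = (\sum_j (din F j \o dpr F j))%VF.
  apply: delta_ext => -[j i]; rewrite id_lfunE sum_lfunE.
  rewrite -[delta _ _](din_hb i) (bigD1 j) //= comp_lfunE din_id big1 ?addr0 // => j' ne.
  by rewrite comp_lfunE (din_neq _ ne) linear0.
move/lfunP/(_ t); rewrite id_lfunE sum_lfunE => {1}->.
by apply: eq_bigr => j _; rewrite comp_lfunE.
Qed.

Lemma dsum_ext (Z : vectType k) (f g : 'Hom(sspace (dsum F), Z)) :
  (forall j v, f (din F j v) = g (din F j v)) -> f = g.
Proof.
by move=> fg; apply/lfunP => t; rewrite (dsum_sum t) !linear_sum; apply: eq_bigr => j _ /=; rewrite fg.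
Qed.

Lemma din_even j : din F j \in spart (shom (F j) (dsum F)) false.
Proof.
apply: mem_shom_hb => i; rewrite addbF din_hb.
exact: (mem_delta (fun x : {j : J & hidx (F j)} => hpar (tagged x))).
Qed.

Lemma dpr_even j : dpr F j \in spart (shom (dsum F) (F j)) false.
Proof.
apply: hom_free_even => -[j' i]; rewrite addbF -[delta _ _](din_hb i) /=.
have [E | ne] := eqVneq j j'; first by subst j'; rewrite din_id mem_hb.
by rewrite din_neq // mem0v.
Qed.

Lemma dsum_spart b (t : dsum F) :
  (forall j, dpr F j t \in spart (F j) b) -> t \in spart (dsum F) b.
Proof.
move=> tb; rewrite (dsum_sum t); apply: memv_suml => j _.
by apply: shom_even (din_even j) (tb j).
Qed.

End DSum.

Section Tensor.
Variables X Y : superspace k.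

Lemma tensPl a (x x' : X) (y : Y) : tens (a *: x + x') y = a *: tens x y + tens x' y.
Proof. by apply/ffunP => ij; rewrite !ffunE hcoordP mulrDl -mulrA. Qed.

Lemma tensPr a (x : X) (y y' : Y) : tens x (a *: y + y') = a *: tens x y + tens x y'.
Proof. by apply/ffunP => ij; rewrite !ffunE hcoordP mulrDr mulrCA. Qed.

Lemma tens_hb (i : hidx X) (j : hidx Y) : tens (hb i) (hb j) = delta k (i, j).
Proof.
apply/ffunP => -[i' j']; rewrite !ffunE /= !hcoord_hb xpair_eqE.
by case: eqP; case: eqP => //=; rewrite ?mulr0 ?mulr1 ?mul0r.
Qed.

Definition tensl (y : Y) : 'Hom(X, stens X Y) := linfun (fun x : X => tens x y).
Definition tensr (x : X) : 'Hom(Y, stens X Y) := linfun (fun y : Y => tens x y).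

Lemma tenslE y x : tensl y x = tens x y.
Proof. by apply: linfun_linear => a u v; apply: tensPl. Qed.

Lemma tensrE y x : tensr x y = tens x y.
Proof. by apply: linfun_linear => a u v; apply: tensPr. Qed.

Lemma tens_suml (I : finType) (P : pred I) (f : I -> X) (y : Y) :
  tens (\sum_(i | P i) f i) y = \sum_(i | P i) tens (f i) y.
Proof. by rewrite -tenslE linear_sum; apply: eq_bigr => i _ /=; rewrite tenslE. Qed.

Lemma tens_sumr (I : finType) (P : pred I) (f : I -> Y) (x : X) :
  tens x (\sum_(i | P i) f i) = \sum_(i | P i) tens x (f i).
Proof. by rewrite -tensrE linear_sum; apply: eq_bigr => i _ /=; rewrite tensrE. Qed.

Lemma tensZl a (x : X) (y : Y) : tens (a *: x) y = a *: tens x y.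
Proof. by rewrite -!tenslE linearZ. Qed.

Lemma tensZr a (x : X) (y : Y) : tens x (a *: y) = a *: tens x y.
Proof. by rewrite -!tensrE linearZ. Qed.

Lemma tens0l (y : Y) : tens (0 : X) y = 0.
Proof. by rewrite -tenslE linear0. Qed.

Lemma tens0r (x : X) : tens x (0 : Y) = 0.
Proof. by rewrite -tensrE linear0. Qed.

Lemma mem_tens b c (x : X) (y : Y) : x \in spart X b -> y \in spart Y c ->
  tens x y \in spart (stens X Y) (b (+) c).
Proof.
move=> xb yc; apply: mem_free => -[i j] /= ij; rewrite ffunE /=.
have [ib | nib] := eqVneq (hpar i) b; last by rewrite (hcoord_par xb nib) mul0r.
have [jc | njc] := eqVneq (hpar j) c; last by rewrite (hcoord_par yc njc) mulr0.
by rewrite ib jc eqxx in ij.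
Qed.

Lemma stens_ext (Z : vectType k) (f g : 'Hom(sspace (stens X Y), Z)) :
  (forall i j, f (tens (hb i) (hb j)) = g (tens (hb i) (hb j))) -> f = g.
Proof. by move=> fg; apply: delta_ext => -[i j]; rewrite -tens_hb. Qed.

Lemma stens_sum (t : stens X Y) :
  t = \sum_(ij : hidx X * hidx Y) (t ij : k) *: tens (hb ij.1) (hb ij.2).
Proof. by rewrite {1}(ffun_deltaE t); apply: eq_bigr => -[i j] _; rewrite tens_hb. Qed.

End Tensor.

Lemma stmapE0 X Y X' Y' (f : 'Hom(sspace X, sspace X')) (g : 'Hom(sspace Y, sspace Y'))
    (x : X) (y : Y) : stmap false f g (tens x y) = tens (f x) (g y).
Proof.
have -> : stmap false f g = tlin (fun x y => tens (f x) (g y)).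
  by apply: stens_ext => i j; rewrite tens_hb !flin_delta /= expr0 scale1r.
apply: tlinE => [v|u] a u1 u2; rewrite linearP /=; [exact: tensPl | exact: tensPr].
Qed.

(** The sign depends only on the parity of [x], so it is absorbed into the first map and [stmapE0]
    applies; the basis vectors occurring in [x] all have parity [c]. *)
Lemma stmapE b c X Y X' Y' (f : 'Hom(sspace X, sspace X')) (g : 'Hom(sspace Y, sspace Y'))
    (x : X) (y : Y) : x \in spart X c ->
  stmap b f g (tens x y) = ((-1) ^+ (b && c) : k) *: tens (f x) (g y).
Proof.
move=> xc; pose s := ((-1) ^+ (b && c) : k).
rewrite -tensZl -/s -(scale_lfunE s f x) -stmapE0.
rewrite !flinE; apply: eq_bigr => -[i j] _ /=; rewrite ffunE /= expr0 scale1r.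
have [-> | /(hpar_spart xc) ->] := eqVneq (hcoord i x) 0; first by rewrite mul0r !scale0r.
by rewrite scale_lfunE tensZl.
Qed.

Lemma pf_evenP n (F : pfunctor k n) V W :
  (forall c (f : ghom n V W), f \in spart (ghom n V W) c ->
    pf_map F f \in spart (shom (F V) (F W)) c) ->
  pf_mor F V W \in spart (shom (ghom n V W) (shom (F V) (F W))) false.
Proof. by move=> Fc; apply/mem_shom => c f fc; rewrite addbF; apply: Fc. Qed.

Lemma pf_map_par n (F : pfunctor k n) V W c (f : ghom n V W) : is_pfunctor F ->
  f \in spart (ghom n V W) c -> pf_map F f \in spart (shom (F V) (F W)) c.
Proof. by case=> Fe _ _; apply: shom_even (Fe V W). Qed.

End Superspaces.

(** * Inversion signs, words and the permutation action *)

Section Inversions.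

Variable n : nat.
Implicit Types (s t : 'S_n) (q : 'I_n -> 'I_n -> bool).

(** Parity of the inversions of [s], a reversed pair [a < b] counting when [q a b] holds. Products
    of parities give the Koszul sign, the constant [true] gives the sign of [s], and [qA] below
    combines both. *)
Definition inv s q : bool :=
  \big[addb/false]_(x : 'I_n * 'I_n | (x.1 < x.2)%N && (s x.2 < s x.1)%N) q x.1 x.2.

Lemma odd_sum (I : Type) (r : seq I) (P : pred I) (F : I -> nat) :
  odd (\sum_(i <- r | P i) F i) = \big[addb/false]_(i <- r | P i) odd (F i).
Proof. by apply: (big_morph odd) => // a b; rewrite oddD. Qed.

Lemma inv_sum s q :
  odd (\sum_(a < n) \sum_(b < n | (a < b)%N && (s b < s a)%N) q a b) = inv s q.
Proof.
rewrite odd_sum; under eq_bigr => a _.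
  rewrite odd_sum; under eq_bigr => b _ do rewrite oddb.
  over.
by rewrite pair_big_dep.
Qed.

Lemma eq_inv s q q' : (forall a b, q a b = q' a b) -> inv s q = inv s q'.
Proof. by move=> qq'; apply: eq_bigr => x _. Qed.

(** Inversion as a symmetric relation, so that sums over unordered pairs can be reindexed by a
    permutation. *)
Definition cross t (a b : 'I_n) := (a < b)%N (+) (t a < t b)%N.

Lemma cross_sym t a b : cross t a b = cross t b a.
Proof.
have [-> // | ab] := eqVneq a b.
have tab : t a != t b by rewrite (inj_eq perm_inj).
rewrite /cross; case: (ltngtP a b) => [_|_|/val_inj E]; last by rewrite E eqxx in ab.
  by case: (ltngtP (t a) (t b)) => // /val_inj E; rewrite E eqxx in tab.
by case: (ltngtP (t a) (t b)) => // /val_inj E; rewrite E eqxx in tab.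
Qed.

Lemma inv_cross s q :
  inv s q = \big[addb/false]_(x : 'I_n * 'I_n | (x.1 < x.2)%N) (q x.1 x.2 && cross s x.1 x.2).
Proof.
rewrite /inv big_mkcondr /=; apply: eq_bigr => -[a b] /= ab.
rewrite /cross ab /= -leqNgt [in RHS]leq_eqVlt.
have -> : (s b == s a :> nat) = false.
  by apply/negP => /eqP/val_inj/perm_inj E; rewrite E ltnn in ab.
by case: ifP => _; rewrite ?andbT ?andbF.
Qed.

(** A permutation permutes the unordered pairs; those it puts in the wrong order are restored by the
    swap [sw], harmless because [g] is symmetric. *)
Lemma pair_sym_reindex s (g : 'I_n -> 'I_n -> bool) : (forall a b, g a b = g b a) ->
  \big[addb/false]_(x : 'I_n * 'I_n | (x.1 < x.2)%N) g (s x.1) (s x.2) =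
  \big[addb/false]_(x : 'I_n * 'I_n | (x.1 < x.2)%N) g x.1 x.2.
Proof.
move=> gsym; pose P (x : 'I_n * 'I_n) := ((s^-1)%g x.1 < (s^-1)%g x.2)%N.
pose sw (x : 'I_n * 'I_n) := (x.2, x.1).
have swK : involutive sw by case.
pose sp (x : 'I_n * 'I_n) := ((s^-1)%g x.1, (s^-1)%g x.2).
pose sp' (x : 'I_n * 'I_n) := (s x.1, s x.2).
have spK : bijective sp.
  by exists sp' => -[a b]; rewrite /sp /sp' /= ?permK ?permKV.
rewrite (reindex sp) /=; last exact: onW_bij.
have -> : \big[addb/false]_(j | ((s^-1)%g j.1 < (s^-1)%g j.2)%N)
     g (s ((s^-1)%g j.1)) (s ((s^-1)%g j.2)) = \big[addb/false]_(j | P j) g j.1 j.2.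
  by apply: eq_bigr => j _; rewrite !permKV.
rewrite (bigID (fun x : 'I_n * 'I_n => (x.1 < x.2)%N)) /=.
rewrite [X in _ (+) X](reindex sw) /=; last by apply: onW_bij; exists sw.
rewrite [X in _ (+) X](eq_bigr (fun x => g x.1 x.2)); last by move=> x _; rewrite gsym.
rewrite [RHS]big_mkcond [X in X (+) _]big_mkcond [X in _ (+) X]big_mkcond -big_split /=.
apply: eq_bigr => -[a b] _; rewrite /P /=.
have [-> | ab] := eqVneq a b; first by rewrite !ltnn.
have sab : (s^-1)%g a != (s^-1)%g b by rewrite (inj_eq perm_inj).
case: (ltngtP a b) => [_|_|/val_inj E] //=; last by rewrite E eqxx in ab.
  by case: (ltngtP ((s^-1)%g a) ((s^-1)%g b)) => [_|_|/val_inj E] //=;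
    rewrite ?addbF //; rewrite E eqxx in sab.
by rewrite !andbF.
Qed.

(** Cocycle identity: [s * t] reverses a pair when exactly one of the two steps does. The sum for
    [t] is reindexed along [s]. *)
Lemma invM s t q : (forall a b, q a b = q b a) ->
  inv (s * t)%g q = inv s q (+) inv t (fun a b => q ((s^-1)%g a) ((s^-1)%g b)).
Proof.
move=> qsym; rewrite !inv_cross.
pose g a b := q ((s^-1)%g a) ((s^-1)%g b) && cross t a b.
rewrite -[X in _ (+) X](@pair_sym_reindex s g) => [|a b]; last by rewrite /g qsym cross_sym.
rewrite -big_split; apply: eq_bigr => -[a b] _; rewrite /= /g !permK /cross !permM.
by case: (q a b) => //=; case: (a < b)%N; case: (s a < s b)%N; case: (t _ < _)%N.
Qed.

Lemma inv1 q : inv 1%g q = false.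
Proof. by rewrite inv_cross big1 // => x _; rewrite /cross !perm1 addbb andbF. Qed.

(** Pairs avoiding [x] and [y] keep their order. For a third position [c] the pairs [{x, c}] and
    [{y, c}] are reversed together and have the same weight, so they cancel; the pair [{x, y}] is
    left. *)
Lemma inv_tperm x y q : (forall a b, q a b = q b a) -> x != y ->
  (forall c, c != x -> c != y -> q x c = q y c) -> inv (tperm x y) q = q x y.
Proof.
move=> qsym xy qxy; rewrite inv_cross big_mkcond /=.
pose g a b := q a b && cross (tperm x y) a b.
have gsym a b : g a b = g b a by rewrite /g qsym cross_sym.
have g0 a b : a != x -> a != y -> b != x -> b != y -> g a b = false.
  by move=> *; rewrite /g /cross !tpermD 1?eq_sym // addbb andbF.
have gx c : c != x -> c != y -> g x c = g y c.
  move=> cx cy; rewrite /g qxy //; congr (_ && _).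
  by rewrite /cross tpermL tpermR tpermD 1?eq_sym // addbC.
have gxy : g x y = q x y.
  rewrite /g /cross tpermL tpermR; case: (ltngtP x y); rewrite ?andbT //.
  by move/val_inj=> E; rewrite E eqxx in xy.
pose G (a b : 'I_n) := if (a < b)%N then g a b else false.
have GG a b : a != b -> G a b (+) G b a = g a b.
  move=> ab; rewrite /G; case: (ltngtP a b) => [_|_|/val_inj E].
  - by rewrite addbF.
  - by rewrite gsym.
  - by rewrite E eqxx in ab.
have Gxx a : G a a = false by rewrite /G ltnn.
have row (h : 'I_n -> bool) : \big[addb/false]_j h j =
    h x (+) (h y (+) \big[addb/false]_(j | (j != x) && (j != y)) h j).
  by rewrite (bigD1 x) //= (bigD1 y) 1?eq_sym.
rewrite -(pair_bigA _ G) /= !row !Gxx /=.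
rewrite [X in _ (+) (_ (+) X)](eq_bigr (fun c => G c x (+) G c y)); last first.
  move=> c /andP[cx cy]; rewrite row big1 ?addbF // => b /andP[bx b_y].
  by rewrite /G g0 //; case: ifP.
rewrite big_split /=.
set A := \big[_/_]_(_ | _) G x _; set B := \big[_/_]_(_ | _) G y _.
set C := \big[_/_]_(_ | _) G _ x; set D := \big[_/_]_(_ | _) G _ y.
have E : (A (+) C) = (B (+) D).
  rewrite -!big_split; apply: eq_bigr => c /andP[cx cy] /=.
  by rewrite !GG 1?eq_sym // gx.
rewrite -gxy -(GG _ _ xy); move: E; clear.
by case: A; case: B; case: C; case: D; case: (G x y); case: (G y x).
Qed.

(** Both sides are additive along products and true on transpositions. *)
Lemma inv_sign s : inv s (fun _ _ => true) = odd_perm s.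
Proof.
have [ts -> tsP] := prod_tpermP s; elim: ts tsP => [|[x y] ts IH] /=.
  by rewrite big_nil inv1 odd_perm1.
case/andP=> /= xy /IH {}IH; rewrite big_cons invM // IH odd_permM odd_tperm xy.
by rewrite inv_tperm.
Qed.

End Inversions.

Section Words.

Variable T : Type.
Variables (m n l : nat) (e : (m + n)%N = l).

Definition posl (a : 'I_m) : 'I_l := cast_ord e (lshift n a).
Definition posr (b : 'I_n) : 'I_l := cast_ord e (rshift m b).

Definition catf (v : 'I_m -> T) (v' : 'I_n -> T) (x : 'I_l) : T :=
  match split (cast_ord (esym e) x) with inl a => v a | inr b => v' b end.

Lemma catf_l v v' a : catf v v' (posl a) = v a.
Proof. by rewrite /catf /posl cast_ordK (unsplitK (inl a)). Qed.

Lemma catf_r v v' b : catf v v' (posr b) = v' b.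
Proof. by rewrite /catf /posr cast_ordK (unsplitK (inr b)). Qed.

Lemma pos_ind (P : 'I_l -> Prop) :
  (forall a, P (posl a)) -> (forall b, P (posr b)) -> forall x, P x.
Proof.
move=> Pl Pr x; rewrite -(cast_ordKV e x) -(splitK (cast_ord (esym e) x)).
by case: (split _) => [a|b]; [exact: Pl | exact: Pr].
Qed.

Lemma posl_val a : posl a = a :> nat. Proof. by []. Qed.
Lemma posr_val b : posr b = (m + b)%N :> nat. Proof. by []. Qed.

Lemma posl_lt (a a' : 'I_m) : (posl a < posl a')%N = (a < a')%N. Proof. by []. Qed.
Lemma posr_lt (b b' : 'I_n) : (posr b < posr b')%N = (b < b')%N.
Proof. by rewrite !posr_val ltn_add2l. Qed.
Lemma poslr_lt a b : (posl a < posr b)%N.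
Proof. by rewrite posr_val posl_val ltn_addr. Qed.
Lemma posrl_lt a b : (posr b < posl a)%N = false.
Proof. by apply/negbTE; rewrite -leqNgt ltnW ?poslr_lt. Qed.

Lemma big_pos (R : Type) (idx : R) (op : Monoid.com_law idx) (F : 'I_l -> R) :
  \big[op/idx]_x F x =
  op (\big[op/idx]_a F (posl a)) (\big[op/idx]_b F (posr b)).
Proof.
rewrite (reindex (cast_ord e)) /=; first by rewrite big_split_ord.
by exists (cast_ord (esym e)) => x _; rewrite ?cast_ordK ?cast_ordKV.
Qed.

End Words.

Arguments posl : simpl never.
Arguments posr : simpl never.

Lemma addb_pos m n l (e : (m + n)%N = l) (F : 'I_l -> bool) :
  \big[addb/false]_x F x =
  \big[addb/false]_a F (posl e a) (+) \big[addb/false]_b F (posr e b).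
Proof. exact: big_pos. Qed.

Section WordCat.

Variable T : Type.
Variables (m n l : nat) (e : (m + n)%N = l).

Definition wcat (w : {ffun 'I_m -> T}) (w' : {ffun 'I_n -> T}) : {ffun 'I_l -> T} :=
  [ffun x => catf e w w' x].

Definition wl (x : {ffun 'I_l -> T}) : {ffun 'I_m -> T} := [ffun a => x (posl e a)].
Definition wr (x : {ffun 'I_l -> T}) : {ffun 'I_n -> T} := [ffun b => x (posr e b)].

Lemma wcat_l w w' a : wcat w w' (posl e a) = w a.
Proof. by rewrite ffunE catf_l. Qed.
Lemma wcat_r w w' b : wcat w w' (posr e b) = w' b.
Proof. by rewrite ffunE catf_r. Qed.
Lemma wcatK w w' : wl (wcat w w') = w.
Proof. by apply/ffunP => a; rewrite ffunE wcat_l. Qed.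
Lemma wcatKr w w' : wr (wcat w w') = w'.
Proof. by apply/ffunP => a; rewrite ffunE wcat_r. Qed.
Lemma wcat_split x : wcat (wl x) (wr x) = x.
Proof.
by apply/ffunP; apply: (pos_ind (e := e)) => a; rewrite ?wcat_l ?wcat_r ffunE.
Qed.

(** The letter at [x] moves to [s x], the convention of [tact]; this is a right action for the
    product of permutations. *)
Definition wact n' (s : 'S_n') (w : {ffun 'I_n' -> T}) : {ffun 'I_n' -> T} :=
  [ffun a => w ((s^-1)%g a)].

Lemma wact_at n' (s : 'S_n') w x : wact s w (s x) = w x.
Proof. by rewrite ffunE permK. Qed.

Lemma wactM n' (s t : 'S_n') w : wact (s * t)%g w = wact t (wact s w).
Proof. by apply/ffunP => a; rewrite !ffunE invMg permM. Qed.

Lemma wact1 n' w : wact (1%g : 'S_n') w = w.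
Proof. by apply/ffunP => a; rewrite !ffunE invg1 perm1. Qed.

Lemma wactK n' (s : 'S_n') : cancel (@wact n' s) (@wact n' (s^-1)%g).
Proof. by move=> w; rewrite -wactM mulgV wact1. Qed.

Lemma ffun_perm_ext n' (s : 'S_n') (f g : {ffun 'I_n' -> T}) :
  (forall x, f (s x) = g (s x)) -> f = g.
Proof. by move=> fg; apply/ffunP => x; rewrite -(permKV s x). Qed.

End WordCat.

Section BlockPerm.

Variables (m n l : nat) (e : (m + n)%N = l).

Definition padd_fun (s : 'S_m) (t : 'S_n) : 'I_l -> 'I_l :=
  catf e (fun a => posl e (s a)) (fun b => posr e (t b)).

Lemma padd_inj s t : injective (padd_fun s t).
Proof.
apply: (@can_inj _ _ _ (padd_fun (s^-1)%g (t^-1)%g)); apply: (pos_ind (e := e)) => a.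
  by rewrite /padd_fun !catf_l permK.
by rewrite /padd_fun !catf_r permK.
Qed.

Definition padd s t : 'S_l := perm (@padd_inj s t).

Lemma padd_l s t a : padd s t (posl e a) = posl e (s a).
Proof. by rewrite permE /padd_fun catf_l. Qed.
Lemma padd_r s t b : padd s t (posr e b) = posr e (t b).
Proof. by rewrite permE /padd_fun catf_r. Qed.

Lemma inv_nest N (s : 'S_N) q : inv s q =
  \big[addb/false]_(a < N) \big[addb/false]_(b < N) ((a < b)%N && (s b < s a)%N && q a b).
Proof.
rewrite /inv big_mkcond -(pair_bigA _ (fun a b : 'I_N =>
  if (a < b)%N && (s b < s a)%N then q a b else false)) /=.
by do 2 (apply: eq_bigr => ? _); case: ifP.
Qed.

Lemma inv_padd s t q : inv (padd s t) q =
  inv s (fun a b => q (posl e a) (posl e b)) (+) inv t (fun a b => q (posr e a) (posr e b)).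
Proof.
rewrite !inv_nest (addb_pos e); congr (_ (+) _); apply: eq_bigr => a _; rewrite (addb_pos e).
  rewrite [X in _ (+) X]big1 ?addbF => [|b _]; last by rewrite padd_l padd_r posrl_lt andbF.
  by apply: eq_bigr => b _; rewrite !padd_l !posl_lt.
rewrite big1 ?addFb => [|b _]; last by rewrite posrl_lt.
by apply: eq_bigr => b _; rewrite !padd_r !posr_lt.
Qed.

Lemma wact_padd (T : Type) s t (w : {ffun 'I_m -> T}) w' :
  wact (padd s t) (wcat e w w') = wcat e (wact s w) (wact t w').
Proof.
apply: (@ffun_perm_ext _ _ (padd s t)) => x; rewrite wact_at; move: x.
by apply: (pos_ind (e := e)) => a;
  rewrite ?padd_l ?padd_r ?wcat_l ?wcat_r ?ffunE ?permK ?catf_l ?catf_r ?ffunE ?permK.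
Qed.

Variable e' : (n + m)%N = l.

Definition pswap_fun : 'I_l -> 'I_l := catf e (posr e') (posl e').

Lemma pswap_inj : injective pswap_fun.
Proof.
apply: (@can_inj _ _ _ (catf e' (posr e) (posl e))); apply: (pos_ind (e := e)) => a.
  by rewrite /pswap_fun !(catf_l, catf_r).
by rewrite /pswap_fun !(catf_l, catf_r).
Qed.

Definition pswap : 'S_l := perm pswap_inj.

Lemma pswap_l a : pswap (posl e a) = posr e' a.
Proof. by rewrite permE /pswap_fun catf_l. Qed.
Lemma pswap_r b : pswap (posr e b) = posl e' b.
Proof. by rewrite permE /pswap_fun catf_r. Qed.

(** The reversed pairs are exactly those with one position in each block. *)
Lemma inv_pswap q : inv pswap q =
  \big[addb/false]_(a < m) \big[addb/false]_(b < n) q (posl e a) (posr e b).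
Proof.
rewrite inv_nest (addb_pos e) [X in _ (+) X]big1 ?addbF => [|a _]; last first.
  rewrite (addb_pos e) !big1 // => b _; rewrite ?posrl_lt //.
  by rewrite !pswap_r posr_lt posl_lt andbC; case: ltngtP; rewrite ?andbF.
apply: eq_bigr => a _; rewrite (addb_pos e) big1 ?addFb => [|b _]; last first.
  by rewrite !pswap_l posr_lt posl_lt andbC; case: ltngtP; rewrite ?andbF.
by apply: eq_bigr => b _; rewrite pswap_l pswap_r !poslr_lt.
Qed.

Lemma wact_pswap (T : Type) (w : {ffun 'I_m -> T}) w' :
  wact pswap (wcat e w w') = wcat e' w' w.
Proof.
apply: (@ffun_perm_ext _ _ pswap) => x; rewrite wact_at; move: x.
by apply: (pos_ind (e := e)) => a;
  rewrite ?pswap_l ?pswap_r ?wcat_l ?wcat_r.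
Qed.

End BlockPerm.

Section TensorPowers.

Variable k : fieldType.
Implicit Types (U V W X Y Z : superspace k).

Lemma signr_nat (x : nat) (b : bool) : odd x = b -> (-1) ^+ x = (-1) ^+ b :> k.
Proof. by move=> <-; rewrite signr_odd. Qed.

Lemma tact_delta n V (s : 'S_n) (w : word n V) :
  tact V s (delta k w) =
  ((-1) ^+ inv s (fun a b => hpar (w a) && hpar (w b)) : k) *:
    (delta k (wact s w : word n V) : tpow n V).
Proof. by rewrite flin_delta (signr_nat (inv_sum _ _)). Qed.

Lemma mem_tpow n V b (z : tpow n V) :
  (forall w, wpar w != b -> z w = 0) -> z \in spart (tpow n V) b.
Proof. exact: mem_free. Qed.

Lemma tmul_hb n V (w : word n V) : tmul (fun a => hb (w a)) = delta k w.
Proof.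
apply/ffunP => w'; rewrite !ffunE; have [-> | ne] := eqVneq w' w.
  by rewrite big1 // => a _; rewrite hcoord_hb eqxx.
have /existsP[a wa] : [exists a, w' a != w a].
  apply: contraR ne; rewrite negb_exists => /forallP E.
  by apply/eqP/ffunP => a; apply/eqP; have := E a; rewrite negbK.
by rewrite (bigD1 a) //= hcoord_hb (negPf wa) mul0r.
Qed.

Lemma eq_tmul n V (v v' : 'I_n -> sspace V) : v =1 v' -> tmul v = tmul v'.
Proof. by move=> E; apply/ffunP => w; rewrite !ffunE; apply: eq_bigr => a _; rewrite E. Qed.

(** Only words whose letters have the parities [q] occur in [tmul v], so all of them get the same
    sign. *)
Lemma tact_tmul n V (s : 'S_n) (v : 'I_n -> sspace V) (q : 'I_n -> bool) :
    (forall a, v a \in spart V (q a)) ->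
  tact V s (tmul v) =
  ((-1) ^+ inv s (fun a b => q a && q b) : k) *: tmul (fun a => v ((s^-1)%g a)).
Proof.
move=> vq; rewrite (ffun_deltaE (tmul v)) linear_sum /=.
transitivity (\sum_(w : word n V) ((-1) ^+ inv s (fun a b => q a && q b) : k) *:
    ((tmul v w : k) *: (delta k (wact s w : word n V) : tpow n V))).
  apply: eq_bigr => w _; rewrite linearZ /= tact_delta.
  have [-> | nz] := eqVneq (tmul v w) 0; first by rewrite !scale0r scaler0.
  have E a : hpar (w a) = q a.
    apply: hpar_spart (vq a) _; apply: contraNneq nz => E.
    by rewrite ffunE (bigD1 a) //= E mul0r.
  by rewrite (eq_inv _ (q' := fun a b => q a && q b)) ?scalerA 1?mulrC // => a b; rewrite !E.
rewrite -scaler_sumr; congr (_ *: _).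
rewrite (reindex (@wact _ _ (s^-1)%g)) /=; last first.
  exists (@wact _ _ s) => w _; rewrite -wactM ?mulgV ?mulVg wact1 //.
rewrite [RHS]ffun_deltaE; apply: eq_bigr => w _.
rewrite -wactM mulVg wact1; congr (_ *: _).
rewrite !ffunE (reindex_inj (@perm_inj _ (s^-1)%g)) /=.
by apply: eq_bigr => a _; rewrite ffunE invgK permKV.
Qed.

Lemma tactM n V (s t : 'S_n) : tact V (s * t)%g = (tact V t \o tact V s)%VF.
Proof.
apply: delta_ext => w; rewrite comp_lfunE !tact_delta linearZ /= tact_delta scalerA.
rewrite wactM invM => [|a b]; last exact: andbC.
rewrite signr_addb; congr (_ * _ *: _); congr (_ ^+ nat_of_bool _).
by apply: eq_inv => a b; rewrite !ffunE.
Qed.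

Lemma tact1 n V : tact V (1%g : 'S_n) = \1%VF.
Proof. by apply: delta_ext => w; rewrite tact_delta inv1 wact1 scale1r id_lfunE. Qed.

Lemma wpar_wact n V (s : 'S_n) (w : word n V) : wpar (wact s w : word n V) = wpar w.
Proof.
rewrite /wpar (reindex_inj (@perm_inj _ s)); apply: eq_bigr => a _.
by rewrite wact_at.
Qed.

Lemma tact_even n V (s : 'S_n) : tact V s \in spart (shom (tpow n V) (tpow n V)) false.
Proof.
apply: hom_free_even => w; rewrite addbF tact_delta memvZ // -(wpar_wact s).
exact: (mem_delta _ (@wpar _ n V)).
Qed.

Lemma mem_tmul n V (v : 'I_n -> sspace V) (q : 'I_n -> bool) :
  (forall a, v a \in spart V (q a)) ->
  tmul v \in spart (tpow n V) (\big[addb/false]_a q a).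
Proof.
move=> vq; apply: mem_tpow => w wq; apply: contraNeq wq => nz.
rewrite /wpar; apply/eqP/eq_bigr => a _; apply: hpar_spart (vq a) _.
by apply: contraNneq nz => E; rewrite ffunE (bigD1 a) //= E mul0r.
Qed.

Section Concat.

Variables (m n l : nat) (e : (m + n)%N = l).
Variable V : superspace k.

Lemma tconcPl a (z1 z2 : tpow m V) (z' : tpow n V) :
  tconc e (a *: z1 + z2) z' = a *: tconc e z1 z' + tconc e z2 z'.
Proof. by apply/ffunP => w; rewrite !ffunE mulrDl -mulrA. Qed.

Lemma tconcPr a (z : tpow m V) (z1 z2 : tpow n V) :
  tconc e z (a *: z1 + z2) = a *: tconc e z z1 + tconc e z z2.
Proof. by apply/ffunP => w; rewrite !ffunE mulrDr mulrCA. Qed.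

Definition tconcl (z' : tpow n V) : 'Hom(tpow m V, tpow l V) :=
  linfun (fun z : tpow m V => tconc e z z').
Definition tconcr (z : tpow m V) : 'Hom(tpow n V, tpow l V) :=
  linfun (fun z' : tpow n V => tconc e z z').

Lemma tconclE z z' : tconcl z' z = tconc e z z'.
Proof. by apply: linfun_linear => a u v; apply: tconcPl. Qed.

Lemma tconcrE z z' : tconcr z z' = tconc e z z'.
Proof. by apply: linfun_linear => a u v; apply: tconcPr. Qed.

Lemma tconcZl a (z : tpow m V) (z' : tpow n V) : tconc e (a *: z) z' = a *: tconc e z z'.
Proof. by rewrite -!tconclE linearZ. Qed.
Lemma tconcZr a (z : tpow m V) (z' : tpow n V) : tconc e z (a *: z') = a *: tconc e z z'.
Proof. by rewrite -!tconcrE linearZ. Qed.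
Lemma tconcDl (z1 z2 : tpow m V) (z' : tpow n V) : tconc e (z1 + z2) z' = tconc e z1 z' + tconc e z2 z'.
Proof. by rewrite -!tconclE linearD. Qed.

Lemma tconc_suml (I : finType) (P : pred I) (f : I -> tpow m V) z' :
  tconc e (\sum_(i | P i) f i) z' = \sum_(i | P i) tconc e (f i) z'.
Proof. by rewrite -tconclE linear_sum; apply: eq_bigr => i _ /=; rewrite tconclE. Qed.
Lemma tconc_sumr (I : finType) (P : pred I) (f : I -> tpow n V) z :
  tconc e z (\sum_(i | P i) f i) = \sum_(i | P i) tconc e z (f i).
Proof. by rewrite -tconcrE linear_sum; apply: eq_bigr => i _ /=; rewrite tconcrE. Qed.

Lemma tconc_tmul (v : 'I_m -> sspace V) (v' : 'I_n -> sspace V) :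
  tconc e (tmul v) (tmul v') = tmul (catf e v v').
Proof.
apply/ffunP => x; rewrite !ffunE (big_pos e) /=; congr (_ * _); apply: eq_bigr => a _.
  by rewrite catf_l ffunE.
by rewrite catf_r ffunE.
Qed.

Lemma tconc_delta (w : word m V) (w' : word n V) :
  tconc e (delta k w : tpow m V) (delta k w' : tpow n V) = delta k (wcat e w w' : word l V).
Proof.
rewrite -!tmul_hb tconc_tmul; apply: eq_tmul => x; rewrite ffunE /catf.
by case: (split _).
Qed.

Lemma tconc_expand (z : tpow m V) (z' : tpow n V) :
  tconc e z z' = \sum_w \sum_w' ((z w : k) * (z' w' : k)) *:
     (delta k (wcat e w w' : word l V) : tpow l V).
Proof.
rewrite {1}(ffun_deltaE z) tconc_suml; apply: eq_bigr => w _.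
rewrite {1}(ffun_deltaE z') tconc_sumr; apply: eq_bigr => w' _.
by rewrite tconcZl tconcZr tconc_delta scalerA.
Qed.

Lemma delta_wcat (x : word l V) : (delta k x : tpow l V) =
  tconc e (delta k (wl e x : word m V) : tpow m V) (delta k (wr e x : word n V) : tpow n V).
Proof. by rewrite tconc_delta wcat_split. Qed.

Lemma tconc_hom_ext (Z : vectType k) (f g : 'Hom(sspace (tpow l V), Z)) :
  (forall z z', f (tconc e z z') = g (tconc e z z')) -> f = g.
Proof. by move=> fg; apply: delta_ext => x; rewrite delta_wcat. Qed.

Lemma tconc_bilin_ext (Z : vectType k) (F G : tpow m V -> tpow n V -> Z) :
    (forall z', linear (F ^~ z')) -> (forall z, linear (F z)) ->
    (forall z', linear (G ^~ z')) -> (forall z, linear (G z)) ->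
    (forall w w', F (delta k w) (delta k w') = G (delta k w) (delta k w')) ->
  forall z z', F z z' = G z z'.
Proof.
move=> Fl Fr Gl Gr FG z z'.
have E1 w : F (delta k w) z' = G (delta k w) z'.
  rewrite -(linfun_linear (Fr _)) -(linfun_linear (Gr _)); congr (fun_of_lfun _ _).
  by apply: delta_ext => w'; rewrite (linfun_linear (Fr _)) (linfun_linear (Gr _)).
rewrite -(linfun_linear (Fl z')) -(linfun_linear (Gl z')); congr (fun_of_lfun _ _).
by apply: delta_ext => w; rewrite (linfun_linear (Fl _)) (linfun_linear (Gl _)).
Qed.

Lemma wpar_wcat (w : word m V) (w' : word n V) :
  wpar (wcat e w w' : word l V) = wpar w (+) wpar w'.
Proof.
rewrite /wpar (big_pos e) /=; congr (_ (+) _); apply: eq_bigr => a _.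
  by rewrite wcat_l.
by rewrite wcat_r.
Qed.

Lemma mem_tconc b c (z : tpow m V) (z' : tpow n V) :
  z \in spart (tpow m V) b -> z' \in spart (tpow n V) c ->
  tconc e z z' \in spart (tpow l V) (b (+) c).
Proof.
move=> zb zc; apply: mem_tpow => x; rewrite -{1}(wcat_split e x) wpar_wcat ffunE => nz.
have [Eb | nb] := eqVneq (wpar (wl e x : word m V)) b; last by rewrite (free_par zb) ?mul0r.
have [Ec | nc] := eqVneq (wpar (wr e x : word n V)) c; last by rewrite (free_par zc) ?mulr0.
by rewrite Eb Ec eqxx in nz.
Qed.

Lemma tact_padd s t (z : tpow m V) (z' : tpow n V) :
  tact V (padd e s t) (tconc e z z') = tconc e (tact V s z) (tact V t z').
Proof.
move: z z'; apply: tconc_bilin_ext => [z|z|z|z|w w'].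
1-4: by move=> a u v; rewrite ?tconcPl ?tconcPr !linearP /= ?tconcPl ?tconcPr.
rewrite tconc_delta !tact_delta tconcZl tconcZr tconc_delta scalerA -signr_addb.
rewrite wact_padd inv_padd; congr (_ *: _); congr (_ ^+ nat_of_bool _).
by congr (_ (+) _); apply: eq_inv => a b; rewrite ?wcat_l ?wcat_r.
Qed.

Lemma tact_pswap (e' : (n + m)%N = l) b c (z : tpow m V) (z' : tpow n V) :
  z \in spart (tpow m V) b -> z' \in spart (tpow n V) c ->
  tact V (pswap e e') (tconc e z z') = ((-1) ^+ (b && c) : k) *:
     (\sum_w \sum_w' ((z w : k) * (z' w' : k)) *:
     (delta k (wcat e' w' w : word l V) : tpow l V)).
Proof.
move=> zb zc; rewrite tconc_expand linear_sum scaler_sumr; apply: eq_bigr => w _ /=.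
rewrite linear_sum scaler_sumr; apply: eq_bigr => w' _ /=.
rewrite linearZ /= tact_delta wact_pswap inv_pswap scalerA scalerA.
have [-> | nz] := eqVneq (z w) 0; first by rewrite !mul0r !mulr0.
have [-> | nz'] := eqVneq (z' w') 0; first by rewrite !(mulr0, mul0r).
have Ew : wpar w = b by apply: contraNeq nz => /(free_par zb) ->.
have Ew' : wpar w' = c by apply: contraNeq nz' => /(free_par zc) ->.
rewrite mulrC; congr (_ * _ *: _); congr (_ ^+ nat_of_bool _).
rewrite -Ew -Ew' /wpar big_distrl; apply: eq_bigr => a _ /=.
by rewrite big_distrr; apply: eq_bigr => d _ /=; rewrite wcat_l wcat_r.
Qed.

End Concat.

Lemma tact_pswapE m n l (e : (m + n)%N = l) (e' : (n + m)%N = l) V b c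
    (z : tpow m V) (z' : tpow n V) :
  z \in spart (tpow m V) b -> z' \in spart (tpow n V) c ->
  tact V (pswap e e') (tconc e z z') = ((-1) ^+ (b && c) : k) *: tconc e' z' z.
Proof.
move=> zb zc; rewrite (tact_pswap e e' zb zc) tconc_expand exchange_big /=.
by do 2 (congr (_ *: _) || (apply: eq_bigr => ? _)); under eq_bigr => ? _ do rewrite mulrC.
Qed.

End TensorPowers.

(** * Equivariant maps and tensor splittings *)

Section Equivariant.

Variable k : fieldType.
Implicit Types (U V W X Y Z : superspace k).

Lemma hproj_unique V (v v0 v1 : V) : v0 \in spart V false -> v1 \in spart V true ->
  v = v0 + v1 -> (hproj V false v = v0) * (hproj V true v = v1).
Proof.
move=> h0 h1 ->; rewrite !linearD /= (hproj_id h0) (hproj_id h1).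
by rewrite (hproj0 h0) // (hproj0 h1) // addr0 add0r.
Qed.

Lemma shom_comp U V W b c (g : 'Hom(sspace V, sspace W)) (f : 'Hom(sspace U, sspace V)) :
  g \in spart (shom V W) c -> f \in spart (shom U V) b ->
  (g \o f)%VF \in spart (shom U W) (b (+) c).
Proof.
move=> gc fb; apply/mem_shom => d v vd; rewrite comp_lfunE addbA.
by apply: shom_spart gc _; apply: shom_spart fb _.
Qed.

Lemma shom_comp_even U V W b (g : 'Hom(sspace V, sspace W)) (f : 'Hom(sspace U, sspace V)) :
  g \in spart (shom V W) false -> f \in spart (shom U V) b ->
  (g \o f)%VF \in spart (shom U W) b.
Proof. by move=> g0 fb; have := shom_comp g0 fb; rewrite addbF. Qed.

Lemma shom_id V : \1%VF \in spart (shom V V) false.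
Proof. by apply/mem_shom => c v vc; rewrite id_lfunE addbF. Qed.

Lemma hproj_shom_comp U V V' W b (A : 'Hom(sspace V, sspace V')) (B : 'Hom(sspace U, sspace W))
    (f : 'Hom(sspace W, sspace V)) :
  A \in spart (shom V V') false -> B \in spart (shom U W) false ->
  hproj (shom U V') b (A \o f \o B)%VF = (A \o hproj (shom W V) b f \o B)%VF.
Proof.
move=> A0 B0.
have h c : (A \o hproj (shom W V) c f \o B)%VF \in spart (shom U V') c.
  have := shom_comp (shom_comp A0 (mem_hproj (V := shom W V) c f)) B0.
  by rewrite addbF.
have E : (A \o f \o B)%VF = (A \o hproj (shom W V) false f \o B)%VF
       + (A \o hproj (shom W V) true f \o B)%VF.
  have fE : f = (hproj (shom W V) false f : 'Hom(sspace W, sspace V))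
              + (hproj (shom W V) true f : 'Hom(sspace W, sspace V)).
    by rewrite -[LHS](hproj_sum (V := shom W V)).
  by rewrite {1}fE comp_lfunDr comp_lfunDl.
by have [] := hproj_unique (V := shom U V') (h false) (h true) E; case: b.
Qed.

Lemma even_inj_spart V W b (f : 'Hom(sspace V, sspace W)) v :
  f \in spart (shom V W) false -> injective f -> f v \in spart W b -> v \in spart V b.
Proof.
move=> f0 fi fvb; have h : hproj V (~~ b) v = 0.
  by apply: fi; rewrite lfun0 -hproj_even // (hproj0 fvb) //; case: (b).
rewrite -(hproj_sum v); case: b {fvb} h => /= ->; rewrite ?add0r ?addr0; exact: mem_hproj.
Qed.

Section EquivDeg.
Variable n : nat.

(** [ghom] is carried by the graded core of the equivariant maps. Permutations act by even maps, so
    homogeneous components of equivariant maps are equivariant and the core loses nothing. *)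
Lemma equiv_hcore V W : hcore (equivariant n V W) = equivariant n V W.
Proof.
apply: hcore_id => b f /mem_equivariant fs; apply/mem_equivariant => s.
have := hproj_shom_comp b f (tact_even W s) (shom_id (tpow n V)).
have := hproj_shom_comp b f (shom_id (tpow n W)) (tact_even V s).
by rewrite !comp_lfun1l !comp_lfun1r fs => -> <-.
Qed.

Lemma gmap_equiv V W (f : ghom n V W) : gmap f \in equivariant n V W.
Proof. exact: mem_ssub. Qed.

Lemma gmap_comm V W (f : ghom n V W) s : (gmap f \o tact V s)%VF = (tact W s \o gmap f)%VF.
Proof. by move/mem_equivariant: (gmap_equiv f). Qed.

Lemma gmap_tact V W (f : ghom n V W) s z : gmap f (tact V s z) = tact W s (gmap f z).
Proof. by rewrite -!comp_lfunE gmap_comm. Qed.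

Lemma gmap_pr V W (f : 'Hom(sspace (tpow n V), sspace (tpow n W))) :
  f \in equivariant n V W -> gmap (ssub_pr (equivariant n V W) f) = f.
Proof. by move=> fe; rewrite /gmap ssub_prK // equiv_hcore. Qed.

Lemma gmap_par V W b (f : ghom n V W) :
  (f \in spart (ghom n V W) b) = (gmap f \in spart (shom (tpow n V) (tpow n W)) b).
Proof. exact: spart_ssub. Qed.

Lemma gmapP V W a (f g : ghom n V W) : gmap (a *: f + g) = a *: gmap f + gmap g.
Proof. by rewrite /gmap linearP. Qed.

Lemma gmap_gcomp U V W (g : ghom n V W) (f : ghom n U V) :
  gmap (gcomp g f) = (gmap g \o gmap f)%VF.
Proof.
rewrite gmap_pr //; apply/mem_equivariant => s.
by rewrite -comp_lfunA gmap_comm comp_lfunA gmap_comm comp_lfunA.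
Qed.

Lemma gmap_gid V : gmap (gid n V) = \1%VF.
Proof.
by rewrite gmap_pr //; apply/mem_equivariant => s; rewrite comp_lfun1l comp_lfun1r.
Qed.

End EquivDeg.

Section Box2.
Variables (m n l : nat) (e : (m + n)%N = l).
Variables V W : superspace k.
Local Notation lb := (@lbox2 k m n l e V W).

Lemma lbox2_delta b f g (x : word l V) : lb b f g (delta k x) =
  ((-1) ^+ (b && wpar (wl e x : word m V)) : k) *:
    tconc e (f (delta k (wl e x : word m V))) (g (delta k (wr e x : word n V))).
Proof. exact: flin_delta. Qed.

Lemma lbox2E b c f g (z : tpow m V) z' : z \in spart (tpow m V) c ->
  lb b f g (tconc e z z') = ((-1) ^+ (b && c) : k) *: tconc e (f z) (g z').
Proof.
move=> zc; rewrite tconc_expand linear_sum /=.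
rewrite {2}(ffun_deltaE z) [f _]linear_sum tconc_suml scaler_sumr; apply: eq_bigr => w _.
rewrite linear_sum linearZ /= tconcZl.
rewrite {2}(ffun_deltaE z') [g _]linear_sum tconc_sumr scaler_sumr scaler_sumr.
apply: eq_bigr => w' _; rewrite !linearZ /= tconcZr lbox2_delta wcatK wcatKr !scalerA.
have [-> | nz] := eqVneq (z w) 0; first by rewrite !(mul0r, mulr0).
have -> : wpar w = c by apply: contraNeq nz => /(free_par zc) ->.
by rewrite mulrAC.
Qed.

Lemma lbox2E0 f g (z : tpow m V) z' : lb false f g (tconc e z z') = tconc e (f z) (g z').
Proof.
have h z0 z1 : z0 \in spart (tpow m V) false -> z1 \in spart (tpow m V) true ->
    lb false f g (tconc e (z0 + z1) z') = tconc e (f (z0 + z1)) (g z').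
  move=> h0 h1; rewrite tconcDl [LHS]linearD /= (lbox2E _ _ _ _ h0) (lbox2E _ _ _ _ h1) /=.
  by rewrite !expr0 !scale1r linearD tconcDl.
by have := h _ _ (mem_hproj false z) (mem_hproj true z); rewrite hproj_sum.
Qed.

Lemma lbox2Pl b a f f' g : lb b (a *: f + f') g = a *: lb b f g + lb b f' g.
Proof.
apply: delta_ext => x; rewrite add_lfunE scale_lfunE !lbox2_delta add_lfunE scale_lfunE.
by rewrite tconcPl scalerDr !scalerA mulrC.
Qed.

Lemma lbox2Pr b a f g g' : lb b f (a *: g + g') = a *: lb b f g + lb b f g'.
Proof.
apply: delta_ext => x; rewrite add_lfunE scale_lfunE !lbox2_delta add_lfunE scale_lfunE.
by rewrite tconcPr scalerDr !scalerA mulrC.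
Qed.

Lemma gsplitE t : gsplit e V W t = \sum_(ij : hidx (ghom m V W) * hidx (ghom n V W))
  (t ij : k) *: lb (hpar ij.2) (gmap (hb ij.1)) (gmap (hb ij.2)).
Proof. exact: flinE. Qed.

(** Coefficient of the word [y] in the last [n] factors, a tensor in the first [m]. *)
Definition slice (y : word n W) : 'Hom(tpow l W, tpow m W) :=
  flin (fun x : word l W => if wr e x == y then delta k (wl e x : word m W) else 0).

Lemma slice_tconc y z z' : slice y (tconc e z z') = (z' y : k) *: (z : tpow m W).
Proof.
rewrite tconc_expand linear_sum [in RHS](ffun_deltaE z) scaler_sumr.
apply: eq_bigr => w _ /=; rewrite linear_sum (bigD1 y) //= linearZ /= flin_delta wcatK wcatKr.
rewrite eqxx big1 ?addr0 => [|w' ne]; first by rewrite !scalerA mulrC.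
by rewrite linearZ /= flin_delta wcatKr (negPf ne) scaler0.
Qed.

Lemma slice_sum z : \sum_y tconc e (slice y z) (delta k y) = z.
Proof.
transitivity ((\sum_y (tconcl e (delta k y) \o slice y))%VF z).
  by rewrite sum_lfunE; apply: eq_bigr => y _; rewrite comp_lfunE tconclE.
rewrite -[RHS]id_lfunE; congr (fun_of_lfun _ _); apply: delta_ext => x.
rewrite id_lfunE sum_lfunE (bigD1 (wr e x)) //= comp_lfunE flin_delta eqxx tconclE.
rewrite tconc_delta wcat_split big1 ?addr0 // => y ne.
by rewrite comp_lfunE flin_delta eq_sym (negPf ne) linear0.
Qed.

Lemma slice_tact_l s y z :
  slice y (tact W (padd e s 1%g) z) = tact W s (slice y z).
Proof.
rewrite -!comp_lfunE; congr (fun_of_lfun _ _); apply: (tconc_hom_ext (e := e)) => a b.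
by rewrite !comp_lfunE tact_padd tact1 id_lfunE !slice_tconc linearZ.
Qed.

Lemma slice_tact_r s (y : word n W) z :
  slice (wact s y) (tact W (padd e 1%g s) z) =
  ((-1) ^+ inv s (fun a b => hpar (y a) && hpar (y b)) : k) *: slice y z.
Proof.
rewrite -!comp_lfunE -scale_lfunE; congr (fun_of_lfun _ _).
apply: (tconc_hom_ext (e := e)) => a b.
rewrite scale_lfunE !comp_lfunE tact_padd tact1 id_lfunE !slice_tconc scalerA.
congr (_ *: _); rewrite {1}(ffun_deltaE b) linear_sum sum_ffunE (bigD1 y) //=.
rewrite linearZ /= tact_delta !ffunE eqxx big1 ?addr0.
  by rewrite [LHS]mulrA mulr1 mulrC.
move=> y' ne; rewrite linearZ /= tact_delta !ffunE; case: eqP => [E|_].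
  by rewrite (can_inj (wactK s) E) eqxx in ne.
by rewrite [LHS]mulrA mulr0.
Qed.

End Box2.

End Equivariant.

Section SplitSurjective.

Variable k : fieldType.

(** The sign in [lbox2] depends on the parity of its second map, so linearity in that map is
    obtained by gluing an even and an odd version. *)
Definition hpaste (Z : superspace k) (Y : vectType k) (L0 L1 : 'Hom(sspace Z, Y)) : 'Hom(sspace Z, Y) :=
  (L0 \o hproj Z false)%VF + (L1 \o hproj Z true)%VF.

Lemma hpasteE (Z : superspace k) (Y : vectType k) (L0 L1 : 'Hom(sspace Z, Y)) b (z : Z) :
  z \in spart Z b -> hpaste L0 L1 z = (if b then L1 else L0) z.
Proof.
move=> zb; rewrite /hpaste add_lfunE !comp_lfunE; case: b zb => zb.
  by rewrite (hproj0 zb) // (hproj_id zb) linear0 add0r.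
by rewrite (hproj0 (c := true) zb) // (hproj_id zb) linear0 addr0.
Qed.

Implicit Types (U V W X Y Z : superspace k).
Variables (m n l : nat) (e : (m + n)%N = l).
Variables V W : superspace k.
Local Notation lb := (@lbox2 k m n l e V W).

Definition elem_map (x : word n V) (y : word n W) : 'Hom(tpow n V, tpow n W) :=
  flin (fun u : word n V => if u == x then (delta k y : tpow n W) else 0).

Lemma elem_map_par x y :
  elem_map x y \in spart (shom (tpow n V) (tpow n W)) (wpar x (+) wpar y).
Proof.
apply: hom_free_even => u; rewrite flin_delta; case: eqP => [->|_]; last exact: mem0v.
by rewrite addbA addbb addFb; apply: mem_delta.
Qed.

Definition psign N X (b : bool) : 'End(tpow N X) :=
  flin (fun w : word N X => ((-1) ^+ (b && wpar w) : k) *: (delta k w : tpow N X)).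

Arguments psign {N} X b.

Lemma psign_tact N X b s (z : tpow N X) : psign X b (tact X s z) = tact X s (psign X b z).
Proof.
rewrite -!comp_lfunE; congr (fun_of_lfun _ _); apply: delta_ext => w.
rewrite !comp_lfunE tact_delta !flin_delta !linearZ /= flin_delta.
by rewrite tact_delta wpar_wact !scalerA mulrC.
Qed.

Lemma psignK N X b (z : tpow N X) : psign X b (psign X b z) = z.
Proof.
rewrite -comp_lfunE -[RHS]id_lfunE; congr (fun_of_lfun _ _); apply: delta_ext => w.
by rewrite comp_lfunE id_lfunE flin_delta linearZ /= flin_delta scalerA -signr_addb addbb scale1r.
Qed.

(* [psign] cancels the sign of [lbox2], so that [phi] is the sum of the [lbox2] of its blocks. *)
Definition hblock (phi : 'Hom(sspace (tpow l V), sspace (tpow l W))) (x : word n V) (y : word n W) :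
    'Hom(tpow m V, tpow m W) :=
  (slice e y \o phi \o tconcl e (delta k x) \o psign V (wpar x (+) wpar y))%VF.

Lemma hblock_sum phi :
  phi = \sum_x \sum_y lb (wpar x (+) wpar y) (hblock phi x y) (elem_map x y).
Proof.
apply: delta_ext => u; rewrite sum_lfunE (bigD1 (wr e u)) //= [X in _ + X]big1 ?addr0.
  rewrite sum_lfunE -[LHS](slice_sum e); apply: eq_bigr => y _.
  rewrite lbox2_delta flin_delta eqxx -tconcZl -linearZ /=; congr (tconc e _ _).
  rewrite !comp_lfunE -{1}(wcat_split e u) -tconc_delta -tconclE; congr (slice _ _ (phi (tconcl _ _ _))).
  by rewrite -{1}(psignK (wpar (wr e u : word n V) (+) wpar y) (delta k (wl e u))) flin_delta.
move=> x xu; rewrite sum_lfunE big1 // => y _.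
rewrite lbox2_delta flin_delta eq_sym (negPf xu) -tconcrE linear0 scaler0 //.
Qed.

Lemma hblock_equiv phi x y : phi \in equivariant l V W -> hblock phi x y \in equivariant m V W.
Proof.
move/mem_equivariant => phis; apply/mem_equivariant => s; apply/lfunP => z.
rewrite !comp_lfunE psign_tact !tconclE.
have := tact_padd e s 1%g (psign V (wpar x (+) wpar y) z) (delta k x).
rewrite tact1 id_lfunE => <-; rewrite -slice_tact_l; congr (slice _ _ _).
by rewrite -!comp_lfunE -phis comp_lfunE.
Qed.

Definition hcoef (i : hidx (ghom m V W)) (f : 'Hom(sspace (tpow m V), sspace (tpow m W))) : k^o :=
  hcoord i (ssub_pr (equivariant m V W) f).

Lemma hcoefZ i a f : hcoef i (a *: f) = a * hcoef i f.
Proof. by rewrite /hcoef linearZ /= /hcoord linearZ. Qed.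

Lemma hcoef_sum f : f \in equivariant m V W -> f = \sum_i (hcoef i f : k) *: gmap (hb i).
Proof.
move=> fe; rewrite -{1}(gmap_pr fe) {1}(hcoord_sum (ssub_pr _ f)) /gmap linear_sum.
by apply: eq_bigr => i _; rewrite linearZ.
Qed.

(** Coefficient of the basis vector [i] of [ghom m V W] in the blocks of [phi], as a map between the
    last [n] factors. *)
Definition hresid phi (i : hidx (ghom m V W)) : 'Hom(tpow n V, tpow n W) :=
  \sum_x \sum_y (hcoef i (hblock phi x y) : k) *: elem_map x y.

Lemma hresid_delta phi i x :
  hresid phi i (delta k x) = \sum_y (hcoef i (hblock phi x y) : k) *: (delta k y : tpow n W).
Proof.
rewrite /hresid sum_lfunE (bigD1 x) //= [X in _ + X]big1 ?addr0 => [|x' ne].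
  by rewrite sum_lfunE; apply: eq_bigr => y _; rewrite scale_lfunE flin_delta eqxx.
rewrite sum_lfunE big1 // => y _.
by rewrite scale_lfunE flin_delta eq_sym (negPf ne) scaler0.
Qed.

(** Equivariance under [padd e 1 t] read on blocks: only the words of the last factors move, each
    with its Koszul sign. *)
Lemma hblock_tact phi t (x : word n V) (y : word n W) : phi \in equivariant l V W ->
  ((-1) ^+ inv t (fun a b => hpar (x a) && hpar (x b)) : k) *:
     hblock phi (wact t x) (wact t y) =
  ((-1) ^+ inv t (fun a b => hpar (y a) && hpar (y b)) : k) *: hblock phi x y.
Proof.
move/mem_equivariant => phis; apply/lfunP => z.
rewrite !scale_lfunE !comp_lfunE !wpar_wact !tconclE -slice_tact_r.
set z' := psign _ _ _.
have := tact_padd e 1%g t z' (delta k x).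
rewrite tact1 id_lfunE tact_delta => E.
have -> u : tact W (padd e 1%g t) (phi u) = phi (tact V (padd e 1%g t) u).
  by have := phis (padd e 1%g t); move/lfunP/(_ u); rewrite !comp_lfunE.
by rewrite E tconcZr !linearZ.
Qed.

Lemma hresid_equiv phi i : phi \in equivariant l V W -> hresid phi i \in equivariant n V W.
Proof.
move=> phie; apply/mem_equivariant => t; apply: delta_ext => x.
rewrite !comp_lfunE tact_delta linearZ /= !hresid_delta scaler_sumr [RHS]linear_sum /=.
rewrite (reindex (@wact _ _ t)) /=; last first.
  exists (@wact _ _ (t^-1)%g) => w _; rewrite -wactM ?mulgV ?mulVg wact1 //.
apply: eq_bigr => y _; rewrite [RHS]linearZ /= (tact_delta t y) !scalerA -!hcoefZ.
by rewrite (hblock_tact _ _ _ phie) hcoefZ mulrC.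
Qed.

Definition lbox2_lin b f : 'Hom('Hom(tpow n V, tpow n W), 'Hom(tpow l V, tpow l W)) :=
  linfun (fun g : 'Hom(tpow n V, tpow n W) => lb b f g).

Lemma lbox2_linE b f g : lbox2_lin b f g = lb b f g.
Proof. by apply: linfun_linear => a u v; rewrite lbox2Pr. Qed.

Definition lbox2_full f : 'Hom('Hom(tpow n V, tpow n W), 'Hom(tpow l V, tpow l W)) :=
  hpaste (Z := shom (tpow n V) (tpow n W)) (lbox2_lin false f) (lbox2_lin true f).

Lemma lbox2_fullE b f (g : 'Hom(sspace (tpow n V), sspace (tpow n W))) :
  g \in spart (shom (tpow n V) (tpow n W)) b -> lbox2_full f g = lb b f g.
Proof. by move=> gb; rewrite /lbox2_full (hpasteE _ _ gb); case: (b); exact: lbox2_linE. Qed.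

Lemma hblock_expand phi : phi \in equivariant l V W ->
  phi = \sum_i lbox2_full (gmap (hb i)) (hresid phi i).
Proof.
move=> phie; rewrite {1}(hblock_sum phi).
transitivity (\sum_x \sum_y \sum_i
    (hcoef i (hblock phi x y) : k) *: lbox2_full (gmap (hb i)) (elem_map x y)).
  apply: eq_bigr => x _; apply: eq_bigr => y _.
  rewrite {1}(hcoef_sum (hblock_equiv x y phie)).
  have L g : linear (fun f => lb (wpar x (+) wpar y) f g).
    by move=> a u v; rewrite lbox2Pl.
  rewrite -(linfun_linear (L _)) linear_sum; apply: eq_bigr => i _.
  by rewrite linearZ /= (linfun_linear (L _)) (lbox2_fullE _ (elem_map_par x y)).
rewrite [RHS](eq_bigr (fun i => \sum_x \sum_y
    (hcoef i (hblock phi x y) : k) *: lbox2_full (gmap (hb i)) (elem_map x y))).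
  rewrite [RHS]exchange_big; apply: eq_bigr => x _ /=; by rewrite exchange_big.
move=> i _; rewrite linear_sum; apply: eq_bigr => x _; rewrite linear_sum.
by apply: eq_bigr => y _; rewrite linearZ.
Qed.

Lemma lbox2_full_hb (i : hidx (ghom m V W)) (g : ghom n V W) :
  lbox2_full (gmap (hb i)) (gmap g) = gsplit e V W (tens (hb i) g).
Proof.
rewrite [g]hcoord_sum tens_sumr /gmap !linear_sum; apply: eq_bigr => j _.
rewrite tensZr !linearZ /= tens_hb flin_delta; congr (_ *: _).
by apply: lbox2_fullE; rewrite -gmap_par mem_hb.
Qed.

(** The inclusion of Gamma^(m+n) in the tensor product of Gamma^m and Gamma^n. Blocks of [phi] are
    equivariant in the first [m] factors; once they are expanded in a basis of [ghom m V W],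
    equivariance in the last [n] factors passes to the coefficients. *)
Lemma gsplit_surj phi : phi \in equivariant l V W -> phi \in limg (gsplit e V W).
Proof.
move=> phie; have -> : phi = gsplit e V W
    (\sum_i tens (hb i) (ssub_pr (equivariant n V W) (hresid phi i))).
  rewrite {1}(hblock_expand phie) linear_sum; apply: eq_bigr => i _.
  by rewrite -{1}(gmap_pr (hresid_equiv i phie)) lbox2_full_hb.
by apply: memv_img; exact: memvf.
Qed.

Lemma ghom_split (f : ghom l V W) :
  exists t : stens (ghom m V W) (ghom n V W), gsplit e V W t = gmap f.
Proof. by have /memv_imgP[t _ ->] := gsplit_surj (gmap_equiv f); exists t. Qed.

Lemma gsplit_app (t : stens (ghom m V W) (ghom n V W)) u :
  (gsplit e V W t : 'Hom(sspace (tpow l V), sspace (tpow l W))) u =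
  \sum_(ij : hidx (ghom m V W) * hidx (ghom n V W))
    (t ij : k) *: lb (hpar ij.2) (gmap (hb ij.1)) (gmap (hb ij.2)) u.
Proof.
by rewrite gsplitE sum_lfunE; apply: eq_bigr => ij _; rewrite scale_lfunE.
Qed.

End SplitSurjective.

Section NaturalOperators.

Variable k : fieldType.
Implicit Types (U V W X Y Z : superspace k).

(** Operators that may be moved across any morphism of Gamma^n. Permutations supply them, and
    [natop_box] combines them over a splitting. *)
Record natural_op n (Phi : forall V, 'End(tpow n V)) : Prop := NaturalOp {
  natop_even : forall V, Phi V \in spart (shom (tpow n V) (tpow n V)) false;
  natop_comm : forall V W (f : ghom n V W) z, gmap f (Phi V z) = Phi W (gmap f z) }.

Lemma natop_tact n (s : 'S_n) : natural_op (fun V => tact V s).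
Proof.
split=> [V|V W f z]; first exact: tact_even.
by rewrite -!comp_lfunE gmap_comm.
Qed.

Lemma natop_id n : @natural_op n (fun V => \1%VF).
Proof. by split=> [V|V W f z]; [exact: shom_id | rewrite !id_lfunE]. Qed.

Lemma natop_comp n Phi Psi : natural_op Phi -> @natural_op n Psi ->
  natural_op (fun V => Phi V \o Psi V)%VF.
Proof.
case=> P0 Pc [Q0 Qc]; split=> [V|V W f z]; first exact: shom_comp_even.
by rewrite !comp_lfunE Pc Qc.
Qed.

Lemma natop_sum n (I : finType) (P : pred I) (Phi : I -> forall V, 'End(tpow n V)) :
  (forall i, natural_op (Phi i)) -> natural_op (fun V => \sum_(i | P i) Phi i V).
Proof.
move=> PhiP; split=> [V|V W f z].
  by apply: memv_suml => i _; case: (PhiP i) => h _; exact: h.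
by rewrite !sum_lfunE linear_sum; apply: eq_bigr => i _ /=; case: (PhiP i) => _ h; rewrite h.
Qed.

Lemma natop_scale n (a : k) Phi : @natural_op n Phi -> natural_op (fun V => a *: Phi V).
Proof.
by case=> P0 Pc; split=> [V|V W f z]; [apply: memvZ; exact: P0 | rewrite !scale_lfunE linearZ /= Pc].
Qed.

(** By [ghom_split] a morphism is a combination of maps [lbox2], which are checked factor by factor;
    the signs agree because [Phi] is even. *)
Lemma natop_box m n l (e : (m + n)%N = l) Phi Psi : @natural_op m Phi -> @natural_op n Psi ->
  natural_op (fun V => lbox2 e false (Phi V) (Psi V)).
Proof.
case=> P0 Pc [Q0 Qc]; split=> [V|V W f z].
  apply: hom_free_even => w; rewrite addbF lbox2_delta expr0 scale1r.
  have := wpar_wcat e (wl e w : word m V) (wr e w); rewrite wcat_split => ->.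
  by apply: mem_tconc; [apply: shom_even (P0 V) _ | apply: shom_even (Q0 V) _]; apply: mem_delta.
have [t Et] := ghom_split e f.
rewrite -!comp_lfunE; congr (fun_of_lfun _ _); apply: delta_ext => w.
rewrite !comp_lfunE (delta_wcat e) lbox2E0 -Et !gsplit_app [RHS]linear_sum.
have wp : (delta k (wl e w) : tpow m V) \in spart (tpow m V) (wpar (wl e w : word m V)).
  exact: mem_delta.
apply: eq_bigr => ij _; rewrite linearZ; congr (_ *: _).
rewrite (lbox2E e _ _ _ _ wp) (lbox2E e _ _ _ _ (shom_even (P0 V) wp)) linearZ.
by rewrite Pc Qc; congr (_ *: _); exact/esym/lbox2E0.
Qed.

End NaturalOperators.

(** * Symmetric and alternating powers *)

Section SymAlt.

Variable k : fieldType.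
Implicit Types (U V W X Y Z : superspace k).
Variable n : nat.

Lemma mem_symrel V s (z : tpow n V) : tact V s z - z \in symrel n V.
Proof.
apply: (subvP (sumv_sup s (P := predT) isT (subvv _))).
have -> : tact V s z - z = (tact V s - \1%VF) z by rewrite sub_lfunE id_lfunE.
by rewrite memv_img ?memvf.
Qed.

Lemma symrel_kill V (Y : vectType k) (f : 'Hom(sspace (tpow n V), Y)) :
  (forall s z, f (tact V s z) = f z) -> forall u, u \in symrel n V -> f u = 0.
Proof.
move=> fs u /memv_sumP[v vP ->]; rewrite linear_sum big1 // => s _ /=.
have /memv_imgP[z _ ->] := vP s isT.
by rewrite sub_lfunE id_lfunE linearB /= fs subrr.
Qed.

Lemma symrel_hcore V : hcore (symrel n V) = symrel n V.
Proof.
apply: hcore_id => b u /memv_sumP[v vP ->]; rewrite linear_sum memv_suml // => s _ /=.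
have /memv_imgP[z _ ->] := vP s isT.
have -> : (tact V s - \1%VF) z = tact V s z - z by rewrite sub_lfunE id_lfunE.
by rewrite lfunB (hproj_even b z (tact_even V s)) mem_symrel.
Qed.

Fact spi_key : unit. Proof. exact: tt. Qed.

(* Locked, since [squot_pi] unfolds to a composition, on which [comp_lfunE] would fire. *)
Definition spi V : 'Hom(tpow n V, psym k n V) :=
  locked_with spi_key (squot_pi (symrel n V)).

Lemma spi_unlock V : spi V = squot_pi (symrel n V).
Proof. by rewrite /spi unlock. Qed.

Lemma spi_tact V s z : spi V (tact V s z) = spi V z.
Proof. by rewrite spi_unlock; apply: squot_eq; [exact: symrel_hcore | exact: mem_symrel]. Qed.

Lemma spi_even V : spi V \in spart (shom (tpow n V) (psym k n V)) false.
Proof. by rewrite spi_unlock; apply: squot_pi_even. Qed.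

Lemma spi_surj V (x : psym k n V) : exists z, spi V z = x.
Proof. by exists (squot_sec _ x); rewrite spi_unlock squot_secK. Qed.

Lemma psym_lift V (Y : vectType k) (f : 'Hom(sspace (tpow n V), Y)) z :
  (forall s z, f (tact V s z) = f z) -> f (squot_sec _ (spi V z)) = f z.
Proof. move=> fs; rewrite spi_unlock; apply: squot_lift (symrel_kill fs); exact: symrel_hcore. Qed.

Lemma psym_mapE V W (f : ghom n V W) z : pf_map (psym k n) f (spi V z) = spi W (gmap f z).
Proof.
have L : linear (fun f : ghom n V W =>
    (squot_pi (symrel n W) \o gmap f \o squot_sec (symrel n V))%VF).
  move=> a u v; rewrite gmapP comp_lfunDr comp_lfunDl.
  by rewrite -!comp_lfunZr -!comp_lfunZl.
rewrite /pf_map /= (linfun_linear L) -spi_unlock comp_lfunE psym_lift => [|s z'].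
  by rewrite comp_lfunE.
by rewrite !comp_lfunE gmap_tact spi_tact.
Qed.

Lemma mem_altsub V (z : tpow n V) :
  z \in altsub n V <-> (forall s, tact V s z = ((-1) ^+ odd_perm s : k) *: z).
Proof.
have E (s : 'S_n) : (z \in lker (tact V s - ((-1) ^+ s : k) *: \1%VF)) =
    (tact V s z == ((-1) ^+ odd_perm s : k) *: z).
  by rewrite memv_ker sub_lfunE scale_lfunE id_lfunE subr_eq0.
split=> [/subv_bigcapP zs s | zs].
  by apply/eqP; rewrite -E memvE; apply: zs.
by rewrite memvE; apply/subv_bigcapP => s _; rewrite -memvE E zs.
Qed.

Lemma altsub_hcore V : hcore (altsub n V) = altsub n V.
Proof.
apply: hcore_id => b u /mem_altsub us; apply/mem_altsub => s.
by rewrite -hproj_even ?tact_even // us linearZ.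
Qed.

Lemma alt_prK V z : z \in altsub n V -> ssub_in (altsub n V) (ssub_pr (altsub n V) z) = z.
Proof. by apply: ssub_prK; exact: altsub_hcore. Qed.

Lemma alt_in V (x : palt k n V) s :
  tact V s (ssub_in _ x) = ((-1) ^+ odd_perm s : k) *: ssub_in _ x.
Proof. by have /mem_altsub := mem_ssub x; apply. Qed.

Lemma altsub_gmap V W (f : ghom n V W) z : z \in altsub n V -> gmap f z \in altsub n W.
Proof.
move/mem_altsub => zs; apply/mem_altsub => s.
by rewrite -gmap_tact zs linearZ.
Qed.

Lemma palt_mapE V W (f : ghom n V W) x :
  ssub_in (altsub n W) (pf_map (palt k n) f x) = gmap f (ssub_in (altsub n V) x).
Proof.
have L : linear (fun f : ghom n V W =>
    (ssub_pr (altsub n W) \o gmap f \o ssub_in (altsub n V))%VF).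
  move=> a u v; rewrite gmapP comp_lfunDr comp_lfunDl.
  by rewrite -!comp_lfunZr -!comp_lfunZl.
by rewrite /pf_map /= (linfun_linear L) !comp_lfunE alt_prK // altsub_gmap // mem_ssub.
Qed.

End SymAlt.

Arguments spi {k} n V.
Notation ain n V := (ssub_in (altsub n V)).
Notation apr n V := (ssub_pr (altsub n V)).

Section SymProduct.

Variable k : fieldType.
Implicit Types (U V W X Y Z : superspace k).
Variables (m n l : nat) (e : (m + n)%N = l).

Lemma spi_tconc_l V (a : tpow m V) (b : tpow n V) s :
  spi l V (tconc e (tact V s a) b) = spi l V (tconc e a b).
Proof.
by rewrite -[in RHS](spi_tact (padd e s 1%g)) tact_padd tact1 id_lfunE.
Qed.

Lemma spi_tconc_r V (a : tpow m V) (b : tpow n V) s :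
  spi l V (tconc e a (tact V s b)) = spi l V (tconc e a b).
Proof.
by rewrite -[in RHS](spi_tact (padd e 1%g s)) tact_padd tact1 id_lfunE.
Qed.

Lemma sym_prodE V a b :
  sym_prod e V (tens (spi m V a) (spi n V b)) = spi l V (tconc e a b).
Proof.
rewrite /sym_prod -spi_unlock tlinE => [|y|x]; last 2 first.
- by move=> c u v; rewrite linearP /= tconcPl linearP.
- by move=> c u v; rewrite linearP /= tconcPr linearP.
have El b' : spi l V (tconc e (squot_sec _ (spi m V a)) b') = spi l V (tconc e a b').
  have := @psym_lift k m V _ (spi l V \o tconcl e b')%VF a.
  by rewrite !comp_lfunE !tconclE; apply=> s z; rewrite !comp_lfunE !tconclE spi_tconc_l.
have := @psym_lift k n V _ (spi l V \o tconcr e a)%VF b.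
by rewrite El !comp_lfunE !tconcrE; apply=> s z; rewrite !comp_lfunE !tconcrE spi_tconc_r.
Qed.

End SymProduct.

Section AltProduct.

Variable k : fieldType.
Implicit Types (U V W X Y Z : superspace k).
Variables (m n l : nat) (e : (m + n)%N = l).

Lemma young_padd (h : 'S_l) : h \in young m l -> exists s t, h = padd e s t.
Proof.
rewrite inE => /forallP hY.
have hl a : (h (posl e a) < m)%N by rewrite (eqP (hY _)) posl_val ltn_ord.
have hr b : (h (posr e b) - m < n)%N.
  have : ~~ (h (posr e b) < m)%N by rewrite (eqP (hY _)) -leqNgt leq_addr.
  by have := ltn_ord (h (posr e b)); move: e; lia.
have si : injective (fun a => Ordinal (hl a)).
  move=> a a' /(congr1 val)/= E.
  have /perm_inj/(congr1 val)/= : h (posl e a) = h (posl e a') by apply: val_inj.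
  by move/val_inj.
have ti : injective (fun b => Ordinal (hr b)).
  move=> b b' /(congr1 val)/= E.
  have hb1 : ~~ (h (posr e b) < m)%N by rewrite (eqP (hY _)) -leqNgt leq_addr.
  have hb2 : ~~ (h (posr e b') < m)%N by rewrite (eqP (hY _)) -leqNgt leq_addr.
  have /val_inj/perm_inj/(congr1 val) : val (h (posr e b)) = val (h (posr e b')).
    by move: E hb1 hb2 => /=; lia.
  by rewrite /= => /addnI/val_inj.
exists (perm si), (perm ti); apply/permP; apply: (pos_ind (e := e)) => a.
  by rewrite padd_l permE; apply: val_inj.
rewrite padd_r permE; apply: val_inj; rewrite /= subnKC //.
by rewrite leqNgt (eqP (hY _)) -leqNgt leq_addr.
Qed.

Lemma odd_padd s t : odd_perm (padd e s t) = odd_perm s (+) odd_perm t.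
Proof. by rewrite -!inv_sign inv_padd. Qed.

Lemma group_set_young : group_set (young m l).
Proof.
apply/group_setP; split; first by rewrite inE; apply/forallP => i; rewrite perm1.
move=> s t; rewrite !inE => /forallP hs /forallP ht; apply/forallP => i.
by rewrite permM (eqP (ht _)) (eqP (hs _)).
Qed.

(* Signed invariance under the Young subgroup, which makes [antisym] independent *)
(* of the choice of representatives.                                             *)
Definition young_alt V (z : tpow l V) :=
  forall h, h \in young m l -> tact V h z = ((-1) ^+ odd_perm h : k) *: z.

Lemma young_alt_tconc V (x : palt k m V) (y : palt k n V) :
  young_alt (tconc e (ain m V x) (ain n V y)).
Proof.
move=> h /young_padd[s [t ->]]; rewrite tact_padd !alt_in tconcZl tconcZr scalerA.
by rewrite odd_padd signr_addb.
Qed.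

Lemma sact_coset V (z : tpow l V) (r : 'S_l) : young_alt z ->
  forall s, s \in (young m l :* r)%g ->
  ((-1) ^+ odd_perm s : k) *: tact V s z = ((-1) ^+ odd_perm r : k) *: tact V r z.
Proof.
move=> zy s /rcosetP[h hY ->]; rewrite tactM comp_lfunE zy // linearZ /= scalerA.
by rewrite odd_permM signr_addb mulrAC -signr_addb addbb mul1r.
Qed.

(** Right multiplication by [s] permutes the right cosets, and by [sact_coset] it does not matter
    that it misses the chosen representatives. *)
Lemma antisym_alt V (z : tpow l V) : young_alt z -> antisym m l V z \in altsub l V.
Proof.
move=> zy; apply/mem_altsub => s.
pose G := Group group_set_young.
rewrite /antisym sum_lfunE linear_sum scaler_sumr /=.
rewrite [RHS](reindex_inj (h := fun C => (C :* s)%g)) /=; last first.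
  by apply: (can_inj (g := fun C => (C :* s^-1)%g)) => C; rewrite rcosetK.
rewrite [RHS](eq_bigl (fun C => C \in rcosets (young m l) [set: 'S_l])); last first.
  move=> C; apply/rcosetsP/rcosetsP => [[r _ E] | [r _ ->]].
    by exists (r * s^-1)%g; rewrite ?inE // rcosetM -E rcosetK.
  by exists (r * s)%g; rewrite ?inE // rcosetM.
apply: eq_bigr => C /rcosetsP[r _ ->]; rewrite !scale_lfunE linearZ /= -comp_lfunE -tactM.
have h1 : repr (young m l :* r)%g \in (young m l :* r)%g by exact: (mem_repr_rcoset G).
have h2 : repr (young m l :* r :* s)%g \in (young m l :* (r * s))%g.
  by rewrite -rcosetM; exact: (mem_repr_rcoset G).
rewrite (sact_coset zy h2).
have h3 : (repr (young m l :* r)%g * s)%g \in (young m l :* (r * s))%g.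
  by rewrite rcosetM mem_rcoset mulgK.
rewrite -(sact_coset zy h3) scalerA odd_permM signr_addb mulrCA -signr_addb addbb mulr1.
by rewrite tactM.
Qed.

Lemma alt_prodE V x y : ain l V (alt_prod e V (tens x y)) =
  antisym m l V (tconc e (ain m V x) (ain n V y)).
Proof.
rewrite /alt_prod tlinE => [|y'|x']; last 2 first.
- by move=> c u v; rewrite linearP /= tconcPl !linearP.
- by move=> c u v; rewrite linearP /= tconcPr !linearP.
by rewrite alt_prK //; apply: antisym_alt; exact: young_alt_tconc.
Qed.

Lemma natop_antisym : natural_op (fun V : superspace k => antisym m l V).
Proof.
by apply: natop_sum => C; apply: natop_scale; apply: natop_tact.
Qed.

End AltProduct.

Section FunctorMaps.

Variable k : fieldType.
Implicit Types (U V W X Y Z : superspace k).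

Lemma pf_map_lin n (F : pfunctor k n) V W a (f g : ghom n V W) :
  pf_map F (a *: f + g) = a *: pf_map F f + pf_map F g.
Proof. by rewrite /pf_map linearP. Qed.

(** [ptensor] uses the chosen inverse of [gsplit]. By [gsplit_surj] the chosen element is a true
    preimage of [gmap f], which is all that later arguments use about it. *)
Lemma ptensor_map m n l (e : (m + n)%N = l) (F : pfunctor k m) (G : pfunctor k n) V W
    (f : ghom l V W) :
  exists t : stens (ghom m V W) (ghom n V W), gsplit e V W t = gmap f /\
    forall x, pf_map (ptensor e F G) f x =
     \sum_(ij : hidx (ghom m V W) * hidx (ghom n V W))
      (t ij : k) *: stmap (hpar ij.2) (pf_map F (hb ij.1)) (pf_map G (hb ij.2)) x.
Proof.
exists ((gsplit e V W)^-1%VF (gmap f)); split.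
  by rewrite limg_lfunVK // gsplit_surj // gmap_equiv.
move=> x; have -> : pf_map (ptensor e F G) f =
    ptensor_img F G V W ((gsplit e V W)^-1%VF (gmap f)).
  exact: etrans (comp_lfunE _ _ _) (comp_lfunE _ _ _).
move: ((gsplit e V W)^-1%VF (gmap f)) => t.
rewrite /ptensor_img flinE sum_lfunE; apply: eq_bigr => ij _.
by rewrite scale_lfunE.
Qed.

Lemma pdsum_mapE n (J : finType) (F : J -> pfunctor k n) V W (f : ghom n V W) j x :
  pf_map (pdsum F) f (din (fun j => F j V) j x) = din (fun j => F j W) j (pf_map (F j) f x).
Proof.
have L : linear (fun f : ghom n V W =>
      (\sum_j (din (fun j => F j W) j \o pf_map (F j) f \o dpr (fun j => F j V) j)%VF
        : 'Hom(dsum (fun j => F j V), dsum (fun j => F j W)))).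
  move=> a u v; rewrite scaler_sumr -big_split; apply: eq_bigr => i _ /=.
  by rewrite pf_map_lin comp_lfunDr comp_lfunDl -!comp_lfunZr -!comp_lfunZl.
rewrite {1}/pf_map /= (linfun_linear L) sum_lfunE (bigD1 j) //= !comp_lfunE din_id.
by rewrite big1 ?addr0 // => i ij; rewrite !comp_lfunE din_neq // !lfun0.
Qed.

Lemma pdsum_map_dpr n (J : finType) (F : J -> pfunctor k n) V W (f : ghom n V W) j x :
  dpr (fun j => F j W) j (pf_map (pdsum F) f x) = pf_map (F j) f (dpr (fun j => F j V) j x).
Proof.
rewrite {1}(dsum_sum x) !lfun_sum (bigD1 j) //= pdsum_mapE din_id big1 ?addr0 // => i ij.
by rewrite pdsum_mapE din_neq // eq_sym.
Qed.

(** Equal fibre sizes make the tuples of values permutations of each other. *)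
Lemma perm_of_count (T : eqType) n (f g : 'I_n -> T) :
  (forall t, #|[pred x | f x == t]| = #|[pred x | g x == t]|) ->
  exists s : 'S_n, forall x, g x = f (s x).
Proof.
move=> fg; have : perm_eq [tuple g x | x < n] [tuple f x | x < n].
  apply/allP => t _ /=; rewrite !count_map; apply/eqP.
  have h (h0 : 'I_n -> T) : count (preim h0 (pred1 t)) (enum 'I_n) = #|[pred x | h0 x == t]|.
    by rewrite cardE /enum_mem size_filter count_filter -enumT; apply: eq_count => x; rewrite /= andbT.
  by rewrite -!enumT; apply: etrans (h g) _; rewrite -fg; apply/esym/(h f).
case/tuple_permP => s E; exists s => x.
have /val_inj E2 : val [tuple g x | x < n] = val [tuple tnth [tuple f x | x < n] (s i) | i < n] by [].
by have := congr1 (fun t => tnth t x) E2; rewrite !tnth_mktuple.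
Qed.

Section GPow.
Variables (n : nat) (V W : superspace k) (f : 'Hom(sspace V, sspace W)).
Hypothesis f0 : f \in spart (shom V W) false.

Definition tensor_map : 'Hom(tpow n V, tpow n W) := tbox (fun _ : 'I_n => false) (fun _ => f).

Lemma tensor_map_delta (w : word n V) : tensor_map (delta k w) = tmul (fun a => f (hb (w a))).
Proof.
rewrite /tensor_map flin_delta big1 ?expr0 ?scale1r // => a _.
by rewrite big1.
Qed.

Lemma tensor_map_tmul (v : 'I_n -> sspace V) : tensor_map (tmul v) = tmul (fun a => f (v a)).
Proof.
rewrite (ffun_deltaE (tmul v)) lfun_sum; apply/ffunP => y; rewrite sum_ffunE ffunE.
transitivity (\sum_(x : word n V) \prod_a (hcoord (x a) (v a) * hcoord (y a) (f (hb (x a))))).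
  apply: eq_bigr => x _; rewrite lfunZ tensor_map_delta !ffunE big_split //.
rewrite -(bigA_distr_bigA (fun a (i : hidx V) => hcoord i (v a) * hcoord (y a) (f (hb i)))).
apply: eq_bigr => a _; rewrite [in RHS](hcoord_sum (v a)) lfun_sum /hcoord linear_sum.
by apply: eq_bigr => i _; rewrite lfunZ linearZ.
Qed.

Lemma tensor_map_equiv : tensor_map \in equivariant n V W.
Proof.
apply/mem_equivariant => s; apply: delta_ext => w.
have fh a : f (hb (w a)) \in spart W (hpar (w a)) by apply: shom_even f0 (mem_hb _).
rewrite !comp_lfunE tact_delta lfunZ !tensor_map_delta (tact_tmul s fh).
by congr (_ *: _); apply: eq_tmul => a; rewrite ffunE.
Qed.

Lemma gpowE : gmap (gpow n f) = tensor_map.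
Proof. by rewrite gmap_pr // tensor_map_equiv. Qed.

End GPow.

Lemma tmul_expand n (V : superspace k) (J : finType) (v : 'I_n -> J -> sspace V) :
  tmul (fun a => \sum_j v a j) = \sum_(w : {ffun 'I_n -> J}) tmul (fun a => v a (w a)).
Proof.
apply/ffunP => y; rewrite sum_ffunE ffunE.
transitivity (\prod_a \sum_j hcoord (y a) (v a j)).
  by apply: eq_bigr => a _; rewrite /hcoord linear_sum.
by rewrite bigA_distr_bigA; apply: eq_bigr => w _; rewrite ffunE.
Qed.

End FunctorMaps.

(** * Coproduct of the symmetric algebra and the formula for the differential *)

Section Coproduct.

Variable k : fieldType.
Implicit Types (U V W X Y Z : superspace k).

Section SymSplit.
Variables (a n : nat) (e : (a + 1)%N = n).

Definition lastp : 'I_n := posr e ord0.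
(** Brings position [c] to the last place; these represent the cosets of the stabilizer of that
    place. *)
Definition cutp (c : 'I_n) : 'S_n := tperm c lastp.

Lemma cutp_last c : cutp c c = lastp. Proof. by rewrite /cutp tpermL. Qed.

Lemma fix_last_young (g : 'S_n) : g lastp = lastp -> g \in young a n.
Proof.
move=> gl; rewrite inE; apply/forallP => i.
have ltE (x : 'I_n) : (x < a)%N = (x != lastp).
  have lE : nat_of_ord lastp = a by rewrite /lastp posr_val addn0.
  have -> : (x != lastp) = (nat_of_ord x != a) by rewrite -lE.
  by have := ltn_ord x; move: e; lia.
by rewrite !ltE -{1}gl (inj_eq perm_inj).
Qed.

Definition split1 V : 'Hom(tpow n V, stens (psym k a V) (psym k 1 V)) :=
  flin (fun w : word n V =>
    tens (spi a V (delta k (wl e w : word a V))) (spi 1 V (delta k (wr e w : word 1 V)))).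

Lemma split1_tconc V z z' : split1 V (tconc e z z') = tens (spi a V z) (spi 1 V z').
Proof.
move: z z'; apply: tconc_bilin_ext => [z|z|z|z|w w'].
1-4: by move=> b u v; rewrite ?tconcPl ?tconcPr ?lfunPl ?tensPl ?tensPr.
by rewrite tconc_delta flin_delta wcatK wcatKr.
Qed.

Lemma split1_tact V (g : 'S_n) z : g lastp = lastp -> split1 V (tact V g z) = split1 V z.
Proof.
move/fix_last_young/(young_padd e) => [s [t ->]].
rewrite -!comp_lfunE; congr (fun_of_lfun _ _); apply: (tconc_hom_ext (e := e)) => b c.
by rewrite comp_lfunE tact_padd !split1_tconc !spi_tact.
Qed.

(** Acting by [s] first replaces [cutp c] by the cut at the preimage of [c], up to a permutation
    fixing the last place, to which [f] is blind. So the sum descends to the symmetric power. *)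
Lemma cut_sum_tact V (Y : vectType k) (f : 'Hom(sspace (tpow n V), Y)) :
  (forall (g : 'S_n) z, g lastp = lastp -> f (tact V g z) = f z) ->
  forall s z, \sum_c f (tact V (cutp c) (tact V s z)) = \sum_c f (tact V (cutp c) z).
Proof.
move=> fg s z; rewrite [RHS](reindex_inj (@perm_inj _ (s^-1)%g)); apply: eq_bigr => c _.
rewrite -[tact V (cutp c) _]comp_lfunE -tactM.
have -> : (s * cutp c = cutp ((s^-1)%g c) * ((cutp ((s^-1)%g c))^-1 * (s * cutp c)))%g.
  by rewrite mulKVg.
rewrite tactM comp_lfunE fg // permM.
have -> : (cutp ((s^-1)%g c))^-1%g lastp = (s^-1)%g c by rewrite -(cutp_last ((s^-1)%g c)) permK.
by rewrite permM permKV cutp_last.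
Qed.

Definition cut_hom V (Y : vectType k) (f : 'Hom(sspace (tpow n V), Y)) : 'Hom(psym k n V, Y) :=
  ((\sum_c (f \o tact V (cutp c)))%VF \o squot_sec (symrel n V))%VF.

Lemma cut_homE V (Y : vectType k) (f : 'Hom(sspace (tpow n V), Y)) z :
  (forall (g : 'S_n) z, g lastp = lastp -> f (tact V g z) = f z) ->
  cut_hom f (spi n V z) = \sum_c f (tact V (cutp c) z).
Proof.
move=> fg.
have E u : (\sum_c (f \o tact V (cutp c)))%VF u = \sum_c f (tact V (cutp c) u).
  by rewrite sum_lfunE; apply: eq_bigr => c _; rewrite comp_lfunE.
by rewrite /cut_hom comp_lfunE psym_lift ?E // => s u; rewrite !E cut_sum_tact.
Qed.

End SymSplit.

Lemma sin_even V b : sin V b \in spart (shom V (sdouble V)) false.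
Proof. exact: din_even. Qed.

Definition sout V (b : bool) : 'Hom(sdouble V, V) := dpr (fun _ : bool => V) b.

Lemma sout_even V b : sout V b \in spart (shom (sdouble V) V) false.
Proof. exact: dpr_even. Qed.

Lemma sout_sin V b c v : sout V b (sin V c v) = if b == c then v else 0.
Proof.
case: eqP => [->|/eqP ne]; first exact: (din_id (F := fun _ : bool => V)).
exact: (din_neq (F := fun _ : bool => V)).
Qed.

Section SymExp.
Variables (n : nat) (V : superspace k).

Lemma sym_exp_din (x : splits n) (u : tpow (val x).1 V) (v : tpow (val x).2 V) :
  sym_exp n V (din (fun x : splits n => stens (psym k (val x).1 V) (psym k (val x).2 V)) x
     (tens (spi _ V u) (spi _ V v))) =
  spi n _ (tconc (eqP (valP x)) (tensor_map (val x).1 (sin V false) u)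
                                (tensor_map (val x).2 (sin V true) v)).
Proof.
rewrite /sym_exp sum_lfunE (sum_only (i := x)) => [|y yx].
  rewrite 2!comp_lfunE din_id stmapE0 2!psym_mapE gpowE ?sin_even // gpowE ?sin_even //.
  by rewrite sym_prodE.
by rewrite comp_lfunE (din_neq _ yx) lfun0.
Qed.

(** Each letter of the double space is split into its two components. A permutation brings the
    letters of the first copy to the front, which in the symmetric power costs only a sign. *)
Lemma sym_exp_surj y : y \in limg (sym_exp n V).
Proof.
have [z <-] := spi_surj y.
suff Z : forall w : word n (sdouble V), spi n _ (delta k w) \in limg (sym_exp n V).
  rewrite (ffun_deltaE z) lfun_sum; apply: memv_suml => w _.
  by rewrite lfunZ memvZ.
move=> w; rewrite -tmul_hb.
have -> : tmul (fun a => hb (w a)) =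
    tmul (fun a => \sum_b sin V b (sout V b (hb (w a)))).
  by apply: eq_tmul => a; rewrite {1}(dsum_sum (hb (w a))).
rewrite tmul_expand lfun_sum; apply: memv_suml => beta _.
pose v c := sin V (beta c) (sout V (beta c) (hb (w c))).
rewrite (_ : tmul _ = tmul v) //.
have vq c : v c \in spart (sdouble V) (hpar (w c)).
  by apply: shom_even (sin_even _ _) _; apply: shom_even (sout_even _ _) _; apply: mem_hb.
pose p := #|[pred x | beta x == false]|; pose q := #|[pred x | beta x == true]|.
have cardE (P : pred 'I_n) : #|P| = (\sum_x P x)%N.
  by rewrite -sum1_card big_mkcond; apply: eq_bigr => x _; rewrite unfold_in; case: (P x).
have pq : (p + q)%N = n.
  rewrite /p /q !cardE -big_split -[RHS](card_ord n) -sum1_card.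
  by apply: eq_big => x //= _; case: (beta x).
have [s sb] : exists s : 'S_n, forall x, beta x = catf pq (fun _ => false) (fun _ => true) (s x).
  apply: perm_of_count => t; rewrite !cardE (big_pos pq) /=.
  under eq_bigr => x _ do rewrite catf_l.
  under [X in (_ + X)%N]eq_bigr => x _ do rewrite catf_r.
  rewrite !sum_nat_const !card_ord; case: t; rewrite /= ?muln0 ?muln1 ?addn0 ?add0n /p /q cardE //.
pose u b c := sout V b (hb (w c)).
pose u0 (c : 'I_p) := u false ((s^-1)%g (posl pq c)).
pose u1 (c : 'I_q) := u true ((s^-1)%g (posr pq c)).
rewrite -(spi_tact s) (tact_tmul s vq) lfunZ memvZ //.
have -> : tmul (fun c => v ((s^-1)%g c)) =
    tconc pq (tmul (fun c => sin V false (u0 c))) (tmul (fun c => sin V true (u1 c))).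
  rewrite tconc_tmul; apply: eq_tmul; apply: (pos_ind (e := pq)) => c.
    by rewrite catf_l /v sb permKV catf_l.
  by rewrite catf_r /v sb permKV catf_r.
rewrite -(tensor_map_tmul (sin V false) u0) -(tensor_map_tmul (sin V true) u1).
pose x := split_at pq.
have := @sym_exp_din x (tmul u0) (tmul u1).
rewrite (eq_irrelevance (eqP (valP x)) pq) => E.
by rewrite -[spi n _ _]E memv_img ?memvf.
Qed.

End SymExp.

End Coproduct.

Section CoproductFormula.

Variable k : fieldType.
Implicit Types (U V W X Y Z : superspace k).

Lemma tmul0 n V (v : 'I_n -> sspace V) a : v a = 0 -> tmul v = 0.
Proof.
move=> v0; apply/ffunP => w; rewrite !ffunE (bigD1 a) //= v0.
by rewrite /hcoord linear0 mul0r.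
Qed.

Lemma tensor_map_comp n U V W (g : 'Hom(sspace V, sspace W)) (f : 'Hom(sspace U, sspace V)) z :
  tensor_map n g (tensor_map n f z) = tensor_map n (g \o f)%VF z.
Proof.
rewrite -comp_lfunE; congr (fun_of_lfun _ _); apply: delta_ext => w.
rewrite comp_lfunE !tensor_map_delta tensor_map_tmul.
by apply: eq_tmul => a; rewrite comp_lfunE.
Qed.

Lemma tensor_map_id n V z : tensor_map n (\1%VF : 'End(V)) z = z.
Proof.
rewrite -[RHS]id_lfunE; congr (fun_of_lfun _ _); apply: delta_ext => w.
rewrite tensor_map_delta id_lfunE -tmul_hb.
by apply: eq_tmul => a; rewrite id_lfunE.
Qed.

Lemma tensor_map_tconc m n l (e : (m + n)%N = l) V W (f : 'Hom(sspace V, sspace W)) z z' :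
  tensor_map l f (tconc e z z') = tconc e (tensor_map m f z) (tensor_map n f z').
Proof.
move: z z'; apply: tconc_bilin_ext => [z|z|z|z|w w'].
1-4: by move=> b u v; rewrite ?tconcPl ?tconcPr ?lfunPl ?tconcPl ?tconcPr.
rewrite tconc_delta !tensor_map_delta tconc_tmul; apply: eq_tmul.
by apply: (pos_ind (e := e)) => a; rewrite ?wcat_l ?wcat_r ?catf_l ?catf_r.
Qed.

Lemma tensor_map_tact n V W (f : 'Hom(sspace V, sspace W)) (s : 'S_n) z :
  f \in spart (shom V W) false -> tensor_map n f (tact V s z) = tact W s (tensor_map n f z).
Proof.
move=> f0; have /mem_equivariant := tensor_map_equiv n f0.
by move=> /(_ s)/lfunP/(_ z); rewrite !comp_lfunE.
Qed.

Section Cut.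
Variables (a n : nat) (e : (a + 1)%N = n) (V : superspace k).
Local Notation last := (lastp e).

(** Keeps the component with the last factor in the second copy and all others in the first: the
    part belonging to the splitting [(a, 1)]. *)
Definition dsplit : 'Hom(tpow n (sdouble V), stens (psym k a V) (psym k 1 V)) :=
  (stmap false (pf_map (psym k a) (gpow a (sout V false))) (pf_map (psym k 1) (gpow 1 (sout V true)))
   \o split1 e (sdouble V))%VF.

Lemma dsplit_tconc z z' : dsplit (tconc e z z') =
  tens (spi a V (tensor_map a (sout V false) z)) (spi 1 V (tensor_map 1 (sout V true) z')).
Proof.
rewrite /dsplit comp_lfunE split1_tconc stmapE0 2!psym_mapE.
by rewrite gpowE ?sout_even // gpowE ?sout_even.
Qed.

Lemma dsplit_tact (g : 'S_n) z : g last = last -> dsplit (tact (sdouble V) g z) = dsplit z.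
Proof. by move=> gl; rewrite /dsplit ![(_ \o split1 _ _)%VF _]comp_lfunE split1_tact. Qed.

Lemma dsplit_tmul0 (v : 'I_n -> sdouble V) :
  (exists2 c, c != last & sout V false (v c) = 0) \/ sout V true (v last) = 0 ->
  dsplit (tmul v) = 0.
Proof.
have -> : tmul v = tconc e (tmul (fun a => v (posl e a))) (tmul (fun b => v (posr e b))).
  rewrite tconc_tmul; apply: eq_tmul.
  by apply: (pos_ind (e := e)) => c; rewrite ?catf_l ?catf_r.
rewrite dsplit_tconc !tensor_map_tmul => -[[c cl v0]|v0]; last first.
  by rewrite (tmul0 (a := ord0 : 'I_1)) // lfun0 tens0r.
move: c cl v0; apply: (pos_ind (e := e)) => c cl v0.
  by rewrite (tmul0 (a := c)) // lfun0 tens0l.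
by rewrite (ord1 c) eqxx in cl.
Qed.

Lemma dsplit_tact_tmul0 (s : 'S_n) (v : 'I_n -> sdouble V) (q : 'I_n -> bool) :
    (forall c, v c \in spart (sdouble V) (q c)) ->
    (exists2 c, s c != last & sout V false (v c) = 0) \/
    (exists2 c, s c = last & sout V true (v c) = 0) ->
  dsplit (tact (sdouble V) s (tmul v)) = 0.
Proof.
move=> vq H; rewrite (tact_tmul s vq) lfunZ dsplit_tmul0 ?scaler0 //.
case: H => -[c sc v0]; [left; exists (s c) => // | right; rewrite -sc]; by rewrite permK.
Qed.

Local Notation spl x := (stens (psym k (val x).1 V) (psym k (val x).2 V)).

(** A term survives only if the position brought to the last place holds the single letter of the
    second copy. This selects the splitting [(a, 1)], and there the cut at the last place, where
    [cutp] is the identity. *)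
Lemma cut_sym_exp_din (x : splits n) u v :
  cut_hom e dsplit (sym_exp n V (din (fun x : splits n => spl x) x (tens (spi _ V u) (spi _ V v)))) =
  dpr (fun x : splits n => spl x) (split_at e)
     (din (fun x : splits n => spl x) x (tens (spi _ V u) (spi _ V v))).
Proof.
rewrite (ffun_deltaE u) lfun_sum tens_suml !lfun_sum; apply: eq_bigr => w _.
rewrite lfunZ tensZl !lfunZ; congr (_ *: _).
rewrite (ffun_deltaE v) lfun_sum tens_sumr !lfun_sum; apply: eq_bigr => w' _.
rewrite lfunZ tensZr !lfunZ; congr (_ *: _).
rewrite sym_exp_din cut_homE => [|g z]; last exact: dsplit_tact.
set ex := eqP _.
pose v0 a := sin V false (hb (w a)); pose v1 b := sin V true (hb (w' b)).
have -> : tconc ex (tensor_map (val x).1 (sin V false) (delta k w))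
    (tensor_map (val x).2 (sin V true) (delta k w')) = tmul (catf ex v0 v1).
  by rewrite !tensor_map_delta tconc_tmul.
have vq : forall c, catf ex v0 v1 c \in spart (sdouble V)
     (catf ex (fun a => hpar (w a)) (fun a => hpar (w' a)) c).
  by apply: (pos_ind (e := ex)) => c; rewrite ?catf_l ?catf_r; apply: shom_even (sin_even _ _) (mem_hb _).
have [Ex | nx] := eqVneq x (split_at e).
  rewrite (sum_only (i := last)) => [|c].
    have -> : cutp e last = 1%g by rewrite /cutp tperm1.
    rewrite tact1 id_lfunE; subst x; rewrite din_id.
    rewrite -tconc_tmul (eq_irrelevance ex e) dsplit_tconc !tensor_map_tmul.
    by congr (tens (spi _ _ _) (spi _ _ _)); rewrite -tmul_hb; apply: eq_tmul => c; rewrite sout_sin.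
  move: c; apply: (pos_ind (e := ex)) => c cl.
    apply: dsplit_tact_tmul0 vq _; right; exists (posl ex c); first exact: cutp_last.
    by rewrite catf_l sout_sin.
  case/negP: cl; subst x; apply/eqP; rewrite /lastp (eq_irrelevance ex e).
  by congr posr; apply: ord1.
rewrite din_neq 1?eq_sym // big1 // => c _.
apply: dsplit_tact_tmul0 vq _; move: c; apply: (pos_ind (e := ex)) => c.
  by right; exists (posl ex c); [exact: cutp_last | rewrite catf_l sout_sin].
(* The cut letter lies in the second copy and the splitting is not [(a, 1)], so that copy has a
   further letter [b], which [sout V false] kills. *)
have n1 : (val x).2 != 1%N :> nat.
  apply: contraNneq nx => E; apply/eqP/val_inj; rewrite [val x]surjective_pairing /=.
  have E1 : (val x).1 = a :> nat by have := esym ex; rewrite -[LHS]e E => /addIn.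
  by congr (_, _); apply: val_inj.
have [b bc] : exists b, b != c.
  have := ltn_ord c; case: (posnP c) => [c0 c1 | cp _].
    have h : (1 < (val x).2)%N by rewrite ltn_neqAle eq_sym n1 (leq_ltn_trans (leq0n c) c1).
    by exists (Ordinal h); rewrite -val_eqE /= c0.
  have h : (0 < (val x).2)%N by apply: leq_ltn_trans (ltn_ord c).
  by exists (Ordinal h); rewrite -val_eqE /= neq_ltn cp.
left; exists (posr ex b); last by rewrite catf_r sout_sin.
rewrite -(cutp_last e (posr ex c)) (inj_eq perm_inj).
by apply: contraNneq bc => /(congr1 val) /=; rewrite -!/(nat_of_ord _) => /addnI/val_inj ->.
Qed.

Lemma cut_sym_exp : (cut_hom e dsplit \o sym_exp n V)%VF =
  dpr (fun x : splits n => spl x) (split_at e).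
Proof.
apply: dsum_ext => x t; rewrite comp_lfunE (stens_sum t) !lfun_sum; apply: eq_bigr => ij _.
rewrite !lfunZ; congr (_ *: _).
have [u <-] := spi_surj (hb ij.1); have [v <-] := spi_surj (hb ij.2).
exact: cut_sym_exp_din.
Qed.

(** The inverse of [sym_exp] is never computed: that map is onto, and [cut_hom e dsplit] composed
    with it is the projection to [(a, 1)], so the projection can be evaluated directly on the image
    of the diagonal. *)
Lemma sym_coprodE z : sym_coprod e V (spi n V z) = \sum_c split1 e V (tact V (cutp e c) z).
Proof.
pose di := (sin V false + sin V true : 'Hom(sspace V, sspace (sdouble V))).
have di0 : di \in spart (shom V (sdouble V)) false by rewrite memvD ?sin_even.
pose y := pf_map (psym k n) (gpow n di) (spi n V z).
have -> : sym_coprod e V (spi n V z) = cut_hom e dsplit y.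
  rewrite /sym_coprod comp_lfunE comp_lfunE -/y -cut_sym_exp comp_lfunE.
  by rewrite limg_lfunVK // sym_exp_surj.
rewrite /y psym_mapE gpowE // cut_homE => [|g u]; last exact: dsplit_tact.
apply: eq_bigr => c _; rewrite -tensor_map_tact //.
move: (tact V _ z) => u; rewrite -comp_lfunE; congr (fun_of_lfun _ _).
apply: (tconc_hom_ext (e := e)) => b b'.
rewrite comp_lfunE tensor_map_tconc dsplit_tconc split1_tconc !tensor_map_comp.
have E d : (sout V d \o di)%VF = \1%VF.
  apply/lfunP => x; rewrite comp_lfunE id_lfunE add_lfunE lfunD !sout_sin.
  by case: d; rewrite ?addr0 ?add0r.
by rewrite !E !tensor_map_id.
Qed.

End Cut.

Section Degree1.
Variable V : superspace k.

Definition vec1 : 'Hom(tpow 1 V, V) := flin (fun w : word 1 V => hb (w ord0)).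

Lemma perm1_eq (s : 'S_1) : s = 1%g.
Proof. by apply/permP => x; rewrite !ord1. Qed.

Lemma sym1E z : sym1 V (spi 1 V z) = vec1 z.
Proof.
rewrite /sym1 comp_lfunE psym_lift // => s u.
by rewrite (perm1_eq s) tact1 id_lfunE.
Qed.

Lemma tmul_lin1 : linear (fun v : V => tmul (fun _ : 'I_1 => v)).
Proof.
move=> a u v; apply/ffunP => w; rewrite !ffunE !big_ord_recl !big_ord0 !mulr1.
rewrite hcoordP //.
Qed.

Lemma tmul_vec1 z : tmul (fun _ : 'I_1 => vec1 z) = z.
Proof.
rewrite -(linfun_linear tmul_lin1) -comp_lfunE -[RHS]id_lfunE; congr (fun_of_lfun _ _).
apply: delta_ext => w; rewrite comp_lfunE id_lfunE (linfun_linear tmul_lin1) flin_delta.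
by rewrite -tmul_hb; apply: eq_tmul => c; rewrite (ord1 c).
Qed.

Lemma alt1E v : ain 1 V (alt1 V v) = tmul (fun _ => v).
Proof.
have L : linear (fun v : V => apr 1 V (tmul (fun _ : 'I_1 => v))).
  by move=> a x y; apply: etrans (congr1 (apr 1 V) (tmul_lin1 a x y)) (lfunPl _ _ _ _).
rewrite /alt1 (linfun_linear L).
rewrite alt_prK //; apply/mem_altsub => s.
by rewrite (perm1_eq s) tact1 id_lfunE odd_perm1 scale1r.
Qed.

Lemma alt1_vec1 z : ain 1 V (alt1 V (vec1 z)) = z.
Proof. by rewrite alt1E tmul_vec1. Qed.

End Degree1.

Arguments vec1 {V}.

Lemma tassocE X Y Z (x : X) (y : Y) (z : Z) :
  tassoc X Y Z (tens (tens x y) z) = tens x (tens y z).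
Proof.
rewrite /tassoc tlinE => [|z'|t]; last 2 first.
- move=> a u v; rewrite scaler_sumr -big_split; apply: eq_bigr => ij _.
  by rewrite !ffunE scalerDl scalerA.
- move=> a u v; rewrite scaler_sumr -big_split; apply: eq_bigr => ij _.
  by rewrite !tensPr scalerDr !scalerA mulrC.
rewrite [in RHS](hcoord_sum x) [in RHS](hcoord_sum y) tens_suml.
rewrite (eq_bigr (fun ij : hidx X * hidx Y => hcoord ij.1 x *: (hcoord ij.2 y *:
   tens (hb ij.1) (tens (hb ij.2) z)))); last by move=> ij _; rewrite ffunE scalerA.
rewrite -(pair_bigA _ (fun i j => hcoord i x *: (hcoord j y *: tens (hb i) (tens (hb j) z)))) /=.
apply: eq_bigr => i _; rewrite tensZl tens_suml tens_sumr scaler_sumr; apply: eq_bigr => j _.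
by rewrite tensZl tensZr.
Qed.

Section DRPart.
Variables (a a' b b' : nat) (ea : (a + 1)%N = a') (eb : (1 + b)%N = b') (V : superspace k).

(** The differential once the letter to be differentiated stands last. *)
Definition dcut (y : palt k b V) : 'Hom(tpow a' V, stens (psym k a V) (palt k b' V)) :=
  flin (fun w : word a' V => tens (spi a V (delta k (wl ea w : word a V)))
    (alt_prod eb V (tens (alt1 V (hb (wr ea w ord0))) y))).

Lemma dcut_tconc y z z' : dcut y (tconc ea z z') =
  tens (spi a V z) (alt_prod eb V (tens (alt1 V (vec1 z')) y)).
Proof.
move: z z'; apply: tconc_bilin_ext => [z|z|z|z|w w'].
1-4: by move=> c u v; rewrite ?tconcPl ?tconcPr ?lfunPl ?tensPl ?lfunPl ?tensPr.
by rewrite tconc_delta !flin_delta wcatK wcatKr.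
Qed.

Lemma dR_partE z y :
  dR_part ea eb V (tens (spi a' V z) y) = \sum_c dcut y (tact V (cutp ea c) z).
Proof.
rewrite /dR_part 2!comp_lfunE stmapE0 id_lfunE.
rewrite [(stmap _ _ _ \o sym_coprod _ _)%VF _]comp_lfunE sym_coprodE.
rewrite lfun_sum tens_suml !lfun_sum; apply: eq_bigr => c _.
move: (tact V _ z) => u.
pose F : 'Hom(tpow a' V, stens (psym k a V) (palt k b' V)) :=
  (stmap false \1%VF (alt_prod eb V \o stmap false (alt1 V) \1%VF)
   \o tassoc (psym k a V) V (palt k b V)
   \o tensl _ y \o stmap false \1%VF (sym1 V) \o split1 ea V)%VF.
rewrite -[LHS]/(_ (_ (tens _ y))).
have -> : dcut y = F.
  apply: (tconc_hom_ext (e := ea)) => x x'.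
  rewrite dcut_tconc /F !comp_lfunE split1_tconc stmapE0 id_lfunE sym1E tenslE tassocE stmapE0.
  by rewrite id_lfunE comp_lfunE stmapE0 id_lfunE.
by rewrite /F !comp_lfunE tenslE.
Qed.

End DRPart.

End CoproductFormula.

(** * Naturality of the de Rham algebra *)

Section SymAltRelation.

Variable k : fieldType.
Implicit Types (U V W X Y Z : superspace k).

Section Rel.
Variables (m n l : nat) (e : (m + n)%N = l).

Definition jmap V : 'Hom(stens (tpow m V) (palt k n V), tpow l V) :=
  tlin (fun (a : tpow m V) (y : palt k n V) => tconc e a (ain n V y)).

Lemma jmapE V a y : jmap V (tens a y) = tconc e a (ain n V y).
Proof.
by apply: tlinE => [z|z] c u v; rewrite ?tconcPl // lfunPl tconcPr.
Qed.

(** A left inverse of [jmap]; it makes the relation [SA] below single-valued. *)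
Definition jinv V : 'Hom(tpow l V, stens (tpow m V) (palt k n V)) :=
  flin (fun w : word l V => tens (delta k (wl e w : word m V) : tpow m V)
     (apr n V (delta k (wr e w : word n V)))).

Lemma jinv_tconc V a b : jinv V (tconc e a b) = tens a (apr n V b).
Proof.
move: a b; apply: tconc_bilin_ext => [z|z|z|z|w w'].
1-4: by move=> c u v; rewrite ?tconcPl ?tconcPr ?lfunPl ?tensPl ?tensPr.
by rewrite tconc_delta flin_delta wcatK wcatKr.
Qed.

Lemma jmapK V u : jinv V (jmap V u) = u.
Proof.
rewrite -comp_lfunE -[RHS]id_lfunE; congr (fun_of_lfun _ _); apply: stens_ext => i j.
by rewrite comp_lfunE id_lfunE jmapE jinv_tconc ssub_inK.
Qed.

Definition qmap V : 'Hom(stens (tpow m V) (palt k n V), stens (psym k m V) (palt k n V)) :=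
  stmap false (spi m V) \1%VF.

Lemma qmapE V a y : qmap V (tens a y) = tens (spi m V a) y.
Proof. by rewrite /qmap stmapE0 id_lfunE. Qed.

(* S^m (x) A^n is a subquotient of T^(m+n): [z] in the subspace T^m (x) A^n represents [x].     *)
(* Naturality of products and differentials is checked on representatives, where they are     *)
(* given by operators commuting with every equivariant map.                                   *)
Definition SA V (z : tpow l V) (x : stens (psym k m V) (palt k n V)) : Prop :=
  exists2 u, jmap V u = z & qmap V u = x.

Lemma SA_fun V z x x' : @SA V z x -> SA z x' -> x = x'.
Proof. by case=> u <- <- [v /(congr1 (jinv V)) + <-]; rewrite !jmapK => ->. Qed.

Lemma SA_lin V a z x z' x' : @SA V z x -> SA z' x' -> SA (a *: z + z') (a *: x + x').
Proof. by case=> u <- <- [v <- <-]; exists (a *: u + v); rewrite lfunPl. Qed.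

Lemma SA0 V : @SA V 0 0.
Proof. by exists 0; rewrite lfun0. Qed.

Lemma SA_scale V a z x : @SA V z x -> SA (a *: z) (a *: x).
Proof. by case=> u <- <-; exists (a *: u); rewrite lfunZ. Qed.

Lemma SA_sum V (I : finType) (F : I -> tpow l V) G :
  (forall i, SA (F i) (G i)) -> SA (\sum_i F i) (\sum_i G i).
Proof.
move=> FG; apply: (big_ind2 (@SA V)) => [|z x z' x' h h'|i _]; last exact: FG.
  exact: SA0.
by have := SA_lin 1 h h'; rewrite !scale1r.
Qed.

Lemma SA_tens V a y : SA (tconc e a (ain n V y)) (tens (spi m V a) y).
Proof. by exists (tens a y); rewrite ?jmapE ?qmapE. Qed.

Lemma SA_basis V z x : @SA V z x ->
  exists (I : finType) (cf : I -> k) (al : I -> tpow m V) (y : I -> palt k n V) (p q : I -> bool),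
  [/\ forall i, al i \in spart (tpow m V) (p i), forall i, y i \in spart (palt k n V) (q i),
      z = \sum_i cf i *: tconc e (al i) (ain n V (y i)) &
      x = \sum_i cf i *: tens (spi m V (al i)) (y i)].
Proof.
case=> u <- <-; exists (hidx (tpow m V) * hidx (palt k n V))%type, (fun ij => u ij).
exists (fun ij => hb ij.1), (fun ij => hb ij.2), (fun ij => hpar ij.1), (fun ij => hpar ij.2).
split=> [ij|ij||]; try exact: mem_hb; rewrite {1}(stens_sum u) lfun_sum; apply: eq_bigr => ij _.
  by rewrite lfunZ jmapE.
by rewrite lfunZ qmapE.
Qed.

(** Homogeneous representatives let parity claims be checked on tensors. Lifts of basis vectors are
    projected to the right parity, which does not change their classes. *)
Lemma SA_homog V b x : x \in spart (stens (psym k m V) (palt k n V)) b ->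
  exists2 z, z \in spart (tpow l V) b & SA z x.
Proof.
move=> xb; pose L (i : hidx (psym k m V)) : tpow m V :=
  hproj (tpow m V) (hpar i) (squot_sec (symrel m V) (hb i)).
have Lp i : L i \in spart (tpow m V) (hpar i) by exact: mem_hproj.
have LE i : spi m V (L i) = hb i.
  rewrite /L -(hproj_even _ _ (spi_even m V)) spi_unlock squot_secK.
  by rewrite hproj_id // mem_hb.
pose u := \sum_(ij : hidx (psym k m V) * hidx (palt k n V)) (x ij : k) *: tens (L ij.1) (hb ij.2).
exists (jmap V u); last first.
  exists u => //; rewrite [RHS]stens_sum lfun_sum; apply: eq_bigr => ij _.
  by rewrite lfunZ qmapE LE.
rewrite /u lfun_sum; apply: memv_suml => -[i j] _; rewrite lfunZ jmapE /=.
have [-> | nz] := eqVneq (x (i, j)) 0; first by rewrite scale0r mem0v.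
have <- : hpar i (+) hpar j = b.
  by apply: contraNeq nz => nb; apply/eqP; exact: (@free_par _ _ _ b x (i, j) xb nb).
apply: memvZ; apply: mem_tconc (Lp i) _.
by apply: shom_even (ssub_in_even _) (mem_hb _).
Qed.

Lemma SA_surj V x : exists z, @SA V z x.
Proof.
have [z0 _ h0] := SA_homog (mem_hproj false x).
have [z1 _ h1] := SA_homog (mem_hproj true x).
by exists (1 *: z0 + z1); have := SA_lin 1 h0 h1; rewrite !scale1r hproj_sum.
Qed.

(** The sign for passing a map over the first factor is the same in [lbox2] and in [stmap], so the
    two expansions along [gsplit] agree term by term. *)
Lemma SA_nat V W (f : ghom l V W) z x : SA z x ->
  SA (gmap f z) (pf_map (ptensor e (psym k m) (palt k n)) f x).
Proof.
case/SA_basis => I [cf [al [y [p [q [alp _ -> ->]]]]]].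
rewrite !lfun_sum; apply: SA_sum => i; rewrite !lfunZ.
apply: SA_scale; move: (al i) (y i) (p i) (alp i) => al0 y0 p0 ap.
have [t [<- ->]] := ptensor_map e (psym k m) (palt k n) f.
rewrite gsplit_app; apply: SA_sum => fg; apply: SA_scale.
rewrite (lbox2E e _ _ _ _ ap) (stmapE _ _ _ _ (shom_even (spi_even m V) ap)).
apply: SA_scale; rewrite psym_mapE -palt_mapE; exact: SA_tens.
Qed.

Lemma jmap_even V :
  jmap V \in spart (shom (stens (tpow m V) (palt k n V)) (tpow l V)) false.
Proof.
apply: hom_free_even => -[i j]; rewrite addbF -tens_hb jmapE.
by apply: mem_tconc (mem_hb _) _; apply: shom_even (ssub_in_even _) (mem_hb _).
Qed.

Lemma qmap_even V : qmap V \in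
  spart (shom (stens (tpow m V) (palt k n V)) (stens (psym k m V) (palt k n V))) false.
Proof.
apply: hom_free_even => -[i j]; rewrite addbF -tens_hb qmapE.
by apply: mem_tens (mem_hb _); apply: shom_even (spi_even _ _) (mem_hb _).
Qed.

Lemma SA_par V b z x : @SA V z x -> z \in spart (tpow l V) b ->
  x \in spart (stens (psym k m V) (palt k n V)) b.
Proof.
case=> u <- <- zb; apply: shom_even (qmap_even V) _.
by apply: even_inj_spart (jmap_even V) (can_inj (@jmapK V)) zb.
Qed.

Lemma ptensor_SA_functor : is_pfunctor (ptensor e (psym k m) (palt k n)).
Proof.
split.
- move=> V W; apply: pf_evenP => c f fc; apply/mem_shom => d x xd.
  have [z zd zx] := SA_homog xd; apply: SA_par (SA_nat f zx) _.
  by apply: shom_spart zd; rewrite -gmap_par.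
- move=> V; apply/lfunP => x; have [z zx] := SA_surj x.
  by have := SA_nat (gid l V) zx; rewrite gmap_gid !id_lfunE => /SA_fun; apply.
- move=> U V W g f; apply/lfunP => x; have [z zx] := SA_surj x.
  have := SA_nat (gcomp g f) zx; rewrite gmap_gcomp !comp_lfunE => /SA_fun; apply.
  exact/SA_nat/SA_nat.
Qed.

End Rel.

(* On representatives, the product swaps the two middle factors, then antisymmetrizes. *)
Section Product.

Variables (m1 n1 l1 m2 n2 l2 m n l : nat).
Variables (e1 : (m1 + n1)%N = l1) (e2 : (m2 + n2)%N = l2) (em : (m1 + m2)%N = m)
  (en : (n1 + n2)%N = n) (e : (m + n)%N = l) (el : (l1 + l2)%N = l).

Lemma tconcA a b c ab bc abc (eab : (a + b)%N = ab) (e12 : (ab + c)%N = abc)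
    (ebc : (b + c)%N = bc) (e21 : (a + bc)%N = abc) V
    (x : tpow a V) (y : tpow b V) (z : tpow c V) :
  tconc e12 (tconc eab x y) z = tconc e21 x (tconc ebc y z).
Proof.
apply/ffunP => w; rewrite !ffunE -mulrA; congr (_ * (_ * _)).
- congr (x _); apply/ffunP => i; rewrite !ffunE; congr (w _); exact: val_inj.
- congr (y _); apply/ffunP => i; rewrite !ffunE; congr (w _); exact: val_inj.
- congr (z _); apply/ffunP => i; rewrite !ffunE; congr (w _); apply: val_inj.
  by rewrite /= -eab addnA.
Qed.

Lemma exists_mid : exists r, [/\ (m1 + r)%N = l, (n1 + m2 + n2)%N = r & (m2 + n1 + n2)%N = r].
Proof. by exists (n1 + m2 + n2)%N; split; lia. Qed.

(** The two middle factors are isolated through an auxiliary length [r]. The sign of swapping [y]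
    and [a'] is the one in the super tensor product of algebras. *)
Lemma exists_swap : exists Phi : forall V : superspace k, 'End(tpow l V), natural_op Phi /\
  forall V b c a y a' y', y \in spart (tpow n1 V) b -> a' \in spart (tpow m2 V) c ->
  Phi V (tconc el (tconc e1 a y) (tconc e2 a' y')) =
  ((-1) ^+ (b && c) : k) *: tconc e (tconc em a a') (tconc en y y').
Proof.
have [r [er1 er2 er3]] := exists_mid.
exists (fun V => lbox2 er1 false \1%VF
   (lbox2 er2 false (tact V (pswap (erefl (n1 + m2)%N) (addnC m2 n1))) \1%VF)).
split.
  by apply: natop_box; [exact: natop_id | apply: natop_box; [exact: natop_tact | exact: natop_id]].
move=> V b c a y a' y' yb ac.
have e3 : (n1 + l2)%N = r by lia.
rewrite (tconcA e1 el e3 er1) -(tconcA (erefl _) er2 e2 e3) lbox2E0 id_lfunE lbox2E0 id_lfunE.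
rewrite (tact_pswapE _ _ yb ac) tconcZl tconcZr; congr (_ *: _).
have e4 : (m2 + n)%N = r by lia.
rewrite (tconcA (addnC m2 n1) er2 en e4).
by rewrite -(tconcA em e e4 er1).
Qed.

Lemma stens_mulE X1 Y1 X2 Y2 X3 Y3
    (mX : 'Hom(sspace (stens X1 X2), sspace X3)) (mY : 'Hom(sspace (stens Y1 Y2), sspace Y3))
    b c (x : X1) (y : Y1) (x' : X2) (y' : Y2) :
  y \in spart Y1 b -> x' \in spart X2 c ->
  stens_mul mX mY (tens (tens x y) (tens x' y')) =
  ((-1) ^+ (b && c) : k) *: tens (mX (tens x x')) (mY (tens y y')).
Proof.
move=> yb xc; rewrite /stens_mul tlinE => [|t|s]; last 2 first.
- move=> a u v; rewrite scaler_sumr -big_split; apply: eq_bigr => ij _ /=.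
  rewrite scaler_sumr -big_split; apply: eq_bigr => kl _ /=.
  by rewrite !ffunE scalerA -scalerDl; congr (_ *: _); rewrite -[a *: _]/(a * _); ring.
- move=> a u v; rewrite scaler_sumr -big_split; apply: eq_bigr => ij _ /=.
  rewrite scaler_sumr -big_split; apply: eq_bigr => kl _ /=.
  by rewrite !ffunE scalerA -scalerDl; congr (_ *: _); rewrite -[a *: _]/(a * _); ring.
have expand (X Y Z : superspace k) (f : 'Hom(sspace (stens X Y), sspace Z)) (u : X) (v : Y) :
    f (tens u v) = \sum_i \sum_j (hcoord i u * hcoord j v) *: f (tens (hb i) (hb j)).
  rewrite {1}(hcoord_sum u) tens_suml lfun_sum; apply: eq_bigr => i _.
  rewrite {1}(hcoord_sum v) tens_sumr lfun_sum; apply: eq_bigr => j _.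
  by rewrite tensZl tensZr !lfunZ scalerA.
rewrite [in RHS]expand [mY _]expand tens_suml scaler_sumr.
rewrite (eq_bigr (fun ij : hidx X1 * hidx Y1 => \sum_(i' : hidx X2) \sum_(j' : hidx Y2)
    ((-1) ^+ (b && c) : k) *: ((hcoord ij.1 x * hcoord i' x' * (hcoord ij.2 y * hcoord j' y')) *:
      tens (mX (tens (hb ij.1) (hb i'))) (mY (tens (hb ij.2) (hb j')))))); last first.
  move=> [i j] _; rewrite pair_bigA /=; apply: eq_bigr => -[i' j'] _ /=.
  rewrite !ffunE /= scalerA.
  have [-> | /(hpar_spart yb) ->] := eqVneq (hcoord j y) 0; first by rewrite !(mul0r, mulr0).
  have [-> | /(hpar_spart xc) ->] := eqVneq (hcoord i' x') 0; first by rewrite !(mul0r, mulr0).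
  by congr (_ *: _); ring.
rewrite -(pair_bigA _ (fun i j => \sum_(i' : hidx X2) \sum_(j' : hidx Y2)
    ((-1) ^+ (b && c) : k) *: ((hcoord i x * hcoord i' x' * (hcoord j y * hcoord j' y')) *:
      tens (mX (tens (hb i) (hb i'))) (mY (tens (hb j) (hb j')))))) /=.
apply: eq_bigr => i _; rewrite exchange_big tens_suml scaler_sumr; apply: eq_bigr => i' _ /=.
rewrite tens_sumr scaler_sumr; apply: eq_bigr => j _.
rewrite tens_sumr scaler_sumr; apply: eq_bigr => j' _.
by rewrite tensZl tensZr !scalerA.
Qed.

Lemma SA_mul : exists Phi : forall V : superspace k, 'End(tpow l V), natural_op Phi /\
  forall V (z : tpow l1 V) x (z' : tpow l2 V) x', SA e1 z x -> SA e2 z' x' ->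
  SA e (Phi V (tconc el z z'))
     (stens_mul (sym_prod em V) (alt_prod en V) (tens x x')).
Proof.
have [Phi [Phi_nat PhiE]] := exists_swap.
exists (fun V => lbox2 e false \1%VF (antisym n1 n V) \o Phi V)%VF; split.
  by apply: natop_comp => //; apply: natop_box; [exact: natop_id | exact: natop_antisym].
move=> V z x z' x' /SA_basis[I [cf [al [y [p [q [_ yq -> ->]]]]]]].
case/SA_basis => I' [cf' [al' [y' [p' [q' [alp' _ -> ->]]]]]].
rewrite tconc_suml tens_suml !lfun_sum; apply: SA_sum => i.
rewrite tconcZl tensZl !lfunZ; apply: SA_scale.
move: (al i) (y i) (q i) (yq i) => al0 y0 b yb.
rewrite tconc_sumr tens_sumr !lfun_sum; apply: SA_sum => i'.
rewrite tconcZr tensZr !lfunZ; apply: SA_scale.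
move: (al' i') (y' i') (p' i') (alp' i') => al0' y0' c alc.
have yb' : ain n1 V y0 \in spart (tpow n1 V) b by apply: shom_even (ssub_in_even _) yb.
rewrite comp_lfunE (PhiE _ _ _ _ _ _ _ yb' alc) lfunZ lbox2E0 id_lfunE.
rewrite (stens_mulE _ _ _ _ yb (shom_even (spi_even m2 V) alc)).
apply: SA_scale; rewrite sym_prodE -alt_prodE; exact: SA_tens.
Qed.

End Product.

Section Differential.
Variables (a a' b b' l : nat) (ea : (a + 1)%N = a') (eb : (1 + b)%N = b').
Variables (e : (a' + b)%N = l) (e' : (a + b')%N = l).

(** Each letter of the S-part in turn is brought to its last place, next to the A-part, and
    antisymmetrized into it. *)
Definition d_op V : 'End(tpow l V) :=
  (lbox2 e' false \1%VF (antisym 1 b' V)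
   \o lbox2 e false (\sum_c tact V (cutp ea c)) \1%VF)%VF.

Lemma natop_d : natural_op d_op.
Proof.
apply: natop_comp; apply: natop_box; try exact: natop_id; first exact: natop_antisym.
by apply: natop_sum => c; apply: natop_tact.
Qed.

Lemma SA_d V z x : SA e z x -> SA e' (d_op V z) (dR_part ea eb V x).
Proof.
case/SA_basis => I [cf [al [y [p [q [_ _ -> ->]]]]]].
rewrite !lfun_sum; apply: SA_sum => i.
rewrite !lfunZ; apply: SA_scale; move: (al i) (y i) => al0 y0.
rewrite dR_partE /d_op comp_lfunE lbox2E0 id_lfunE sum_lfunE tconc_suml lfun_sum.
apply: SA_sum => c; move: (tact V _ al0) => al1.
rewrite (ffun_deltaE al1) tconc_suml !lfun_sum; apply: SA_sum => w.
rewrite tconcZl !lfunZ; apply: SA_scale; rewrite (delta_wcat ea).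
rewrite dcut_tconc (tconcA ea e eb e') lbox2E0 id_lfunE.
by rewrite -{1}(alt1_vec1 (delta k (wr ea w))) -alt_prodE; apply: SA_tens.
Qed.

End Differential.

End SymAltRelation.

(** * The functors Omega_n, their products and differentials *)

Section OmegaFunctor.

Variable k : fieldType.
Implicit Types (U V W X Y Z : superspace k).

Lemma pdsum_functor n (J : finType) (F : J -> pfunctor k n) :
  (forall j, is_pfunctor (F j)) -> is_pfunctor (pdsum F).
Proof.
move=> FP; split.
- move=> V W; apply: pf_evenP => c f fc; apply/mem_shom => d x xd.
  apply: dsum_spart => j; rewrite pdsum_map_dpr.
  by apply: shom_spart (pf_map_par (FP j) fc) _; apply: shom_even (dpr_even _ _) xd.
- move=> V; apply: dsum_ext => j x; rewrite pdsum_mapE id_lfunE.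
  by case: (FP j) => _ -> _; rewrite id_lfunE.
- move=> U V W g f; apply: dsum_ext => j x; rewrite comp_lfunE !pdsum_mapE.
  by case: (FP j) => _ _ ->; rewrite comp_lfunE.
Qed.

Definition om n V (i : 'I_n.+1) : 'Hom(stens (psym k (n - i) V) (palt k i V), Omega k n V) :=
  din (fun i => atens_part (Salg k) (Aalg k) i V) i.

Definition opr n V (i : 'I_n.+1) : 'Hom(Omega k n V, stens (psym k (n - i) V) (palt k i V)) :=
  dpr (fun i => atens_part (Salg k) (Aalg k) i V) i.

Arguments om {n V} i.
Arguments opr {n} V i.

Lemma om_id n V i x : opr V i (@om n V i x) = x. Proof. exact: din_id. Qed.

Lemma om_neq n V i j x : j != i -> opr V j (@om n V i x) = 0. Proof. exact: din_neq. Qed.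

Lemma om_sum n V (x : Omega k n V) : x = \sum_i om i (opr V i x).
Proof. exact: dsum_sum. Qed.

Lemma om_even n V i : @om n V i \in
  spart (shom (stens (psym k (n - i) V) (palt k i V)) (Omega k n V)) false.
Proof. exact: din_even. Qed.

Lemma opr_even n V i : @opr n V i \in
  spart (shom (Omega k n V) (stens (psym k (n - i) V) (palt k i V))) false.
Proof. exact: dpr_even. Qed.

Lemma om_ext n V (Z : vectType k) (f g : 'Hom(sspace (Omega k n V), Z)) :
  (forall i x, f (@om n V i x) = g (om i x)) -> f = g.
Proof. by move=> fg; apply: dsum_ext. Qed.

Lemma Omega_spart n V b (x : Omega k n V) :
  (forall i, opr V i x \in spart (stens (psym k (n - i) V) (palt k i V)) b) ->
  x \in spart (Omega k n V) b.
Proof. by move=> xb; apply: dsum_spart. Qed.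

Definition SAi n V (i : 'I_n.+1) : tpow n V -> stens (psym k (n - i) V) (palt k i V) -> Prop :=
  SA (subnK (leq_ord i)) (V := V).

Arguments SAi {n V} i z x.

Definition omap n (i : 'I_n.+1) V W (f : ghom n V W) :=
  pf_map (ptensor (subnK (leq_ord i)) (psym k (n - i)) (palt k i)) f.

Arguments omap {n} i [V W] f.

Lemma Omega_functor n : is_pfunctor (Omega k n).
Proof. by apply: pdsum_functor => i; apply: ptensor_SA_functor. Qed.

Lemma Omega_mapE n V W (f : ghom n V W) i x :
  pf_map (Omega k n) f (om i x) = om i (omap i f x).
Proof. exact: pdsum_mapE. Qed.

Lemma SAi_nat n V W (f : ghom n V W) i z x :
  @SAi n V i z x -> SAi i (gmap f z) (omap i f x).
Proof. exact: SA_nat. Qed.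

Definition omul m n l (e : (m + n)%N = l) V (x : Omega k m V) (y : Omega k n V) : Omega k l V :=
  pa_mul e x y.

Lemma pa_mul_suml (A : palgebra k) m n l (e : (m + n)%N = l) V (I : finType) (F : I -> A m V) y :
  pa_mul e (\sum_i F i) y = \sum_i pa_mul e (F i) y.
Proof. by rewrite /pa_mul tens_suml lfun_sum. Qed.

Lemma pa_mul_sumr (A : palgebra k) m n l (e : (m + n)%N = l) V (I : finType) x (F : I -> A n V) :
  pa_mul e x (\sum_i F i) = \sum_i pa_mul e x (F i).
Proof. by rewrite /pa_mul tens_sumr lfun_sum. Qed.

Lemma om_mul m n l (e : (m + n)%N = l) V (i : 'I_m.+1) (j : 'I_n.+1) (r : 'I_l.+1)
    (er : (i + j)%N = r) x y :
  omul e (om i x) (om j y) =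
  om r (stens_mul (sym_prod (atens_eq e er) V) (alt_prod er V) (tens x y) : stens _ _).
Proof.
have -> : omul e (om i x) (om j y) =
    @atens_prod k (Salg k) (Aalg k) _ _ _ e V (tens (om i x) (om j y)) by [].
have z3 (X1 X2 X3 X4 X5 X6 : superspace k) (f : 'Hom(X5, X6)) (g : 'Hom(stens X3 X4, X5))
   (h1 : 'Hom(X1, X3)) (h2 : 'Hom(X2, X4)) u v :
   (f \o g \o stmap false h1 h2)%VF (tens u v) = f (g (tens (h1 u) (h2 v))).
  by rewrite 2!comp_lfunE stmapE0.
rewrite /atens_prod sum_lfunE (sum_only (i := i)) => [|i' ii]; last first.
  rewrite sum_lfunE big1 // => j' _; rewrite sum_lfunE big1 // => r' _.
  case: eqP => [er'|_]; last by rewrite zero_lfunE.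
  by rewrite z3 [dpr _ i' _]om_neq // tens0l !lfun0.
rewrite sum_lfunE (sum_only (i := j)) => [|j' jj]; last first.
  rewrite sum_lfunE big1 // => r' _.
  case: eqP => [er'|_]; last by rewrite zero_lfunE.
  by rewrite z3 [dpr _ j' _]om_neq // tens0r !lfun0.
rewrite sum_lfunE (sum_only (i := r)) => [|r' rr]; last first.
  case: eqP => [er'|_]; last by rewrite zero_lfunE.
  by case/eqP: rr; apply: val_inj; rewrite /= -er -er'.
case: eqP => [er'|]; last by rewrite er.
rewrite z3 [dpr _ i _]om_id [dpr _ j _]om_id (eq_irrelevance er' er).
by [].
Qed.

Lemma omul_rep m n l (e : (m + n)%N = l) (i : 'I_m.+1) (j : 'I_n.+1) :
  exists (r : 'I_l.+1) (Phi : forall V, 'End(tpow l V)), natural_op Phi /\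
  forall V z x z' x', @SAi m V i z x -> @SAi n V j z' x' ->
    exists2 y, omul e (om i x) (om j x') = om r y & SAi r (Phi V (tconc e z z')) y.
Proof.
have rl : (i + j < l.+1)%N by rewrite ltnS -e leq_add ?leq_ord.
pose r := Ordinal rl; have er : (i + j)%N = r by [].
have [Phi [Pn PE]] := @SA_mul k _ _ _ _ _ _ _ _ _ (subnK (leq_ord i)) (subnK (leq_ord j))
  (atens_eq e er) er (subnK (leq_ord r)) e.
exists r, Phi; split=> // V z x z' x' zx zx'.
by exists (stens_mul (sym_prod (atens_eq e er) V) (alt_prod er V) (tens x x'));
  [exact: om_mul | exact: PE].
Qed.

Definition omull m n l (e : (m + n)%N = l) V (y : Omega k n V) : 'Hom(Omega k m V, Omega k l V) :=
  (pa_prod (Omega k) e V \o tensl _ y)%VF.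

Definition omulr m n l (e : (m + n)%N = l) V (x : Omega k m V) : 'Hom(Omega k n V, Omega k l V) :=
  (pa_prod (Omega k) e V \o tensr _ x)%VF.

Lemma omullE m n l (e : (m + n)%N = l) V x y : omull e y x = @omul m n l e V x y.
Proof. by rewrite /omull comp_lfunE tenslE. Qed.

Lemma omulrE m n l (e : (m + n)%N = l) V x y : omulr e x y = @omul m n l e V x y.
Proof. by rewrite /omulr comp_lfunE tensrE. Qed.

Section OmulNat.
Variables (m n l : nat) (e : (m + n)%N = l) (V W : superspace k) (f : ghom l V W).
Variables (I : finType) (cf : I -> k) (g : I -> ghom m V W) (h : I -> ghom n V W) (q : I -> bool).
Hypothesis fE :
  forall u, gmap f u = \sum_i cf i *: lbox2 e (q i) (gmap (g i)) (gmap (h i)) u.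

Lemma omul_nat_om b (i : 'I_m.+1) (j : 'I_n.+1) x y :
    x \in spart (stens (psym k (m - i) V) (palt k i V)) b ->
  pf_map (Omega k l) f (omul e (om i x) (om j y)) =
  \sum_a (cf a * (-1) ^+ (q a && b)) *:
    omul e (pf_map (Omega k m) (g a) (om i x)) (pf_map (Omega k n) (h a) (om j y)).
Proof.
move=> xb; have [r [Phi [[_ Pn] PE]]] := omul_rep e i j.
have [z zb zx] := SA_homog (subnK (leq_ord i)) xb.
have [z' zy] := SA_surj (subnK (leq_ord j)) y.
have [u Eu uR] := PE _ _ _ _ _ zx zy.
pose v a := opr W r (omul e (om i (omap i (g a) x)) (om j (omap j (h a) y))).
have H a := PE _ _ _ _ _ (SAi_nat (g a) zx) (SAi_nat (h a) zy).
have Ev a : omul e (om i (omap i (g a) x)) (om j (omap j (h a) y)) = om r (v a).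
  by rewrite /v; have [w -> _] := H a; rewrite om_id.
have vR a : SAi r (Phi W (tconc e (gmap (g a) z) (gmap (h a) z'))) (v a).
  by rewrite /v; have [w -> wR] := H a; rewrite om_id.
transitivity (om r (\sum_a (cf a * (-1) ^+ (q a && b)) *: v a)); last first.
  rewrite lfun_sum; apply: eq_bigr => a _.
  by rewrite lfunZ -Ev (Omega_mapE (g a)) (Omega_mapE (h a)).
rewrite Eu Omega_mapE; congr (om r _).
apply: (SA_fun (e := subnK (leq_ord r)) (SAi_nat f uR)).
rewrite Pn fE lfun_sum; apply: SA_sum => a.
rewrite lfunZ (lbox2E e _ _ _ _ zb) lfunZ scalerA; apply: SA_scale; exact: vR.
Qed.

Lemma omul_nat b x y : x \in spart (Omega k m V) b ->
  pf_map (Omega k l) f (omul e x y) =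
  \sum_a (cf a * (-1) ^+ (q a && b)) *:
    omul e (pf_map (Omega k m) (g a) x) (pf_map (Omega k n) (h a) y).
Proof.
move=> xb.
pose Lx y := (pf_map (Omega k l) f \o omull e y)%VF.
pose Rx y := \sum_a (cf a * (-1) ^+ (q a && b)) *:
  (omull e (pf_map (Omega k n) (h a) y) \o pf_map (Omega k m) (g a))%VF.
have LE x' y' : Lx y' x' = pf_map (Omega k l) f (omul e x' y') by rewrite comp_lfunE omullE.
have RE x' y' : Rx y' x' = \sum_a (cf a * (-1) ^+ (q a && b)) *:
    omul e (pf_map (Omega k m) (g a) x') (pf_map (Omega k n) (h a) y').
  by rewrite sum_lfunE; apply: eq_bigr => a _; rewrite scale_lfunE comp_lfunE omullE.
rewrite -LE -RE (om_sum x) !lfun_sum; apply: eq_bigr => i _; rewrite LE RE.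
have xib : opr V i x \in spart _ b by apply: shom_even (opr_even _ _) xb.
move: (opr V i x) xib => x0 x0b.
pose Ly := (pf_map (Omega k l) f \o omulr e (om i x0))%VF.
pose Ry := \sum_a (cf a * (-1) ^+ (q a && b)) *:
  (omulr e (pf_map (Omega k m) (g a) (om i x0)) \o pf_map (Omega k n) (h a))%VF.
have LyE y' : Ly y' = pf_map (Omega k l) f (omul e (om i x0) y') by rewrite comp_lfunE omulrE.
have RyE y' : Ry y' = \sum_a (cf a * (-1) ^+ (q a && b)) *:
    omul e (pf_map (Omega k m) (g a) (om i x0)) (pf_map (Omega k n) (h a) y').
  by rewrite sum_lfunE; apply: eq_bigr => a _; rewrite scale_lfunE comp_lfunE omulrE.
rewrite -LyE -RyE (om_sum y) !lfun_sum; apply: eq_bigr => j _; rewrite LyE RyE.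
exact: omul_nat_om.
Qed.

End OmulNat.

Lemma omul_par m n l (e : (m + n)%N = l) V b c x y :
  x \in spart (Omega k m V) b -> y \in spart (Omega k n V) c ->
  omul e x y \in spart (Omega k l V) (b (+) c).
Proof.
move=> xb yc; rewrite {1}(om_sum x) {1}(om_sum y) [omul _ _ _]pa_mul_suml.
apply: memv_suml => i _; rewrite pa_mul_sumr; apply: memv_suml => j _.
have [r [Phi [[P0 _] PE]]] := omul_rep e i j.
have xib : opr V i x \in spart _ b by apply: shom_even (opr_even _ _) xb.
have yjc : opr V j y \in spart _ c by apply: shom_even (opr_even _ _) yc.
have [z zb zx] := SA_homog (subnK (leq_ord i)) xib.
have [z' zc zy] := SA_homog (subnK (leq_ord j)) yjc.
have [u Eu uR] := PE _ _ _ _ _ zx zy.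
rewrite -[pa_mul _ _ _]/(omul _ _ _) Eu; apply: shom_even (om_even _ _) _.
by apply: SA_par uR _; apply: shom_even (P0 V) _; apply: mem_tconc.
Qed.

Lemma dR_om n V (i j : 'I_n.+1) (e : (1 + i)%N = j) x :
  dR n V (om i x) = om j (dR_part (dR_eq e) e V x : stens _ _).
Proof.
rewrite /dR sum_lfunE (sum_only (i := i)) => [|i' ii]; last first.
  rewrite sum_lfunE big1 // => j' _; case: eqP => [er'|_]; last by rewrite zero_lfunE.
  by rewrite comp_lfunE [dpr _ i' _]om_neq // !lfun0.
rewrite sum_lfunE (sum_only (i := j)) => [|j' jj]; last first.
  case: eqP => [er'|_]; last by rewrite zero_lfunE.
  by case/eqP: jj; apply: val_inj; rewrite /= -e -er'.
case: eqP => [e'|]; last by rewrite e.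
by rewrite (eq_irrelevance e' e) 2!comp_lfunE [dpr _ i _]om_id.
Qed.

Lemma dR_om_last n V (i : 'I_n.+1) x : i = n :> nat -> dR n V (om i x) = 0.
Proof.
move=> iN; rewrite /dR sum_lfunE big1 // => i' _; rewrite sum_lfunE big1 // => j' _.
case: eqP => [er'|_]; last by rewrite zero_lfunE.
rewrite comp_lfunE [dpr _ i' _]om_neq ?lfun0 //.
by apply/eqP => ii; have := ltn_ord j'; rewrite -er' ii iN ltnn.
Qed.

Lemma next_ord n (i : 'I_n.+1) : i != n :> nat -> exists j : 'I_n.+1, (1 + i)%N = j.
Proof.
move=> ni; have h : (1 + i < n.+1)%N by rewrite add1n ltnS ltn_neqAle ni leq_ord.
by exists (Ordinal h).
Qed.

(** On representatives the differential is the natural operator [d_op]. *)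
Lemma dR_nat n V W (f : ghom n V W) x :
  dR n W (pf_map (Omega k n) f x) = pf_map (Omega k n) f (dR n V x).
Proof.
rewrite -!comp_lfunE; congr (fun_of_lfun _ _); apply: om_ext => i {}x.
rewrite !comp_lfunE Omega_mapE.
have [iN | /next_ord[j e]] := eqVneq (i : nat) n; first by rewrite !dR_om_last // lfun0.
rewrite !(dR_om e) Omega_mapE; congr (om j _).
have [z zx] := SA_surj (subnK (leq_ord i)) x.
have [P0 Pn] := natop_d k (dR_eq e) (subnK (leq_ord i)) (subnK (leq_ord j)).
have h1 := SA_d (dR_eq e) e (subnK (leq_ord j)) (SAi_nat f zx).
have h2 := SAi_nat f (SA_d (dR_eq e) e (subnK (leq_ord j)) zx).
by apply: SA_fun h1 _; rewrite -Pn.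
Qed.

Lemma dR_even n V : dR n V \in spart (shom (Omega k n V) (Omega k n V)) false.
Proof.
apply/mem_shom => b x xb; rewrite addbF (om_sum x) lfun_sum; apply: memv_suml => i _.
have [iN | /next_ord[j e]] := eqVneq (i : nat) n; first by rewrite dR_om_last // mem0v.
rewrite (dR_om e); apply: shom_even (om_even _ _) _.
have xib : opr V i x \in spart _ b by apply: shom_even (opr_even _ _) xb.
have [z zb zx] := SA_homog (subnK (leq_ord i)) xib.
have [P0 Pn] := natop_d k (dR_eq e) (subnK (leq_ord i)) (subnK (leq_ord j)).
by apply: SA_par (SA_d (dR_eq e) e (subnK (leq_ord j)) zx) _; apply: shom_even (P0 V) zb.
Qed.

Lemma word0_eq V (w : word 0 V) : w = word0 V.
Proof. by apply/ffunP => -[]. Qed.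

Lemma Omega_oneE V : pa_one (Omega k) V =
  om (ord0 : 'I_1) (tens (spi 0 V (delta k (word0 V))) (apr 0 V (delta k (word0 V)))).
Proof.
rewrite /pa_one -[pa_unit _ _]/(atens_unit (Salg k) (Aalg k) V) flin_delta.
rewrite /pa_one -[pa_unit (Salg k) _]/(sym_unit V) -[pa_unit (Aalg k) _]/(alt_unit V).
by rewrite /sym_unit /alt_unit !flin_delta spi_unlock.
Qed.

Lemma alt0 V z : ain 0 V (apr 0 V z) = z.
Proof.
rewrite alt_prK //; apply/mem_altsub => s; have -> : s = 1%g by apply/permP => -[].
by rewrite tact1 id_lfunE odd_perm1 scale1r.
Qed.

Lemma Omega_one_rep V : SAi ord0 (delta k (word0 V)) (opr V (ord0 : 'I_1) (pa_one (Omega k) V)).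
Proof.
rewrite Omega_oneE om_id.
set t := tens _ _; have := SA_tens (subnK (leq_ord (ord0 : 'I_1)))
  (delta k (word0 V) : tpow (0 - 0) V) (apr 0 V (delta k (word0 V))).
rewrite alt0 tconc_delta; congr (SA _ _ _).
by congr (delta k _); exact: word0_eq.
Qed.

Lemma Omega_one_par V : pa_one (Omega k) V \in spart (Omega k 0 V) false.
Proof.
apply: Omega_spart => i; have -> : i = ord0 by apply: ord1.
apply: SA_par (Omega_one_rep V) _; have := @mem_delta k _ (@wpar k 0 V) (word0 V).
by rewrite /wpar big_ord0.
Qed.

Lemma Omega_one_nat V W (f : ghom 0 V W) :
  pf_map (Omega k 0) f (pa_one (Omega k) V) =
  (gmap f (delta k (word0 V)) (word0 W) : k) *: pa_one (Omega k) W.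
Proof.
rewrite (om_sum (pa_one _ V)) (om_sum (pa_one _ W)) lfun_sum scaler_sumr.
apply: eq_bigr => i _; have -> : i = ord0 by apply: ord1.
rewrite Omega_mapE -lfunZ; congr (om _ _).
apply: SA_fun (SAi_nat f (Omega_one_rep V)) _.
set c := (gmap f _ _); have -> : gmap f (delta k (word0 V)) = c *: (delta k (word0 W) : tpow 0 W).
  apply/ffunP => w; rewrite (word0_eq w) !ffunE eqxx -/c; exact/esym/mulr1.
exact/SA_scale/Omega_one_rep.
Qed.

End OmegaFunctor.

Arguments om {k n V} i.
Arguments om_even {k n} V i.

(** * Monomials *)

Section Contents.

Variable N : nat.
Notation ct := {ffun 'I_N -> nat}.
Implicit Types (a b c : ct) (q : 'I_N -> 'I_N -> bool).

Definition addc a b : ct := [ffun i => a i + b i]%N.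
Definition zeroc : ct := [ffun=> 0%N].
Definition singc (i : 'I_N) (m : nat) : ct := [ffun j => if j == i then m else 0%N].
Definition degc a : nat := (\sum_i a i)%N.
Definition content n (w : {ffun 'I_n -> 'I_N}) : ct := [ffun i => (\sum_x (w x == i))%N].

Lemma addcC a b : addc a b = addc b a.
Proof. by apply/ffunP => i; rewrite !ffunE addnC. Qed.
Lemma addcA a b c : addc a (addc b c) = addc (addc a b) c.
Proof. by apply/ffunP => i; rewrite !ffunE addnA. Qed.
Lemma add0c a : addc zeroc a = a.
Proof. by apply/ffunP => i; rewrite !ffunE. Qed.
Lemma addc0 a : addc a zeroc = a. Proof. by rewrite addcC add0c. Qed.
Lemma degcD a b : degc (addc a b) = (degc a + degc b)%N.
Proof. by rewrite /degc -big_split; apply: eq_bigr => i _; rewrite ffunE. Qed.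
Lemma degc0 : degc zeroc = 0%N.
Proof. by rewrite /degc big1 // => i _; rewrite ffunE. Qed.
Lemma degc_sing i m : degc (singc i m) = m.
Proof.
rewrite /degc (bigD1 i) //= ffunE eqxx big1 ?addn0 // => j ji.
by rewrite ffunE (negPf ji).
Qed.
Lemma degc_eq0 a : (degc a == 0%N) = (a == zeroc).
Proof.
apply/idP/eqP => [|->]; last by rewrite degc0.
rewrite /degc sum_nat_eq0 => /forallP a0; apply/ffunP => i; rewrite ffunE.
exact/eqP/a0.
Qed.
Lemma split_content a i : (0 < a i)%N -> exists b, a = addc b (singc i 1).
Proof.
move=> ai; exists [ffun j => (a j - (j == i))%N]; apply/ffunP => j; rewrite !ffunE.
by case: eqP => [->|_]; rewrite ?subnK // subn0 addn0.
Qed.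

Section WordSums.
Variables (n : nat) (w : {ffun 'I_n -> 'I_N}).

Lemma sum_content (F : 'I_N -> nat) : (\sum_x F (w x) = \sum_i content w i * F i)%N.
Proof.
transitivity (\sum_x \sum_i (w x == i) * F i)%N.
  apply: eq_bigr => x _; rewrite (bigD1 (w x)) //= eqxx mul1n big1 ?addn0 // => i iw.
  by rewrite eq_sym (negPf iw).
by rewrite exchange_big; apply: eq_bigr => i _; rewrite -big_distrl ffunE.
Qed.

Lemma degc_content : degc (content w) = n.
Proof.
have := sum_content (fun=> 1%N); rewrite sum_nat_const card_ord muln1 => E.
by rewrite [RHS]E; apply: eq_bigr => i _; rewrite muln1.
Qed.

Lemma content_wact s : content (wact s w) = content w.
Proof.
apply/ffunP => i; rewrite !ffunE (reindex_inj (@perm_inj _ s)) /=.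
by apply: eq_bigr => x _; rewrite wact_at.
Qed.

Lemma content_gt0 x : (0 < content w (w x))%N.
Proof. by rewrite ffunE (bigD1 x) //= eqxx. Qed.

Lemma content_gt1 x y : x != y -> w x = w y -> (1 < content w (w x))%N.
Proof.
by move=> xy wxy; rewrite ffunE (bigD1 x) //= eqxx (bigD1 y) 1?eq_sym //= wxy eqxx.
Qed.

Lemma content_perm (w' : {ffun 'I_n -> 'I_N}) : content w' = content w ->
  exists s, w' = wact s w.
Proof.
move=> ww'; have [|s E] := @perm_of_count _ n w w'.
  move=> i; have := congr1 (fun c : ct => c i) ww'; rewrite !ffunE.
  have cardE (h : {ffun 'I_n -> 'I_N}) : #|[pred x | h x == i]| = (\sum_x (h x == i))%N.
    by rewrite -sum1_card big_mkcond; apply: eq_bigr => x _; rewrite inE; case: eqP.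
  by rewrite !cardE => ->.
exists (s^-1)%g; apply/ffunP => x; rewrite ffunE invgK; exact: E.
Qed.

End WordSums.

Lemma content_wcat m n l (e : (m + n)%N = l) w w' :
  content (wcat e w w') = addc (content w) (content w').
Proof.
apply/ffunP => i; rewrite !ffunE (big_pos e) /=; congr addn.
  by apply: eq_bigr => x _; rewrite wcat_l.
by apply: eq_bigr => x _; rewrite wcat_r.
Qed.

Lemma content_exists n c : degc c = n -> exists w : {ffun 'I_n -> 'I_N}, content w = c.
Proof.
elim: n c => [|n IH] c.
  move=> /eqP; rewrite degc_eq0 => /eqP ->.
  have v0 : 'I_0 -> 'I_N by case.
  by exists [ffun x => v0 x]; apply/ffunP => i; rewrite !ffunE big_ord0.
move=> cn; have [i ci] : exists i, (0 < c i)%N.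
  apply/existsP; rewrite -[X in is_true X]negbK negb_exists; apply/negP => /forallP h.
  suff : degc c == 0%N by rewrite cn.
  by rewrite /degc sum_nat_eq0; apply/forallP => i; have := h i; rewrite -eqn0Ngt.
have [b cE] := split_content ci.
have /IH[w wb] : degc b = n by move: cn; rewrite cE degcD degc_sing addn1 => -[].
exists (wcat (addn1 n) w [ffun=> i]); rewrite content_wcat wb cE; congr addc.
by apply/ffunP => j; rewrite !ffunE big_ord1 ffunE eq_sym; case: eqP.
Qed.

(* Contents on which the signed permutation action, with sign (-1)^(q i j) for *)
(* exchanging letters i and j, has trivial stabilizer character.               *)
Definition validc q c : bool := [forall i, q i i ==> (c i <= 1)%N].

(** Weighted inversions of the word itself: the sign of sorting its letters into increasing
    order. *)
Definition weps q n (w : {ffun 'I_n -> 'I_N}) : bool :=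
  \big[addb/false]_(x : 'I_n * 'I_n | (x.1 < x.2)%N) (q (w x.1) (w x.2) && (w x.2 < w x.1)%N).

(** Weighted number of exchanges that sort a sorted word of content [a] followed by a sorted word of
    content [b]. *)
Definition bform q a b : nat := (\sum_(i < N) \sum_(j < N | (j < i)%N) q i j * a i * b j)%N.

Lemma bformDl q a a' b : bform q (addc a a') b = (bform q a b + bform q a' b)%N.
Proof.
rewrite /bform -big_split; apply: eq_bigr => i _; rewrite -big_split; apply: eq_bigr => j _ /=.
by rewrite ffunE mulnDr mulnDl.
Qed.

Lemma bformDr q a b b' : bform q a (addc b b') = (bform q a b + bform q a b')%N.
Proof.
rewrite /bform -big_split; apply: eq_bigr => i _; rewrite -big_split; apply: eq_bigr => j _ /=.
by rewrite ffunE mulnDr.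
Qed.

Lemma bform0l q b : bform q zeroc b = 0%N.
Proof. by rewrite /bform big1 // => i _; rewrite big1 // => j _; rewrite ffunE muln0. Qed.

Lemma bform0r q b : bform q b zeroc = 0%N.
Proof. by rewrite /bform big1 // => i _; rewrite big1 // => j _; rewrite ffunE muln0. Qed.

(** Sorting cannot order two positions with equal letters. In a valid content [q] is false on such
    pairs, and all other pairs compare strictly. *)
Lemma weps_wact q n (s : 'S_n) (w : {ffun 'I_n -> 'I_N}) : (forall i j, q i j = q j i) ->
    validc q (content w) ->
  weps q (wact s w) = weps q w (+) inv s (fun x y => q (w x) (w y)).
Proof.
move=> qsym /forallP wv.
have q0 x y : x != y -> w x = w y -> q (w x) (w y) = false.
  move=> xy wxy; have := wv (w x); rewrite leqNgt (content_gt1 xy wxy) implybF wxy.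
  by move/negbTE.
pose g (x y : 'I_n) := q (w ((s^-1)%g x)) (w ((s^-1)%g y)) &&
   ((x < y)%N (+) (w ((s^-1)%g x) < w ((s^-1)%g y))%N).
have gsym x y : g x y = g y x.
  have [-> // | xy] := eqVneq x y; rewrite /g qsym; case E: (q _ _) => //=.
  have sxy : (s^-1)%g y != (s^-1)%g x by rewrite (inj_eq perm_inj) eq_sym.
  have wxy : w ((s^-1)%g y) != w ((s^-1)%g x).
    by apply: contraTneq E => /(q0 _ _ sxy) ->.
  case: (ltngtP x y) => [_|_|/val_inj E2]; last by rewrite E2 eqxx in xy.
    by case: ltngtP => // /val_inj E2; rewrite E2 eqxx in wxy.
  by case: ltngtP => // /val_inj E2; rewrite E2 eqxx in wxy.
transitivity (\big[addb/false]_(x : 'I_n * 'I_n | (x.1 < x.2)%N) g x.1 x.2).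
  apply: eq_bigr => -[x y] /= xy; rewrite /g !ffunE xy /=.
  case E: (q _ _) => //=.
  have sxy : (s^-1)%g x != (s^-1)%g y.
    by rewrite (inj_eq perm_inj); apply: contraTneq xy => ->; rewrite ltnn.
  case: ltngtP => // /val_inj wE; have := q0 _ _ sxy (esym wE); by rewrite E.
rewrite -(pair_sym_reindex s gsym) inv_cross -big_split; apply: eq_bigr => -[x y] /= xy.
rewrite /g !permK /cross xy /=.
case E: (q _ _) => //=.
have xny : x != y by apply: contraTneq xy => ->; rewrite ltnn.
have wxy : w x != w y by apply: contraTneq E => /(q0 _ _ xny) ->.
case: (ltngtP (w x) (w y)) => [_|_|/val_inj E2]; last by rewrite E2 eqxx in wxy.
  by case: (s x < s y)%N.
by case: (s x < s y)%N.
Qed.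

Lemma weps_wcat q m n l (e : (m + n)%N = l) w w' :
  weps q (wcat e w w') = weps q w (+) weps q w' (+) odd (bform q (content w) (content w')).
Proof.
have nest n' (F : 'I_n' -> 'I_n' -> bool) :
    \big[addb/false]_(x : 'I_n' * 'I_n' | (x.1 < x.2)%N) F x.1 x.2 =
    \big[addb/false]_(x < n') \big[addb/false]_(y < n') ((x < y)%N && F x y).
  rewrite big_mkcond -(pair_bigA _ (fun x y : 'I_n' => if (x < y)%N then F x y else false)) /=.
  by do 2 (apply: eq_bigr => ? _); case: ifP.
have nestw n' (u : {ffun 'I_n' -> 'I_N}) : weps q u =
    \big[addb/false]_(x < n') \big[addb/false]_(y < n') ((x < y)%N && (q (u x) (u y) && (u y < u x)%N)).
  by rewrite /weps (nest _ (fun x y => q (u x) (u y) && (u y < u x)%N)).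
rewrite !nestw (addb_pos e).
have -> : \big[addb/false]_b0 \big[addb/false]_(y < l) ((posr e b0 < y)%N &&
    (q (wcat e w w' (posr e b0)) (wcat e w w' y) && (wcat e w w' y < wcat e w w' (posr e b0))%N)) =
    \big[addb/false]_(x < n) \big[addb/false]_(y < n) ((x < y)%N && (q (w' x) (w' y) && (w' y < w' x)%N)).
  apply: eq_bigr => x _; rewrite (addb_pos e) big1 ?addFb => [|y _]; last by rewrite posrl_lt.
  by apply: eq_bigr => y _; rewrite posr_lt !wcat_r.
rewrite -[RHS]addbA [X in _ = _ (+) X]addbC addbA; congr (_ (+) _).
transitivity (\big[addb/false]_(x < m) (
   (\big[addb/false]_(y < m) ((x < y)%N && (q (w x) (w y) && (w y < w x)%N)))
   (+) odd (\sum_(y < n) q (w x) (w' y) * (w' y < w x)%N))).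
  apply: eq_bigr => x _; rewrite (addb_pos e); congr (_ (+) _).
    by apply: eq_bigr => y _; rewrite posl_lt !wcat_l.
  rewrite odd_sum; apply: eq_bigr => y _; rewrite poslr_lt wcat_l wcat_r oddM !oddb //.
rewrite big_split -odd_sum; congr (_ (+) odd _).
rewrite (sum_content w (fun i => \sum_(y < n) q i (w' y) * (w' y < i))%N); apply: eq_bigr => i _.
rewrite (sum_content w' (fun j => q i j * (j < i))%N) big_distrr [RHS]big_mkcond /=.
apply: eq_bigr => j _; case: (j < i)%N; rewrite ?muln1 ?muln0 //.
by rewrite mulnA mulnC mulnA.
Qed.

Lemma validcDl q a b : validc q (addc a b) -> validc q a.
Proof.
move/forallP => h; apply/forallP => i; apply/implyP => qi.
by have := h i; rewrite qi ffunE /=; apply: leq_trans; rewrite leq_addr.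
Qed.

Lemma validcDr q a b : validc q (addc a b) -> validc q b.
Proof. by rewrite addcC; apply: validcDl. Qed.

Section SignK.
Variable k : fieldType.

(* For a valid content, the sign of any permutation sorting the letters of [w]. *)
Definition wsgn q n (w : {ffun 'I_n -> 'I_N}) : k :=
  if validc q (content w) then (-1) ^+ weps q w else 0.

Lemma wsgn_sq q n (w : {ffun 'I_n -> 'I_N}) :
  wsgn q w * wsgn q w = (validc q (content w))%:R.
Proof. by rewrite /wsgn; case: ifP => _; rewrite ?mulr0 // -signr_addb addbb. Qed.

Lemma wsgn_wact q n (s : 'S_n) (w : {ffun 'I_n -> 'I_N}) : (forall i j, q i j = q j i) ->
  wsgn q (wact s w) = (-1) ^+ inv s (fun x y => q (w x) (w y)) * wsgn q w.
Proof.
move=> qsym; rewrite /wsgn content_wact; case: ifP => [v|_]; last by rewrite mulr0.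
by rewrite weps_wact // signr_addb mulrC.
Qed.

Lemma wsgn_wcat q m n l (e : (m + n)%N = l) w w' :
  validc q (addc (content w) (content w')) ->
  wsgn q (wcat e w w') = wsgn q w * wsgn q w' * (-1) ^+ bform q (content w) (content w').
Proof.
move=> v; rewrite /wsgn content_wcat v (validcDl v) (validcDr v) weps_wcat !signr_addb.
by rewrite signr_odd.
Qed.

End SignK.

End Contents.

(** * Homogeneous bases and the monomial basis of Omega *)

Section HBase.

Variable k : fieldType.
Implicit Types (U V W X Y Z : superspace k).

(** Two kinds of basis are needed: the chosen one of [V], and on the twist the one formed by the
    [delta k i], which need not be the basis chosen for [stwist V]. *)
Record hbase X := HBase {
  bdim : nat;
  bpar : 'I_bdim -> bool;
  bvec : 'I_bdim -> X;
  bco : 'I_bdim -> 'Hom(X, k^o);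
  bvec_par : forall i, bvec i \in spart X (bpar i);
  bco_vec : forall i j, bco i (bvec j) = (i == j)%:R;
  bvec_sum : forall x, x = \sum_i (bco i x : k) *: bvec i }.

Arguments bvec_par {X} h i.
Arguments bpar {X} h i.
Arguments bvec {X} h i.
Arguments bco {X} h i.

Variables (X : superspace k) (E : hbase X).
Local Notation N := (bdim E).

Definition tw n (w : {ffun 'I_n -> 'I_N}) : tpow n X := tmul (fun a => bvec E (w a)).
Definition tc n (w : {ffun 'I_n -> 'I_N}) : 'Hom(tpow n X, k^o) :=
  flin (fun u : word n X => (\prod_a bco E (w a) (hb (u a)) : k^o)).

Lemma tc_tmul n (w : {ffun 'I_n -> 'I_N}) v : tc w (tmul v) = \prod_a bco E (w a) (v a).
Proof.
rewrite flinE.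
transitivity (\sum_(u : word n X) \prod_a (hcoord (u a) (v a) * bco E (w a) (hb (u a)))).
  by apply: eq_bigr => u _; rewrite ffunE big_split.
rewrite -(bigA_distr_bigA (fun a (i : hidx X) => hcoord i (v a) * bco E (w a) (hb i))).
apply: eq_bigr => a _; rewrite [in RHS](hcoord_sum (v a)) lfun_sum.
by apply: eq_bigr => i _; rewrite lfunZ.
Qed.

Lemma tc_tw n (w w' : {ffun 'I_n -> 'I_N}) : tc w (tw w') = (w == w')%:R.
Proof.
rewrite tc_tmul; have [-> | ne] := eqVneq w w'.
  by rewrite big1 // => a _; rewrite bco_vec eqxx.
have /existsP[a wa] : [exists a, w a != w' a].
  apply: contraR ne; rewrite negb_exists => /forallP h.
  by apply/eqP/ffunP => a; apply/eqP; have := h a; rewrite negbK.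
by rewrite (bigD1 a) //= bco_vec (negPf wa) mul0r.
Qed.

Lemma tmulZ n (c : 'I_n -> k) (v : 'I_n -> sspace X) :
  tmul (fun a => c a *: v a) = (\prod_a c a) *: tmul v.
Proof.
apply/ffunP => u; rewrite !ffunE -[_ *: _]/(_ * _) -big_split; apply: eq_bigr => a _ /=.
by rewrite /hcoord linearZ.
Qed.

Lemma tw_sum n (z : tpow n X) : z = \sum_w (tc w z : k) *: tw w.
Proof.
have D (u : word n X) : (delta k u : tpow n X) = \sum_w (tc w (delta k u) : k) *: tw w.
  rewrite -tmul_hb [LHS](eq_tmul (v' := fun a => \sum_i (bco E i (hb (u a)) : k) *: bvec E i)).
    by rewrite tmul_expand; apply: eq_bigr => w _; rewrite tmulZ tc_tmul.
  by move=> a; rewrite -bvec_sum.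
rewrite {1}(ffun_deltaE z) [in LHS](eq_bigr (fun u => \sum_w ((z u : k) * tc w (delta k u)) *: tw w)).
  rewrite exchange_big; apply: eq_bigr => w _ /=; rewrite -scaler_suml; congr (_ *: _).
  by rewrite [in RHS](ffun_deltaE z) lfun_sum; apply: eq_bigr => u _; rewrite lfunZ.
by move=> u _; rewrite {1}D scaler_sumr; apply: eq_bigr => w _; rewrite scalerA.
Qed.

Lemma tw_ext n (Y : vectType k) (f g : 'Hom(sspace (tpow n X), Y)) :
  (forall w, f (tw w) = g (tw w)) -> f = g.
Proof.
move=> fg; apply/lfunP => z; rewrite (tw_sum z) !lfun_sum; apply: eq_bigr => w _.
by rewrite !lfunZ fg.
Qed.

Lemma tc_inj n (z z' : tpow n X) : (forall w, tc w z = tc w z') -> z = z'.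
Proof. by move=> h; rewrite (tw_sum z) (tw_sum z'); apply: eq_bigr => w _; rewrite h. Qed.

(** Exchanging two letters costs a sign in S when both are odd, and in A unless both are odd, where
    the Koszul and the alternating sign cancel. *)
Definition qS (i j : 'I_N) : bool := bpar E i && bpar E j.
Definition qA (i j : 'I_N) : bool := ~~ (bpar E i && bpar E j).

Lemma qS_sym i j : qS i j = qS j i. Proof. exact: andbC. Qed.
Lemma qA_sym i j : qA i j = qA j i. Proof. by rewrite /qA andbC. Qed.

Lemma tact_tw n (s : 'S_n) (w : {ffun 'I_n -> 'I_N}) : tact X s (tw w) =
  ((-1) ^+ inv s (fun x y => qS (w x) (w y)) : k) *: tw (wact s w).
Proof.
rewrite /tw (tact_tmul s (fun a => bvec_par E (w a))); congr (_ *: _).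
by apply: eq_tmul => a; rewrite ffunE.
Qed.

Lemma inv_qA n (s : 'S_n) (w : {ffun 'I_n -> 'I_N}) :
  (-1) ^+ inv s (fun x y => qA (w x) (w y)) =
  (-1) ^+ odd_perm s * (-1) ^+ inv s (fun x y => qS (w x) (w y)) :> k.
Proof.
rewrite -signr_addb -inv_sign; congr (_ ^+ nat_of_bool _).
by rewrite !inv_cross -big_split; apply: eq_bigr => x _; rewrite /qA /qS; case: (bpar _ _); case: (bpar _ _); case: (cross _ _ _).
Qed.

Lemma tc_tact n (s : 'S_n) (w : {ffun 'I_n -> 'I_N}) z :
  tc (wact s w) (tact X s z) = (-1) ^+ inv s (fun x y => qS (w x) (w y)) * tc w z.
Proof.
rewrite (tw_sum z) !lfun_sum mulr_sumr; apply: eq_bigr => w' _.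
rewrite !lfunZ tact_tw lfunZ !tc_tw (inj_eq (can_inj (wactK s))).
by case: eqP => [->|_]; rewrite -![_ *: _]/(_ * _) ?mulr0 // !mulr1 mulrC.
Qed.

Lemma tconc_tw m n l (e : (m + n)%N = l) (w : {ffun 'I_m -> 'I_N}) (w' : {ffun 'I_n -> 'I_N}) :
  tconc e (tw w) (tw w') = tw (wcat e w w').
Proof.
by rewrite /tw tconc_tmul; apply: eq_tmul; apply: (pos_ind (e := e)) => a;
  rewrite ?wcat_l ?wcat_r ?catf_l ?catf_r.
Qed.

Lemma tc_tconc m n l (e : (m + n)%N = l) (x : {ffun 'I_l -> 'I_N}) (z : tpow m X) (z' : tpow n X) :
  tc x (tconc e z z') = tc (wl e x) z * tc (wr e x) z'.
Proof.
rewrite (tw_sum z) tconc_suml !lfun_sum mulr_suml; apply: eq_bigr => w _.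
rewrite tconcZl !lfunZ (tw_sum z') tconc_sumr !lfun_sum mulr_sumr scaler_sumr; apply: eq_bigr => w' _.
rewrite tconcZr !lfunZ tconc_tw !tc_tw -![_ *: _]/(_ * _).
rewrite -[x in x == _](wcat_split e) mulrACA -mulrA; congr (_ * (_ * _)).
rewrite -natrM mulnb; congr (_ *+ (nat_of_bool _)).
apply/eqP/andP => [E2 | [/eqP -> /eqP ->] //].
by split; apply/eqP; [have := congr1 (wl e) E2 | have := congr1 (wr e) E2]; rewrite !(wcatK, wcatKr).
Qed.

Lemma tw_spart n (w : {ffun 'I_n -> 'I_N}) :
  tw w \in spart (tpow n X) (\big[addb/false]_a bpar E (w a)).
Proof. by apply: mem_tmul => a; apply: bvec_par. Qed.

(** Exchange two occurrences of a repeated letter [i] with [q i i]. *)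
Lemma invalid_swap n q (w : {ffun 'I_n -> 'I_N}) : (forall i j, q i j = q j i) ->
  ~~ validc q (content w) -> exists s : 'S_n,
    wact s w = w /\ inv s (fun x y => q (w x) (w y)) = true.
Proof.
move=> qsym; rewrite negb_forall => /existsP[i]; rewrite negb_imply -ltnNge => /andP[qi ci].
have /card_gt1P[x [y [xi yi xy]]] : (1 < #|[pred x | w x == i]|)%N.
  rewrite -sum1_card big_mkcond /=; move: ci; rewrite ffunE.
  by rewrite (eq_bigr (fun x => if w x == i then 1%N else 0%N)) // => x _; case: eqP.
move: xi yi; rewrite !inE => /eqP xi /eqP yi.
exists (tperm x y); split.
  apply/ffunP => z; rewrite ffunE tpermV; case: tpermP => [->|->|] //; by rewrite xi yi.
rewrite inv_tperm ?xi ?yi // => c _ _.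
Qed.

End HBase.

Arguments bpar {k X} h i.
Arguments bvec {k X} h i.
Arguments bco {k X} h i.
Arguments bvec_par {k X} h i.
Arguments qS {k X} E i j.
Arguments qA {k X} E i j.
Arguments qS_sym {k X} E i j.
Arguments qA_sym {k X} E i j.
Arguments tw {k X} E {n} w.
Arguments tc {k X} E {n} w.

Section FiniteContents.
Variables (N : nat).

(** Bounded contents form a finite type, over which monomials can be summed. *)
Definition fct M : finType := {ffun 'I_N -> 'I_M.+1}.
Definition ctn M (f : fct M) : {ffun 'I_N -> nat} := [ffun i => f i : nat].

Lemma ctn_inj M : injective (@ctn M).
Proof.
move=> f g fg; apply/ffunP => i; apply: val_inj.
by have := congr1 (fun h : {ffun _ -> _} => h i) fg; rewrite !ffunE.
Qed.

Lemma ctn_surj M c : (degc c <= M)%N -> exists f : fct M, ctn f = c.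
Proof.
move=> cM; exists [ffun i => inord (c i)]; apply/ffunP => i; rewrite !ffunE inordK //.
by rewrite ltnS; apply: leq_trans cM; rewrite /degc (bigD1 i) //= leq_addr.
Qed.

Lemma sum_by_content (U : nmodType) n M (F : {ffun 'I_n -> 'I_N} -> U) : (n <= M)%N ->
  \sum_w F w = \sum_(f : fct M) \sum_(w | content w == ctn f) F w.
Proof.
move=> nM; rewrite (exchange_big_dep predT) //=; apply: eq_bigr => w _.
have [f fE] : exists f : fct M, ctn f = content w by apply: ctn_surj; rewrite degc_content.
rewrite (big_pred1 f) // => g; rewrite /= -fE eq_sym.
by apply/eqP/eqP => [/ctn_inj|->].
Qed.

End FiniteContents.

Lemma lincomb_linear (k : fieldType) (U Y : vectType k) (I : finType) (L : I -> 'Hom(U, k^o)) (g : I -> Y) :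
  linear (fun u => \sum_i (L i u : k) *: g i).
Proof.
move=> c u v; rewrite scaler_sumr -big_split; apply: eq_bigr => i _ /=.
by rewrite linearP /= scalerDl scalerA.
Qed.

Section Monomials.

Variables (k : fieldType) (k2 : 2%:R != 0 :> k) (X : superspace k) (E : hbase X).
Local Notation N := (bdim E).
Local Notation ct := {ffun 'I_N -> nat}.
Implicit Types (a b : ct) (m : ct * ct).

Let qSs := qS_sym E.
Let qAs := qA_sym E.

(** Disposes of words that some permutation fixes while reversing their sign. *)
Lemma eq_oppr_0 (Y : lmodType k) (y : Y) : y = - y -> y = 0.
Proof.
move/eqP; rewrite -subr_eq0 opprK -mulr2n -scaler_nat scaler_eq0 (negPf k2) /=.
by move/eqP.
Qed.

Lemma wsgn_pick n c : (exists2 w : {ffun 'I_n -> 'I_N}, [pick w | content w == c] = Some w &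
  content w = c) \/ (([pick w : {ffun 'I_n -> 'I_N} | content w == c] = None) /\ degc c != n).
Proof using Type.
case: pickP => [w /eqP wc | h]; [by left; exists w | right; split=> //].
by apply/negP => /eqP /content_exists[w wc]; have := h w; rewrite wc eqxx.
Qed.

(** The signed sum over the orbit is invariant under permutations, so it descends to [psym] as the
    coordinate [cS]. *)
Definition lamS n a : 'Hom(tpow n X, k^o) :=
  (\sum_(w : {ffun 'I_n -> 'I_N} | content w == a) wsgn k (qS E) w *: tc E w)%VF.

Lemma lamSE n a z : lamS n a z =
  \sum_(w : {ffun 'I_n -> 'I_N} | content w == a) wsgn k (qS E) w * (tc E w z : k).
Proof. by rewrite sum_lfunE; apply: eq_bigr => w _; rewrite scale_lfunE. Qed.

Lemma lamS_tact n a s z : lamS n a (tact X s z) = lamS n a z.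
Proof.
rewrite !lamSE (reindex_inj (can_inj (wactK s))) /=.
apply: eq_big => [w | w _]; first by rewrite content_wact.
rewrite tc_tact (wsgn_wact k s w qSs) mulrACA -signr_addb addbb.
exact: mul1r.
Qed.

Definition cS n a : 'Hom(psym k n X, k^o) := (lamS n a \o squot_sec (symrel n X))%VF.

Lemma cS_spi n a z : cS n a (spi n X z) = lamS n a z.
Proof. by rewrite comp_lfunE psym_lift // => s y; rewrite lamS_tact. Qed.

Lemma lamS_tw n a (w : {ffun 'I_n -> 'I_N}) :
  lamS n a (tw E w) = if content w == a then wsgn k (qS E) w else 0.
Proof.
rewrite lamSE; case: eqP => [<-|ne].
  by rewrite (bigD1 w) //= tc_tw eqxx mulr1 big1 ?addr0 // => w' /andP[_ /negPf ww'];
    rewrite tc_tw ww' mulr0.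
rewrite big1 // => w' /eqP wa; rewrite tc_tw; case: eqP => [E2|_]; last by rewrite mulr0.
by rewrite -E2 in ne.
Qed.

(** Any word of the content serves once corrected by its sign, see [spi_tw]. If there is none, or if
    the content is invalid, the value is 0. *)
Definition mS n a : psym k n X :=
  if [pick w : {ffun 'I_n -> 'I_N} | content w == a] is Some w
  then wsgn k (qS E) w *: spi n X (tw E w) else 0.

Lemma spi_tw n (w : {ffun 'I_n -> 'I_N}) :
  spi n X (tw E w) = wsgn k (qS E) w *: mS n (content w).
Proof.
rewrite /mS; case: (wsgn_pick n (content w)) => [[w' -> w'w] | [_]]; last by rewrite degc_content eqxx.
have [s wE] := content_perm (esym w'w).
have [v | nv] := boolP (validc (qS E) (content w)); last first.
  have [s0 [sw i1]] := invalid_swap qSs nv.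
  rewrite /wsgn (negPf nv) scale0r; apply: eq_oppr_0.
  by rewrite -{1}(spi_tact s0) tact_tw sw i1 expr1 scaleN1r lfunN.
rewrite -(spi_tact s (tw E w')) tact_tw lfunZ !scalerA -wE -[LHS]scale1r; congr (_ *: _).
rewrite {1}wE (wsgn_wact k _ _ qSs) -(mulrA _ (wsgn k _ w') (wsgn k _ w')) wsgn_sq w'w v mulr1.
by rewrite -signr_addb addbb.
Qed.

Lemma cS_mS n a a' : cS n a (mS n a') =
  ((a == a') && (validc (qS E) a' && (degc a' == n)))%:R.
Proof.
rewrite /mS; case: (wsgn_pick n a') => [[w -> wa] | [-> /negPf ->]]; last by rewrite lfun0 !andbF.
rewrite lfunZ cS_spi lamS_tw wa eq_sym; case: eqP => [_|_]; last by rewrite scaler0.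
by rewrite -[_ *: _]/(_ * _) wsgn_sq wa -wa degc_content eqxx andbT.
Qed.

Lemma mS_expand n M (x : psym k n X) : (n <= M)%N ->
  x = \sum_(f : fct N M) (cS n (ctn f) x : k) *: mS n (ctn f).
Proof.
move=> nM; have [z <-] := spi_surj x.
rewrite {1}(tw_sum E z) lfun_sum (sum_by_content _ nM); apply: eq_bigr => f _.
rewrite cS_spi lamSE scaler_suml; apply: eq_bigr => w /eqP wf.
by rewrite lfunZ spi_tw wf scalerA mulrC.
Qed.

Lemma mS0 n a : ~~ (validc (qS E) a && (degc a == n)) -> mS n a = 0.
Proof.
rewrite /mS; case: (wsgn_pick n a) => [[w -> wa] | [-> _] //].
by rewrite -wa degc_content eqxx andbT /wsgn => /negPf ->; rewrite scale0r.
Qed.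

(** For an odd letter the sum over the orbit is a divided power for the product of A, whence the
    binomials in [mA_mul]. *)
Definition avec n b : tpow n X :=
  \sum_(w : {ffun 'I_n -> 'I_N} | content w == b) wsgn k (qA E) w *: tw E w.

Lemma avec_alt n b : avec n b \in altsub n X.
Proof.
apply/mem_altsub => s; rewrite /avec lfun_sum scaler_sumr.
rewrite [RHS](reindex_inj (can_inj (wactK s))) /=.
apply: eq_big => [w | w _]; first by rewrite content_wact.
rewrite lfunZ tact_tw !scalerA (wsgn_wact k s w qAs) inv_qA; congr (_ *: _).
by rewrite !mulrA -signr_addb addbb mul1r mulrC.
Qed.

Definition mA n b : palt k n X := apr n X (avec n b).

Lemma ain_mA n b : ain n X (mA n b) = avec n b.
Proof. exact/alt_prK/avec_alt. Qed.

Lemma tc_avec n b (w : {ffun 'I_n -> 'I_N}) :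
  tc E w (avec n b) = if content w == b then wsgn k (qA E) w else 0.
Proof.
rewrite lfun_sum; case: eqP => [<-|ne].
  rewrite (bigD1 w) //= lfunZ tc_tw eqxx big1 => [|w' /andP[_ /negPf ww']].
    by rewrite addr0 -[_ *: _]/(_ * _) mulr1.
  by rewrite lfunZ tc_tw eq_sym ww' scaler0.
rewrite big1 // => w' /eqP wa; rewrite lfunZ tc_tw; case: eqP => [E2|_]; last by rewrite scaler0.
by rewrite E2 in ne.
Qed.

(** Coefficient at one chosen word; by [tc_ain] it determines the coefficients at all words of the
    content. *)
Definition cA n b : 'Hom(palt k n X, k^o) :=
  if [pick w : {ffun 'I_n -> 'I_N} | content w == b] is Some w
  then wsgn k (qA E) w *: (tc E w \o ain n X)%VF else 0.

Lemma tc_ain n (w : {ffun 'I_n -> 'I_N}) y :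
  tc E w (ain n X y) = wsgn k (qA E) w * (cA n (content w) y : k).
Proof.
rewrite /cA; case: (wsgn_pick n (content w)) => [[w' -> w'w] | [_]]; last by rewrite degc_content eqxx.
have flip s (u : {ffun 'I_n -> 'I_N}) : (tc E (wact s u) (ain n X y) : k) =
    (-1) ^+ inv s (fun x y => qA E (u x) (u y)) * (tc E u (ain n X y) : k).
  have := tc_tact s u (ain n X y); rewrite alt_in lfunZ => h.
  rewrite inv_qA -mulrA -h -[_ *: _]/(_ * _) mulrA -signr_addb addbb mul1r //.
have [s wE] := content_perm (esym w'w).
rewrite scale_lfunE comp_lfunE -[_ *: _]/(_ * _).
have [v | nv] := boolP (validc (qA E) (content w)); last first.
  have [s0 [sw i1]] := invalid_swap qAs nv.
  rewrite [X in X * _]/wsgn (negPf nv) mul0r; apply: eq_oppr_0.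
  by rewrite -{1}sw flip i1 expr1 mulN1r.
rewrite {1}wE flip {1}wE (wsgn_wact k _ _ qAs) -!mulrA; congr (_ * _).
by rewrite mulrA wsgn_sq w'w v mul1r.
Qed.

Lemma cA_mA n b b' : cA n b (mA n b') =
  ((b == b') && (validc (qA E) b' && (degc b' == n)))%:R.
Proof.
rewrite /cA; case: (wsgn_pick n b) => [[w -> wb] | [-> db]]; last first.
  by rewrite zero_lfunE; case: eqP => //= <-; rewrite (negPf db) andbF.
rewrite scale_lfunE comp_lfunE ain_mA tc_avec wb; case: eqP => [<-|_]; last by rewrite scaler0.
by rewrite -[_ *: _]/(_ * _) wsgn_sq wb -wb degc_content eqxx andbT.
Qed.

Lemma mA_expand n M (y : palt k n X) : (n <= M)%N ->
  y = \sum_(f : fct N M) (cA n (ctn f) y : k) *: mA n (ctn f).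
Proof.
move=> nM; apply: (@ssub_in_inj _ _ (altsub n X)); apply: (tc_inj (E := E)) => w.
rewrite !lfun_sum; have [f fE] : exists f : fct N M, ctn f = content w.
  by apply: ctn_surj; rewrite degc_content.
rewrite (bigD1 f) //= big1 => [|g gf]; last first.
  rewrite !lfunZ ain_mA tc_avec -fE ifN ?scaler0 //.
  by apply: contra gf => /eqP/ctn_inj ->.
by rewrite !lfunZ ain_mA tc_avec fE eqxx addr0 tc_ain mulrC.
Qed.

Lemma mA0 n b : ~~ (validc (qA E) b && (degc b == n)) -> mA n b = 0.
Proof.
move=> h; apply: (@ssub_in_inj _ _ (altsub n X)); rewrite ain_mA lfun0 /avec big1 // => w /eqP wb.
move: h; rewrite -wb degc_content eqxx andbT /wsgn => /negPf ->; exact: scale0r.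
Qed.

(* [mon n (a, b)] is the product of the divided-power type monomial with content *)
(* [a] in S and the one with content [b] in A, in the summand [i = degc b].       *)
Definition mon n m : Omega k n X :=
  \sum_(i : 'I_n.+1) om i (tens (mS (n - i) m.1) (mA i m.2)).

Definition okm n m : bool :=
  [&& validc (qS E) m.1, validc (qA E) m.2 & (degc m.1 + degc m.2 == n)%N].

Lemma okmP n a b : okm n (a, b) -> [/\ validc (qS E) a, validc (qA E) b & (degc a + degc b = n)%N].
Proof. by case/and3P => ? ? /eqP. Qed.

Lemma om_mon n (i : 'I_n.+1) a b :
  om i (tens (mS (n - i) a) (mA i b)) =
  if (degc b == i) && (degc a == n - i)%N then mon n (a, b) else 0.
Proof.
case: ifP => [/andP[/eqP bi /eqP ai] | h]; last first.
  case/nandP: (negbT h) => ni; first by rewrite (@mA0 i b) ?negb_and ?ni ?orbT // tens0r lfun0.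
  by rewrite (@mS0 (n - i)%N a) ?negb_and ?ni ?orbT // tens0l lfun0.
rewrite /mon (sum_only (i := i)) // => j ji; rewrite (@mA0 j b) ?tens0r ?lfun0 //.
by rewrite bi negb_and (inj_eq val_inj) eq_sym ji orbT.
Qed.

Lemma mon_om n a b (i : 'I_n.+1) : degc b = i -> mon n (a, b) = om i (tens (mS (n - i) a) (mA i b)).
Proof.
move=> bi; rewrite /mon (sum_only (i := i)) // => j ji; rewrite (@mA0 j b) ?tens0r ?lfun0 //.
by rewrite bi negb_and (inj_eq val_inj) eq_sym ji orbT.
Qed.

Lemma mon0 n m : ~~ okm n m -> mon n m = 0.
Proof.
case: m => a b h; rewrite /mon big1 // => i _.
have [/andP[vb /eqP bi] | /mA0 ->] := boolP (validc (qA E) b && (degc b == i)); last by rewrite tens0r lfun0.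
rewrite mS0 ?tens0l ?lfun0 //; apply: contra h => /= /andP[va /eqP ai].
by rewrite /okm /= va vb ai bi subnK ?leq_ord // eqxx.
Qed.

Definition co n m : 'Hom(Omega k n X, k^o) :=
  (\sum_(i : 'I_n.+1) (tlin (fun (x : psym k (n - i) X) (y : palt k i X) =>
     (cS (n - i) m.1 x * cA i m.2 y : k^o)) \o opr X i))%VF.

Lemma co_om n m (i : 'I_n.+1) x y :
  co n m (om i (tens x y)) = (cS (n - i) m.1 x : k) * (cA i m.2 y : k).
Proof.
rewrite sum_lfunE (sum_only (i := i)) => [|j ji].
  rewrite comp_lfunE om_id tlinE // => [z c u v | z c u v]; rewrite lfunPl.
    by rewrite -[_ *: _ + _]/((_ * _) + _) mulrDl -mulrA.
  by rewrite -[_ *: _ + _]/((_ * _) + _) mulrDr mulrCA.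
by rewrite comp_lfunE om_neq // lfun0.
Qed.

Lemma co_mon n m m' : co n m (mon n m') = ((m == m') && okm n m')%:R.
Proof.
case: m m' => [a b] [a' b']; have [ok|nok] := boolP (okm n _); last by rewrite mon0 // lfun0 andbF.
have [va vb ab] := okmP ok; rewrite [_ && true]andbT.
have bn : (degc b' < n.+1)%N by rewrite ltnS -ab leq_addl.
rewrite (@mon_om n a' b' (Ordinal bn)) // co_om cS_mS cA_mA va vb.
have -> : degc a' == (n - Ordinal bn)%N by rewrite eqn_leq -[(n - Ordinal bn)%N]/(n - degc b')%N -ab addnK leqnn.
rewrite [degc b' == _]eqxx !andbT.
by rewrite -natrM mulnb xpair_eqE.
Qed.

Lemma om_tens_ext n (Y : vectType k) (f g : 'Hom(sspace (Omega k n X), Y)) :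
  (forall i x y, f (om i (tens x y)) = g (om i (tens x y))) -> f = g.
Proof.
move=> fg; apply: om_ext => i t.
have E2 : (f \o om i)%VF = (g \o om i)%VF.
  by apply: stens_ext => u v; rewrite !comp_lfunE fg.
by have := congr1 (fun h : 'Hom(_, _) => h t) E2; rewrite !comp_lfunE.
Qed.

(** Prescribes the values on monomials. The coordinates [co] vanish outside [okm], so only valid
    pairs of total degree [n] count. *)
Definition monlin n (Y : vectType k) (g : ct * ct -> Y) : 'Hom(Omega k n X, Y) :=
  linfun (fun x => \sum_(f : fct N n * fct N n)
    (co n (ctn f.1, ctn f.2) x : k) *: g (ctn f.1, ctn f.2)).

Lemma monlin_sum n (Y : vectType k) (g : ct * ct -> Y) x : monlin n g x =
  \sum_(f : fct N n * fct N n) (co n (ctn f.1, ctn f.2) x : k) *: g (ctn f.1, ctn f.2).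
Proof. by rewrite linfun_linear //; exact: lincomb_linear. Qed.

Lemma comp_monlin n (Y Z : vectType k) (f : 'Hom(Y, Z)) (g : ct * ct -> Y) x :
  f (monlin n g x) = monlin n (fun m => f (g m)) x.
Proof. by rewrite !monlin_sum lfun_sum; apply: eq_bigr => h _; rewrite lfunZ. Qed.

Lemma monlin_mon n (x : Omega k n X) : monlin n (Y := sspace (Omega k n X)) (mon n) x = x.
Proof.
rewrite -[RHS]id_lfunE; congr (fun_of_lfun _ x).
apply: om_tens_ext => i u v; rewrite [RHS]id_lfunE; apply/esym.
rewrite (mS_expand u (leq_subr i n)) tens_suml !lfun_sum; apply: eq_bigr => f _.
rewrite tensZl !lfunZ; congr (_ *: _).
rewrite (mA_expand v (leq_ord i)) tens_sumr !lfun_sum; apply: eq_bigr => g _.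
rewrite tensZr !lfunZ om_mon; congr (_ *: _); case: ifP => [_|_]; last by rewrite lfun0.
rewrite monlin_sum.
rewrite (sum_only (i := (f, g))) => [|h hne].
  rewrite co_mon eqxx; have [ok|nok] := boolP (okm n _); first by rewrite scale1r.
  by rewrite mon0 // scaler0.
rewrite co_mon xpair_eqE; case: eqP => [/ctn_inj h1 | _]; last by rewrite scale0r.
case: eqP => [/ctn_inj h2 | _]; last by rewrite scale0r.
by case: h hne h1 h2 => h1 h2 /= hne e1 e2; rewrite e1 e2 eqxx in hne.
Qed.

Lemma omega_ext n (Y : vectType k) (f g : 'Hom(sspace (Omega k n X), Y)) :
  (forall m, okm n m -> f (mon n m) = g (mon n m)) -> f = g.
Proof.
move=> fg; apply/lfunP => x; rewrite -(monlin_mon x) !comp_monlin !monlin_sum.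
apply: eq_bigr => h _; congr (_ *: _).
by have [/fg //|/mon0 ->] := boolP (okm n (ctn h.1, ctn h.2)); rewrite !lfun0.
Qed.

Lemma monlinE n (Y : vectType k) (g : ct * ct -> Y) m : okm n m -> monlin n g (mon n m) = g m.
Proof.
move=> ok; rewrite monlin_sum.
case: m ok => a b ok; have [_ _ ab] := okmP ok.
have [|f fE] := @ctn_surj _ n a; first by rewrite -ab leq_addr.
have [|f' fE'] := @ctn_surj _ n b; first by rewrite -ab leq_addl.
rewrite (sum_only (i := (f, f'))) => [|h hne].
  by rewrite -[(f, f').1]/f -[(f, f').2]/f' fE fE' co_mon eqxx ok scale1r.
rewrite co_mon xpair_eqE -fE -fE'; case: eqP => [/ctn_inj h1 | _]; last by rewrite scale0r.
case: eqP => [/ctn_inj h2 | _]; last by rewrite scale0r.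
by case: h hne h1 h2 => h1 h2 /= hne e1 e2; rewrite e1 e2 eqxx in hne.
Qed.

Definition parc a : bool := \big[addb/false]_i (bpar E i && odd (a i)).

Lemma parc_content n (w : {ffun 'I_n -> 'I_N}) :
  \big[addb/false]_x bpar E (w x) = parc (content w).
Proof.
have oddb_sum (I : finType) (F : I -> nat) : odd (\sum_i F i) = \big[addb/false]_i odd (F i).
  by apply: (big_morph odd oddD).
transitivity (odd (\sum_x bpar E (w x))).
  by rewrite oddb_sum; apply: eq_bigr => x _; rewrite oddb.
rewrite (sum_content w (fun i => bpar E i : nat)) oddb_sum; apply: eq_bigr => i _.
by rewrite oddM oddb andbC.
Qed.

Lemma mS_par n a : mS n a \in spart (psym k n X) (parc a).
Proof.
rewrite /mS; case: (wsgn_pick n a) => [[w -> wa]|[-> _]]; last exact: mem0v.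
apply: memvZ; apply: (shom_even (spi_even n X)); rewrite -wa -parc_content; exact: tw_spart.
Qed.

Lemma mA_par n b : mA n b \in spart (palt k n X) (parc b).
Proof.
rewrite spart_ssub -[ssub_in _ _]/(ain n X (mA n b)) ain_mA; apply: memv_suml => w /eqP wb.
by apply: memvZ; rewrite -wb -parc_content; exact: tw_spart.
Qed.

Lemma mon_par n a b : mon n (a, b) \in spart (Omega k n X) (parc a (+) parc b).
Proof.
apply: memv_suml => i _; apply: (shom_even (om_even X i)); apply: mem_tens.
  exact: mS_par.
exact: mA_par.
Qed.

Lemma parcD a b : parc (addc a b) = parc a (+) parc b.
Proof.
rewrite /parc -big_split; apply: eq_bigr => i _; rewrite ffunE oddD.
by case: (bpar _ _).
Qed.

End Monomials.

Arguments lamS {k X} E n a.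
Arguments cS {k X} E n a.
Arguments cA {k X} E n b.
Arguments mS {k X} E n a.
Arguments mA {k X} E n b.
Arguments avec {k X} E n b.
Arguments mon {k X} E n m.
Arguments okm {k X} E n m.
Arguments co {k X} E n m.
Arguments monlin {k X} E n {Y} g.
Arguments parc {k X} E a.

(** * Counting Young cosets; products of monomials *)

Section YoungCosets.

Variables (m n l : nat) (e : (m + n)%N = l).

(* The right coset of [r] is determined by the image of the first block. *)
Definition jset (r : 'S_l) : {set 'I_l} := [set z | ((r^-1)%g z < m)%N].

Lemma jset_coset r r' : (jset r == jset r') = (r \in (young m l :* r')%g).
Proof.
rewrite mem_rcoset; apply/eqP/idP => [jj | ].
  rewrite inE; apply/forallP => i; rewrite permM.
  by have := congr1 (fun J : {set _} => r i \in J) jj; rewrite !inE permK => ->.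
rewrite inE => /forallP h; apply/setP => z; rewrite !inE.
by have := eqP (h ((r^-1)%g z)); rewrite permM permKV => ->.
Qed.

Lemma card_jset r : #|jset r| = m.
Proof.
rewrite -sum1dep_card (reindex_inj (@perm_inj _ r)) /=.
rewrite (eq_bigl (fun z : 'I_l => (z < m)%N)) => [|z]; last by rewrite permK.
rewrite big_mkcond (big_pos e) (eq_bigr (fun=> 1%N)) => [|a _]; last by rewrite posl_val ltn_ord.
rewrite -[RHS]addn0; apply: (f_equal2 addn); first by rewrite sum_nat_const card_ord muln1.
by rewrite big1 // => b _; rewrite posr_val ltnNge leq_addr.
Qed.

Lemma jset_surj (J : {set 'I_l}) : #|J| = m -> exists r, jset r = J.
Proof.
move=> Jm; have [|s sE] := @perm_of_count _ l (fun z => (z < m)%N) (fun z => z \in J).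
  have c0 : #|[pred z : 'I_l | (z < m)%N]| = m.
    by rewrite -[RHS](card_jset 1%g); apply: eq_card => z; rewrite !inE invg1 perm1.
  have c1 : #|[pred z : 'I_l | (z < m)%N == true]| = #|[pred z | (z \in J) == true]|.
    transitivity m; first by rewrite -{2}c0; apply: eq_card => z; rewrite !inE eqb_id.
    by rewrite -Jm; apply: eq_card => z; rewrite !inE eqb_id.
  case=> //; apply/eqP; rewrite -(eqn_add2l #|[pred z : 'I_l | (z < m)%N == true]|) {2}c1.
  apply/eqP; transitivity l.
    rewrite -[RHS](card_ord l) -(cardC [pred z : 'I_l | (z < m)%N == true]); congr addn.
    by apply: eq_card => z; rewrite !inE; case: (_ < _)%N.
  rewrite -[LHS](card_ord l) -(cardC [pred z | (z \in J) == true]); congr addn.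
  by apply: eq_card => z; rewrite !inE; case: (_ \in _).
by exists (s^-1)%g; apply/setP => z; rewrite inE invgK -sE.
Qed.

(** Through [jset] the cosets correspond to the subsets with [m] elements. *)
Lemma count_cosets (P : pred {set 'I_l}) :
  (\sum_(C in rcosets (young m l) [set: 'S_l]) P (jset (repr C)) =
   #|[set J : {set 'I_l} | (#|J| == m) && P J]|)%N.
Proof.
pose G := Group (group_set_young m l).
have rC r : repr (young m l :* r)%g \in (young m l :* r)%g by exact: (mem_repr_rcoset G).
have jr r : jset (repr (young m l :* r)%g) = jset r by apply/eqP; rewrite jset_coset; exact: rC.
pose S := [set C in rcosets (young m l) [set: 'S_l] | P (jset (repr C))].
transitivity #|S|.
  by rewrite -sum1dep_card big_mkcondr /=; apply: eq_bigr => C _; case: (P _).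
have inj : {in S &, injective (fun C => jset (repr C))}.
  move=> C C'; rewrite !inE => /andP[/rcosetsP[r _ ->] _] /andP[/rcosetsP[r' _ ->] _].
  rewrite !jr => /eqP; rewrite jset_coset => h; exact/(rcoset_eqP (G := G)).
rewrite -(card_in_imset inj); congr #|pred_of_set _|; apply/setP => J.
apply/imsetP/idP => [[C] | ].
  by rewrite !inE => /andP[_ PC] ->; rewrite PC andbT card_jset.
rewrite inE => /andP[/eqP /jset_surj[r <-] PJ]; exists (young m l :* r)%g; last by rewrite jr.
by rewrite inE jr PJ andbT; apply/rcosetsP; exists r; rewrite ?inE.
Qed.

End YoungCosets.

Section CountWords.

Variables (N m n l : nat) (e : (m + n)%N = l) (x : {ffun 'I_l -> 'I_N}).
Notation ct := {ffun 'I_N -> nat}.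
Implicit Types b : ct.

Let F i := [set z | x z == i].

Lemma card_content i : content x i = #|F i|.
Proof. by rewrite ffunE -sum1_card [RHS]big_mkcond /=; apply: eq_bigr => z _; rewrite inE; case: eqP. Qed.

Lemma content_jset r b : (content (wl e (wact (r^-1)%g x)) == b) =
  [forall i, #|jset m r :&: F i| == b i].
Proof.
have E i : content (wl e (wact (r^-1)%g x)) i = #|jset m r :&: F i|.
  rewrite ffunE -sum1_card [RHS]big_mkcond (reindex_inj (@perm_inj _ r)) [RHS](big_pos e).
  rewrite [X in _ = (_ + X)%N]big1 => [|c _]; last by rewrite !inE permK posr_val ltnNge leq_addr.
  rewrite addn0; apply: eq_bigr => a _.
  by rewrite !inE permK posl_val ltn_ord !ffunE invgK; case: eqP.
apply/eqP/forallP => [<- i | h]; first by rewrite E.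
by apply/ffunP => i; rewrite E; exact/eqP.
Qed.

Lemma card_by_fiber (J : {set 'I_l}) : (#|J| = \sum_i #|J :&: F i|)%N.
Proof.
rewrite -sum1_card (partition_big x predT) //=; apply: eq_bigr => i _.
by rewrite -sum1_card; apply: eq_bigl => z; rewrite !inE.
Qed.

(** Such a subset is an independent choice of [b i] positions in each fibre of [x]. *)
Lemma count_subwords b : degc b = m ->
  #|[set J : {set 'I_l} | (#|J| == m) && [forall i, #|J :&: F i| == b i]]| =
  (\prod_i 'C(content x i, b i))%N.
Proof.
move=> bm; pose fam := family (fun i => mem [set A : {set 'I_l} | (A \subset F i) && (#|A| == b i)]).
pose h (J : {set 'I_l}) := [ffun i => J :&: F i].
have hinj : injective h.
  move=> J J' /ffunP JJ'; apply/setP => z; have := JJ' (x z); rewrite !ffunE => /setP/(_ z).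
  by rewrite !inE eqxx !andbT.
rewrite -(card_imset _ hinj); transitivity #|fam|; last first.
  rewrite card_family foldrE big_map big_enum; apply: eq_bigr => i _ /=.
  by rewrite card_content -cards_draws.
apply: eq_card => f; apply/imsetP/familyP => [[J] | ff].
  rewrite inE => /andP[_ /forallP Jb] -> i; rewrite ffunE inE /= subsetIr; exact: Jb.
pose J := [set z | z \in f (x z)].
have JF i : J :&: F i = f i.
  have := ff i; rewrite inE /= => /andP[/subsetP fi _]; apply/setP => z; rewrite !inE.
  apply/andP/idP => [[zf /eqP <-] // | zf]; have := fi z zf; rewrite inE => /eqP xz.
  by rewrite xz.
exists J; last by apply/ffunP => i; rewrite ffunE JF.
have fb i : #|f i| = b i by have := ff i; rewrite inE /= => /andP[_ /eqP].
rewrite inE card_by_fiber -bm; apply/andP; split.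
  by apply/eqP; apply: eq_bigr => i _; rewrite JF fb.
by apply/forallP => i; rewrite JF fb.
Qed.

Lemma count_coset_words b : degc b = m ->
  (\sum_(C in rcosets (young m l) [set: 'S_l])
    (content (wl e (wact (repr C)^-1%g x)) == b) = \prod_i 'C(content x i, b i))%N.
Proof.
move=> bm; rewrite -(count_subwords bm) -(count_cosets e (fun J => [forall i, #|J :&: F i| == b i])).
by apply: eq_bigr => C _; rewrite content_jset.
Qed.

End CountWords.

Section MonomialProduct.

Variables (k : fieldType) (k2 : 2%:R != 0 :> k) (X : superspace k) (E : hbase X).
Local Notation N := (bdim E).
Local Notation ct := {ffun 'I_N -> nat}.
Implicit Types (a b : ct).

Definition bindom b b' : nat := (\prod_i 'C(b i + b' i, b i))%N.

Lemma mS_tw n (w : {ffun 'I_n -> 'I_N}) : validc (qS E) (content w) ->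
  mS E n (content w) = wsgn k (qS E) w *: spi n X (tw E w).
Proof. by move=> v; rewrite (spi_tw k2) scalerA wsgn_sq v scale1r. Qed.

Section Products.
Variables (m n l : nat) (e : (m + n)%N = l).

Lemma mS_mul a a' : validc (qS E) a -> validc (qS E) a' -> degc a = m -> degc a' = n ->
  sym_prod e X (tens (mS E m a) (mS E n a')) =
  ((-1) ^+ bform (qS E) a a' : k) *: mS E l (addc a a').
Proof.
move=> va va' /content_exists[w wa] /content_exists[w' wa']; rewrite -{}wa in va *; rewrite -{}wa' in va' *.
rewrite !mS_tw // tensZl tensZr !lfunZ sym_prodE tconc_tw (spi_tw k2) content_wcat !scalerA.
have [v | nv] := boolP (validc (qS E) (addc (content w) (content w'))); last first.
  by rewrite mS0 ?(negPf nv) // !scaler0.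
rewrite (wsgn_wcat k e v) !mulrA; congr (_ *: _).
by rewrite -(mulrA (wsgn k (qS E) w * wsgn k (qS E) w')) mulrACA !wsgn_sq va va' !mul1r.
Qed.

(** Compare coefficients at a word [x]. A coset contributes when the letters it puts in the first
    block have content [b]; every contribution carries the same sign, and there are [bindom b b'] of
    them. *)
Lemma mA_mul b b' : degc b = m -> degc b' = n ->
  alt_prod e X (tens (mA E m b) (mA E n b')) =
  ((-1) ^+ bform (qA E) b b' * (bindom b b')%:R : k) *: mA E l (addc b b').
Proof.
move=> bm bn; apply: (@ssub_in_inj _ _ (altsub l X)); apply: (tc_inj (E := E)) => x.
rewrite !lfunZ ain_mA tc_avec.
have [v | nv] := boolP (validc (qA E) (content x)); last first.
  have w0 : wsgn k (qA E) x = 0 by rewrite /wsgn (negPf nv).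
  by rewrite (tc_ain k2) w0 mul0r if_same scaler0.
have term (C : {set 'S_l}) : tc E x (((-1) ^+ (repr C : 'S_l) : k) *: tact X (repr C)
      (tconc e (avec E m b) (avec E n b'))) =
    if content x == addc b b' then
      wsgn k (qA E) x * (-1) ^+ bform (qA E) b b' *
        (content (wl e (wact (repr C)^-1%g x)) == b)%:R
    else 0.
  move: (repr C) => r; set u := wact (r^-1)%g x.
  have xu : x = wact r u by rewrite /u -wactM mulVg wact1.
  rewrite lfunZ {1}xu tc_tact tc_tconc !tc_avec.
  have uc : content x = addc (content (wl e u)) (content (wr e u)).
    by rewrite -(content_wcat e) (wcat_split e u); exact/esym/content_wact.
  have [cl | ncl] := eqVneq (content (wl e u)) b; last first.
    by rewrite mul0r !mulr0 scaler0 if_same.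
  rewrite uc cl; have [cr | ncr] := eqVneq (content (wr e u)) b'; last first.
    rewrite !mulr0 scaler0 ifN //; apply: contra ncr => /eqP/ffunP h; apply/eqP/ffunP => i.
    by have := h i; rewrite !ffunE => /addnI.
  rewrite cr eqxx mulr1 -[_ *: _]/(_ * _) mulrA -inv_qA.
  rewrite xu (wsgn_wact k r u (qA_sym E)) -mulrA; congr (_ * _).
  rewrite -[in RHS](wcat_split e u) (wsgn_wcat k e); last by rewrite -uc.
  rewrite cl cr.
  by rewrite -mulrA -signr_odd -signr_addb addbb mulr1.
rewrite alt_prodE !ain_mA /antisym sum_lfunE lfun_sum.
rewrite (eq_bigr _ (fun C _ => etrans (congr1 _ (scale_lfunE _ _ _)) (term C))).
case: eqP => [xb | _]; last by rewrite big1 // scaler0.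
rewrite -mulr_sumr -natr_sum (count_coset_words e x bm) -[RHS]/(_ * _).
have -> : (\prod_i 'C(content x i, b i))%N = bindom b b' by apply: eq_bigr => i _; rewrite xb ffunE.
by rewrite [RHS]mulrC mulrA.
Qed.

End Products.

Lemma mon_mul m n l (e : (m + n)%N = l) a b a' b' : okm E m (a, b) -> okm E n (a', b') ->
  omul e (mon E m (a, b)) (mon E n (a', b')) =
  ((-1) ^+ (odd (bform (qS E) a a') (+) (parc E b && parc E a') (+) odd (bform (qA E) b b'))
    * (bindom b b')%:R : k) *: mon E l (addc a a', addc b b').
Proof.
move=> /okmP[va vb ab] /okmP[va' vb' ab'].
have bm : (degc b < m.+1)%N by rewrite ltnS -ab leq_addl.
have bn : (degc b' < n.+1)%N by rewrite ltnS -ab' leq_addl.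
have bl : (degc b + degc b' < l.+1)%N by rewrite ltnS -e -ab -ab' leq_add ?leq_addl.
pose i := Ordinal bm; pose j := Ordinal bn; pose r := Ordinal bl.
have er : (i + j)%N = r by [].
rewrite (@mon_om _ _ E m a b i) // (@mon_om _ _ E n a' b' j) // (om_mul e er).
have ai : degc a = (m - i)%N by rewrite -[(m - i)%N]/(m - degc b)%N -ab addnK.
have aj : degc a' = (n - j)%N by rewrite -[(n - j)%N]/(n - degc b')%N -ab' addnK.
rewrite (@stens_mulE _ _ _ _ _ _ _ _ _ (parc E b) (parc E a')); last 2 first.
- exact: mA_par.
- exact: mS_par.
rewrite (mS_mul (atens_eq e er) va va' ai aj) (mA_mul er) // tensZl tensZr !scalerA lfunZ.
rewrite (@mon_om _ _ E l _ _ r) ?degcD //; congr (_ *: _).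
rewrite !signr_addb !signr_odd.
move: ((-1) ^+ bform (qS E) a a') ((-1) ^+ (_ && _)) ((-1) ^+ bform (qA E) b b') (_%:R) => s1 s2 s3 c.
by ring.
Qed.

End MonomialProduct.

(** * The differential on monomials and the Leibniz rule *)

Section DerivationFormula.

Variables (k : fieldType) (k2 : 2%:R != 0 :> k) (X : superspace k) (E : hbase X).
Local Notation N := (bdim E).
Local Notation ct := {ffun 'I_N -> nat}.
Implicit Types (a b : ct).

Notation eps i := (singc i 1).
Notation BS a b := (odd (bform (qS E) a b)).
Notation BA a b := (odd (bform (qA E) a b)).

Definition subc a i : ct := [ffun j => (a j - (j == i))%N].

Lemma subcK a i : (0 < a i)%N -> addc (subc a i) (eps i) = a.
Proof.
move=> ai; apply/ffunP => j; rewrite !ffunE; case: eqP => [->|_]; first by rewrite subnK.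
by rewrite subn0 addn0.
Qed.

Lemma addcK a i : subc (addc a (eps i)) i = a.
Proof. by apply/ffunP => j; rewrite !ffunE; case: eqP => _; rewrite /= addnK. Qed.

Lemma content_sing (w : {ffun 'I_1 -> 'I_N}) : content w = eps (w ord0).
Proof. by apply/ffunP => j; rewrite !ffunE big_ord1 eq_sym; case: eqP. Qed.

Lemma bform_eps_self q (i : 'I_N) : bform q (eps i) (eps i) = 0%N.
Proof.
rewrite /bform big1 // => j _; rewrite big1 // => j' jj'; rewrite !ffunE.
case: eqP => [E1|_]; last by rewrite muln0.
case: eqP => [E2|_]; last by rewrite muln0.
by rewrite E1 E2 ltnn in jj'.
Qed.

Lemma degc_subc a i : (0 < a i)%N -> degc a = (degc (subc a i)).+1.
Proof. by move=> ai; rewrite -{1}(subcK ai) degcD degc_sing addn1. Qed.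

Lemma bindom_eps i b : bindom (eps i) b = (b i).+1.
Proof.
rewrite /bindom (bigD1 i) //= !ffunE eqxx add1n bin1 big1 ?muln1 // => j ji.
by rewrite !ffunE (negPf ji) add0n bin0.
Qed.

Lemma wsgn1 q (w : {ffun 'I_1 -> 'I_N}) : wsgn k q w = 1.
Proof.
rewrite /wsgn content_sing /weps big1 => [|[c d] /=]; last by rewrite !ord1.
by rewrite ifT //; apply/forallP => j; rewrite ffunE; case: eqP; rewrite implybT.
Qed.

Lemma alt1_tw (w : {ffun 'I_1 -> 'I_N}) : alt1 X (vec1 X (tw E w)) = mA E 1 (eps (w ord0)).
Proof.
apply: (@ssub_in_inj _ _ (altsub 1 X)); rewrite ain_mA alt1_vec1.
apply: (tc_inj (E := E)) => x; rewrite tc_avec tc_tw content_sing wsgn1.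
have [-> | xw] := eqVneq x w; first by rewrite eqxx.
case: eqP => // h; case/eqP: xw; apply/ffunP => c; rewrite (ord1 c).
have := congr1 (fun f : ct => f (x ord0)) h; rewrite !ffunE eqxx.
by case: eqP.
Qed.

Lemma sum_letters (U : nmodType) n (w : {ffun 'I_n -> 'I_N}) (F : 'I_N -> U) :
  \sum_x F (w x) = \sum_i F i *+ content w i.
Proof.
rewrite (partition_big w predT) //=; apply: eq_bigr => i _.
rewrite (eq_bigr (fun=> F i)) => [|x /eqP -> //]; rewrite sumr_const card_content; congr (_ *+ _).
by apply: eq_card => x; rewrite !inE.
Qed.

Section Part.
Variables (m m' l l' : nat) (ea : (m + 1)%N = m') (eb : (1 + l)%N = l').

(** The term of position [c] depends only on the letter there. The letter [i] occurs [a i] times,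
    and multiplying it into the divided power of exponent [b i] produces the factor [b i + 1]. *)
Lemma dR_part_mon a b : validc (qS E) a -> degc a = m' -> degc b = l ->
  dR_part ea eb X (tens (mS E m' a) (mA E l b)) =
  \sum_i ((a i * (b i).+1)%:R * (-1) ^+ (BS (subc a i) (eps i) (+) BA (eps i) b) : k) *:
    tens (mS E m (subc a i)) (mA E l' (addc (eps i) b)).
Proof.
move=> va /content_exists[w wa] bl; rewrite -{}wa in va *.
rewrite mS_tw // tensZl lfunZ dR_partE scaler_sumr.
pose G i := ((-1) ^+ BS (subc (content w) i) (eps i) : k) *:
  tens (mS E m (subc (content w) i)) (alt_prod eb X (tens (mA E 1 (eps i)) (mA E l b))).
transitivity (\sum_c G (w c)).
  apply: eq_bigr => c _; set s := cutp ea c; set u := wact s w.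
  rewrite tact_tw lfunZ scalerA mulrC -(wsgn_wact k s w (qS_sym E)) -/u.
  have uE := wcat_split ea u.
  have ui : wr ea u ord0 = w c by rewrite ffunE -(wact_at s w c) /s (cutp_last ea c).
  have cE : content w = addc (content (wl ea u)) (eps (w c)).
    by rewrite -ui -content_sing -(content_wcat ea) uE content_wact.
  have lE : content (wl ea u) = subc (content w) (w c) by rewrite cE addcK.
  rewrite -{2}uE -tconc_tw dcut_tconc (spi_tw k2) tensZl scalerA /G alt1_tw ui lE; congr (_ *: _).
  rewrite -[in wsgn k _ u]uE wsgn_wcat; last by rewrite -(content_wcat ea) uE content_wact.
  rewrite wsgn1 mulr1 mulrAC wsgn_sq signr_odd content_sing ui lE -lE; rewrite cE in va.
  by rewrite (validcDl va) mul1r.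
rewrite (sum_letters w G); apply: eq_bigr => i _; rewrite /G.
rewrite (mA_mul k2 eb (degc_sing i 1) bl) tensZr scalerA -scaler_nat scalerA; congr (_ *: _).
rewrite bindom_eps signr_addb !signr_odd natrM.
move: ((-1) ^+ bform (qS E) _ _) ((-1) ^+ bform (qA E) _ _) ((b i).+1%:R) (_%:R) => s1 s2 c c'.
by ring.
Qed.

End Part.
Definition dsg i a b : bool := BS (subc a i) (eps i) (+) BA (eps i) b.

(* For valid [a] this is [a i]; the parity makes the formula for the differential *)
(* hold for all contents.                                                         *)
Definition red i a : nat := if bpar E i then nat_of_bool (odd (a i)) else a i.

Lemma red_valid i a : validc (qS E) a -> red i a = a i.
Proof.
move/forallP => /(_ i); rewrite /red /qS andbb; case: (bpar E i) => //=.
by case: (a i) => [|[|]].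
Qed.

Lemma red_gt0 i a : (0 < red i a)%N -> (0 < a i)%N.
Proof. by rewrite /red; case: ifP => // _; case: (a i). Qed.

Lemma red_ok n i a b : (0 < red i a)%N -> okm E n (subc a i, addc (eps i) b) -> okm E n (a, b).
Proof.
move=> ai /okmP[va vb ab]; have a0 := red_gt0 ai; apply/and3P; split=> /=.
- apply/forallP => j; have := forallP va j; rewrite !ffunE; case: eqP => [->|_]; last by rewrite subn0.
  rewrite /qS andbb; move: ai; rewrite /red; case: (bpar E i) => //=; case: (a i) => [|[|[|]]] //.
- exact: validcDr vb.
- by rewrite -ab degcD degc_sing (degc_subc a0) addSn addnS.
Qed.

Lemma dR_mon_ok n a b : okm E n (a, b) -> dR n X (mon E n (a, b)) =
  \sum_i ((red i a * (b i).+1)%:R * (-1) ^+ dsg i a b : k) *: mon E n (subc a i, addc (eps i) b).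
Proof.
move=> ok; have [va vb ab] := okmP ok.
have bn : (degc b < n.+1)%N by rewrite ltnS -ab leq_addl.
pose r := Ordinal bn; rewrite (@mon_om _ _ E n a b r) //.
have [rn | /next_ord[j er]] := eqVneq (r : nat) n.
  rewrite dR_om_last // big1 // => i _.
  have : degc a == 0%N by rewrite -(eqn_add2r (degc b)) ab add0n -[degc b]/(r : nat) rn.
  by rewrite degc_eq0 => /eqP ->; rewrite /red ffunE if_same mul0n mul0r scale0r.
rewrite (dR_om er) (dR_part_mon (dR_eq er) er va) //; last first.
  by rewrite -[(n - r)%N]/(n - degc b)%N -ab addnK.
rewrite lfun_sum; apply: eq_bigr => i _; rewrite lfunZ (red_valid i va) -/(dsg i a b); congr (_ *: _).
by rewrite (@mon_om _ _ E n _ _ j) // degcD degc_sing er.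
Qed.

(** For invalid pairs both sides vanish, by [red_ok]; later computations are spared the case
    distinction. *)
Lemma dR_mon n a b : dR n X (mon E n (a, b)) =
  \sum_i ((red i a * (b i).+1)%:R * (-1) ^+ dsg i a b : k) *: mon E n (subc a i, addc (eps i) b).
Proof.
have [/dR_mon_ok // | nok] := boolP (okm E n (a, b)).
rewrite mon0 // lfun0 big1 // => i _; have [r0 | r0] := posnP (red i a).
  by rewrite r0 mul0n mul0r scale0r.
by rewrite mon0 ?scaler0 //; apply: contra nok; apply: red_ok.
Qed.

Lemma mon_mul_deg m n l (e : (m + n)%N = l) a b a' b' :
    (degc a + degc b = m)%N -> (degc a' + degc b' = n)%N ->
  omul e (mon E m (a, b)) (mon E n (a', b')) =
  ((-1) ^+ (BS a a' (+) (parc E b && parc E a') (+) BA b b') * (bindom b b')%:R : k)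
    *: mon E l (addc a a', addc b b').
Proof.
move=> ab ab'; have [ok | nok] := boolP (okm E m (a, b)); last first.
  rewrite mon0 // -omullE lfun0 mon0 ?scaler0 //; apply: contra nok => /okmP[va vb _].
  by rewrite /okm /= (validcDl va) (validcDl vb) ab eqxx.
have [ok' | nok] := boolP (okm E n (a', b')); first exact: mon_mul.
rewrite [mon E n _]mon0 // -omulrE lfun0 mon0 ?scaler0 //; apply: contra nok => /okmP[va vb _].
by rewrite /okm /= (validcDr va) (validcDr vb) ab' eqxx.
Qed.

(** The sign of the Leibniz rule. It comes from the cohomological degree, since [dR] is even for the
    superspace grading. *)
Definition sgm n V : 'End(Omega k n V) := (\sum_(i : 'I_n.+1) ((-1) ^+ i : k) *: (om i \o opr V i))%VF.

Lemma sgm_om n V (i : 'I_n.+1) x : sgm n V (om i x) = ((-1) ^+ i : k) *: om i x.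
Proof.
rewrite /sgm sum_lfunE (sum_only (i := i)) => [|j ji].
  by rewrite scale_lfunE comp_lfunE om_id.
by rewrite scale_lfunE comp_lfunE om_neq // lfun0 scaler0.
Qed.

Lemma sgm_mon n a b : sgm n X (mon E n (a, b)) = ((-1) ^+ degc b : k) *: mon E n (a, b).
Proof.
have [ok | nok] := boolP (okm E n (a, b)); last by rewrite mon0 // lfun0 scaler0.
have [_ _ ab] := okmP ok; have bn : (degc b < n.+1)%N by rewrite ltnS -ab leq_addl.
by rewrite (@mon_om _ _ E n a b (Ordinal bn)) // sgm_om.
Qed.

Lemma bindom_epsl i b b' : (bindom (addc (eps i) b) b' * (b i).+1 = bindom b b' * (b i + b' i).+1)%N.
Proof.
rewrite /bindom (bigD1 i) //= [in RHS](bigD1 i) //= !ffunE eqxx !add1n addSn.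
rewrite mulnAC [RHS]mulnAC (eq_bigr (fun j => 'C(b j + b' j, b j))); last first.
  by move=> j ji; rewrite !ffunE (negPf ji).
by congr (_ * _)%N; rewrite [LHS]mulnC -mul_bin_diag mulnC.
Qed.

Lemma bindom_sym b b' : bindom b b' = bindom b' b.
Proof. by apply: eq_bigr => i _; rewrite addnC -bin_sub ?leq_addl // addnK. Qed.

Lemma bindom_epsr i b b' : (bindom b (addc (eps i) b') * (b' i).+1 = bindom b b' * (b i + b' i).+1)%N.
Proof. by rewrite bindom_sym bindom_epsl bindom_sym [(b' i + _)%N]addnC. Qed.

(** The first form counts the letters [j < i] of [a], the second those with [i < j]; letters equal
    to [i] are counted by neither. *)
Lemma odd_bform_sym q a i : (forall j j', q j j' = q j' j) ->
  odd (bform q (eps i) a) (+) odd (bform q a (eps i)) =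
  (\big[addb/false]_j (q i j && odd (a j))) (+) (q i i && odd (a i)).
Proof.
move=> qsym; have oddb_sum (I : finType) (P : pred I) (F : I -> nat) :
  odd (\sum_(i | P i) F i) = \big[addb/false]_(i | P i) odd (F i) by apply: (big_morph odd oddD).
have -> : odd (bform q (eps i) a) = \big[addb/false]_(j < N) ((j < i)%N && (q i j && odd (a j))).
  rewrite /bform (bigD1 i) //= [X in (_ + X)%N]big1 => [|j ji]; last first.
    by rewrite big1 // => j' _; rewrite ffunE (negPf ji) muln0.
  rewrite addn0 oddb_sum [LHS]big_mkcond; apply: eq_bigr => j _; case: (j < i)%N => //=.
  by rewrite ffunE eqxx muln1 oddM oddb.
have -> : odd (bform q a (eps i)) = \big[addb/false]_(j < N) ((i < j)%N && (q i j && odd (a j))).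
  rewrite /bform oddb_sum; apply: eq_bigr => j _; case: ltnP => ij /=.
    rewrite (bigD1 i) //= big1 => [|j' /andP[_ ji]]; last by rewrite ffunE (negPf ji) muln0.
    by rewrite addn0 ffunE eqxx muln1 oddM oddb qsym.
  by rewrite big1 // => j' jj; rewrite ffunE; case: eqP jj => [->|_]; rewrite ?muln0 // ltnNge ij.
rewrite -big_split (bigD1 i) //= ltnn /= [in RHS](bigD1 i) //= addbAC addbb !addFb.
apply: eq_bigr => j ji; case: (ltngtP j i) => [_|_|/val_inj E1] /=; rewrite ?addbF //.
by rewrite E1 eqxx in ji.
Qed.

Lemma BS_sym i a : BS (eps i) a (+) BS a (eps i) =
  bpar E i && (parc E a (+) odd (a i)).
Proof.
rewrite odd_bform_sym; last exact: qS_sym.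
rewrite /qS andbb; case: (bpar E i) => /=; last by rewrite big1.
by congr addb.
Qed.

Lemma odd_degc b : odd (degc b) = \big[addb/false]_j odd (b j).
Proof. by rewrite /degc; apply: (big_morph odd oddD). Qed.

Lemma BA_sym i b : BA (eps i) b (+) BA b (eps i) =
  odd (degc b) (+) (bpar E i && parc E b) (+) (~~ bpar E i && odd (b i)).
Proof.
rewrite odd_bform_sym; last exact: qA_sym.
rewrite {2}/qA andbb; congr (_ (+) _); rewrite odd_degc /qA.
case: (bpar E i) => /=; last by rewrite addbF.
by rewrite /parc -big_split; apply: eq_bigr => j _ /=; case: (bpar E j); rewrite /= ?addbb ?addbF.
Qed.

Lemma subcD a a' i : (0 < a i)%N -> subc (addc a a') i = addc (subc a i) a'.
Proof.
move=> ai; apply/ffunP => j; rewrite !ffunE; case: eqP => [->|_]; last by rewrite !subn0.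
by rewrite addnBAC.
Qed.

Lemma oform_subl q a c i : (0 < a i)%N ->
  odd (bform q (subc a i) c) = odd (bform q a c) (+) odd (bform q (eps i) c).
Proof. by move=> ai; rewrite -{2}(subcK ai) bformDl oddD addbK. Qed.

Lemma oform_subr q a c i : (0 < a i)%N ->
  odd (bform q c (subc a i)) = odd (bform q c a) (+) odd (bform q c (eps i)).
Proof. by move=> ai; rewrite -{2}(subcK ai) bformDr oddD addbK. Qed.

Lemma dsgE i a b : (0 < a i)%N -> dsg i a b = BS a (eps i) (+) BA (eps i) b.
Proof. by move=> ai; rewrite /dsg oform_subl // bform_eps_self addbF. Qed.

Lemma parc_eps i : parc E (eps i) = bpar E i.
Proof.
rewrite /parc (bigD1 i) //= big1 => [|j ji]; first by rewrite addbF ffunE eqxx andbT.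
by rewrite ffunE (negPf ji) andbF.
Qed.

Lemma parc_sub a i : (0 < a i)%N -> parc E (subc a i) = parc E a (+) bpar E i.
Proof. by move=> ai; rewrite -{2}(subcK ai) parcD parc_eps addbK. Qed.

Definition msg a b a' b' : bool := BS a a' (+) (parc E b && parc E a') (+) BA b b'.

(** Signs of differentiating a letter of the first factor and of multiplying, in both orders. The
    discrepancy comes from letters of [a'] equal to an odd [i], which [bform] does not count. *)
Lemma msg_dl i a b a' b' : (0 < a i)%N ->
  dsg i a b (+) msg (subc a i) (addc (eps i) b) a' b' =
  msg a b a' b' (+) dsg i (addc a a') (addc b b') (+) (bpar E i && odd (a' i)).
Proof.
move=> ai; have aai : (0 < addc a a' i)%N by rewrite ffunE addn_gt0 ai.
rewrite !dsgE // /msg oform_subl // !bformDl !bformDr !oddD parcD parc_eps.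
have h : BS a' (eps i) = BS (eps i) a' (+) (bpar E i && (parc E a' (+) odd (a' i))).
  by rewrite -BS_sym addKb.
rewrite h; move: (BS a (eps i)) (BA (eps i) b) (BS a a') (BS (eps i) a') (parc E a') (parc E b) (BA b b').
move: (BA (eps i) b') (bpar E i) (odd (a' i)).
by do 10 case.
Qed.

Lemma msg_dr i a b a' b' : (0 < a' i)%N ->
  odd (degc b) (+) dsg i a' b' (+) msg a b (subc a' i) (addc (eps i) b') =
  msg a b a' b' (+) dsg i (addc a a') (addc b b') (+) (~~ bpar E i && odd (b i)).
Proof.
move=> ai; have aai : (0 < addc a a' i)%N by rewrite ffunE addn_gt0 ai orbT.
rewrite !dsgE // /msg oform_subr // !bformDl !bformDr !oddD parc_sub //.
have h : BA b (eps i) = BA (eps i) b (+)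
    (odd (degc b) (+) (bpar E i && parc E b) (+) (~~ bpar E i && odd (b i))).
  by rewrite -BA_sym addKb.
rewrite h; move: (BS a (eps i)) (BA (eps i) b) (BS a a') (BS a' (eps i)) (parc E a') (parc E b) (BA b b').
move: (BA (eps i) b') (bpar E i) (odd (b i)) (odd (degc b)).
by do 11 case.
Qed.

Lemma dR_omul_mon m n l (e : (m + n)%N = l) a b a' b' :
    okm E m (a, b) -> okm E n (a', b') ->
  dR l X (omul e (mon E m (a, b)) (mon E n (a', b'))) =
  omul e (dR m X (mon E m (a, b))) (mon E n (a', b')) +
  omul e (sgm m X (mon E m (a, b))) (dR n X (mon E n (a', b'))).
Proof.
move=> /okmP[va vb ab] /okmP[va' vb' ab'].
rewrite sgm_mon mon_mul_deg // lfunZ !dR_mon scaler_sumr.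
rewrite -omullE lfun_sum -omulrE lfun_sum -big_split; apply: eq_bigr => i _.
rewrite lfunZ omullE [in X in _ = X]lfunZ omulrE -[omul e (_ *: _) _]omullE lfunZ omullE.
(* For each [i] all three terms are multiples of [T]; [s0] and [c0] are the sign and the coefficient
   that they share. *)
set T := mon E l (subc (addc a a') i, addc (eps i) (addc b b')).
set c0 : k := (bindom b b' * (b i + b' i).+1)%:R; set s0 : bool := msg a b a' b' (+) dsg i (addc a a') (addc b b').
have t1 : ((red i a * (b i).+1)%:R * (-1) ^+ dsg i a b : k) *:
    omul e (mon E m (subc a i, addc (eps i) b)) (mon E n (a', b')) =
    ((red i a)%:R * (-1) ^+ (bpar E i && odd (a' i)) * ((-1) ^+ s0 * c0)) *: T.
  have [r0 | r0] := posnP (red i a); first by rewrite r0 mul0n !mul0r !scale0r.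
  have ai := red_gt0 r0; rewrite mon_mul_deg //; last first.
    by rewrite degcD degc_sing -ab (degc_subc ai) addSn addnS.
  rewrite -/(msg _ _ _ _) -subcD // -addcA -/T scalerA; congr (_ *: _).
  rewrite /c0 -bindom_epsl !natrM; move: (msg_dl b a' b' ai); rewrite -/s0.
  move: (s0) (dsg i a b) (msg (subc a i) _ _ _) (_ && odd (a' i)) => z d1 m1 p.
  move/(congr1 (fun s : bool => (-1) ^+ s : k)); rewrite !signr_addb.
  move: ((-1) ^+ z) ((-1) ^+ d1) ((-1) ^+ m1) ((-1) ^+ p) (_%:R) (_%:R) (_%:R) => {}z {}d1 {}m1 {}p r c c' h.
  by transitivity (r * c * c' * (d1 * m1)); [ring | rewrite h; ring].
have t2 : ((red i a' * (b' i).+1)%:R * (-1) ^+ dsg i a' b' : k) *: (((-1) ^+ degc b : k) *: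
    omul e (mon E m (a, b)) (mon E n (subc a' i, addc (eps i) b'))) =
    ((red i a')%:R * (-1) ^+ (~~ bpar E i && odd (b i)) * ((-1) ^+ s0 * c0)) *: T.
  have [r0 | r0] := posnP (red i a'); first by rewrite r0 mul0n !mul0r !scale0r.
  have ai := red_gt0 r0; rewrite mon_mul_deg //; last first.
    by rewrite degcD degc_sing -ab' (degc_subc ai) addSn addnS.
  rewrite -/(msg _ _ _ _) [addc a (subc a' i)]addcC -subcD // [addc a' a]addcC.
  rewrite addcA [addc b (eps i)]addcC -addcA -/T !scalerA; congr (_ *: _).
  rewrite /c0 -bindom_epsr !natrM; move: (msg_dr a b b' ai); rewrite -/s0.
  move: (s0) (dsg i a' b') (msg _ _ (subc a' i) _) (_ && odd (b i)) => z d1 m1 p.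
  move/(congr1 (fun s : bool => (-1) ^+ s : k)); rewrite !signr_addb signr_odd.
  move: ((-1) ^+ z) ((-1) ^+ d1) ((-1) ^+ m1) ((-1) ^+ p) ((-1) ^+ degc b) (_%:R) (_%:R) (_%:R) => {}z {}d1 {}m1 {}p q r c c' h.
  by transitivity (r * c * c' * (q * d1 * m1)); [ring | rewrite h; ring].
transitivity ((((red i (addc a a'))%:R : k) * ((-1) ^+ s0 * c0)) *: T).
  rewrite scalerA; congr (_ *: _); rewrite -/(msg _ _ _ _) /s0 signr_addb /c0 !natrM ffunE.
  move: ((-1) ^+ dsg _ _ _) ((-1) ^+ msg _ _ _ _) (_%:R) (_%:R) (_%:R) => *; ring.
rewrite t1 t2 -[RHS]/(_ + _) -scalerDl -mulrDl; have [ok | nok] := boolP (okm E l (subc (addc a a') i, addc (eps i) (addc b b'))); last first.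
  by rewrite /T mon0 // !scaler0.
(* For an even letter validity forces [b i = 0], and the exponents of S add up. For an odd letter
   parities add, and the two terms cancel when both are odd. *)
congr ((_ * _) *: _); have [_ vbb _] := okmP ok; rewrite /red !ffunE.
have := forallP vbb i; rewrite /qA andbb !ffunE eqxx; case: (bpar E i) => /=; last first.
  by case: (b i) => [|?] // _; rewrite expr0 !mulr1 natrD.
by move=> _; rewrite oddD expr0 mulr1; case: (odd (a i)); case: (odd (a' i)); rewrite /=; ring.
Qed.

Lemma dR_omul m n l (e : (m + n)%N = l) x y :
  dR l X (omul e x y) = omul e (dR m X x) y + omul e (sgm m X x) (dR n X y).
Proof.
have h2 a b : okm E m (a, b) -> forall y, dR l X (omul e (mon E m (a, b)) y) =
    omul e (dR m X (mon E m (a, b))) y + omul e (sgm m X (mon E m (a, b))) (dR n X y).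
  move=> ok {}y; rewrite -!omulrE -!comp_lfunE -add_lfunE; congr (fun_of_lfun _ y).
  apply: (omega_ext k2 (E := E)) => -[a' b'] ok'.
  by rewrite add_lfunE [(dR _ _ \o _)%VF _]comp_lfunE [(_ \o dR _ _)%VF _]comp_lfunE !omulrE (dR_omul_mon e ok ok').
rewrite -!omullE -[dR l X (omull _ _ _)]comp_lfunE -[omull e y (dR m X x)]comp_lfunE.
rewrite -[omull e _ (sgm m X x)]comp_lfunE -add_lfunE; congr (fun_of_lfun _ x).
apply: (omega_ext k2 (E := E)) => -[a b] ok.
by rewrite add_lfunE [(dR l _ \o _)%VF _]comp_lfunE [(_ \o dR m _)%VF _]comp_lfunE [(_ \o sgm m _)%VF _]comp_lfunE !omullE h2.
Qed.

Lemma sgm_dR n x : sgm n X (dR n X x) = - dR n X (sgm n X x).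
Proof.
rewrite -!comp_lfunE -opp_lfunE; congr (fun_of_lfun _ x).
apply: (omega_ext k2 (E := E)) => -[a b] _; rewrite opp_lfunE !comp_lfunE sgm_mon lfunZ dR_mon lfun_sum.
rewrite -scalerN -sumrN scaler_sumr; apply: eq_bigr => i _.
rewrite lfunZ sgm_mon degcD degc_sing add1n exprS mulN1r scaleNr !scalerN; congr (- _).
by rewrite !scalerA mulrC.
Qed.

Lemma sgmK n x : sgm n X (sgm n X x) = x.
Proof.
rewrite -[RHS]id_lfunE -comp_lfunE; congr (fun_of_lfun _ x).
apply: (omega_ext k2 (E := E)) => -[a b] _; rewrite id_lfunE comp_lfunE sgm_mon lfunZ sgm_mon scalerA.
by rewrite -signr_odd -signr_addb addbb scale1r.
Qed.

End DerivationFormula.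

(** * Algebra laws and cohomology *)

Section OmegaAssoc.

Variables (k : fieldType) (k2 : 2%:R != 0 :> k).

(** Transparent, because its parities and vectors have to reduce to [hpar] and [hb]. *)
Definition hb_base (X : superspace k) : hbase X.
Proof.
apply: (@HBase k X _ (fun i => @hpar k X i) (fun i => @hb k X i) (fun i => linfun (@hcoord k X i : X -> k^o))).
- exact: mem_hb.
- by move=> i j; rewrite (linfun_linear (hcoord_linear i)) hcoord_hb.
- by move=> x; rewrite {1}(hcoord_sum x); apply: eq_bigr => i _; rewrite (linfun_linear (hcoord_linear i)).
Defined.

Section Monomials.
Variables (X : superspace k) (E : hbase X).
Local Notation N := (bdim E).
Local Notation ct := {ffun 'I_N -> nat}.
Implicit Types (a b c : ct).

(** Letter by letter both sides are multinomial coefficients: multiplied by the three factorials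
    they become the factorial of the sum. *)
Lemma bindomA b b' b'' :
  (bindom b b' * bindom (addc b b') b'' = bindom b' b'' * bindom b (addc b' b''))%N.
Proof.
rewrite /bindom -!big_split; apply: eq_bigr => i _ /=; rewrite !ffunE.
move: (b i) (b' i) (b'' i) => x y z.
have h : (0 < x`! * y`! * z`!)%N by rewrite !muln_gt0 !fact_gt0.
have B u v : ('C(u + v, u) * (u`! * v`!) = (u + v)`!)%N.
  by have := bin_fact (leq_addr v u); rewrite [(u + v - u)%N]addKn.
apply/eqP; rewrite -(eqn_pmul2r h); apply/eqP.
transitivity ((x + y + z)`!).
  rewrite -(B (x + y)%N z) -(B x y); ring.
by rewrite -addnA -(B x (y + z)%N) -(B y z); ring.
Qed.

Lemma msgA a b a' b' a'' b'' :
  msg a b a' b' (+) msg (addc a a') (addc b b') a'' b'' =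
  msg a' b' a'' b'' (+) msg a b (addc a' a'') (addc b' b'').
Proof.
rewrite /msg !bformDl !bformDr !oddD !parcD.
move: (odd (bform _ a a')) (odd (bform _ a a'')) (odd (bform _ a' a'')).
move: (odd (bform _ b b')) (odd (bform _ b b'')) (odd (bform _ b' b'')).
by move: (parc E b) (parc E a') (parc E b') (parc E a''); do 10 case.
Qed.

Lemma omulA_mon m n q mn nq l (emn : (m + n)%N = mn) (enq : (n + q)%N = nq)
    (e1 : (mn + q)%N = l) (e2 : (m + nq)%N = l) a b a' b' a'' b'' :
  okm E m (a, b) -> okm E n (a', b') -> okm E q (a'', b'') ->
  omul e1 (omul emn (mon E m (a, b)) (mon E n (a', b'))) (mon E q (a'', b'')) =
  omul e2 (mon E m (a, b)) (omul enq (mon E n (a', b')) (mon E q (a'', b''))).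
Proof.
move=> /okmP[_ _ h] /okmP[_ _ h'] /okmP[_ _ h''].
rewrite (mon_mul_deg k2 emn) // (mon_mul_deg k2 enq) //.
rewrite -omullE -omulrE !lfunZ omullE omulrE.
rewrite (mon_mul_deg k2 e1) ?degcD; last 2 first.
- by rewrite -emn -h -h' addnACA.
- by [].
rewrite (mon_mul_deg k2 e2) ?degcD; last 2 first.
- by [].
- by rewrite -enq -h' -h'' addnACA.
rewrite !scalerA !addcA; congr (_ *: _).
rewrite mulrACA [RHS]mulrACA -!signr_addb -!natrM bindomA; congr (_ * _).
by congr (_ ^+ nat_of_bool _); exact: msgA.
Qed.

Lemma mon_one : mon E 0 (zeroc _, zeroc _) = pa_one (Omega k) X.
Proof.
rewrite Omega_oneE (@mon_om _ _ E 0 _ _ (ord0 : 'I_1)) ?degc0 //.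
pose w : {ffun 'I_0 -> 'I_N} := finfun (fun i : 'I_0 => match i with Ordinal m h => match notF h with end end).
have w0 : content w = zeroc N by apply/ffunP => i; rewrite !ffunE big_ord0.
have wl (u : {ffun 'I_0 -> 'I_N}) : u = w by apply/ffunP; case.
have s0 q : wsgn k q w = 1.
  rewrite /wsgn ifT ?w0; first by rewrite /weps big1 // => -[[]].
  by apply/forallP => i; rewrite ffunE implybT.
have tw0 : tw E w = delta k (word0 X).
  by rewrite -tmul_hb; apply: eq_tmul; case.
have E1 : mS E (0 - (ord0 : 'I_1)) (zeroc _) = spi 0 X (delta k (word0 X)).
  rewrite -tw0 -w0 -[(0 - (ord0 : 'I_1))%N]/0%N -[RHS]scale1r -(s0 (qS E)); apply: mS_tw => //.
  by rewrite w0; apply/forallP => i; rewrite ffunE implybT.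
have E2 : mA E (ord0 : 'I_1) (zeroc _) = apr 0 X (delta k (word0 X)).
  rewrite /mA; congr (apr 0 X _); rewrite /avec (big_pred1 w) ?s0 ?scale1r //.
  by move=> u; rewrite /= (wl u) w0 !eqxx.
by rewrite E1 E2.
Qed.

Lemma bindom0l b : bindom (zeroc _) b = 1%N.
Proof. by rewrite /bindom big1 // => i _; rewrite ffunE bin0. Qed.

Lemma bindom0r b : bindom b (zeroc _) = 1%N.
Proof. by rewrite bindom_sym bindom0l. Qed.

Lemma parc0 : parc E (zeroc _) = false.
Proof. by rewrite /parc big1 // => i _; rewrite ffunE andbF. Qed.

End Monomials.

Lemma omulA m n q mn nq l (emn : (m + n)%N = mn) (enq : (n + q)%N = nq)
    (e1 : (mn + q)%N = l) (e2 : (m + nq)%N = l) X x y z :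
  omul e1 (omul emn x y) z = @omul k _ _ _ e2 X x (omul enq y z).
Proof.
pose E := hb_base X.
have h1 a b a' b' : okm E m (a, b) -> okm E n (a', b') -> forall z,
    omul e1 (omul emn (mon E m (a, b)) (mon E n (a', b'))) z =
    omul e2 (mon E m (a, b)) (omul enq (mon E n (a', b')) z).
  move=> ok ok' {}z; rewrite -!omulrE -[RHS]comp_lfunE; congr (fun_of_lfun _ z).
  apply: (omega_ext k2 (E := E)) => -[a'' b''] ok''.
  by rewrite [RHS]comp_lfunE !omulrE; apply: omulA_mon.
have h2 a b : okm E m (a, b) -> forall y,
    omul e1 (omul emn (mon E m (a, b)) y) z =
    omul e2 (mon E m (a, b)) (omul enq y z).
  move=> ok {}y; rewrite -omullE -[omul emn _ _]omulrE -[omul enq _ _]omullE -[RHS]omulrE.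
  rewrite -[LHS]comp_lfunE -[RHS]comp_lfunE; congr (fun_of_lfun _ y).
  apply: (omega_ext k2 (E := E)) => -[a' b'] ok'.
  by rewrite [LHS]comp_lfunE [RHS]comp_lfunE !omulrE !omullE; apply: h1.
rewrite -omullE -[omul emn _ _]omullE -[RHS]omullE -[LHS]comp_lfunE; congr (fun_of_lfun _ x).
apply: (omega_ext k2 (E := E)) => -[a b] ok.
by rewrite [LHS]comp_lfunE !omullE; apply: h2.
Qed.

Lemma omul1l n (e : (0 + n)%N = n) X x : @omul k _ _ _ e X (pa_one (Omega k) X) x = x.
Proof.
rewrite -omulrE -[RHS]id_lfunE; congr (fun_of_lfun _ x).
apply: (omega_ext k2 (E := hb_base X)) => -[a b] /okmP[_ _ h].
rewrite id_lfunE omulrE -(mon_one (hb_base X)) (mon_mul_deg k2 e) ?degc0 //.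
by rewrite !bform0l parc0 bindom0l !add0c mulr1 scale1r.
Qed.

Lemma omul1r n (e : (n + 0)%N = n) X x : @omul k _ _ _ e X x (pa_one (Omega k) X) = x.
Proof.
rewrite -omullE -[RHS]id_lfunE; congr (fun_of_lfun _ x).
apply: (omega_ext k2 (E := hb_base X)) => -[a b] /okmP[_ _ h].
rewrite id_lfunE omullE -(mon_one (hb_base X)) (mon_mul_deg k2 e) ?degc0 //.
by rewrite !bform0r parc0 andbF bindom0r !addc0 mulr1 scale1r.
Qed.

Lemma dR_one X : dR 0 X (pa_one (Omega k) X) = 0.
Proof.
rewrite -(mon_one (hb_base X)) (dR_mon k2) big1 // => i _.
by rewrite /red !ffunE if_same mul0n mul0r scale0r.
Qed.

End OmegaAssoc.

(** * Cohomology as a P-algebra *)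

Section Cohomology.

Variables (k : fieldType) (k2 : 2%:R != 0 :> k).

Section Classes.
Variables (n : nat) (V : superspace k).
Implicit Types x y z : Omega k n V.

Fact cls_key : unit. Proof. exact: tt. Qed.

(* Locked, since [comp_lfunE] would unfold [coho_class] and [coho_repr]. *)
Definition cls : 'Hom(Omega k n V, coho k n V) := locked_with cls_key (coho_class n V).
Definition crep : 'Hom(coho k n V, Omega k n V) := locked_with cls_key (coho_repr n V).

Lemma clsE : cls = coho_class n V. Proof. by rewrite /cls unlock. Qed.
Lemma crepE : crep = coho_repr n V. Proof. by rewrite /crep unlock. Qed.

Lemma cocycles_hcore : hcore (lker (dR n V)) = lker (dR n V).
Proof.
apply: hcore_id => b v; rewrite !memv_ker => /eqP dv.
by rewrite -(hproj_even b v (dR_even n V)) dv linear0.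
Qed.

Lemma coboundaries_hcore : hcore (coboundaries n V) = coboundaries n V.
Proof.
apply: hcore_id => b v; rewrite -!memv_preim => /memv_imgP[z _ dz].
have := hproj_even b v (ssub_in_even (lker (dR n V))) => <-.
by rewrite dz (hproj_even b z (dR_even n V)) memv_img ?memvf.
Qed.

Lemma cls_linear x y : cls (x - y) = cls x - cls y. Proof. exact: lfunB. Qed.

Lemma cls_eq0 x : dR n V x = 0 -> (cls x == 0) = (x \in limg (dR n V)).
Proof.
move=> dx; rewrite clsE comp_lfunE squot_pi0; last exact: coboundaries_hcore.
by rewrite -memv_preim ssub_prK ?cocycles_hcore // memv_ker dx.
Qed.

Lemma cls_eq x y z : dR n V x = 0 -> dR n V y = 0 -> x - y = dR n V z -> cls x = cls y.
Proof.
move=> dx dy xy; apply/eqP; rewrite -subr_eq0 -cls_linear cls_eq0; last by rewrite lfunB dx dy subrr.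
by rewrite xy memv_img ?memvf.
Qed.

Lemma crep_cocycle c : dR n V (crep c) = 0.
Proof. by rewrite crepE comp_lfunE; apply/eqP; rewrite -memv_ker; exact: mem_ssub. Qed.

Lemma crepK c : cls (crep c) = c.
Proof. by rewrite clsE crepE comp_lfunE [(ssub_in _ \o _)%VF _]comp_lfunE ssub_inK squot_secK. Qed.

Lemma crep_cls x : dR n V x = 0 -> exists z, crep (cls x) = x + dR n V z.
Proof.
move=> dx; have : crep (cls x) - x \in limg (dR n V).
  rewrite -cls_eq0; last by rewrite lfunB crep_cocycle dx subrr.
  by rewrite cls_linear crepK subrr.
by case/memv_imgP => z _ E; exists z; rewrite -E addrC subrK.
Qed.

Lemma cls_even b x : dR n V x = 0 -> x \in spart (Omega k n V) b -> cls x \in spart (coho k n V) b.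
Proof.
move=> dx xb; rewrite clsE comp_lfunE; apply: shom_even (squot_pi_even _) _.
by rewrite spart_ssub ssub_prK ?cocycles_hcore // memv_ker dx.
Qed.

Lemma cls_homog b c : c \in spart (coho k n V) b ->
  exists x, [/\ x \in spart (Omega k n V) b, dR n V x = 0 & cls x = c].
Proof.
case/squot_homog => v vb vc; exists (ssub_in (lker (dR n V)) v); split.
- by rewrite -spart_ssub.
- by apply/eqP; rewrite -memv_ker; exact: mem_ssub.
- by rewrite clsE comp_lfunE ssub_inK.
Qed.

Lemma cls_surj c : exists2 x, dR n V x = 0 & cls x = c.
Proof. by exists (crep c); [exact: crep_cocycle | exact: crepK]. Qed.

Lemma coho_ext (Y : vectType k) (f g : 'Hom(sspace (coho k n V), Y)) :
  (forall x, dR n V x = 0 -> f (cls x) = g (cls x)) -> f = g.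
Proof. by move=> fg; apply/lfunP => c; have [x dx <-] := cls_surj c; apply: fg. Qed.

End Classes.

Arguments cls {n V}.
Arguments crep {n V}.

Lemma coho_mapE n V W (f : ghom n V W) :
  pf_map (coho k n) f = (cls \o pf_map (Omega k n) f \o crep)%VF.
Proof.
have L : linear (fun f : ghom n V W => (coho_class n W \o pf_map (Omega k n) f \o coho_repr n V)%VF).
  move: (coho_class n W) (coho_repr n V) => A B a g h; apply/lfunP => u.
  by rewrite add_lfunE scale_lfunE !comp_lfunE pf_map_lin add_lfunE scale_lfunE lfunPl.
rewrite clsE crepE; exact: (linfun_linear L f).
Qed.

Lemma coho_map n V W (f : ghom n V W) x : dR n V x = 0 ->
  pf_map (coho k n) f (cls x) = cls (pf_map (Omega k n) f x).
Proof.
move=> dx; rewrite coho_mapE 2!comp_lfunE.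
have := crep_cocycle (cls x); have [z ->] := crep_cls dx => dxz.
apply: (cls_eq (z := pf_map (Omega k n) f z)); first by rewrite dR_nat dxz lfun0.
  by rewrite dR_nat dx lfun0.
by rewrite lfunD addrAC subrr add0r dR_nat.
Qed.

Lemma coho_functor n : is_pfunctor (coho k n).
Proof.
have [_ Oid Ocomp] := @Omega_functor k n; split.
- move=> V W; apply: pf_evenP => c f fc; apply/mem_shom => d h hd.
  have [x [xd dx <-]] := cls_homog hd; rewrite (coho_map f dx); apply: cls_even.
    by rewrite dR_nat dx lfun0.
  apply: shom_spart xd; exact (pf_map_par (Omega_functor k n) fc).
- by move=> V; apply: coho_ext => x dx; rewrite (coho_map _ dx) Oid !id_lfunE.
move=> U V W g f; apply: coho_ext => x dx.
have dfx : dR n V (pf_map (Omega k n) f x) = 0 by rewrite dR_nat dx lfun0.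
apply: etrans (coho_map (gcomp g f) dx) _; rewrite Ocomp [in LHS]comp_lfunE.
apply/esym; apply: etrans (comp_lfunE _ _ _) _.
by apply: etrans (congr1 _ (coho_map f dx)) _; exact (coho_map g dfx).
Qed.

Section Products.
Variables (m n l : nat) (e : (m + n)%N = l) (V : superspace k).
Implicit Types (x : Omega k m V) (y : Omega k n V).

Lemma omul_cocycle x y : dR m V x = 0 -> dR n V y = 0 -> dR l V (omul e x y) = 0.
Proof.
move=> dx dy; rewrite (dR_omul k2 (hb_base V)) dx dy.
by rewrite -omullE lfun0 -omulrE lfun0 addr0.
Qed.

(** [coho_prod] multiplies chosen representatives, which differ from [x] and [y] by coboundaries;
    the Leibniz rule makes the difference of the products exact. *)
Lemma cls_mul x y : dR m V x = 0 -> dR n V y = 0 ->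
  @pa_mul k (HOmega k) m n l e V (cls x) (cls y) = cls (omul e x y).
Proof.
move=> dx dy; rewrite /pa_mul -[pa_prod _ _ _]/(coho_prod e V) /coho_prod -clsE -!crepE 2!comp_lfunE stmapE0.
have := crep_cocycle (cls x); have := crep_cocycle (cls y).
have [z ->] := crep_cls dx; have [t ->] := crep_cls dy => dyt dxz.
rewrite -[pa_prod _ _ _ _]/(omul e (x + dR m V z) (y + dR n V t)).
have DL u u' v : omul e (u + u') v = omul e u v + omul e u' v.
  by rewrite -!omullE lfunD.
have DR u v v' : omul e u (v + v') = omul e u v + omul e u v'.
  by rewrite -!omulrE lfunD.
(* The sign operator is inserted so that the differential of [omul e (sgm m V x) t] is the product
   of [x] and [dR n V t] for the cocycle [x]. *)
apply: (cls_eq (z := omul e z (y + dR n V t) + omul e (sgm m V x) t)).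
- exact: omul_cocycle.
- exact: omul_cocycle.
rewrite lfunD !(dR_omul k2 (hb_base V)) dyt (sgmK k2 (hb_base V)).
have -> : dR m V (sgm m V x) = 0 by rewrite -[LHS]opprK -(sgm_dR k2 (hb_base V)) dx lfun0 oppr0.
rewrite DL DR -[omul e _ 0]omulrE lfun0 addr0 -[omul e 0 _]omullE lfun0 add0r.
by rewrite addrAC [X in X - _]addrC addrK addrC.
Qed.

End Products.

Lemma HOmega_one V : pa_one (HOmega k) V = cls (pa_one (Omega k) V).
Proof. by rewrite /pa_one -[pa_unit (HOmega k) V]/(@coho_unit k V) /coho_unit -clsE comp_lfunE. Qed.

(** On homogeneous cocycles this is [omul_nat], applied with the preimage under [gsplit] that
    [ptensor] uses. *)
Lemma HOmega_prod_nat m n l (e : (m + n)%N = l) :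
  @is_pmorphism k false l (ptensor e (coho k m) (coho k n)) (coho k l) (coho_prod (k := k) e).
Proof.
have hom_ext V (Y : vectType k) (f g : 'Hom(sspace (stens (coho k m V) (coho k n V)), Y)) :
    (forall b c x y, x \in spart (Omega k m V) b -> y \in spart (Omega k n V) c ->
       dR m V x = 0 -> dR n V y = 0 ->
       f (tens (cls x) (cls y)) = g (tens (cls x) (cls y))) -> f = g.
  move=> fg; apply: stens_ext => i j.
  have [x [xb dx <-]] := cls_homog (mem_hb i); have [y [yb dy <-]] := cls_homog (mem_hb j).
  exact: fg xb yb dx dy.
have prodE V x y : dR m V x = 0 -> dR n V y = 0 ->
    coho_prod e V (tens (cls x) (cls y)) = cls (omul e x y) by exact: cls_mul.
split=> [V | V W c f fc].
  apply: hom_free_even => -[i j]; rewrite -tens_hb addbF.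
  have [x [xb dx <-]] := cls_homog (mem_hb i); have [y [yb dy <-]] := cls_homog (mem_hb j).
  by rewrite prodE //; apply: cls_even; [exact: omul_cocycle | exact: omul_par].
rewrite scale1r; apply: hom_ext => b c' x y xb yc dx dy; rewrite [LHS]comp_lfunE [RHS]comp_lfunE.
have fxy : pf_map (coho k l) f (coho_prod e V (tens (cls x) (cls y))) =
    cls (pf_map (Omega k l) f (omul e x y)).
  apply: etrans (congr1 (pf_map (coho k l) f) (prodE _ _ _ dx dy)) _.
  exact (coho_map f (omul_cocycle e dx dy)).
rewrite fxy.
have [t [tf tE]] := ptensor_map e (coho k m) (coho k n) f.
apply: etrans (congr1 (coho_prod e W) (tE _)) _.
have fE u : gmap f u = \sum_ij (t ij : k) *: lbox2 e (hpar ij.2) (gmap (hb ij.1)) (gmap (hb ij.2)) u.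
  by rewrite -tf gsplit_app.
have /(congr1 (@cls l W)) := @omul_nat k m n l e V W f _ _ _ _ _ fE b x y xb.
move=> fE2; apply/esym; apply: etrans fE2 _; apply/esym.
rewrite !lfun_sum; apply: eq_bigr => -[i j] _; rewrite -[(i, j).1]/i -[(i, j).2]/j.
move: (hpar j) (t (i, j)) (hb i) (hb j) => q c0 g h; rewrite !lfunZ -scalerA; congr (_ *: _).
apply: etrans (congr1 (coho_prod e W) (@stmapE k q b _ _ _ _ (pf_map (coho k m) g) (pf_map (coho k n) h)
  (cls x) (cls y) (cls_even dx xb))) _.
rewrite lfunZ; congr (_ *: _).
apply: etrans (congr1 (coho_prod e W) (f_equal2 (fun u v => tens u v) (coho_map g dx) (coho_map h dy))) _.
by apply: prodE; rewrite dR_nat ?dx ?dy lfun0.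
Qed.

Lemma pone_mapE V W (f : ghom 0 V W) x :
  pf_map (pone k) f x = (gmap f (delta k (word0 V)) (word0 W) : k) *: x.
Proof.
have L : linear (fun f : ghom 0 V W =>
    ((gmap f (delta k (word0 V)) (word0 W) : k) *: \1%VF : 'Hom(sone k, sone k))).
  by move=> a g h; rewrite gmapP add_lfunE scale_lfunE !ffunE scalerDl scalerA.
by have := congr1 (fun h : 'Hom(_, _) => h x) (linfun_linear L f); rewrite [RHS]scale_lfunE id_lfunE.
Qed.

Lemma HOmega_unit_hom : @is_pmorphism k false 0 (pone k) (coho k 0) (@coho_unit k).
Proof.
have unitE V : coho_unit V (delta k tt) = cls (pa_one (Omega k) V) by exact: HOmega_one.
split=> [V | V W c f fc].
  apply: hom_free_even => -[]; rewrite unitE; apply: cls_even; [exact: dR_one | exact: Omega_one_par].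
rewrite scale1r; apply: delta_ext => -[]; apply: etrans (comp_lfunE _ _ _) _.
apply: etrans (congr1 (coho_unit W) (pone_mapE f (delta k tt))) _; rewrite lfunZ; apply/esym.
apply: etrans (comp_lfunE _ _ _) _; apply: etrans (congr1 (pf_map (coho k 0) f) (unitE V)) _.
apply: etrans (coho_map f (dR_one k2 V)) _.
by rewrite Omega_one_nat lfunZ unitE.
Qed.

Lemma HOmega_palgebra : is_palgebra (HOmega k).
Proof.
split.
- exact: coho_functor.
- exact: HOmega_unit_hom.
- exact: HOmega_prod_nat.
- move=> n e V c; have [x dx <-] := cls_surj c.
  rewrite HOmega_one (cls_mul e (dR_one k2 V) dx); congr (cls _); exact: omul1l.
- move=> n e V c; have [x dx <-] := cls_surj c.
  rewrite HOmega_one (cls_mul e dx (dR_one k2 V)); congr (cls _); exact: omul1r.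
move=> m n q mn nq l emn enq e1 e2 V c c' c''.
have [x dx <-] := cls_surj c; have [y dy <-] := cls_surj c'; have [z dz <-] := cls_surj c''.
rewrite (cls_mul emn dx dy) (cls_mul enq dy dz) (cls_mul e1 (omul_cocycle emn dx dy) dz).
rewrite (cls_mul e2 dx (omul_cocycle enq dy dz)); congr (cls _); exact: omulA.
Qed.

End Cohomology.

Arguments cls {k n V}.
Arguments crep {k n V}.

(** * Contracting homotopy *)

Section Homotopy.

Variables (k : fieldType) (k2 : 2%:R != 0 :> k) (p : nat) (charp : p \in [pchar k]).
Variables (X : superspace k) (E : hbase X).
Local Notation N := (bdim E).
Local Notation ct := {ffun 'I_N -> nat}.
Implicit Types (a b : ct) (m : ct * ct).
Notation eps i := (singc i 1).

Lemma monlin_mon0 n (Y : vectType k) (g : ct * ct -> Y) m :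
  (~~ okm E n m -> g m = 0) -> monlin E n g (mon E n m) = g m.
Proof.
by have [ok _|nok /(_ isT) ->] := boolP (okm E n m); [exact: monlinE | rewrite mon0 // lfun0].
Qed.

(** Coefficient of contracting the letter [i]. A divided power of an odd letter contracts with
    coefficient 1; a valid content has an even letter at most once, so that its parity is its
    count. *)
Definition redb i b : nat := if bpar E i then nat_of_bool (0 < b i)%N else nat_of_bool (odd (b i)).

Lemma redb_gt0 i b : (0 < redb i b)%N -> (0 < b i)%N.
Proof. by rewrite /redb; case: ifP => _; case: (b i). Qed.

(* Contraction with the i-th coordinate of the Euler vector field: [iota_dR] shows that it is a *)
(* homotopy between 0 and multiplication by the i-th weight.                                   *)
Definition ival n i a b : Omega k n X :=
  ((redb i b)%:R * (-1) ^+ dsg i (addc a (eps i)) (subc b i) : k) *: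
  mon E n (addc a (eps i), subc b i).

Definition iota n i : 'End(Omega k n X) := monlin E n (fun m => ival n i m.1 m.2).

Lemma iota_mon n i a b : iota n i (mon E n (a, b)) = ival n i a b.
Proof.
apply: (@monlin_mon0 n _ (fun m => ival n i m.1 m.2) (a, b)) => nok; rewrite -[(a, b).1]/a -[(a, b).2]/b; rewrite /ival; have [r0 | r0] := posnP (redb i b).
  by rewrite r0 mul0r scale0r.
rewrite mon0 ?scaler0 //; apply: contra nok => /okmP[va vb ab]; have b0 := redb_gt0 r0.
apply/and3P; split=> /=; first exact: validcDl va.
  apply/forallP => j; have := forallP vb j; rewrite !ffunE; case: eqP => [->|_]; last by rewrite subn0.
  by move: r0; rewrite /redb /qA andbb; case: (bpar E i) => //=; case: (b i) => [|[|[|]]].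
by rewrite -ab degcD degc_sing (degc_subc b0) addn1 addSn addnS.
Qed.

Lemma eps_neq (i j : 'I_N) : j != i -> eps i j = 0%N.
Proof. by move=> /negPf ji; rewrite ffunE ji. Qed.

Lemma addc_subc_swap a i j : j != i -> subc (addc a (eps i)) j = addc (subc a j) (eps i).
Proof.
move=> ji; apply/ffunP => x; rewrite !ffunE; case: (x =P j) => [->|_]; last by rewrite !subn0.
by rewrite (negPf ji) !addn0.
Qed.

(** Contracting [i] and differentiating another letter [j] anticommute, so the mixed terms of the
    homotopy formula cancel. *)
Lemma dsg_anti i j a b : j != i -> (0 < a j)%N -> (0 < b i)%N ->
  dsg i (addc a (eps i)) (subc b i) (+) dsg j (addc a (eps i)) (subc b i) =
  ~~ (dsg j a b (+) dsg i (addc (subc a j) (eps i)) (subc (addc (eps j) b) i)).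
Proof.
move=> ji aj bi; rewrite /dsg !addcK addc_subc_swap // !(bformDl, oddD).
have -> : subc (addc (eps j) b) i = addc (eps j) (subc b i).
  by rewrite addcC addc_subc_swap 1?eq_sym // addcC.
rewrite !bformDr !oddD !(oform_subr _ _ bi) !(oform_subl _ _ aj).
have hS := @BS_sym k X E i (eps j); have hA := @BA_sym k X E i (eps j).
move: hS hA; rewrite parc_eps degc_sing (eps_neq (i := j)) 1?eq_sym // andbF !addbF /=.
move: (odd (bform (qS E) a (eps i))) (odd (bform (qS E) (eps j) (eps i))) (odd (bform (qS E) a (eps j))).
move: (odd (bform (qS E) (eps i) (eps j))) (odd (bform (qA E) (eps j) (eps i))).
rewrite !bform_eps_self.
move: (odd (bform (qA E) (eps i) (eps j))) (odd (bform (qA E) (eps i) b)) (odd (bform (qA E) (eps j) b)).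
by move: (bpar E i && bpar E j); do 9 case.
Qed.

(** The terms with [j != i] cancel by [dsg_anti]. For [j = i] validity turns the products of [red]
    and [redb] into the weight. *)
Lemma iota_dR n i a b : okm E n (a, b) ->
  dR n X (iota n i (mon E n (a, b))) + iota n i (dR n X (mon E n (a, b))) =
  ((a i + b i)%:R : k) *: mon E n (a, b).
Proof.
move=> ok; have [va vb ab] := okmP ok.
rewrite iota_mon /ival lfunZ !(dR_mon k2) scaler_sumr lfun_sum -big_split (sum_only (i := i)) => [|j ji]; rewrite -[LHS]/(_ + _).
  rewrite lfunZ iota_mon /ival !scalerA addcK.
  have e1 : ((redb i b)%:R * (-1) ^+ dsg i (addc a (eps i)) (subc b i) *
      ((red i (addc a (eps i)) * (subc b i i).+1)%:R * (-1) ^+ dsg i (addc a (eps i)) (subc b i)) : k) *: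
      mon E n (a, addc (eps i) (subc b i)) =
      ((redb i b * (red i (addc a (eps i)) * b i))%:R : k) *: mon E n (a, b).
    have [r0 | r0] := posnP (redb i b); first by rewrite r0 !mul0r !scale0r.
    have b0 := redb_gt0 r0; rewrite [addc (eps i) (subc b i)]addcC subcK // mulrACA -signr_addb addbb mulr1 -natrM.
    by congr (_%:R *: _); rewrite ffunE eqxx subn1 prednK.
  have e2 : ((red i a * (b i).+1)%:R * (-1) ^+ dsg i a b *
      ((redb i (addc (eps i) b))%:R * (-1) ^+ dsg i (addc (subc a i) (eps i)) (subc (addc (eps i) b) i)) : k) *:
      mon E n (addc (subc a i) (eps i), subc (addc (eps i) b) i) =
      ((red i a * (b i).+1 * redb i (addc (eps i) b))%:R : k) *: mon E n (a, b).
    have [r0 | r0] := posnP (red i a); first by rewrite r0 !mul0r !scale0r.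
    have a0 := red_gt0 r0; rewrite subcK // [addc (eps i) b]addcC addcK mulrACA -signr_addb addbb mulr1 -natrM //.
  rewrite e1 e2 -scalerDl -natrD; congr (_%:R *: _).
  have := forallP va i; have := forallP vb i; rewrite /redb /red /qS /qA andbb !ffunE eqxx.
  case: (bpar E i) => /=; case: (a i) => [|[|?]]; case: (b i) => [|[|?]] //= *; lia.
rewrite lfunZ iota_mon /ival !scalerA.
have [r0 | r0] := posnP (red j a).
  have -> : red j (addc a (eps i)) = 0%N by rewrite /red !ffunE (negPf ji) addn0.
  by rewrite r0 !(mul0n, mul0r, mulr0) !scale0r addr0.
have [s0 | s0] := posnP (redb i b).
  have -> : redb i (addc (eps j) b) = 0%N by rewrite /redb !ffunE eq_sym (negPf ji) add0n.
  by rewrite s0 !(mul0n, mul0r, mulr0) !scale0r addr0.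
have a0 := red_gt0 r0; have b0 := redb_gt0 s0.
rewrite addc_subc_swap //.
have -> : addc (eps j) (subc b i) = subc (addc (eps j) b) i.
  by rewrite [addc (eps j) b]addcC addc_subc_swap 1?eq_sym // addcC.
rewrite -scalerDl; apply/eqP; rewrite scaler_eq0; apply/orP; left; apply/eqP.
have -> : red j (addc a (eps i)) = red j a by rewrite /red !ffunE (negPf ji) addn0.
have -> : redb i (addc (eps j) b) = redb i b by rewrite /redb !ffunE eq_sym (negPf ji) add0n.
have -> : subc b i j = b j by rewrite ffunE (negPf ji) subn0.
rewrite mulrACA -signr_addb (dsg_anti ji a0 b0) [X in _ + X]mulrACA -signr_addb signrN.
by rewrite mulrN [_%:R * (_ * _)%:R]mulrC addNr.
Qed.

Let p_pr : prime p := pcharf_prime charp.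
Let p_gt0 : (0 < p)%N := prime_gt0 p_pr.

Lemma natr_p j : (p %| j)%N -> j%:R = 0 :> k.
Proof. by rewrite (dvdn_pcharf charp) => /eqP. Qed.

Definition wt m : ct := addc m.1 m.2.
Definition pdivc a : bool := [forall i, (p %| a i)%N].

Lemma wt_sub i a b : (0 < a i)%N -> wt (subc a i, addc (eps i) b) = wt (a, b).
Proof. by move=> ai; rewrite /wt addcA subcK. Qed.

(** Any letter whose weight is invertible in [k] would serve. The choice depends on the weights
    only, which [d] preserves, so a monomial and the terms of its differential use the same [i]. *)
Definition hval n m : Omega k n X :=
  if [pick i | ~~ (p %| wt m i)%N] is Some i then ((wt m i)%:R^-1 : k) *: iota n i (mon E n m) else 0.

Definition htp n : 'End(Omega k n X) := monlin E n (hval n).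

Lemma htp_mon n m : htp n (mon E n m) = hval n m.
Proof.
apply: monlin_mon0 => nok; rewrite /hval; case: pickP => // i _.
by rewrite mon0 // lfun0 scaler0.
Qed.

Lemma htp_dR n a b : htp n (dR n X (mon E n (a, b))) =
  if [pick i | ~~ (p %| wt (a, b) i)%N] is Some i
  then ((wt (a, b) i)%:R^-1 : k) *: iota n i (dR n X (mon E n (a, b))) else 0.
Proof.
rewrite (dR_mon k2) lfun_sum.
transitivity (\sum_j if [pick i | ~~ (p %| wt (a, b) i)%N] is Some i
   then ((wt (a, b) i)%:R^-1 : k) *: iota n i (((red j a * (b j).+1)%:R * (-1) ^+ dsg j a b : k) *:
      mon E n (subc a j, addc (eps j) b)) else 0).
  apply: eq_bigr => j _; have [r0 | r0] := posnP (red j a).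
    by rewrite r0 mul0n mul0r scale0r lfun0; case: pickP => // i _; rewrite lfun0 scaler0.
  rewrite lfunZ htp_mon /hval (wt_sub _ (red_gt0 r0)); case: pickP => [i _ | _]; last by rewrite scaler0.
  by rewrite lfunZ !scalerA mulrC.
by case: pickP => [i _ | _]; [rewrite lfun_sum scaler_sumr | rewrite big1].
Qed.

Definition proj_p n : 'End(Omega k n X) :=
  monlin E n (fun m => if pdivc (wt m) then mon E n m else 0).

Lemma proj_p_mon n m : proj_p n (mon E n m) = if pdivc (wt m) then mon E n m else 0.
Proof.
apply: (@monlin_mon0 n _ (fun m => if pdivc (wt m) then mon E n m else 0) m) => nok.
by rewrite mon0 // if_same.
Qed.

(** If the new monomial is valid, an even [i] has [b i = 0], so [p] divides [a i]; an odd [i] with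
    nonzero [red] has [a i = 1], so [p] divides [b i + 1]. The coefficient is zero in [k] either
    way. *)
Lemma dR_pdiv n a b : okm E n (a, b) -> pdivc (wt (a, b)) -> dR n X (mon E n (a, b)) = 0.
Proof.
move=> ok /forallP pw; have [va vb ab] := okmP ok.
rewrite (dR_mon k2) big1 // => i _.
have [oki | nok] := boolP (okm E n (subc a i, addc (eps i) b)); last by rewrite mon0 ?scaler0.
rewrite natr_p ?mul0r ?scale0r //; have := pw i; have [_ vb' _] := okmP oki.
have := forallP va i; have := forallP vb' i; rewrite /red /qS /qA andbb !ffunE eqxx.
case: (bpar E i) => /=; case: (a i) => [|[|?]] //=; rewrite ?mul1n ?add1n //.
by case: (b i) => [|?] //= _ _; rewrite addn0 muln1.
Qed.

Lemma proj_p_dR n x : proj_p n (dR n X x) = 0.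
Proof.
rewrite -comp_lfunE -[RHS](zero_lfunE _ x); congr (fun_of_lfun _ x).
apply: (omega_ext k2 (E := E)) => -[a b] ok; rewrite zero_lfunE comp_lfunE.
have [pw | npw] := boolP (pdivc (wt (a, b))); first by rewrite dR_pdiv // lfun0.
rewrite (dR_mon k2) lfun_sum big1 // => i _; rewrite lfunZ.
have [r0 | r0] := posnP (red i a); first by rewrite r0 mul0n mul0r scale0r.
by rewrite proj_p_mon wt_sub ?red_gt0 // (negPf npw) scaler0.
Qed.

Lemma htpE n x : x = proj_p n x + (dR n X (htp n x) + htp n (dR n X x)).
Proof.
transitivity ((proj_p n + ((dR n X \o htp n) + (htp n \o dR n X)))%VF x); last first.
  by rewrite 2!add_lfunE !comp_lfunE.
rewrite -[LHS]id_lfunE; congr (fun_of_lfun _ x).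
apply: (omega_ext k2 (E := E)) => -[a b] ok; rewrite id_lfunE 2!add_lfunE !comp_lfunE.
rewrite proj_p_mon htp_mon htp_dR /hval; case: pickP => [i npi | pd].
  have -> : pdivc (wt (a, b)) = false by apply/negbTE; rewrite negb_forall; apply/existsP; exists i.
  rewrite lfunZ -scalerDr iota_dR // scalerA add0r /wt ffunE mulVf ?scale1r //.
  by rewrite -(dvdn_pcharf charp); move: npi; rewrite /wt ffunE.
have -> : pdivc (wt (a, b)) by apply/forallP => i; have := pd i => /negbT; rewrite negbK.
by rewrite lfun0 !addr0.
Qed.

(* x |-> x^p and dx |-> x^(p-1) dx for an even letter x; for an odd letter, whose powers in A *)
(* are divided powers: x |-> x (dx)^[p-1] and (dx)^[b] |-> (dx)^[pb].                          *)
Definition Th m : ct * ct :=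
  ([ffun i => if bpar E i then m.1 i else p * m.1 i + p.-1 * m.2 i]%N,
   [ffun i => if bpar E i then p * m.2 i + p.-1 * m.1 i else m.2 i]%N).

(** [Th] multiplies weights by [p] and leaves one of the two exponents of each letter unchanged, so
    dividing the weight by [p] and subtracting recovers the other. *)
Definition Ps m : ct * ct :=
  ([ffun i => if bpar E i then m.1 i else (wt m i %/ p - m.2 i)%N],
   [ffun i => if bpar E i then (wt m i %/ p - m.1 i)%N else m.2 i]).

Lemma wt_Th m i : wt (Th m) i = (p * wt m i)%N.
Proof. by rewrite /wt !ffunE; case: (bpar E i); move: p_gt0; case: (p) => //= q _; ring. Qed.

Lemma pdiv_Th m : pdivc (wt (Th m)).
Proof. by apply/forallP => i; rewrite wt_Th dvdn_mulr. Qed.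

Lemma ThK m : Ps (Th m) = m.
Proof.
case: m => a b; congr pair; apply/ffunP => i; rewrite ffunE wt_Th mulKn // /wt !ffunE;
  by case: (bpar E i); rewrite // ?addnK ?addKn.
Qed.

Lemma ok_Th n l m : (n * p)%N = l -> okm E l (Th m) = okm E n m.
Proof.
case: m => a b <-; rewrite /okm /=; congr [&& _, _ & _].
- by apply: eq_forallb => i; rewrite /qS andbb ffunE; case: (bpar E i).
- by apply: eq_forallb => i; rewrite /qA andbb ffunE; case: (bpar E i).
rewrite -!degcD -[addc _ _]/(wt (Th (a, b))) -[addc a b]/(wt (a, b)).
have -> : degc (wt (Th (a, b))) = (degc (wt (a, b)) * p)%N.
  by rewrite /degc big_distrl /=; apply: eq_bigr => i _; rewrite wt_Th mulnC.
by rewrite eqn_pmul2r.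
Qed.

Lemma divp_split u v : (p %| u + v)%N -> (v <= 1)%N -> (p * ((u + v) %/ p - v) + p.-1 * v = u)%N.
Proof.
case/dvdnP => t tE; rewrite tE mulnK //; case: v tE => [|[|//]] tE _.
  by rewrite subn0 muln0 addn0 mulnC -tE addn0.
case: t tE => [|t]; first by rewrite mul0n addn1.
by rewrite subn1 /= muln1 mulSn mulnC addn1; move: p_gt0 => h0 h; lia.
Qed.

Lemma PsK l m : okm E l m -> pdivc (wt m) -> Th (Ps m) = m.
Proof.
case: m => a b /okmP[va vb _] /forallP pw; congr pair; apply/ffunP => i; rewrite !ffunE /=;
  have := pw i; have := forallP va i; have := forallP vb i; rewrite /qS /qA andbb /wt !ffunE /=;
  case: (bpar E i) => //=.
- by move=> vbi _ pwi; exact: divp_split.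
by move=> _ vai pwi; rewrite addnC in pwi; rewrite [(a i + b i)%N]addnC; exact: divp_split.
Qed.

Lemma pdiv_deg l m : okm E l m -> pdivc (wt m) -> (p %| l)%N.
Proof.
case: m => a b /okmP[_ _ <-] /forallP pw; rewrite -degcD; apply: dvdn_sum => i _; exact: pw.
Qed.

Section Descent.
Variables (n l : nat) (e : (n * p)%N = l) (Y : vectType k) (g : ct * ct -> Y).

(* [Zmap] reads off the components with weight divisible by [p], which determine the class of a cocycle. *)
Definition Zmap : 'Hom(Omega k l X, Y) := monlin E l (fun m => if pdivc (wt m) then g (Ps m) else 0).

Lemma Zmap_mon m : okm E l m -> Zmap (mon E l m) = if pdivc (wt m) then g (Ps m) else 0.
Proof. by move=> ok; rewrite /Zmap monlinE. Qed.

Lemma Zmap_Th m : okm E n m -> Zmap (mon E l (Th m)) = g m.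
Proof. by move=> ok; rewrite Zmap_mon ?(ok_Th _ e) // pdiv_Th ThK. Qed.

Lemma Zmap_proj x : Zmap (proj_p l x) = Zmap x.
Proof.
rewrite -comp_lfunE; congr (fun_of_lfun _ x); apply: (omega_ext k2 (E := E)) => m ok.
rewrite comp_lfunE proj_p_mon Zmap_mon //; case: ifP => [pw|_]; last by rewrite lfun0.
by rewrite Zmap_mon // pw.
Qed.

Lemma Zmap_dR x : Zmap (dR l X x) = 0.
Proof. by rewrite -Zmap_proj proj_p_dR lfun0. Qed.

End Descent.

End Homotopy.

Arguments Th {k} p {X} E m.
Arguments Ps {k} p {X} E m.
Arguments Zmap {k} p {X} E l {Y} g.
Arguments proj_p {k} p {X} E n.
Arguments htp {k} p {X} E n.

(** * The Cartier map *)

Section Lucas.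

Variables (k : fieldType) (p : nat) (charp : p \in [pchar k]).

Lemma coef_exp1X n j : ((1 + 'X : {poly k}) ^+ n)`_j = ('C(n, j))%:R.
Proof.
rewrite exprDn coef_sum; have [jn | nj] := leqP j n; last first.
  rewrite bin_small // big1 // => i _; rewrite expr1n mul1r coefMn coefXn.
  case: eqP => [ji|_]; last by rewrite mul0rn.
  by have := ltn_ord i; rewrite -ji ltnS leqNgt nj.
rewrite (bigD1 (Ordinal (jn : (j < n.+1)%N))) //= expr1n mul1r coefMn coefXn eqxx big1 ?addr0 // => i ij.
rewrite expr1n mul1r coefMn coefXn; case: eqP => [ji|_]; last by rewrite mul0rn.
by case/eqP: ij; apply: val_inj.
Qed.

(** Coefficients in [(1 + X)^(p m + r) = (1 + X^p)^m (1 + X)^r]: since [r] and [s] are below [p],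
    only the term [i = n] reaches degree [p n + s]. *)
Lemma lucas m n r s : (r < p)%N -> (s < p)%N ->
  ('C(p * m + r, p * n + s))%:R = ('C(m, n) * 'C(r, s))%:R :> k.
Proof.
move=> rp sp; have p_gt0 : (0 < p)%N by apply: leq_ltn_trans rp.
rewrite -coef_exp1X exprD exprM.
have -> : (1 + 'X : {poly k}) ^+ p = 1 + 'X ^+ p.
  rewrite exprDn_pchar ?expr1n //.
  by rewrite pnatE ?(pcharf_prime charp) // pchar_poly.
rewrite exprDn mulr_suml coef_sum.
have termE (i : 'I_m.+1) : (1 ^+ (m - i) * 'X^p ^+ i *+ 'C(m, i) * (1 + 'X : {poly k}) ^+ r)`_(p * n + s) =
    if (p * n + s < p * i)%N then 0 else ('C(m, i) * 'C(r, p * n + s - p * i))%:R.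
  rewrite expr1n mul1r -exprM mulrnAl coefMn coefXnM; case: ifP => _; first by rewrite mul0rn.
  by rewrite coef_exp1X natrM mulr_natl.
rewrite (eq_bigr _ (fun i _ => termE i)).
have [nm | mn] := leqP n m; last first.
  rewrite ['C(m, n)]bin_small // mul0n big1 // => i _; case: ifP => // _.
  rewrite ['C(r, _)]bin_small ?muln0 //; have := ltn_ord i; rewrite ltnS => im.
  apply: leq_trans rp _; rewrite leq_subRL; first by rewrite addnC -mulnS; apply: leq_trans (leq_addr _ _); rewrite leq_mul2l; lia.
  by apply: leq_trans (leq_addr _ _); rewrite leq_mul2l; lia.
rewrite (bigD1 (Ordinal (nm : (n < m.+1)%N))) //= ltnNge leq_addr addKn big1 ?addr0 // => i ni.
have {}ni : (i : nat) != n by apply: contra ni => /eqP ni; apply/eqP/val_inj.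
case: ifP => //; move/negbT; rewrite -leqNgt => ipn.
rewrite ['C(r, _)]bin_small ?muln0 //; apply: leq_trans rp _.
have {}ni : (i < n)%N.
  rewrite ltn_neqAle ni /= -ltnS -(ltn_pmul2l p_gt0) mulnS; apply: leq_ltn_trans ipn _.
  by rewrite addnC ltn_add2r.
rewrite leq_subRL // addnC -mulnS; apply: leq_trans (leq_addr _ _); rewrite leq_mul2l; lia.
Qed.

End Lucas.

Section CartierMap.

Variables (k : fieldType) (p : nat) (charp : p \in [pchar k]) (p_gt2 : (2 < p)%N).

Let p_pr : prime p := pcharf_prime charp.
Let p_gt0 : (0 < p)%N := prime_gt0 p_pr.

Lemma odd_p : odd p. Proof. by case: (even_prime p_pr) p_gt2 => [->|]. Qed.

Lemma pchar_gt2_neq0 : 2%:R != 0 :> k.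
Proof. by rewrite -(dvdn_pcharf charp); apply: contraL p_gt2 => /dvdn_leq h; rewrite -leqNgt h. Qed.

Let k2 := pchar_gt2_neq0.

Section Monomials.
Variables (X : superspace k) (E : hbase X).
Local Notation N := (bdim E).
Local Notation ct := {ffun 'I_N -> nat}.
Implicit Types (a b : ct).
Local Notation Th := (Th p E).

(** As [p] is odd, [p - 1] is even. All signs depend on these parities only, so [Th] leaves them
    unchanged. *)
Lemma odd_Th m i : (odd ((Th m).1 i) = odd (m.1 i)) * (odd ((Th m).2 i) = odd (m.2 i)).
Proof.
have op : odd p.-1 = false by move: odd_p p_gt0; case: (p) => //= q /negbTE.
by split; rewrite ffunE; case: (bpar E i); rewrite // oddD !oddM odd_p op addbF.
Qed.

Lemma odd_bform_ext q a a' b b' : (forall i, odd (a i) = odd (b i)) -> (forall i, odd (a' i) = odd (b' i)) ->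
  odd (bform q a a') = odd (bform q b b').
Proof.
move=> h h'; rewrite /bform !(big_morph odd oddD (erefl (odd 0))); apply: eq_bigr => i _.
by rewrite !(big_morph odd oddD (erefl (odd 0))); apply: eq_bigr => j _; rewrite !oddM h h'.
Qed.

Lemma parc_ext a b : (forall i, odd (a i) = odd (b i)) -> parc E a = parc E b.
Proof. by move=> h; apply: eq_bigr => i _; rewrite h. Qed.

Lemma ThD a b a' b' : (addc (Th (a, b)).1 (Th (a', b')).1, addc (Th (a, b)).2 (Th (a', b')).2) =
  Th (addc a a', addc b b').
Proof. by congr pair; apply/ffunP => i; rewrite /= !ffunE /= ?ffunE; case: (bpar E i) => //; ring. Qed.

(** For an odd letter at most one of [a i] and [a' i] is 1, so the last digits in base [p] are 0 or
    [p - 1] and add without carry; their binomial is 1. *)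
Lemma bindom_Th a b a' b' : validc (qS E) (addc a a') ->
  (bindom (Th (a, b)).2 (Th (a', b')).2)%:R = (bindom b b')%:R :> k.
Proof.
move=> v; rewrite /bindom !natr_prod; apply: eq_bigr => i _; rewrite !ffunE /=.
have := forallP v i; rewrite /qS andbb ffunE; case: (bpar E i) => //=.
have pp : (p.-1 < p)%N by rewrite prednK.
have E0 : (p * b i + p * b' i = p * (b i + b' i))%N by rewrite mulnDr.
case: (a i) => [|[|//]]; case: (a' i) => [|[|//]] // _; rewrite ?muln0 ?addn0 ?muln1.
- by have := lucas charp (b i + b' i) (b i) p_gt0 p_gt0; rewrite !addn0 bin0 muln1 mulnDr.
- have := lucas charp (b i + b' i) (b i) pp p_gt0; rewrite !addn0 bin0 muln1 mulnDr => <-.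
  by rewrite addnA.
have := lucas charp (b i + b' i) (b i) pp pp; rewrite binn muln1 mulnDr => <-.
by rewrite addnAC.
Qed.

Lemma mon_Th_mul (m n l : nat) (e : (m + n)%N = l) a b a' b' m1 n1 l1 :
  (m1 * p)%N = m -> (n1 * p)%N = n -> (l1 * p)%N = l ->
  okm E m1 (a, b) -> okm E n1 (a', b') ->
  omul e (mon E m (Th (a, b))) (mon E n (Th (a', b'))) =
  ((-1) ^+ msg a b a' b' * (bindom b b')%:R : k) *: mon E l (Th (addc a a', addc b b')).
Proof.
move=> em en el; rewrite -(ok_Th charp _ em) -(ok_Th charp _ en).
case E1: (Th (a, b)) => [A B]; case E2: (Th (a', b')) => [A' B'] ok ok'.
rewrite (mon_mul k2 e ok ok').
have -> : (addc A A', addc B B') = Th (addc a a', addc b b') by rewrite -ThD E1 E2.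
have [okD | nok] := boolP (okm E l (Th (addc a a', addc b b'))); last by rewrite mon0 // !scaler0.
move: okD; rewrite (ok_Th charp _ el) => /okmP[va _ _].
have hA i : odd (A i) = odd (a i) by have [<- _] := odd_Th (a, b) i; rewrite E1.
have hB i : odd (B i) = odd (b i) by have [_ <-] := odd_Th (a, b) i; rewrite E1.
have hA' i : odd (A' i) = odd (a' i) by have [<- _] := odd_Th (a', b') i; rewrite E2.
have hB' i : odd (B' i) = odd (b' i) by have [_ <-] := odd_Th (a', b') i; rewrite E2.
congr ((_ * _) *: _).
  by rewrite /msg (odd_bform_ext _ hA hA') (odd_bform_ext _ hB hB') (parc_ext hB) (parc_ext hA').
by have := bindom_Th b b' va; rewrite E1 E2.
Qed.

Lemma mon_Th_par l a b : mon E l (Th (a, b)) \in spart (Omega k l X) (parc E a (+) parc E b).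
Proof.
have := mon_par (E := E) l (Th (a, b)).1 (Th (a, b)).2; rewrite -surjective_pairing.
by rewrite (parc_ext (fun i => (odd_Th (a, b) i).1)) (parc_ext (fun i => (odd_Th (a, b) i).2)).
Qed.

Lemma dR_mon_Th n l m : (n * p)%N = l -> dR l X (mon E l (Th m)) = 0.
Proof.
move=> e; have [ok | nok] := boolP (okm E l (Th m)); last by rewrite mon0 // lfun0.
by rewrite [Th m]surjective_pairing (dR_pdiv k2 charp) -?surjective_pairing // pdiv_Th.
Qed.

Lemma Omega_hom_even n (Y : superspace k) (f : 'Hom(sspace (Omega k n X), Y)) :
  (forall a b, okm E n (a, b) -> f (mon E n (a, b)) \in spart Y (parc E a (+) parc E b)) ->
  f \in spart (shom (Omega k n X) Y) false.
Proof.
move=> fE; apply/mem_shom => c x xc; rewrite addbF -(hproj_id xc).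
have -> : f (hproj (Omega k n X) c x) = hproj Y c (f x); last exact: mem_hproj.
rewrite -[LHS]comp_lfunE -[RHS]comp_lfunE; congr (fun_of_lfun _ x).
apply: (omega_ext k2 (E := E)) => -[a b] ok; rewrite [LHS]comp_lfunE [RHS]comp_lfunE.
have mp := mon_par (E := E) n a b; have fp := fE a b ok.
have [pc | npc] := eqVneq c (parc E a (+) parc E b).
  by rewrite pc (hproj_id mp) (hproj_id fp).
by rewrite (hproj0 mp npc) (hproj0 fp npc) lfun0.
Qed.

End Monomials.

Definition tw_base (V : superspace k) : hbase (stwist V).
Proof.
apply: (@HBase k (stwist V) _ (fun i => @hpar k V i) (fun i : hidx V => (delta k i : stwist V))
  (fun i => linfun (fun t : stwist V => (t i : k^o)))).
- by move=> i; exact: (@mem_delta k _ (@hpar k V) i).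
- move=> i j; rewrite linfun_linear ?ffunE // => a u v; by rewrite !ffunE.
move=> x; rewrite {1}(ffun_deltaE x); apply: eq_bigr => i _; congr (_ *: _).
by rewrite linfun_linear // => a u v; rewrite !ffunE.
Defined.

Section Theta.
Variables (n l : nat) (e : (n * p)%N = l) (V : superspace k).
Local Notation E := (hb_base V).
Local Notation E1 := (tw_base V).

Definition ctheta : 'Hom(Omega k n (stwist V), coho k l V) :=
  monlin E1 n (fun m => cls (mon E l (Th p E m))).

Lemma ctheta_mon m : ctheta (mon E1 n m) = cls (mon E l (Th p E m)).
Proof.
apply: (@monlin_mon0 k _ E1 n _ (fun m => cls (mon E l (Th p E m))) m) => nok.
by rewrite mon0 ?lfun0 // (ok_Th charp _ e).
Qed.

(** The choice of representative made by [crep] does not matter, since [Zmap] kills coboundaries. *)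
Definition czeta : 'Hom(coho k l V, Omega k n (stwist V)) :=
  (Zmap p E l (mon E1 n) \o crep)%VF.

(** By [htpE] a cocycle differs from its projection by the differential of its image under [htp]. *)
Lemma cls_proj y : dR l V y = 0 -> cls (proj_p p E l y) = cls y.
Proof.
move=> dy; apply/esym; apply: (cls_eq (z := htp p E l y)) => //.
  rewrite -comp_lfunE -[RHS](zero_lfunE _ y); congr (fun_of_lfun _ y).
  apply: (omega_ext k2 (E := E)) => -[a b] ok; rewrite zero_lfunE comp_lfunE proj_p_mon //.
  by case: ifP => [pw | _]; rewrite ?lfun0 // (dR_pdiv k2 charp).
by rewrite {1}(htpE k2 charp E y) dy lfun0 addr0 addrC addKr.
Qed.

Lemma ctheta_Z y : ctheta (Zmap p E l (mon E1 n) y) = cls (proj_p p E l y).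
Proof.
rewrite -[LHS]comp_lfunE -[RHS]comp_lfunE; congr (fun_of_lfun _ y).
apply: (omega_ext k2 (E := E)) => m ok; rewrite [LHS]comp_lfunE [RHS]comp_lfunE.
rewrite (Zmap_mon _ _ ok) proj_p_mon; case: ifP => [pw | _]; last by rewrite !lfun0.
by rewrite ctheta_mon (PsK k2 charp ok pw).
Qed.

Lemma czetaK : cancel czeta ctheta.
Proof.
by move=> c; rewrite comp_lfunE ctheta_Z cls_proj ?crepK // crep_cocycle.
Qed.

Lemma cthetaK : cancel ctheta czeta.
Proof.
move=> x; rewrite -[LHS]comp_lfunE -[RHS]id_lfunE; congr (fun_of_lfun _ x).
apply: (omega_ext k2 (E := E1)) => m ok; rewrite id_lfunE [LHS]comp_lfunE ctheta_mon.
rewrite /czeta comp_lfunE; have [z ->] := crep_cls (dR_mon_Th (E := E) m e).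
by rewrite lfunD (Zmap_dR k2 charp) addr0 (Zmap_Th charp e).
Qed.

Lemma ctheta_even : ctheta \in spart (shom (Omega k n (stwist V)) (coho k l V)) false.
Proof.
apply: (Omega_hom_even (E := E1)) => a b ok; rewrite ctheta_mon; apply: cls_even.
  exact: dR_mon_Th e.
exact: (mon_Th_par (E := E)).
Qed.

End Theta.

(** Weights sum to the degree, so in a degree prime to [p] no monomial has all its weights divisible
    by [p]. *)
Lemma coho_eq0 l V (c : coho k l V) : ~~ (p %| l)%N -> c = 0.
Proof.
move=> pl; have [y dy <-] := cls_surj c; rewrite -cls_proj //.
have -> : proj_p p (hb_base V) l = 0.
  apply: (omega_ext k2 (E := hb_base V)) => m ok; rewrite zero_lfunE proj_p_mon.
  by case: ifP => // pw; rewrite (pdiv_deg ok pw) in pl.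
by rewrite zero_lfunE lfun0.
Qed.

Lemma ctheta_one V :
  ctheta 0 0 V (pa_one (Omega k) (stwist V)) = pa_one (HOmega k) V.
Proof.
rewrite HOmega_one -(mon_one k2 (tw_base V)) (ctheta_mon (mul0n p)) -(mon_one k2 (hb_base V)); congr (cls (mon _ _ _)).
by congr pair; apply/ffunP => i; rewrite !ffunE !muln0 if_same.
Qed.

Lemma ctheta_mul m n l (e : (m + n)%N = l) m1 n1 l1 (em : (m1 * p)%N = m) (en : (n1 * p)%N = n)
    (el : (l1 * p)%N = l) (e1 : (m1 + n1)%N = l1) V x y :
  ctheta l1 l V (omul e1 x y) = @pa_mul k (HOmega k) m n l e V (ctheta m1 m V x) (ctheta n1 n V y).
Proof.
have h1 a b a' b' : okm (tw_base V) m1 (a, b) -> okm (tw_base V) n1 (a', b') ->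
    ctheta l1 l V (omul e1 (mon (tw_base V) m1 (a, b)) (mon (tw_base V) n1 (a', b'))) =
    @pa_mul k (HOmega k) m n l e V (ctheta m1 m V (mon (tw_base V) m1 (a, b)))
      (ctheta n1 n V (mon (tw_base V) n1 (a', b'))).
  move=> ok ok'; rewrite (mon_mul k2 e1 ok ok') lfunZ !(ctheta_mon em, ctheta_mon en, ctheta_mon el).
  rewrite (cls_mul k2 e (dR_mon_Th _ em) (dR_mon_Th _ en)).
  have -> := mon_Th_mul (E := hb_base V) e em en el ok ok'.
  by rewrite lfunZ.
have h2 a b : okm (tw_base V) m1 (a, b) -> forall y,
    ctheta l1 l V (omul e1 (mon (tw_base V) m1 (a, b)) y) =
    @pa_mul k (HOmega k) m n l e V (ctheta m1 m V (mon (tw_base V) m1 (a, b))) (ctheta n1 n V y).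
  move=> ok {}y; rewrite -omulrE -[LHS]comp_lfunE.
  transitivity ((pa_prod (HOmega k) e V \o tensr _ (ctheta m1 m V (mon (tw_base V) m1 (a, b))) \o ctheta n1 n V)%VF y);
    last by rewrite 2!comp_lfunE tensrE.
  congr (fun_of_lfun _ y); apply: (omega_ext k2 (E := tw_base V)) => -[a' b'] ok'.
  by rewrite [LHS]comp_lfunE omulrE h1 // 2!comp_lfunE tensrE.
rewrite -omullE -[LHS]comp_lfunE.
transitivity ((pa_prod (HOmega k) e V \o tensl _ (ctheta n1 n V y) \o ctheta m1 m V)%VF x);
  last by rewrite 2!comp_lfunE tenslE.
congr (fun_of_lfun _ x); apply: (omega_ext k2 (E := tw_base V)) => -[a b] ok.
by rewrite [LHS]comp_lfunE omullE h2 // 2!comp_lfunE tenslE.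
Qed.

End CartierMap.

(** * Frobenius twist of an equivariant map *)

Section Blocks.

Variable k : fieldType.
Implicit Types (U V W X Y Z : superspace k).

Lemma lbox2_even m n l (e : (m + n)%N = l) V W b c f g :
  f \in spart (shom (tpow m V) (tpow m W)) b -> g \in spart (shom (tpow n V) (tpow n W)) c ->
  lbox2 e c f g \in spart (shom (tpow l V) (tpow l W)) (b (+) c).
Proof.
move=> fb gc; apply: hom_free_even => x; rewrite lbox2_delta; apply: memvZ.
have -> : wpar x (+) (b (+) c) = (wpar (wl e x : word m V) (+) b) (+) (wpar (wr e x : word n V) (+) c).
  by rewrite -{1}(wcat_split e x) wpar_wcat addbACA.
by apply: mem_tconc; apply: shom_spart; eauto; exact: mem_delta.
Qed.

Lemma gsplit_even m n l (e : (m + n)%N = l) V W : gsplit e V W \in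
  spart (shom (stens (ghom m V W) (ghom n V W)) (shom (tpow l V) (tpow l W))) false.
Proof.
apply: hom_free_even => -[i j]; rewrite addbF flin_delta /=.
by apply: lbox2_even; rewrite -gmap_par mem_hb.
Qed.

Section Cons.
Variables (n p l l' : nat) (e : (n.+1 * p)%N = l) (e' : (n * p)%N = l') (es : (p + l')%N = l).

Lemma wblock0 V (x : word l V) : wblock e x ord0 = wl es x.
Proof. by apply/ffunP => c; rewrite !ffunE; congr (x _); apply: ord_inj; rewrite posl_val. Qed.

Lemma wblock_lift V (x : word l V) a : wblock e x (lift ord0 a) = wblock e' (wr es x) a.
Proof.
apply/ffunP => c; rewrite !ffunE; congr (x _); apply: ord_inj; rewrite posr_val /= /bump /= add1n.
by rewrite mulSn addnA.
Qed.

Lemma tmconc_cons V (z : 'I_n.+1 -> tpow p V) :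
  tmconc e z = tconc es (z ord0) (tmconc e' (fun a => z (lift ord0 a))).
Proof.
apply/ffunP => x; rewrite !ffunE big_ord_recl wblock0; congr (_ * _).
by apply: eq_bigr => a _; rewrite wblock_lift.
Qed.

(** Peeling off the first block reduces [lbox] to [lbox2], so that results on splittings can be
    iterated. *)
Lemma lbox_cons V W (par : 'I_n.+1 -> bool) (f : 'I_n.+1 -> 'Hom(tpow p V, tpow p W)) :
  lbox e par f = lbox2 es (\big[addb/false]_a par (lift ord0 a)) (f ord0)
    (lbox e' (fun a => par (lift ord0 a)) (fun a => f (lift ord0 a))).
Proof.
apply: delta_ext => x; rewrite lbox2_delta !flin_delta tmconc_cons tconcZr scalerA wblock0; congr (_ *: _).
  rewrite big_ord_recl [X in (X + _)%N]big1 ?add0n => [|b]; last by rewrite ltn0.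
  rewrite (eq_bigr (fun a : 'I_n => (par (lift ord0 a) && wpar (wl es x : word p V)) +
     \sum_(b < n | (b < a)%N) (par (lift ord0 a) && wpar (wblock e' (wr es x : word l' V) b)))%N).
    rewrite big_split exprD /=; congr (_ * _); rewrite -signr_odd; congr (_ ^+ nat_of_bool _).
    rewrite (big_morph odd oddD (erefl (odd 0))).
    elim/big_ind2: _ => // [x1 x2 y1 y2 -> -> | i _]; first by rewrite andb_addl.
    by rewrite oddb.
  move=> a _; rewrite big_mkcond big_ord_recl /= wblock0 [in RHS]big_mkcond; congr addn.
  by apply: eq_bigr => b _; rewrite /bump /= !add1n ltnS wblock_lift.
by congr (tconc _ _ _); apply/ffunP => y; rewrite !ffunE; apply: eq_bigr => a _; rewrite wblock_lift.
Qed.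

End Cons.

Lemma gblocks_delta n p l (e : (n * p)%N = l) V W (w : word n (ghom p V W)) :
  gblocks e V W (delta k w) = lbox e (fun a => hpar (w a)) (fun a => gmap (hb (w a))).
Proof. exact: flin_delta. Qed.

Lemma eq_lbox n p l (e : (n * p)%N = l) V W (par par' : 'I_n -> bool) (f f' : 'I_n -> 'Hom(tpow p V, tpow p W)) :
  par =1 par' -> f =1 f' -> lbox e par f = lbox e par' f'.
Proof.
move=> pp ff; apply: delta_ext => x; rewrite !flin_delta; congr (_ *: _).
  by congr (_ ^+ _); apply: eq_bigr => a _; apply: eq_bigr => b _; rewrite pp.
by apply/ffunP => y; rewrite !ffunE; apply: eq_bigr => a _; rewrite ff.
Qed.

Lemma gblocks_cons n p l l' (e : (n.+1 * p)%N = l) (e' : (n * p)%N = l') (es : (p + l')%N = l) V W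
    (i : hidx (ghom p V W)) q (t : tpow n (ghom p V W)) : t \in spart (tpow n (ghom p V W)) q ->
  gblocks e V W (tconc (add1n n) (delta k ([ffun=> i] : word 1 (ghom p V W)) : tpow 1 _) t) =
  lbox2 es q (gmap (hb i)) (gblocks e' V W t).
Proof.
move=> tq; apply: delta_ext => x; rewrite lbox2_delta {1}(ffun_deltaE t) tconc_sumr lfun_sum sum_lfunE.
rewrite [in RHS](ffun_deltaE t) lfun_sum sum_lfunE tconc_sumr scaler_sumr; apply: eq_bigr => w _.
rewrite tconcZr !lfunZ !scale_lfunE tconcZr scalerA mulrC -scalerA; have [wq | nwq] := eqVneq (wpar w) q; last first.
  by rewrite (free_par tq nwq) !scale0r.
congr (_ *: _); rewrite tconc_delta !gblocks_delta (lbox_cons e e' es) lbox2_delta.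
set u := wcat _ _ _.
have u0 : u ord0 = i.
  by rewrite /u -[ord0](_ : posl (add1n n) ord0 = _) ?wcat_l ?ffunE //; apply: ord_inj; rewrite posl_val.
have ul a : u (lift ord0 a) = w a.
  by rewrite /u -[lift ord0 a](_ : posr (add1n n) a = _) ?wcat_r //; apply: ord_inj; rewrite posr_val /bump /= add1n.
have -> : \big[addb/false]_(a < n) hpar (u (lift ord0 a)) = q.
  by rewrite -wq /wpar; apply: eq_bigr => a _; rewrite ul.
by rewrite u0 (eq_lbox e' (par' := fun a => hpar (w a)) (f' := fun a => gmap (hb (w a)))) // => a; rewrite ul.
Qed.

(** The inclusion of Gamma^(np) in the [n]-th tensor power of Gamma^p, by iterating [ghom_split].
    Parity is carried along because [gblocks_cons] needs a homogeneous tail. *)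
Lemma gblocks_surj n p l (e : (n * p)%N = l) V W c (f : ghom l V W) : f \in spart (ghom l V W) c ->
  exists2 t, t \in spart (tpow n (ghom p V W)) c & gblocks e V W t = gmap f.
Proof.
elim: n l e c f => [|n IH] l e c f fc.
  case: l / e f fc => f fc; exists ((gmap f (delta k (word0 V)) (word0 W) : k) *: delta k (word0 (ghom p V W))).
    case: c fc => fc; last by apply: memvZ; have := @mem_delta k _ (@wpar k 0 (ghom p V W)) (word0 _); rewrite /wpar big_ord0.
    rewrite gmap_par in fc; have := shom_spart fc (@mem_delta k _ (@wpar k 0 V) (word0 V)).
    rewrite /wpar big_ord0 => h; rewrite (free_par h) ?scale0r ?mem0v //; by rewrite /wpar big_ord0.
  apply: delta_ext => x; rewrite (word0_eq x) lfunZ scale_lfunE !flin_delta big_ord0 scale1r.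
  apply/ffunP => y; rewrite (word0_eq y) !ffunE big_ord0; exact: mulr1.
have es : (p + n * p)%N = l by rewrite -e mulSn.
have [t0 t0f] := ghom_split es f.
pose t1 := hproj _ c t0; have t1c : t1 \in spart _ c := mem_hproj _ _.
have t1f : gsplit es V W t1 = gmap f.
  by rewrite -(hproj_even c t0 (gsplit_even es V W)) t0f hproj_id // -gmap_par.
have [tt ttP] : exists tt : hidx (ghom (n * p) V W) -> tpow n (ghom p V W),
    forall j, tt j \in spart _ (hpar j) /\ gblocks (erefl (n * p)%N) V W (tt j) = gmap (hb j).
  have h j : exists t, t \in spart (tpow n (ghom p V W)) (hpar j) /\
      gblocks (erefl (n * p)%N) V W t = gmap (hb j : ghom (n * p) V W).
    by have [t th tE] := IH _ (erefl (n * p)%N) _ _ (mem_hb j); exists t.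
  exact: (fin_all_exists h).
pose d i : tpow 1 (ghom p V W) := delta k ([ffun=> i] : word 1 (ghom p V W)).
have dpar i : d i \in spart _ (hpar i).
  by have := @mem_delta k _ (@wpar k 1 (ghom p V W)) [ffun=> i]; rewrite /wpar big_ord1 ffunE.
exists (\sum_ij (t1 ij : k) *: tconc (add1n n) (d ij.1) (tt ij.2)).
  apply: memv_suml => -[i j] _; rewrite -[(i, j).1]/i -[(i, j).2]/j; have [ij | nij] := eqVneq (hpar i (+) hpar j) c.
    by rewrite memvZ // -ij; apply: mem_tconc; [exact: dpar | have [] := ttP j].
  by rewrite (@free_par k _ _ c t1 (i, j) t1c nij) scale0r mem0v.
rewrite -t1f; apply/lfunP => u; rewrite gsplit_app lfun_sum sum_lfunE; apply: eq_bigr => -[i j] _.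
rewrite lfunZ scale_lfunE -![(_, _).1]/i -![(_, _).2]/j; congr (_ *: _).
by have [tj <-] := ttP j; rewrite /d (gblocks_cons e (erefl _) es i tj).
Qed.

Lemma tbox_tmul n V W (par q : 'I_n -> bool) (g : 'I_n -> 'Hom(sspace V, sspace W)) (v : 'I_n -> sspace V) :
  (forall a, v a \in spart V (q a)) ->
  tbox par g (tmul v) = ((-1) ^+ (\sum_(a < n) \sum_(b < n | (b < a)%N) (par a && q b)) : k)
    *: tmul (fun a => g a (v a)).
Proof.
move=> vq; rewrite {1}(ffun_deltaE (tmul v)) lfun_sum.
rewrite [in RHS](eq_tmul (v' := fun a => \sum_i hcoord i (v a) *: g a (hb i))); last first.
  by move=> a; rewrite {1}(hcoord_sum (v a)) lfun_sum; apply: eq_bigr => i _; rewrite lfunZ.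
rewrite tmul_expand scaler_sumr; apply: eq_bigr => w _; rewrite lfunZ flin_delta tmulZ !scalerA mulrC ffunE.
have [/forallP wq | ] := boolP [forall a, hpar (w a) == q a].
  congr (_ * _ *: _); congr (_ ^+ _); apply: eq_bigr => a _; apply: eq_bigr => b _.
  by rewrite (eqP (wq b)).
rewrite negb_forall => /existsP[a na].
have z : \prod_(a < n) hcoord (w a) (v a) = 0.
  by apply/eqP/prodf_eq0; exists a; rewrite ?(hcoord_par (vq a) na).
by rewrite !z !mulr0 !scale0r.
Qed.

End Blocks.

(** * Matrix coefficients of the twist of a morphism *)

Section Frobenius.

Variables (k : fieldType) (p : nat) (charp : p \in [pchar k]) (p_gt2 : (2 < p)%N).
Implicit Types (U V W X Y Z : superspace k).

Let p_pr : prime p := pcharf_prime charp.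
Let p_gt0 : (0 < p)%N := prime_gt0 p_pr.

Lemma hb_base_tw n V (w : word n V) : tw (hb_base V) w = delta k w :> tpow n V.
Proof. by rewrite -tmul_hb; apply: eq_tmul. Qed.

Lemma hb_base_tc n V (w : word n V) (z : tpow n V) : tc (hb_base V) w z = z w.
Proof.
rewrite {2}(tw_sum (hb_base V) z) sum_ffunE (sum_only (i := w)) => [|w' ww'].
  by rewrite hb_base_tw !ffunE eqxx; exact/esym/mulr1.
by rewrite hb_base_tw !ffunE eq_sym (negPf ww'); exact: mulr0.
Qed.

Lemma pfrob_mapE V W (f : ghom p V W) (i : hidx V) (i' : hidx W) :
  (pf_map (pfrob k p) f (delta k i : stwist V) : stwist W) i' =
  if hpar i' == hpar i then gmap f (delta k ([ffun=> i] : word p V)) ([ffun=> i'] : word p W) else 0.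
Proof.
pose G (f : ghom p V W) (i : hidx V) : stwist W := \sum_(j | hpar j == hpar i)
  (gmap f (delta k ([ffun=> i] : word p V)) ([ffun=> j] : word p W) : k) *: (delta k j : stwist W).
have L : linear (fun f : ghom p V W => (flin (G f) : 'Hom(stwist V, stwist W))).
  move=> a g h; apply: delta_ext => x; rewrite add_lfunE scale_lfunE !flin_delta /G scaler_sumr -big_split.
  by apply: eq_bigr => y _; rewrite gmapP add_lfunE scale_lfunE !ffunE scalerDl scalerA.
have -> : pf_map (pfrob k p) f = flin (G f) by exact: (linfun_linear L f).
rewrite flin_delta /G sum_ffunE; case: ifP => ij.
  rewrite (bigD1 i') //= big1 => [|y /andP[_ yi]]; first by rewrite addr0 !ffunE eqxx; exact: mulr1.
  by rewrite !ffunE eq_sym (negPf yi); exact: mulr0.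
rewrite big1 // => y yi; rewrite !ffunE; case: eqP => [E|_]; last exact: mulr0.
by rewrite E yi in ij.
Qed.

Section Words.
Variables (n l : nat) (e : (n * p)%N = l).

Lemma bidx_lt (y : 'I_l) : (y %/ p < n)%N.
Proof. by rewrite ltn_divLR // e. Qed.

Definition bidx (y : 'I_l) : 'I_n := Ordinal (bidx_lt y).

Definition rep (T : Type) (v : {ffun 'I_n -> T}) : {ffun 'I_l -> T} := [ffun y => v (bidx y)].

Lemma bidx_blk a (c : 'I_p) : bidx (Ordinal (wblock_lt e a c)) = a.
Proof. by apply: ord_inj; rewrite /= divnMDl // divn_small ?addn0. Qed.

Lemma wblock_rep V (v : word n V) a : wblock e (rep v) a = [ffun=> v a].
Proof. by apply/ffunP => c; rewrite !ffunE bidx_blk. Qed.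

(** An odd number of repetitions keeps the parity, so Koszul signs on the twist match those on
    repeated words. *)
Lemma wpar_const V (i : hidx V) : wpar ([ffun=> i] : word p V) = hpar i.
Proof.
have op : odd p by case: (even_prime p_pr) p_gt2 => [->|].
rewrite /wpar (eq_bigr (fun=> hpar i)) => [|a _]; last by rewrite ffunE.
have E b m : iter m (addb b) false = odd m && b by elim: m => //= m ->; case: (odd m); case: b.
by rewrite big_const_ord E op.
Qed.

Lemma big_bidx (R : Type) (idx : R) (op : Monoid.com_law idx) (F : 'I_n -> R) :
  \big[op/idx]_(y < l) F (bidx y) = \big[op/idx]_(a < n) \big[op/idx]_(c < p) F a.
Proof.
pose g (x : 'I_n * 'I_p) : 'I_l := Ordinal (wblock_lt e x.1 x.2).
pose g' (y : 'I_l) : 'I_n * 'I_p := (bidx y, Ordinal (ltn_pmod y p_gt0)).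
have gK : {on [pred i | true], bijective g}.
  exists g' => [[a c]|y] _; last by apply: ord_inj; rewrite /= -divn_eq.
  rewrite /g' bidx_blk; congr (_, _); apply: ord_inj; by rewrite /= modnMDl modn_small.
rewrite (reindex g gK) -(pair_bigA _ (fun a c => F (bidx (g (a, c))))).
by apply: eq_bigr => a _; apply: eq_bigr => c _; rewrite bidx_blk.
Qed.

Lemma wpar_rep V (v : word n V) : wpar (rep v : word l V) = wpar v.
Proof.
rewrite /wpar (eq_bigr (fun y => hpar (v (bidx y)))) => [|y _]; last by rewrite ffunE.
rewrite (big_bidx _ (fun a => hpar (v a))); apply: eq_bigr => a _.
by rewrite -[RHS]wpar_const; apply: eq_bigr => c _; rewrite ffunE.
Qed.

Lemma content_rep N (w : {ffun 'I_n -> 'I_N}) i : content (rep w) i = (p * content w i)%N.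
Proof.
rewrite !ffunE (eq_bigr (fun y => (w (bidx y) == i) : nat)) => [|y _]; last by rewrite ffunE.
rewrite (big_bidx _ (fun a => (w a == i) : nat)) big_distrr; apply: eq_bigr => a _.
by rewrite sum_nat_const card_ord.
Qed.

(** The lift moves whole blocks and keeps the place inside each block. *)
Lemma blk_perm (s : 'S_n) : exists t : 'S_l, forall (T : Type) (v : {ffun 'I_n -> T}),
  rep (wact s v) = wact t (rep v).
Proof.
have lt (y : 'I_l) : (s (bidx y) * p + y %% p < l)%N.
  by have := wblock_lt e (s (bidx y)) (Ordinal (ltn_pmod y p_gt0)).
pose g (y : 'I_l) : 'I_l := Ordinal (lt y).
have bg y : bidx (g y) = s (bidx y).
  by apply: ord_inj; rewrite /= divnMDl // divn_small ?addn0 // ltn_pmod.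
have ginj : injective g.
  move=> y y' E; have Eb : bidx y = bidx y' by apply: (@perm_inj _ s); rewrite -!bg E.
  apply: ord_inj; rewrite (divn_eq y p) (divn_eq y' p); congr (_ + _)%N.
    by congr (_ * p)%N; exact: (congr1 val Eb).
  by have := congr1 (fun z : 'I_l => (z %% p)%N) E; rewrite /= !modnMDl !modn_mod.
exists (perm ginj) => T v; apply: (ffun_perm_ext (s := perm ginj)) => y.
by rewrite wact_at !ffunE [perm ginj y]permE bg permK.
Qed.

Definition same_par V W (v : word n V) (w : word n W) : bool := [forall a, hpar (w a) == hpar (v a)].

(** [pfrob] reads the coefficient of a morphism at constant words of length [p]; the product of
    these over the blocks is a coefficient at words of repeated letters. *)
Lemma pcompose_img_tw V W u (v : word n V) (w : word n W) :
  tc (tw_base W) w (pcompose_img n (pfrob k p) V W u (tw (tw_base V) v)) =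
  if same_par v w then (gblocks e V W u (delta k (rep v)) (rep w) : k) else 0.
Proof.
transitivity (\sum_s (u s : k) * (if same_par v w then gblocks e V W (delta k s) (delta k (rep v)) (rep w) else 0)); last first.
  case: ifP => _; last by rewrite big1 // => s _; rewrite mulr0.
  by rewrite [in RHS](ffun_deltaE u) lfun_sum sum_lfunE sum_ffunE; apply: eq_bigr => s _;
    rewrite lfunZ scale_lfunE ffunE.
rewrite {1}(ffun_deltaE u) lfun_sum sum_lfunE lfun_sum; apply: eq_bigr => s _.
rewrite lfunZ scale_lfunE lfunZ; congr (_ * _).
rewrite gblocks_delta [pcompose_img _ _ _ _ _]flin_delta.
rewrite /tw (@tbox_tmul k n _ _ _ (fun a => hpar (v a))); last by move=> a; exact: (bvec_par (tw_base V)).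
rewrite lfunZ tc_tmul flin_delta -[_ *: _]/(_ * _) !ffunE -[RHS]/(if _ then _ * _ else 0).
have coE (z : stwist W) i : bco (tw_base W) i z = z i.
  by rewrite /= linfun_linear // => a y y'; rewrite !ffunE.
rewrite (eq_bigr (fun a => if hpar (w a) == hpar (v a) then
   gmap (hb (s a)) (delta k ([ffun=> v a] : word p V)) ([ffun=> w a] : word p W) else 0)); last first.
  by move=> a _; exact: etrans (coE _ _) (pfrob_mapE (hb (s a)) (v a) (w a)).
case: ifP => [/forallP vw | /negbT]; last first.
  rewrite negb_forall => /existsP[a na]; rewrite [\prod_a _](_ : _ = 0) ?mulr0 //.
  by apply/eqP/prodf_eq0; exists a; rewrite ?(negPf na).
congr (_ * _).
  by congr (_ ^+ _); apply: eq_bigr => a _; apply: eq_bigr => b _; rewrite wblock_rep wpar_const.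
by apply: eq_bigr => a _; rewrite vw !wblock_rep.
Qed.

Lemma gmap_gblocks V W (f : ghom l V W) : gmap f \in limg (gblocks e V W).
Proof.
have [t0 _ t0E] := gblocks_surj e (mem_hproj (V := ghom l V W) false f).
have [t1 _ t1E] := gblocks_surj e (mem_hproj (V := ghom l V W) true f).
have -> : gmap f = gblocks e V W (t0 + t1).
  rewrite lfunD t0E t1E -{1}(hproj_sum (V := ghom l V W) f); exact: lfunD.
exact: memv_img (memvf _).
Qed.

(* The matrix of the Frobenius twist of [f]; by [frobmx_tw] its coefficients are those of [f] *)
(* on words whose letters are repeated [p] times.                                             *)
Definition frobmx V W (f : ghom l V W) : 'Hom(tpow n (stwist V), tpow n (stwist W)) :=
  pcompose_img n (pfrob k p) V W ((gblocks e V W)^-1%VF (gmap f)).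

Lemma frobmx_tw V W (f : ghom l V W) (v : word n V) (w : word n W) :
  tc (tw_base W) w (frobmx f (tw (tw_base V) v)) =
  if same_par v w then (gmap f (delta k (rep v)) (rep w) : k) else 0.
Proof. by rewrite /frobmx pcompose_img_tw limg_lfunVK // gmap_gblocks. Qed.

(** Words joined by a nonzero coefficient have matching parities, so their signs agree; the
    coefficients agree because [f] commutes with the block permutation lifting [s]. *)
Lemma frobmx_equiv V W (f : ghom l V W) : frobmx f \in equivariant n (stwist V) (stwist W).
Proof.
apply/mem_equivariant => s; apply: (tw_ext (E := tw_base V)) => v; apply: (tc_inj (E := tw_base W)) => w.
rewrite 2!comp_lfunE tact_tw !lfunZ -[w](_ : wact s (wact (s^-1)%g w) = w); last by rewrite -wactM mulVg wact1.
move: (wact (s^-1)%g w : word n W) => {}w; rewrite tc_tact !frobmx_tw.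
have -> : same_par (wact s v : word n V) (wact s w : word n W) = same_par v w.
  apply/forallP/forallP => h a; last by rewrite !ffunE.
  by have := h (s a); rewrite !wact_at.
case: ifP => [/forallP vw | _]; last by rewrite scaler0 mulr0.
rewrite -[_ *: _]/(_ * _); congr (_ * _).
  congr (_ ^+ nat_of_bool _); apply: eq_inv => a b; by rewrite /qS /= !(eqP (vw _)).
have [t tE] := blk_perm s; rewrite !tE.
have := gmap_tact f t (delta k (rep v)); rewrite tact_delta lfunZ.
move/(congr1 (tc (hb_base W) (wact t (rep w)))); rewrite tc_tact lfunZ !hb_base_tc -[_ *: _]/(_ * _).
rewrite (_ : inv t (fun a b => qS (hb_base W) (rep w a) (rep w b)) =
   inv t (fun a b => hpar (rep v a) && hpar (rep v b))); last first.
  by apply: eq_inv => a b; rewrite /qS /= !ffunE !(eqP (vw _)).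
by apply: mulfI; rewrite signr_eq0.
Qed.

Definition frob V W (f : ghom l V W) : ghom n (stwist V) (stwist W) :=
  ssub_pr (equivariant n (stwist V) (stwist W)) (frobmx f).

Lemma gmap_frob V W (f : ghom l V W) : gmap (frob f) = frobmx f.
Proof. exact: gmap_pr (frobmx_equiv f). Qed.

Lemma pcompose_map (F : pfunctor k n) V W (f : ghom l V W) :
  pf_map (pcompose e F (pfrob k p)) f = pf_map F (frob f).
Proof.
transitivity ((pf_mor F (stwist V) (stwist W) \o ssub_pr (equivariant n (stwist V) (stwist W)) \o
  pcompose_img n (pfrob k p) V W \o (gblocks e V W)^-1 \o ssub_in (equivariant l V W))%VF f) => //.
by rewrite 4!comp_lfunE.
Qed.

End Words.

(** Repeating letters commutes with concatenation and preserves parities, hence signs. This is what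
    lets naturality pass to products. *)
Lemma frobmx_lbox2 n1 n2 n l1 l2 l (e1 : (n1 * p)%N = l1) (e2 : (n2 * p)%N = l2) (e : (n * p)%N = l)
    (en : (n1 + n2)%N = n) (el : (l1 + l2)%N = l) V W (f : ghom l V W) (I : finType)
    (cf : I -> k) (g : I -> ghom l1 V W) (h : I -> ghom l2 V W) (q : I -> bool) :
  (forall u, gmap f u = \sum_i cf i *: lbox2 el (q i) (gmap (g i)) (gmap (h i)) u) ->
  forall u, gmap (frob e f) u = \sum_i cf i *: lbox2 en (q i) (gmap (frob e1 (g i))) (gmap (frob e2 (h i))) u.
Proof.
move=> fE u; transitivity ((\sum_i cf i *: lbox2 en (q i) (gmap (frob e1 (g i))) (gmap (frob e2 (h i))))%VF u);
  last by rewrite sum_lfunE; apply: eq_bigr => i _; rewrite scale_lfunE.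
congr (fun_of_lfun _ u); apply: (tw_ext (E := tw_base V)) => v; apply: (tc_inj (E := tw_base W)) => w.
rewrite sum_lfunE lfun_sum gmap_frob frobmx_tw fE sum_ffunE.
have repE (T : Type) (x : {ffun 'I_n -> T}) : rep e x = wcat el (rep e1 (wl en x)) (rep e2 (wr en x)).
  apply/ffunP; apply: (pos_ind (e := el)) => y; rewrite ?wcat_l ?wcat_r !ffunE; congr (x _); apply: ord_inj.
    by rewrite -!/(_ %/ p)%N posl_val /bidx -[LHS]/(posl el y %/ p)%N posl_val.
  by rewrite posr_val -[LHS]/(posr el y %/ p)%N posr_val -e1 divnMDl.
have vpar : tw (tw_base V) (wl en v) \in spart (tpow n1 (stwist V)) (wpar (rep e1 (wl en v) : word l1 V)).
  rewrite (_ : wpar _ = \big[addb/false]_a bpar (tw_base V) (wl en v a)); first exact: tw_spart.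
  exact: wpar_rep.
rewrite [RHS](eq_bigr (fun i => cf i * ((-1) ^+ (q i && wpar (rep e1 (wl en v) : word l1 V)) *
    ((if same_par (wl en v : word n1 V) (wl en w : word n1 W) then
        gmap (g i) (delta k (rep e1 (wl en v))) (rep e1 (wl en w)) else 0) *
     (if same_par (wr en v : word n2 V) (wr en w : word n2 W) then
        gmap (h i) (delta k (rep e2 (wr en v))) (rep e2 (wr en w)) else 0))) : k)); last first.
  move=> i _; rewrite scale_lfunE lfunZ; congr (_ * _).
  rewrite -{1}(wcat_split en v) -tconc_tw (lbox2E _ _ _ _ _ vpar) lfunZ tc_tconc.
  by rewrite !gmap_frob !frobmx_tw.
have -> : same_par v w = same_par (wl en v : word n1 V) (wl en w : word n1 W) &&
    same_par (wr en v : word n2 V) (wr en w : word n2 W).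
  apply/forallP/andP => [vw | [/forallP h1 /forallP h2]].
    by split; apply/forallP => a; rewrite !ffunE.
  by apply: (pos_ind (e := en)) => a; [have := h1 a | have := h2 a]; rewrite !ffunE.
case: (same_par _ _) => /=; last by rewrite big1 // => i _; rewrite mul0r !mulr0.
case: (same_par _ _); last by rewrite big1 // => i _; rewrite !mulr0.
apply: eq_bigr => i _; rewrite ffunE -[_ *: _]/(_ * _); congr (_ * _).
rewrite !repE lbox2_delta ffunE wcatK wcatKr -[_ *: _]/(_ * _) ffunE; congr (_ * (_ * _)).
  by congr (_ _); rewrite -[RHS](wcatK el _ (rep e2 (wr en w))).
by congr (_ _); rewrite -[RHS](wcatKr el (rep e1 (wl en w)) _).
Qed.

End Frobenius.

(** * Naturality of the Cartier map *)

Section ConstantWords.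

Variables (k : fieldType) (k2 : 2%:R != 0 :> k).
Implicit Types (X Y : superspace k).

Lemma content_const N n (i : 'I_N) : content ([ffun=> i] : {ffun 'I_n -> 'I_N}) = singc i n.
Proof.
apply/ffunP => j; rewrite !ffunE (eq_bigr (fun=> (i == j) : nat)) => [|x _]; last by rewrite ffunE.
by rewrite sum_nat_const card_ord eq_sym; case: eqP; rewrite ?muln1 ?muln0.
Qed.

Lemma content_const_inv N n (i : 'I_N) (w : {ffun 'I_n -> 'I_N}) : content w = singc i n -> w = [ffun=> i].
Proof.
move=> cw; apply/ffunP => x; have := content_gt0 w x; rewrite cw !ffunE.
by case: eqP.
Qed.

Lemma wsgn_const N n q (i : 'I_N) : validc q (singc i n) -> wsgn k q ([ffun=> i] : {ffun 'I_n -> 'I_N}) = 1.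
Proof.
rewrite /wsgn content_const => ->; rewrite /weps big1 // => x _.
by rewrite !ffunE ltnn andbF.
Qed.

Lemma wcat_const (T : Type) m n l (e : (m + n)%N = l) (t : T) :
  wcat e [ffun=> t] [ffun=> t] = [ffun=> t].
Proof. by apply/ffunP; apply: (pos_ind (e := e)) => y; rewrite ?wcat_l ?wcat_r !ffunE. Qed.

Section Coefficients.
Variables (X : superspace k) (E : hbase X).
Local Notation N := (bdim E).
Local Notation ct := {ffun 'I_N -> nat}.
Implicit Types (a b : ct).

(** A coordinate can be read on any representative: the sum over [w1] is the functional [lamS] on
    the S-part, while one word [w2] suffices for the alternating part. *)
Lemma co_SA n (i : 'I_n.+1) z x a b (w2 : {ffun 'I_i -> 'I_N}) :
    SAi (V := X) (i := i) z x -> content w2 = b -> validc (qA E) b ->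
  co E n (a, b) (om i x) = \sum_(w1 : {ffun 'I_(n - i) -> 'I_N} | content w1 == a)
    wsgn k (qS E) w1 * (wsgn k (qA E) w2 * (tc E (wcat (subnK (leq_ord i)) w1 w2) z : k)).
Proof.
case/SA_basis => I [cf [al [y [p [q [_ _ -> ->]]]]]] cw vb.
rewrite !lfun_sum; transitivity (\sum_(w1 : {ffun 'I_(n - i) -> 'I_N} | content w1 == a) \sum_j
  cf j * ((wsgn k (qS E) w1 * (tc E w1 (al j) : k)) * (cA E i b (y j) : k))); last first.
  apply: eq_bigr => w1 _; rewrite lfun_sum mulr_sumr mulr_sumr; apply: eq_bigr => j _.
  rewrite lfunZ -[_ *: _]/(_ * _) tc_tconc wcatK wcatKr (tc_ain k2) cw.
  move: (wsgn_sq k (qA E) w2); rewrite cw vb.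
  move: (wsgn k (qS E) w1) (wsgn k (qA E) w2) (tc E w1 (al j) : k) (cA E i b (y j) : k) => s s' u v ss.
  by rewrite -[v in LHS]mul1r -[1]ss; ring.
rewrite exchange_big; apply: eq_bigr => j _; rewrite !lfunZ -[_ *: _]/(_ * _) -mulr_sumr; congr (_ * _).
by rewrite co_om -mulr_suml; congr (_ * _); rewrite cS_spi lamSE.
Qed.

Lemma co_om_neq n (i : 'I_n.+1) x a b : degc b != i -> co E n (a, b) (om i x) = 0.
Proof.
move=> nb; rewrite (stens_sum x) !lfun_sum big1 // => ij _; rewrite !lfunZ co_om.
rewrite -[cA E i (a, b).2]/(cA E i b) /cA.
have [[w _ cw] | [-> _]] := wsgn_pick i b; last by rewrite zero_lfunE mulr0 scaler0.
by rewrite -cw degc_content eqxx in nb.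
Qed.

(** With a single letter the orbit sums have one term, so a constant word represents the
    monomial. *)
Lemma SA_const n (i : 'I_N) u v : okm E n (singc i u, singc i v) ->
  exists (r : 'I_n.+1) x, [/\ r = v :> nat, mon E n (singc i u, singc i v) = om r x &
    SAi (V := X) (i := r) (tw E [ffun=> i]) x].
Proof.
move=> /okmP[vS vA uv]; rewrite !degc_sing in uv.
have vn : (v < n.+1)%N by rewrite ltnS -uv leq_addl.
pose r := Ordinal vn; have ur : (n - r)%N = u by rewrite /= -uv addnK.
exists r, (tens (mS E (n - r) (singc i u)) (mA E r (singc i v))).
split => //; first by rewrite (mon_om _ (i := r)) ?degc_sing.
have := SA_tens (subnK (leq_ord r)) (tw E ([ffun=> i] : {ffun 'I_(n - r) -> 'I_N})) (mA E r (singc i v)).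
have eu : singc i (n - r) = singc i u by rewrite ur.
rewrite (spi_tw k2) content_const wsgn_const eu // scale1r ain_mA /avec.
rewrite (eq_bigl (pred1 ([ffun=> i] : {ffun 'I_r -> 'I_N}))); last first.
  move=> w; apply/eqP/eqP => [/content_const_inv | ->] //; exact: content_const.
rewrite big_pred1_eq wsgn_const // scale1r tconc_tw; congr (SA _ _ _).
exact: (congr1 (tw E) (wcat_const _ _)).
Qed.

End Coefficients.

Section Maps.
Variables (X Y : superspace k) (E : hbase X) (F : hbase Y) (n : nat) (g : ghom n X Y).

Lemma co_map_sing i j u v u' v' :
    okm E n (singc i u, singc i v) -> okm F n (singc j u', singc j v') ->
  co F n (singc j u', singc j v') (pf_map (Omega k n) g (mon E n (singc i u, singc i v))) =
  if v' == v then (tc F [ffun=> j] (gmap g (tw E [ffun=> i])) : k) else 0.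
Proof.
move=> ok /okmP[vS vA]; rewrite !degc_sing => uv'; have [r [x [rv -> zx]]] := SA_const ok.
rewrite Omega_mapE; have [vv|nv] := eqVneq v' v; last by rewrite co_om_neq // degc_sing rv.
have cw : content ([ffun=> j] : {ffun 'I_r -> _}) = singc j v' by rewrite content_const rv vv.
rewrite (co_SA _ (SAi_nat g zx) cw vA); have ur : (n - r)%N = u' by rewrite rv -vv -uv' addnK.
rewrite (eq_bigl (pred1 ([ffun=> j] : {ffun 'I_(n - r) -> 'I_(bdim F)}))); last first.
  move=> w; rewrite -ur; apply/eqP/eqP => [/content_const_inv | ->] //; exact: content_const.
by rewrite big_pred1_eq wsgn_const ?ur // wsgn_const ?rv -?vv // !mul1r wcat_const.
Qed.

Lemma co_map_top i a (w : {ffun 'I_n -> 'I_(bdim F)}) :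
    okm E n (singc i 0, singc i n) -> validc (qA F) (content w) ->
  co F n (a, content w) (pf_map (Omega k n) g (mon E n (singc i 0, singc i n))) =
  if a == zeroc _ then wsgn k (qA F) w * (tc F w (gmap g (tw E [ffun=> i])) : k) else 0.
Proof.
move=> ok vA; have [r [x [rn -> zx]]] := SA_const ok.
have er : r = ord_max by apply: ord_inj.
move: x zx; rewrite er => x zx; rewrite Omega_mapE (co_SA _ (SAi_nat g zx) (erefl (content w)) vA).
have n0 : (n - (ord_max : 'I_n.+1))%N = 0%N by exact: subnn.
have w1_0 (w1 : {ffun 'I_(n - (ord_max : 'I_n.+1)) -> 'I_(bdim F)}) : content w1 = zeroc _.
  by apply/eqP; rewrite -degc_eq0 degc_content n0.
have cat_w (w1 : {ffun 'I_(n - (ord_max : 'I_n.+1)) -> 'I_(bdim F)}) :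
    wcat (subnK (leq_ord (ord_max : 'I_n.+1))) w1 w = w.
  apply/ffunP; apply: (pos_ind (e := subnK (leq_ord (ord_max : 'I_n.+1)))) => y.
    by have := ltn_ord y; rewrite {2}n0.
  by rewrite wcat_r; congr (w _); apply: ord_inj; rewrite posr_val n0.
case: eqP => [-> | na]; last by rewrite big1 // => w1 /eqP; rewrite w1_0 => /esym.
have [w0 cw0] := content_exists (etrans (degc0 _) (esym n0) : degc (zeroc (bdim F)) = _).
rewrite (bigD1 w0) ?cw0 ?eqxx //= big1 ?addr0 => [|w1 /andP[_ /eqP[]]]; last first.
  by apply/ffunP => y; have := ltn_ord y; rewrite {2}n0.
rewrite cat_w (_ : wsgn k (qS F) w0 = 1) ?mul1r // /wsgn cw0.
have -> : validc (qS F) (zeroc (bdim F)) by apply/forallP => y; rewrite ffunE implybT.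
by rewrite /weps big1 // => -[[z hz] y] _; exfalso; move: hz; rewrite n0.
Qed.

End Maps.

End ConstantWords.

Section CartierNaturality.

Variables (k : fieldType) (p : nat) (charp : p \in [pchar k]) (p_gt2 : (2 < p)%N).
Implicit Types (U V W X Y Z : superspace k).

Let p_pr : prime p := pcharf_prime charp.
Let p_gt0 : (0 < p)%N := prime_gt0 p_pr.
Let k2 := pchar_gt2_neq0 charp p_gt2.

Lemma co_ext X (E : hbase X) n (x y : Omega k n X) :
  (forall m, okm E n m -> co E n m x = co E n m y) -> x = y.
Proof.
move=> xy; rewrite -(monlin_mon k2 E x) -(monlin_mon k2 E y) !monlin_sum.
apply: eq_bigr => f _; set m := (_, _).
have [ok | nok] := boolP (okm E n m); first by rewrite xy.
by rewrite (mon0 nok) !scaler0.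
Qed.

(** [Zmap] with monomial values is the transpose of [Th] on coordinates. *)
Lemma co_Zmap W n l (e : (n * p)%N = l) m y : okm (hb_base W) n m ->
  co (tw_base W) n m (Zmap p (hb_base W) l (mon (tw_base W) n) y) = co (hb_base W) l (Th p (hb_base W) m) y.
Proof.
move=> ok; rewrite -[LHS]comp_lfunE; congr (fun_of_lfun _ y).
apply: (omega_ext k2 (E := hb_base W)) => M okM; rewrite [LHS]comp_lfunE (Zmap_mon _ _ okM) co_mon okM andbT.
case: ifP => [pw | npw].
  rewrite [LHS]co_mon; congr (_ *+ nat_of_bool _); apply/andP/eqP => [[/eqP -> _] | <-].
    exact: (PsK k2 charp okM pw).
  have PT : Ps p (hb_base W) (Th p (hb_base W) m) = m by exact: ThK.
  by split; [apply/eqP; rewrite PT | rewrite PT].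
rewrite lfun0; case: eqP => // mM; by rewrite -mM pdiv_Th in npw.
Qed.

(** Naturality at one vector, for all morphisms out of [V]. It is stable under scalars and products,
    which permits induction on monomials. *)
Definition natural_at n V (x : Omega k n (stwist V)) : Prop :=
  forall l (e : (n * p)%N = l) W (f : ghom l V W),
  ctheta p n l W (pf_map (Omega k n) (frob e f) x) = pf_map (coho k l) f (ctheta p n l V x).

Lemma natural0 n V : @natural_at n V 0.
Proof.
move=> l e W f; apply: etrans (congr1 (ctheta p n l W) (lfun0 (pf_map (Omega k n) (frob e f)))) _.
apply: etrans (lfun0 (ctheta p n l W)) _; apply/esym.
by apply: etrans (congr1 (pf_map (coho k l) f) (lfun0 (ctheta p n l V))) _; exact: lfun0.
Qed.

(** In cohomology only the coordinates at the [Th m'] are visible, so only these coefficients of [f]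
    have to be compared with those of its twist. *)
Lemma natural_crit n V m :
  (forall l (e : (n * p)%N = l) W (f : ghom l V W) m', okm (hb_base W) n m' ->
    co (tw_base W) n m' (pf_map (Omega k n) (frob e f) (mon (tw_base V) n m)) =
    co (hb_base W) l (Th p (hb_base W) m')
      (pf_map (Omega k l) f (mon (hb_base V) l (Th p (hb_base V) m)))) ->
  natural_at (mon (tw_base V) n m).
Proof.
move=> H l e W f; have dm := dR_mon_Th charp p_gt2 (E := hb_base V) m e.
apply/esym; apply: etrans (congr1 (pf_map (coho k l) f) (ctheta_mon charp e m)) _.
apply: etrans (coho_map f dm) _.
have dfm : dR l W (pf_map (Omega k l) f (mon (hb_base V) l (Th p (hb_base V) m))) = 0.
  by rewrite dR_nat dm lfun0.
rewrite -(cls_proj charp p_gt2 dfm) -(ctheta_Z charp p_gt2 e); congr (ctheta p n l W _).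
by apply: (co_ext (E := tw_base W)) => m' ok; rewrite H // (co_Zmap e).
Qed.

(* The degree-one monomials: [t] selects the generator of S^1 or the one of A^1. *)
Definition gen N (t : bool) (i : 'I_N) : {ffun 'I_N -> nat} * {ffun 'I_N -> nat} :=
  (singc i (~~ t), singc i t).

(** Degree in A of [Th] of the generator of type [t] of a letter of parity [q]. *)
Definition gdeg (q t : bool) : nat := if q then (if t then p else p.-1) else t.

Lemma Th_gen X (E : hbase X) t i : Th p E (gen t i) = (singc i (p - gdeg (bpar E i) t)%N, singc i (gdeg (bpar E i) t)).
Proof.
by congr pair; apply/ffunP => j; rewrite !ffunE; case: eqP => [->|_];
  rewrite ?ffunE ?eqxx /gdeg; case: (bpar E _); case: t; rewrite /= ?muln0 ?muln1 ?addn0 ?add0n ?subnn ?subn0 //; lia.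
Qed.

(** The degrees 0, 1, p - 1 and p are distinct because [p > 2]. So the A-degree, which morphisms
    preserve, forces matching parities for [f] just as the definition of the twist does. *)
Lemma gdeg_inj q t q' t' : (gdeg q t == gdeg q' t') = ((q == q') && (t == t')).
Proof. by rewrite /gdeg; case: q q' t t' => [] [] [] []; rewrite ?eqxx //=; lia. Qed.

Lemma okm1 X (E : hbase X) m : okm E 1 m -> exists t i, m = gen t i.
Proof.
case: m => a b /okmP[_ _ ab].
have one (c : {ffun 'I_(bdim E) -> nat}) : degc c = 1%N -> exists i, c = singc i 1.
  move=> c1; have [w <-] := content_exists c1; exists (w ord0).
  by rewrite -(content_const 1) //; congr content; apply/ffunP => x; rewrite !ffunE (ord1 x).
have zero (c : {ffun 'I_(bdim E) -> nat}) : degc c = 0%N -> forall i, c = singc i 0.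
  by move/eqP; rewrite degc_eq0 => /eqP -> i; apply/ffunP => j; rewrite !ffunE if_same.
case Ea: (degc a) ab => [|u] ab.
  by have [i bi] := one b ab; exists true, i; rewrite bi (zero a Ea i).
have [i ai] := one a (ltac:(lia)); exists false, i; rewrite ai (zero b _ i) //; lia.
Qed.

Lemma natural_gen V t i : natural_at (mon (tw_base V) 1 (gen t i)).
Proof.
have [ok | nok] := boolP (okm (tw_base V) 1 (gen t i)); last first.
  by rewrite (mon0 nok); exact: natural0.
apply: natural_crit => l e W f m' okm'; have [t' [j Em]] := okm1 okm'.
have okT := etrans (ok_Th charp (E := hb_base V) (gen t i) e) ok; rewrite Th_gen in okT.
have okT' := etrans (ok_Th charp (E := hb_base W) m' e) okm'; rewrite Em Th_gen in okT'.
have okg : okm (tw_base W) 1 (gen t' j) by rewrite -Em.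
rewrite {m' okm'}Em; apply: etrans (co_map_sing k2 (frob e f) ok okg) _.
rewrite !Th_gen (co_map_sing k2 f okT okT') gdeg_inj.
have H : (tc (tw_base W) [ffun=> j] (frobmx e f (tw (tw_base V) [ffun=> i])) : k) =
    if bpar (hb_base W) j == bpar (hb_base V) i
    then (tc (hb_base W) [ffun=> j] (gmap f (tw (hb_base V) [ffun=> i])) : k) else 0.
  apply: etrans (frobmx_tw charp p_gt2 e f ([ffun=> i] : word 1 V) ([ffun=> j] : word 1 W)) _.
  rewrite (hb_base_tw ([ffun=> i] : word l V)) (hb_base_tc ([ffun=> j] : word l W)).
  have -> : same_par ([ffun=> i] : word 1 V) ([ffun=> j] : word 1 W) = (hpar j == hpar i).
    by apply/forallP/idP => [/(_ ord0)|h x]; rewrite !ffunE.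
  have repc (T : Type) (x : T) : rep charp e [ffun=> x] = [ffun=> x] by apply/ffunP => y; rewrite !ffunE.
  by rewrite !repc.
rewrite (gmap_frob charp p_gt2).
move: t t' {ok okT okg okT'} => [] []; rewrite ?andbT ?andbF; first [exact: H | by []].
Qed.

(** Both coefficients vanish unless the target monomial lies wholly in A and has only odd letters;
    then a single word contributes on each side. *)
Lemma natural_top V n i : bpar (tw_base V) i ->
  natural_at (mon (tw_base V) n (singc i 0, singc i n)).
Proof.
move=> pi; have [ok | nok] := boolP (okm (tw_base V) n (singc i 0, singc i n)); last first.
  by rewrite (mon0 nok); exact: natural0.
apply: natural_crit => l e W f [a b] ok'.
have pi' : hpar i := pi.
have ThE : Th p (hb_base V) (singc i 0, singc i n) = (singc i 0, singc i l).
  congr pair; apply/ffunP => j; rewrite !ffunE /= ?ffunE; case: eqP => [->|_]; rewrite ?pi' ?muln0 ?if_same //.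
  by rewrite addn0 mulnC e.
have okT := etrans (ok_Th charp (E := hb_base V) (singc i 0, singc i n) e) ok; rewrite ThE in okT.
have okT' := etrans (ok_Th charp (E := hb_base W) (a, b) e) ok'.
rewrite ThE; have [_ vb ab] := okmP ok'.
have repc (T : Type) (x : T) : rep charp e [ffun=> x] = [ffun=> x] by apply/ffunP => y; rewrite !ffunE.
have LHS0 : degc b != n -> co (tw_base W) n (a, b)
     (pf_map (Omega k n) (frob e f) (mon (tw_base V) n (singc i 0, singc i n))) = 0.
  move=> nb; have [r [x [rn -> zx]]] := SA_const k2 ok.
  by rewrite Omega_mapE co_om_neq // rn.
have RHS0 : (Th p (hb_base W) (a, b)).1 != zeroc _ -> co (hb_base W) l (Th p (hb_base W) (a, b))
     (pf_map (Omega k l) f (mon (hb_base V) l (singc i 0, singc i l))) = 0.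
  move=> nz; have [r [x [rn -> zx]]] := SA_const k2 okT; rewrite Omega_mapE.
  rewrite [Th p (hb_base W) (a, b)]surjective_pairing co_om_neq // rn.
  move: okT' nz; rewrite [Th p (hb_base W) (a, b)]surjective_pairing => /okmP[_ _ <-] /=.
  by rewrite -degc_eq0 -[X in X != (_ + _)%N]add0n eqn_add2r eq_sym.
have th1 j : (Th p (hb_base W) (a, b)).1 j = if bpar (hb_base W) j then a j else (p * a j + p.-1 * b j)%N.
  by rewrite ffunE.
have [bn | nbn] := eqVneq (degc b) n; last first.
  rewrite LHS0 // RHS0 //; apply: contraNneq nbn => z.
  suff a0 : a = zeroc _ by move: ab; rewrite a0 degc0 add0n => ->.
  apply/ffunP => j; have := th1 j; rewrite z !ffunE; case: (bpar _ j) => // /esym/eqP.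
  by rewrite addn_eq0 muln_eq0 eqn0Ngt p_gt0 => /andP[/eqP].
have a0 : a = zeroc _ by apply/eqP; rewrite -degc_eq0 -(eqn_add2r (degc b)) add0n ab bn.
have [w cw] := content_exists bn.
have vw : validc (qA (tw_base W)) (content w) by rewrite cw.
have H1 := @co_map_top k k2 _ _ (tw_base V) (tw_base W) n (frob e f) i a w ok vw.
rewrite -{1}cw {}H1 a0 eqxx (gmap_frob charp p_gt2) (frobmx_tw charp p_gt2) repc.
case: ifP => [/forallP sp | /negbT]; last first.
  (* Some letter of [w] is even. The twist kills the coefficient, and on the other side [Th] has the
     nonzero entry [(p - 1) * b (w x)] in S, which the degree in A excludes. *)
  rewrite negb_forall mulr0 => /existsP[x]; rewrite ffunE => wx; rewrite -a0 RHS0 //.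
  have bx : (0 < b (w x))%N by rewrite -cw content_gt0.
  have wev : bpar (hb_base W) (w x) = false by move: wx pi; rewrite /=; case: (hpar (w x)) => //; case: (hpar i).
  apply/eqP => z; have := th1 (w x); rewrite z ffunE wev => /esym/eqP.
  by rewrite addn_eq0 !muln_eq0 [b _ == _]eqn0Ngt bx orbF -subn1 subn_eq0 leqNgt (ltn_trans _ p_gt2) ?andbF.
have wodd x : bpar (hb_base W) (w x) by have := sp x; rewrite ffunE => /eqP wx; exact: (etrans wx pi').
have b0 j : ~~ hpar j -> b j = 0%N.
  move=> nj; rewrite -cw ffunE big1 // => x _; case: eqP => // xj.
  by have := wodd x; rewrite xj /= (negPf nj).
have cr : Th p (hb_base W) (zeroc _, b) = (zeroc _, content (rep charp e w)).
  congr pair; apply/ffunP => j; rewrite ?content_rep ?cw !ffunE /= ?ffunE.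
    by case: ifP => // /negbT/b0 ->; rewrite !muln0.
  by rewrite muln0 addn0; case: ifP => // /negbT/b0 ->; rewrite muln0.
(* Odd letters commute in A, so their words are valid and carry no sign. *)
have sgn1 N (w' : {ffun 'I_N -> 'I_(bdim (hb_base W))}) : (forall x, bpar (hb_base W) (w' x)) ->
    wsgn k (qA (hb_base W)) w' = 1.
  move=> odd'; rewrite /wsgn /weps big1 => [|x _]; last by rewrite /qA !odd'.
  rewrite (_ : validc _ _) //; apply/forallP => j; apply/implyP; rewrite /qA andbb => nj.
  rewrite ffunE big1 // => x _; case: eqP => // xj; by rewrite -xj odd' in nj.
have vr : validc (qA (hb_base W)) (content (rep charp e w)).
  by move: okT'; rewrite a0 cr => /okmP[].
apply/esym; rewrite cr; apply: etrans (co_map_top k2 f _ okT vr) _; rewrite eqxx sgn1; last first.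
  by move=> x; rewrite ffunE.
rewrite (sgn1 _ w) // !mul1r; rewrite -(repc _ i).
rewrite -[tc _ _ _]/(tc (hb_base W) (rep charp e w : word l W) _) hb_base_tc.
by rewrite -[tw _ _]/(tw (hb_base V) (rep charp e [ffun=> i] : word l V)) hb_base_tw.
Qed.

End CartierNaturality.

Section CartierNaturalityMonomials.

Variables (k : fieldType) (p : nat) (charp : p \in [pchar k]) (p_gt2 : (2 < p)%N).
Implicit Types (U V W X Y Z : superspace k).

Let k2 := pchar_gt2_neq0 charp p_gt2.

Lemma natural_scale n V c (x : Omega k n (stwist V)) :
  natural_at p x -> natural_at p (c *: x).
Proof.
move=> nx l e W f; apply: etrans (congr1 (ctheta p n l W) (lfunZ (pf_map (Omega k n) (frob e f)) c x)) _.
apply: etrans (lfunZ (ctheta p n l W) c _) _; apply/esym.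
apply: etrans (congr1 (pf_map (coho k l) f) (lfunZ (ctheta p n l V) c x)) _.
by apply: etrans (lfunZ (pf_map (coho k l) f) c _) _; congr (_ *: _); exact/esym/nx.
Qed.

(** A splitting of [f] along the two degrees also splits [frob e f], with the same signs and
    coefficients, so [omul_nat] on both sides reduces the claim to the factors. *)
Lemma natural_mul m n s (e1 : (m + n)%N = s) V b (x : Omega k m (stwist V)) (y : Omega k n (stwist V)) :
  x \in spart (Omega k m (stwist V)) b -> natural_at p x -> natural_at p y -> natural_at p (omul e1 x y).
Proof.
move=> xb nx ny l e W f.
have el : (m * p + n * p = l)%N by rewrite -mulnDl e1.
have [t tE] := ghom_split el f.
have fE u : gmap f u = \sum_ij (t ij : k) *: lbox2 el (hpar ij.2) (gmap (hb ij.1)) (gmap (hb ij.2)) u.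
  by rewrite -tE; exact: gsplit_app.
have fE' := frobmx_lbox2 charp p_gt2 (erefl (m * p)%N) (erefl (n * p)%N) e e1 fE.
(* [omul_nat] needs a homogeneous first factor, so the cocycle is chosen of parity [b]. *)
have [x' [x'b dx' x'E]] := cls_homog (shom_even (ctheta_even charp p_gt2 (erefl (m * p)%N) V) xb).
have [y' dy' y'E] := cls_surj (ctheta p n (n * p) V y).
apply: etrans (congr1 (ctheta p s l W) (omul_nat fE' y xb)) _.
apply/esym; apply: etrans (congr1 (pf_map (coho k l) f)
  (ctheta_mul charp p_gt2 el (erefl _) (erefl _) e e1 x y)) _.
rewrite -x'E -y'E (cls_mul k2 el dx' dy').
apply: etrans (coho_map f (omul_cocycle k2 el dx' dy')) _.
rewrite (omul_nat fE y' x'b) !lfun_sum; apply: eq_bigr => ij _; rewrite !lfunZ; congr (_ *: _).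
rewrite -(cls_mul k2 el); last 2 first.
- by rewrite dR_nat dx' lfun0.
- by rewrite dR_nat dy' lfun0.
rewrite (ctheta_mul charp p_gt2 el (erefl _) (erefl _) e e1).
apply: (f_equal2 (@pa_mul k (HOmega k) _ _ _ el W)).
  by apply: etrans (esym (coho_map _ dx')) _; rewrite x'E; exact/esym/nx.
by apply: etrans (esym (coho_map _ dy')) _; rewrite y'E; exact/esym/ny.
Qed.

Lemma natural_one V : natural_at p (pa_one (Omega k) (stwist V)).
Proof.
move=> l e W f; case: l / e f => f.
apply: etrans (congr1 (ctheta p 0 0 W) (Omega_one_nat (frob (erefl (0 * p)%N) f))) _.
apply/esym; apply: etrans (congr1 (pf_map (coho k 0) f) (ctheta_one charp p_gt2 V)) _.
rewrite HOmega_one; apply: etrans (coho_map f (dR_one k2 V)) _.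
apply: etrans (congr1 cls (Omega_one_nat f)) _; rewrite lfunZ.
apply/esym; apply: etrans (lfunZ (ctheta p 0 0 W) _ _) _; rewrite (ctheta_one charp p_gt2 W) HOmega_one; congr (_ *: _).
have H := frobmx_tw charp p_gt2 (erefl (0 * p)%N) f (word0 V) (word0 W).
have -> : gmap (frob (erefl (0 * p)%N) f) (delta k (word0 (stwist V))) (word0 (stwist W)) =
   tc (tw_base W) (word0 W) (frobmx (erefl (0 * p)%N) f (tw (tw_base V) (word0 V))).
  rewrite (gmap_frob charp p_gt2).
  have -> : tw (tw_base V) (word0 V) = delta k (word0 (stwist V)) :> tpow 0 (stwist V).
    by apply/ffunP => w; rewrite !ffunE big_ord0 (word0_eq w) eqxx.
  move: (frobmx _ _ _) => z; rewrite {2}(ffun_deltaE z) lfun_sum.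
  rewrite (sum_only (i := word0 (stwist W))) => [|w]; last by rewrite (word0_eq w) eqxx.
  by rewrite lfunZ flin_delta big_ord0; exact/esym/mulr1.
apply: etrans H _; case: ifP => [_ | /forallP[] []] //.
exact: (f_equal2 (fun (v : word 0 V) (w : word 0 W) => (gmap f (delta k v) : tpow 0 W) w) (word0_eq _) (word0_eq _)).
Qed.

Lemma singc0 N (i : 'I_N) : singc i 0 = zeroc N.
Proof. by apply/ffunP => j; rewrite !ffunE if_same. Qed.

(** Induction on the degree: split off one letter of S, or the full power of one letter of A. Then
    the binomial coefficient is 1 and the monomial is a product up to sign; for part of a divided
    power the coefficient could be divisible by [p]. *)
Lemma natural_mon n V m : natural_at p (mon (tw_base V) n m).
Proof.
elim/ltn_ind: n m => n IH [a b].
have [ok | nok] := boolP (okm (tw_base V) n (a, b)); last by rewrite (mon0 nok); exact: natural0.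
have [va vb ab] := okmP ok.
have prod n1 n2 (e : (n1 + n2)%N = n) a1 b1 a2 b2 : natural_at p (mon (tw_base V) n2 (a2, b2)) ->
    (n1 < n)%N -> okm (tw_base V) n1 (a1, b1) -> okm (tw_base V) n2 (a2, b2) ->
    bindom b1 b2 = 1%N -> natural_at p (mon (tw_base V) n (addc a1 a2, addc b1 b2)).
  move=> nat2 ltn ok1 ok2 b12.
  have := natural_mul e (mon_par (E := tw_base V) n1 a1 b1) (IH _ ltn (a1, b1)) nat2.
  rewrite (mon_mul k2 e ok1 ok2) b12 mulr1; set s := (-1) ^+ _.
  have ss : s * s = 1 by rewrite /s -exprD addnn -mul2n exprM sqrrN !expr1n.
  move/(natural_scale s); rewrite scalerA [X in X *: _](_ : _ = 1) ?scale1r //.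
have [a0 | [i ai]] : a = zeroc _ \/ exists i, (0 < a i)%N.
  have [i ai | h] := pickP (fun i => (0 < a i)%N); [by right; exists i | left].
  by apply/ffunP => i; apply/eqP; rewrite ffunE -leqn0 leqNgt h.
  have [b0 | [i bi]] : b = zeroc _ \/ exists i, (0 < b i)%N.
    have [i bi | h] := pickP (fun i => (0 < b i)%N); [by right; exists i | left].
    by apply/ffunP => i; apply/eqP; rewrite ffunE -leqn0 leqNgt h.
    have n0 : n = 0%N by rewrite -ab a0 b0 degc0.
    by rewrite n0 a0 b0 (mon_one k2); exact: natural_one.
  pose b1 : {ffun 'I_(bdim (tw_base V)) -> nat} := [ffun j => if j == i then 0%N else b j].
  have bE : b = addc b1 (singc i (b i)).
    by apply/ffunP => j; rewrite !ffunE; case: eqP => [->|_]; rewrite ?addn0.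
  have vb1 : validc (qA (tw_base V)) b1 by move: vb; rewrite {1}bE => /validcDl.
  have vb2 : validc (qA (tw_base V)) (singc i (b i)) by move: vb; rewrite {1}bE => /validcDr.
  have v0 : validc (qS (tw_base V)) (zeroc _) by rewrite -a0.
  have e : (degc b1 + b i)%N = n by rewrite -ab a0 degc0 add0n {2}bE degcD degc_sing.
  have := prod (degc b1) (b i) e (zeroc _) b1 (singc i 0) (singc i (b i)).
  rewrite -bE singc0 add0c -a0 => H; apply: H; rewrite ?a0.
  - have [pi | npi] := boolP (bpar (tw_base V) i); first by rewrite -(singc0 i); exact: natural_top.
    have -> : b i = 1%N.
      by have := forallP vb i; rewrite /qA andbb npi /=; case: (b i) bi => [|[]].
    by have := @natural_gen k p charp p_gt2 V true i; rewrite /gen singc0.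
  - by rewrite -e -addn1 leq_add2l.
  - by rewrite /okm v0 vb1 degc0 eqxx.
  - by rewrite /okm v0 vb2 degc0 degc_sing eqxx.
  rewrite /bindom big1 // => j _; rewrite !ffunE; case: eqP => _; first by rewrite bin0.
  by rewrite addn0 binn.
have aE := subcK ai.
have va1 : validc (qS (tw_base V)) (subc a i) by move: va; rewrite -{1}aE => /validcDl.
have va2 : validc (qS (tw_base V)) (singc i 1) by move: va; rewrite -{1}aE => /validcDr.
have v0 : validc (qA (tw_base V)) (zeroc _) by apply/forallP => j; rewrite ffunE implybT.
have e : (n.-1 + 1)%N = n by have := degc_subc ai; move: ab; lia.
have := prod n.-1 1%N e (subc a i) b (singc i 1) (singc i 0).
rewrite aE singc0 addc0; apply.
- by have := @natural_gen k p charp p_gt2 V false i; rewrite /gen singc0.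
- by rewrite -e; lia.
- by rewrite /okm va1 vb /= -(eqn_add2r 1) e -ab (degc_subc ai) addn1 addSn eqxx.
- by rewrite /okm va2 v0 degc0 degc_sing.
exact: bindom0r.
Qed.

Lemma ctheta_nat n l (e : (n * p)%N = l) V W (f : ghom l V W) x :
  ctheta p n l W (pf_map (Omega k n) (frob e f) x) = pf_map (coho k l) f (ctheta p n l V x).
Proof.
rewrite -[LHS]comp_lfunE -[RHS]comp_lfunE; congr (fun_of_lfun _ x).
apply: (omega_ext k2 (E := tw_base V)) => m ok; rewrite [LHS]comp_lfunE [RHS]comp_lfunE.
exact: natural_mon.
Qed.

End CartierNaturalityMonomials.

(** * Transport of the algebra structure *)

Section Transport.

Variable k : fieldType.
Implicit Types (U V W X Y : superspace k).

Lemma pmorphism_nat n (F G : pfunctor k n) (eta : forall V, 'Hom(F V, G V)) :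
  (forall V, eta V \in spart (shom (F V) (G V)) false) ->
  (forall V W (f : ghom n V W) x, eta W (pf_map F f x) = pf_map G f (eta V x)) ->
  is_pmorphism false eta.
Proof.
move=> ev nt; split=> // V W c f _; rewrite scale1r; apply/lfunP => x.
by rewrite [LHS]comp_lfunE [RHS]comp_lfunE.
Qed.

Lemma pmorphism_natE n (F G : pfunctor k n) (eta : forall V, 'Hom(F V, G V)) V W (f : ghom n V W) x :
  is_pmorphism false eta -> eta W (pf_map F f x) = pf_map G f (eta V x).
Proof.
case=> _ nt; have h c (g : ghom n V W) : g \in spart (ghom n V W) c ->
    eta W (pf_map F g x) = pf_map G g (eta V x).
  by move/nt/(congr1 (fun h : 'Hom(F V, G W) => h x)); rewrite scale1r [LHS]comp_lfunE [RHS]comp_lfunE.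
have pD (H : pfunctor k n) (g g' : ghom n V W) y : pf_map H (g + g') y = pf_map H g y + pf_map H g' y.
  by rewrite -[g]scale1r pf_map_lin scale1r add_lfunE scale1r.
rewrite -(hproj_sum f) !pD lfunD.
by congr (_ + _); exact: h (mem_hproj _ f).
Qed.

Lemma pisomorphism_bij n (F G : pfunctor k n) (eta : forall V, 'Hom(F V, G V)) (zeta : forall V, 'Hom(G V, F V)) :
  is_pmorphism false eta -> (forall V, cancel (eta V) (zeta V)) -> (forall V, cancel (zeta V) (eta V)) ->
  is_pisomorphism eta.
Proof.
move=> em eK zK; split=> //; exists zeta.
  apply: pmorphism_nat => [V | V W f x].
    apply/mem_shom => c x xc; rewrite addbF.
    by apply: even_inj_spart (em.1 V) (can_inj (eK V)) _; rewrite zK.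
  by apply: (can_inj (eK W)); rewrite zK (pmorphism_natE f (zeta V x) em) zK.
by move=> V; split; apply/lfunP => x; rewrite comp_lfunE id_lfunE; [exact: eK | exact: zK].
Qed.

Lemma eq_pisomorphism n (F G : pfunctor k n) (eta eta' : forall V, 'Hom(F V, G V)) :
  (forall V, eta V = eta' V) -> is_pisomorphism eta -> is_pisomorphism eta'.
Proof.
move=> ee [[em en] [zeta zm zK]]; split.
  by split=> [V | V W c f fc]; rewrite -!ee; [exact: em | exact: en].
by exists zeta => // V; rewrite -ee.
Qed.

(** Both tensor products expand [f] through the same preimage under [gsplit], so the comparison is
    made term by term. *)
Lemma ptensor_nat m n l (e : (m + n)%N = l) (F F' : pfunctor k m) (G G' : pfunctor k n)
    (eta : forall V, 'Hom(F V, F' V)) (mu : forall V, 'Hom(G V, G' V)) V W (f : ghom l V W) x :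
  is_pmorphism false eta -> is_pmorphism false mu ->
  stmap false (eta W) (mu W) (pf_map (ptensor e F G) f x) =
  pf_map (ptensor e F' G') f (stmap false (eta V) (mu V) x).
Proof.
move=> em mm; have pE (H : pfunctor k m) (K : pfunctor k n) :
    pf_map (ptensor e H K) f = ptensor_img H K V W ((gsplit e V W)^-1%VF (ssub_in (equivariant l V W) f)).
  transitivity ((ptensor_img H K V W \o (gsplit e V W)^-1 \o ssub_in (equivariant l V W))%VF f) => //.
  by rewrite 2!comp_lfunE.
rewrite !pE; move: ((gsplit e V W)^-1%VF _) => t.
rewrite (ffun_deltaE t) !lfun_sum !sum_lfunE lfun_sum; apply: eq_bigr => -[i j] _.
rewrite !lfunZ !scale_lfunE lfunZ; congr (_ *: _).
rewrite [ptensor_img F G V W _]flin_delta [ptensor_img F' G' V W _]flin_delta -[(i, j).1]/i -[(i, j).2]/j.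
move: (hb i) (hb j) (hpar j) => g h q.
rewrite -[LHS]comp_lfunE -[RHS]comp_lfunE; congr (fun_of_lfun _ x); apply: stens_ext => a b.
rewrite [LHS]comp_lfunE [RHS]comp_lfunE (stmapE _ _ _ _ (mem_hb a)) lfunZ !stmapE0.
rewrite (stmapE _ _ _ _ (shom_even (em.1 V) (mem_hb a))).
by rewrite (pmorphism_natE g (hb a) em) (pmorphism_natE h (hb b) mm).
Qed.

Section Algebras.
Variables (A B : palgebra k) (HB : is_palgebra B).
Variables (theta : forall n V, 'Hom(A n V, B n V)) (zeta : forall n V, 'Hom(B n V, A n V)).
Hypothesis theta_mor : forall n, is_pmorphism false (theta n).
Hypothesis theta_one : forall V, theta 0 V (pa_one A V) = pa_one B V.
Hypothesis theta_mul : forall m n l (e : (m + n)%N = l) V (a : A m V) (b : A n V),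
  theta l V (pa_mul e a b) = pa_mul e (theta m V a) (theta n V b).
Hypothesis thetaK : forall n V, cancel (theta n V) (zeta n V).
Hypothesis zetaK : forall n V, cancel (zeta n V) (theta n V).

Let inj n V : injective (theta n V) := can_inj (thetaK (n := n) (V := V)).
Let nt n V W (f : ghom n V W) x : theta n W (pf_map (A n) f x) = pf_map (B n) f (theta n V x) :=
  pmorphism_natE f x (theta_mor n).

(** Equations are checked after the injective [theta], and parities descend by [even_inj_spart]. The
    twist thereby gets its laws without a study of composite functors. *)
Lemma palgebra_transport : is_palgebra A.
Proof.
have theta_even n V : theta n V \in spart (shom (A n V) (B n V)) false := (theta_mor n).1 V.
case: HB => Bf Bu Bp B1l B1r BA; split.
- move=> n; have [_ Bid Bcomp] := Bf n; split.
  + move=> V W; apply: pf_evenP => c f fc; apply/mem_shom => d x xd.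
    apply: even_inj_spart (theta_even n W) (@inj n W) _; rewrite nt.
    by apply: shom_spart (pf_map_par (Bf n) fc) _; apply: shom_even (theta_even n V) xd.
  + by move=> V; apply/lfunP => x; apply: inj; rewrite nt Bid !id_lfunE.
  + by move=> U V W g f; apply/lfunP => x; apply: inj; rewrite nt Bcomp !comp_lfunE !nt.
- have uE V t : theta 0 V (pa_unit A V t) = pa_unit B V t.
    rewrite -[LHS]comp_lfunE; congr (fun_of_lfun _ t); apply: delta_ext => -[].
    by rewrite [LHS]comp_lfunE; exact: theta_one.
  apply: pmorphism_nat => [V | V W f x].
    apply/mem_shom => c t tc; rewrite addbF.
    apply: even_inj_spart (theta_even 0 V) (@inj 0 V) _; rewrite uE.
    by apply: shom_even (Bu.1 V) tc.
  by apply: inj; rewrite nt !uE; exact (pmorphism_natE f (x : pone k V) Bu).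
- move=> m n l e; have pE V t : theta l V (pa_prod A e V t) =
      pa_prod B e V (stmap false (theta m V) (theta n V) t).
    rewrite -[LHS]comp_lfunE -[RHS]comp_lfunE; congr (fun_of_lfun _ t); apply: stens_ext => i j.
    by rewrite [LHS]comp_lfunE [RHS]comp_lfunE stmapE0; exact: theta_mul.
  apply: pmorphism_nat => [V | V W f x].
    apply: hom_free_even => -[i j]; rewrite addbF -tens_hb.
    apply: even_inj_spart (theta_even l V) (@inj l V) _; rewrite pE stmapE0.
    have ti := shom_even (theta_even m V) (mem_hb i); have tj := shom_even (theta_even n V) (mem_hb j).
    exact (shom_even ((Bp _ _ _ e).1 V) (mem_tens ti tj)).
  apply: inj; rewrite nt !pE.
  have H := @ptensor_nat m n l e (A m) (B m) (A n) (B n) _ _ V W f x (theta_mor m) (theta_mor n).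
  apply: etrans (congr1 (pa_prod B e W) H) _; exact (pmorphism_natE f _ (Bp _ _ _ e)).
- by move=> n e V a; apply: inj; rewrite theta_mul theta_one B1l.
- by move=> n e V a; apply: inj; rewrite theta_mul theta_one B1r.
by move=> m n q mn nq l emn enq e1 e2 V a b c; apply: inj; rewrite !theta_mul; exact: BA.
Qed.

Lemma palgebra_isomorphism_bij : is_palgebra_isomorphism theta.
Proof.
split=> //; first exact: palgebra_transport.
by move=> n; apply: (pisomorphism_bij (zeta := zeta n)).
Qed.

End Algebras.

End Transport.

(** * The isomorphism in all degrees *)

Section SuperCartier.

Variables (k : fieldType) (p : nat) (charp : p \in [pchar k]) (p_gt2 : (2 < p)%N).
Implicit Types (U V W X Y Z : superspace k).

Let p_gt0 : (0 < p)%N := prime_gt0 (pcharf_prime charp).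
Let k2 := pchar_gt2_neq0 charp p_gt2.
Local Notation idx := (acomp_idx p).
Local Notation part V := (fun x => acomp_part (Omega k) (pfrob k p) x V).

(** So the direct sum defining the twist in degree [m] has at most one summand, and none when [p]
    does not divide [m]. *)
Lemma acomp_idx_eq m (x y : idx m) : x = y.
Proof.
apply: val_inj; apply: ord_inj; apply/eqP; rewrite -(eqn_pmul2r p_gt0).
by rewrite (eqP (valP x)) (eqP (valP y)).
Qed.

Definition cartier m V : 'Hom(twist p (Omega k) m V, HOmega k m V) :=
  \sum_(x : idx m) (ctheta p (val x) m V \o dpr (part V) x)%VF.

Definition cartier_inv m V : 'Hom(HOmega k m V, twist p (Omega k) m V) :=
  \sum_(x : idx m) (din (part V) x \o czeta p (val x) m V)%VF.

Lemma cartierE m V z : cartier m V z = \sum_(x : idx m) ctheta p (val x) m V (dpr (part V) x z).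
Proof. by rewrite sum_lfunE; apply: eq_bigr => x _; rewrite comp_lfunE. Qed.

Lemma cartier_invE m V z : cartier_inv m V z = \sum_(x : idx m) din (part V) x (czeta p (val x) m V z).
Proof. by rewrite sum_lfunE; apply: eq_bigr => x _; rewrite comp_lfunE. Qed.

Lemma cartier_din m V (x : idx m) y : cartier m V (din (part V) x y) = ctheta p (val x) m V y.
Proof.
rewrite cartierE (sum_only (i := x)) => [|x']; last by rewrite (acomp_idx_eq x' x) eqxx.
by congr (ctheta _ _ _ _ _); exact: (din_id (F := part V)).
Qed.

Lemma cartier_in m n (e : (n * p)%N = m) V (y : Omega k n (stwist V)) :
  cartier m V (acomp_in (Omega k) (pfrob k p) p_gt0 e V y) = ctheta p n m V y.
Proof. exact: (@cartier_din m V (acomp_at p_gt0 e) y). Qed.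

(** In degrees prime to [p] the sum over [idx m] is empty, in agreement with the vanishing of the
    cohomology there. *)
Lemma cartier_invK m V : cancel (cartier_inv m V) (cartier m V).
Proof.
move=> c; rewrite cartier_invE lfun_sum (eq_bigr (fun=> c)) => [|x _]; last first.
  by rewrite cartier_din; exact: (czetaK charp p_gt2 (eqP (valP x))).
have [/dvdnP[n mE] | npm] := boolP (p %| m)%N; last by rewrite (coho_eq0 charp p_gt2 c npm) big1.
rewrite (sum_only (i := acomp_at p_gt0 (esym mE))) // => x'.
by rewrite (acomp_idx_eq x' (acomp_at p_gt0 (esym mE))) eqxx.
Qed.

Lemma cartierK m V : cancel (cartier m V) (cartier_inv m V).
Proof.
move=> z; rewrite cartier_invE [RHS](dsum_sum (F := part V)); apply: eq_bigr => x _; congr (din _ _ _).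
rewrite cartierE (sum_only (i := x)) => [|x']; last by rewrite (acomp_idx_eq x' x) eqxx.
exact: (cthetaK charp p_gt2 (eqP (valP x))).
Qed.

Lemma ctheta_pmorphism n l (e : (n * p)%N = l) :
  @is_pmorphism k false l (pcompose e (Omega k n) (pfrob k p)) (coho k l) (ctheta p n l).
Proof.
apply: pmorphism_nat => [V | V W f x]; first exact: (ctheta_even charp p_gt2 e V).
by rewrite pcompose_map; exact: (ctheta_nat charp p_gt2 e).
Qed.

Lemma cartier_pmorphism m :
  @is_pmorphism k false m (twist p (Omega k) m) (HOmega k m) (cartier m).
Proof.
apply: pmorphism_nat => [V | V W f z].
  apply: memv_suml => x _; apply: shom_comp_even (dpr_even _ _).
  exact: (ctheta_even charp p_gt2 (eqP (valP x)) V).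
have L (g : 'Hom(coho k m V, coho k m W)) (F : idx m -> coho k m V) : g (\sum_x F x) = \sum_x g (F x).
  by rewrite lfun_sum.
apply: etrans (cartierE _) _; apply/esym; apply: etrans (congr1 (pf_map (coho k m) f) (cartierE z)) _.
apply: etrans (L _ _) _; apply/esym; apply: eq_bigr => x _.
apply: etrans (congr1 (ctheta p (val x) m W)
  (@pdsum_map_dpr k m (idx m) (fun x => acomp_part (Omega k) (pfrob k p) x) V W f x z)) _.
exact (pmorphism_natE f _ (ctheta_pmorphism (eqP (valP x)))).
Qed.

Lemma cartier_one V : cartier 0 V (pa_one (twist p (Omega k)) V) = pa_one (HOmega k) V.
Proof.
rewrite -(ctheta_one charp p_gt2).
set x : idx 0 := exist (fun n : 'I_1 => (n * p)%N == 0%N) ord0 (eqxx 0%N).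
have -> : pa_one (twist p (Omega k)) V = din (part V) x (pa_one (Omega k) (stwist V)).
  by rewrite {1}/pa_one -[pa_unit _ _]/(acomp_unit (Omega k) (pfrob k p) V) /acomp_unit comp_lfunE.
exact: cartier_din.
Qed.

Lemma cartier_mul m n l (e : (m + n)%N = l) V (a : twist p (Omega k) m V) (b : twist p (Omega k) n V) :
  cartier l V (pa_mul e a b) = @pa_mul k (HOmega k) m n l e V (cartier m V a) (cartier n V b).
Proof.
pose G (x : idx m) (y : idx n) (z : idx l) : 'Hom(_, _) := match (val x + val y)%N =P val z with
    | ReflectT ez => (din (part V) z \o pa_prod (Omega k) ez (stwist V) \o stmap false (dpr (part V) x) (dpr (part V) y))%VF
    | ReflectF _ => 0 end.
have -> : pa_mul e a b = \sum_x \sum_y \sum_z G x y z (tens a b).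
  transitivity ((\sum_x \sum_y \sum_z G x y z)%VF (tens a b)) => //.
  rewrite sum_lfunE; apply: eq_bigr => x _; rewrite sum_lfunE; apply: eq_bigr => y _.
  by rewrite sum_lfunE.
rewrite (cartierE a) (cartierE b) pa_mul_suml (lfun_sum (cartier l V)); apply: eq_bigr => x _.
rewrite pa_mul_sumr (lfun_sum (cartier l V)); apply: eq_bigr => y _; rewrite (lfun_sum (cartier l V)).
have ex := eqP (valP x); have ey := eqP (valP y).
have ez : ((val x + val y)%N * p = l)%N by rewrite mulnDl ex ey e.
pose z := acomp_at p_gt0 ez.
rewrite (sum_only (i := z)) => [|z']; last by rewrite (acomp_idx_eq z' z) eqxx.
rewrite /G; case: eqP => [exy|[]] //; rewrite 2!comp_lfunE stmapE0 cartier_din.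
exact: (ctheta_mul charp p_gt2 e ex ey ez exy).
Qed.

Lemma cartier_isomorphism : is_palgebra_isomorphism cartier.
Proof.
apply: (@palgebra_isomorphism_bij k (twist p (Omega k)) (HOmega k) (HOmega_palgebra k2)
  cartier cartier_inv _ _ _ cartierK cartier_invK).
- exact: cartier_pmorphism.
- exact: cartier_one.
- exact: cartier_mul.
Qed.

Lemma cartier_in_isomorphism n :
  @is_pisomorphism k (p * n)%N
    (pcompose (mulnC n p) (Omega k n) (pfrob k p)) (HOmega k (p * n)%N)
    (fun V => (cartier (p * n)%N V \o
       acomp_in (Omega k) (pfrob k p) (prime_gt0 (pcharf_prime charp)) (mulnC n p) V)%VF).
Proof.
apply: (@eq_pisomorphism k (p * n)%N (pcompose (mulnC n p) (Omega k n) (pfrob k p)) (HOmega k (p * n)%N)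
  (ctheta p n (p * n)%N)) => [V|].
  by apply/lfunP => x; rewrite [RHS]comp_lfunE; exact (esym (@cartier_in (p * n)%N n (mulnC n p) V x)).
exact (@pisomorphism_bij k (p * n)%N (pcompose (mulnC n p) (Omega k n) (pfrob k p)) (HOmega k (p * n)%N)
  (ctheta p n (p * n)%N) (czeta p n (p * n)%N) (ctheta_pmorphism (mulnC n p))
  (cthetaK charp p_gt2 (mulnC n p)) (czetaK charp p_gt2 (mulnC n p))).
Qed.

End SuperCartier.

Theorem theorem4p1p2 (k : fieldType) (p : nat) (charp : p \in [pchar k])
    (p_gt2 : (2 < p)%N) (perfect : forall x : k, exists y : k, y ^+ p = x) :
  exists theta : forall m V, 'Hom(twist p (Omega k) m V, HOmega k m V),
    is_palgebra_isomorphism theta /\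
    forall n : nat,
      @is_pisomorphism k (p * n)%N
        (pcompose (mulnC n p) (Omega k n) (pfrob k p)) (HOmega k (p * n)%N)
        (fun V => (theta (p * n)%N V \o
                   acomp_in (Omega k) (pfrob k p)
                     (prime_gt0 (pcharf_prime charp)) (mulnC n p) V)%VF).
Proof.
exists (@cartier k p); split; first exact: cartier_isomorphism.
by move=> n; exact: cartier_in_isomorphism.
Qed.
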